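(* Let $1\le q<\infty$, let $(V,\mu)$ be a measure space, $n\ge1$, and let $X_1,\dots,X_n,Y_1,\dots,Y_n$ be independent symmetric random variables with logarithmically concave tails satisfying the normalization $\inf\{t\ge 0: N^X_i(t)\ge 1\}=\inf\{t\ge0: M^Y_j(t)\ge 1\}=1$ for all $i,j$. Assume moreover that $Y_1,\dots,Y_n$ are subgaussian with constant $\gamma>0$. Let $(a_{ij})_{i,j\le n}$ be an $L_q(V,\mu)$-valued matrix. Then for every $p\ge1$, \begin{align*} \Big\|\sum_{i,j}a_{ij}X_iY_j\Big\|_p\le C(q)\Bigg(&\gamma\,\mathbb{E}\Big\|\sum_{i,j}a_{ij}X_iY_j\Big\|_{L_q}+\sup_{x\in B^X_p}\mathbb{E}\Big\|\sum_{i,j}a_{ij}x_iY_j\Big\|_{L_q}+\sup_{y\in B^Y_p}\mathbb{E}\Big\|\sum_{i,j}a_{ij}X_iy_j\Big\|_{L_q}\\ &+\sup_{f\in B^*(L_q)}\Big\|\Big(\sqrt{\textstyle\sum_jf(a_{ij})^2}\Big)_i\Big\|_{X,p}+\sup_{f\in B^*(L_q)}\big\|(f(a_{ij}))_{ij}\big\|_{X,Y,p}\Bigg), \end{align*} where $C(q)$ depends only on $q$ and $\|Z\|_p=(\mathbb{E}\|Z\|_{L_q}^p)^{1/p}$.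
   Context: A random variable $Z$ has logarithmically concave tails if $t\mapsto -\ln\mathbb{P}(|Z|\ge t)\in[0,\infty]$ is convex on $[0,\infty)$. $Y$ is subgaussian with constant $\gamma$ if $\mathbb{E}Y=0$ and $\mathbb{E}\exp(tY)\le\exp(\gamma t^2)$ for all $t\in\mathbb{R}$. Set $N^X_i(t)=-\ln\mathbb{P}(|X_i|\ge t)$, $M^Y_j(t)=-\ln\mathbb{P}(|Y_j|\ge t)$, $\hat N^X_i(t)=t^2$ for $|t|\le1$ and $\hat N^X_i(t)=N^X_i(|t|)$ for $|t|>1$, and $\hat M^Y_j$ analogously. $B^X_p=\{x\in\mathbb{R}^n:\sum_i\hat N^X_i(x_i)\le p\}$, $B^Y_p=\{y\in\mathbb{R}^n:\sum_j\hat M^Y_j(y_j)\le p\}$. For real $(b_i)$, $\|(b_i)\|_{X,p}=\sup_{x\in B^X_p}\sum_ib_ix_i$; for a real matrix, $\|(b_{ij})\|_{X,Y,p}=\sup\{\sum_{ij}b_{ij}x_iy_j:x\in B^X_p,y\in B^Y_p\}$. $B^*(L_q)$ is the unit ball of the dual of $L_q(V,\mu)$. *)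

(* Defs.v *)
From HB Require Import structures.
From mathcomp Require Import all_boot all_order all_algebra.
From mathcomp Require Import all_classical all_reals all_analysis.
Set Implicit Arguments. Unset Strict Implicit. Unset Printing Implicit Defensive.
Import Order.TTheory GRing.Theory Num.Theory.
Import numFieldNormedType.Exports.
Local Open Scope classical_set_scope.
Local Open Scope ring_scope.

Section Defs.
Context {R : realType}.

Section Prob.
Context {d : measure_display} {Omega : measurableType d}.
Variable P : probability Omega R.

Definition mutually_independent (I : finType) (Z : I -> Omega -> R) : Prop :=
  (forall i, measurable_fun setT (Z i)) /\
  forall B : I -> set R, (forall i, measurable (B i)) ->
    P (\bigcap_(i in setT) (Z i @^-1` B i)) =
    (\prod_(i : I) P (Z i @^-1` B i))%E.

Definition symmetric_rv (Z : Omega -> R) : Prop :=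
  forall A : set R, measurable A ->
    P (Z @^-1` A) = P ((fun w => - Z w) @^-1` A).

Definition tailN (Z : Omega -> R) (t : R) : \bar R :=
  let pr := P [set w | t <= `|Z w|] in
  if pr == 0%E then +oo%E else (- ln (fine pr))%:E.

Definition log_concave_tails (Z : Omega -> R) : Prop :=
  forall (s t l : R), 0 <= s -> 0 <= t -> 0 < l < 1 ->
    (tailN Z (l * s + (1 - l) * t) <=
     l%:E * tailN Z s + (1 - l)%:E * tailN Z t)%E.

Definition tail_normalized (Z : Omega -> R) : Prop :=
  inf [set t : R | 0 <= t /\ (1 <= tailN Z t)%E] = 1.

Definition subgaussian (gamma : R) (Z : Omega -> R) : Prop :=
  (\int[P]_w (Z w)%:E = 0)%E /\
  forall t : R, (\int[P]_w (expR (t * Z w))%:E <= (expR (gamma * t ^+ 2))%:E)%E.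

Definition hatN (Z : Omega -> R) (t : R) : \bar R :=
  if `|t| <= 1 then (t ^+ 2)%:E else tailN Z `|t|.

Definition Bball (n : nat) (Z : 'I_n -> Omega -> R) (p : R) : set ('I_n -> R) :=
  [set x | (\sum_(i < n) hatN (Z i) (x i) <= p%:E)%E].

Definition normZp (n : nat) (Z : 'I_n -> Omega -> R) (p : R) (b : 'I_n -> R)
  : \bar R :=
  ereal_sup ((fun x : 'I_n -> R => (\sum_(i < n) b i * x i)%:E) @` Bball Z p).

Definition normXYp (n : nat) (X Y : 'I_n -> Omega -> R) (p : R)
  (b : 'I_n -> 'I_n -> R) : \bar R :=
  ereal_sup [set e | exists2 x, Bball X p x &
     exists2 y, Bball Y p y & e = (\sum_(i < n) \sum_(j < n) b i j * x i * y j)%:E].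
End Prob.

Section Lq.
Context {d : measure_display} {V : measurableType d}.
Variable mu : {measure set V -> \bar R}.
Variable q : R.

Definition Lqnorm (g : V -> R) : \bar R := Lnorm mu q%:E (fun v => (g v)%:E).

Definition in_Lq (g : V -> R) : Prop :=
  measurable_fun setT g /\ (Lqnorm g < +oo)%E.

Definition dual_unit_ball : set ((V -> R) -> R) :=
  [set f | (forall (c : R) (g h : V -> R), in_Lq g -> in_Lq h ->
              f (fun v => c * g v + h v) = c * f g + f h) /\
           (forall g, in_Lq g -> (`|f g|%:E <= Lqnorm g)%E)].
End Lq.

End Defs.

(* Main.v *)
(* Truncating at M and rounding to multiples of 1/(2M) turns all expectations into finite sums. At finitely
   many points the L_q norm of the chaos is a maximum N(x, y) = max_a |b_a(x, y)| over norming functionals, so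
   that it suffices to prove E N(X, Y)^p <= (C r)^p when each of the five terms is at most r, with a constant
   that depends neither on M nor on q; Fatou's lemma does the rest. After a comparison in the convex order,
   X_i and Y_j are symmetric and integer valued with log-concave tails.

   A law of this kind has Maurey's property (tau) for a cost equivalent to the truncated function of the
   statement. Tensorization gives E M^p <= (C R)^p for every nonnegative convex M with E M <= R and M <= R on
   the ball of level p. Applying this twice leaves E sup_y N(X, y), with y in the ball, to be bounded by C r.
   Here both the maximizing a and y depend on X: y is written as the mean of a random vector having a density
   with respect to a fixed product law, and Young's inequality reduces the claim, for a fixed vector u, to
   the mean of N(X, u) and to the supremum of b_a(x, u) over x in the ball. The second moment of the latter
   at u = Y is finite by a union bound over rounded points of the ball, after ranking the rows of b_a by their
   Euclidean norms; this is where the fourth term is used. *)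
Require Import Defs.
From HB Require Import structures.
From mathcomp Require Import all_boot all_order all_algebra.
From mathcomp Require Import all_classical all_reals all_analysis.
From mathcomp Require Import measurable_realfun.
From mathcomp Require Import ring lra zify.
Set Implicit Arguments. Unset Strict Implicit. Unset Printing Implicit Defensive.
Import Order.TTheory GRing.Theory Num.Theory.
Import numFieldNormedType.Exports.
Local Open Scope classical_set_scope.
Local Open Scope ring_scope.

(** * Expectations over finitely many independent coordinates *)

(** One norming functional is taken for each discrete outcome, so their number grows with [M] and
    exponentially with [n], and no bound may depend on it. Concentration from (tau) does not see how
    many linear forms enter a maximum; this is why it is used for both vectors. The obstacle is E
    sup_y N(X, y). Integrating against a product density D for [y] leaves, by Young's inequality
    with exponents p + 1 and (p + 1)/p, the integral of D^(1 + 1/p). For a point of the ball, D can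
    be chosen with mean half that point and with this integral bounded by a constant, because each
    coordinate contributes a factor at most exp(2 cost / p) and the costs sum to at most p + 1. The
    size of the slice then enters only through its square, so a second moment suffices for the
    supremum of b_a(x, Y) over x. Magnitudes are divided by 64 before the integer part is taken. The
    tail at 1 is then below 2^-28, the series of the one-dimensional inequality are ruled by their
    first terms, and explicit constants suffice. *)

Definition upd (A : Type) (x : nat -> A) (n : nat) (a : A) : nat -> A :=
  fun i => if i == n then a else x i.

Lemma upd_same (A : Type) (x : nat -> A) n a : upd x n a n = a.
Proof. by rewrite /upd eqxx. Qed.

Lemma upd_ne (A : Type) (x : nat -> A) n a i : i != n -> upd x n a i = x i.
Proof. by rewrite /upd => /negbTE ->. Qed.

Lemma upd_comm (A : Type) (x : nat -> A) n a m b : n != m ->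
  upd (upd x n a) m b = upd (upd x m b) n a.
Proof.
move=> nm; apply/funext => i; rewrite /upd.
by case: (eqVneq i m) => [->|//]; rewrite eq_sym (negbTE nm).
Qed.

Section Ev.
Context {R : realType}.
Implicit Types (f g : R -> R).

(* Expectation of [Phi]: the coordinates [i < n] are independent and equal to [v i s] with weight [w i s],
   the coordinates [i >= n] are those of [x]. *)
Fixpoint Ev (A : Type) (S : finType) (n : nat) (w : nat -> S -> R)
    (v : nat -> S -> A) (x : nat -> A) (Phi : (nat -> A) -> R) : R :=
  match n with
  | 0 => Phi x
  | n'.+1 => \sum_(s : S) w n' s * Ev n' w v (upd x n' (v n' s)) Phi
  end.

(** Keeps the label [s] itself, so that several value maps, or a choice depending on the whole
    outcome, can be evaluated on one and the same outcome. *)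
Definition Ex (S : finType) (n : nat) (w : nat -> S -> R) (sg : nat -> S)
  (Phi : (nat -> S) -> R) : R := Ev n w (fun _ s => s) sg Phi.

Section Basic.
Variables (A : Type) (S : finType) (w : nat -> S -> R) (v : nat -> S -> A).
Implicit Types (x : nat -> A) (Phi Psi : (nat -> A) -> R).

Lemma Ev_ext_on n x Phi Psi :
  (forall y, (forall i, (n <= i)%N -> y i = x i) -> Phi y = Psi y) ->
  Ev n w v x Phi = Ev n w v x Psi.
Proof.
elim: n x => [|n IH] x H /=; first exact: H.
apply: eq_bigr => s _; congr (_ * _); apply: IH => y Hy; apply: H => i ni.
by rewrite Hy ?(ltnW ni) // upd_ne // neq_ltn ni orbT.
Qed.

Lemma Ev_ext n x Phi Psi : Phi =1 Psi -> Ev n w v x Phi = Ev n w v x Psi.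
Proof. by move=> H; apply: Ev_ext_on => y _. Qed.

Lemma EvD n x Phi Psi :
  Ev n w v x (fun y => Phi y + Psi y) = Ev n w v x Phi + Ev n w v x Psi.
Proof.
elim: n x => //= n IH x; rewrite -big_split /=.
by apply: eq_bigr => s _; rewrite IH mulrDr.
Qed.

Lemma EvZ n x c Phi : Ev n w v x (fun y => c * Phi y) = c * Ev n w v x Phi.
Proof.
elim: n x => //= n IH x; rewrite mulr_sumr.
by apply: eq_bigr => s _; rewrite IH mulrCA.
Qed.

Lemma Ev0 n x : Ev n w v x (fun=> 0) = 0.
Proof. by elim: n x => //= n IH x; apply: big1 => s _; rewrite IH mulr0. Qed.

Lemma Ev_sum (I : Type) (r : seq I) (Q : pred I) n x (F : I -> (nat -> A) -> R) :
  Ev n w v x (fun y => \sum_(i <- r | Q i) F i y) =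
  \sum_(i <- r | Q i) Ev n w v x (F i).
Proof.
elim: r => [|a r IH].
  by rewrite big_nil; apply: etrans (Ev0 n x); apply: Ev_ext => y; rewrite big_nil.
rewrite big_cons -IH; case: ifP => Qa.
  by rewrite -EvD; apply: Ev_ext => y; rewrite big_cons Qa.
by apply: Ev_ext => y; rewrite big_cons Qa.
Qed.

Hypothesis w0 : forall i s, 0 <= w i s.

Lemma Ev_le_on n x Phi Psi :
  (forall y, (forall i, (n <= i)%N -> y i = x i) ->
     (forall i, (i < n)%N -> exists s, y i = v i s) -> Phi y <= Psi y) ->
  Ev n w v x Phi <= Ev n w v x Psi.
Proof.
elim: n x => [|n IH] x H /=; first exact: H.
apply: ler_sum => s _; apply: ler_wpM2l => //; apply: IH => y Hy Hs; apply: H => i ni.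
  by rewrite Hy ?(ltnW ni) // upd_ne // neq_ltn ni orbT.
rewrite ltnS leq_eqVlt in ni; case/orP: ni => [/eqP ->|ni]; last exact: Hs.
by exists s; rewrite Hy // upd_same.
Qed.

Lemma Ev_le n x Phi Psi : (forall y, Phi y <= Psi y) ->
  Ev n w v x Phi <= Ev n w v x Psi.
Proof. by move=> H; apply: Ev_le_on => y _ _. Qed.

Lemma Ev_ge0 n x Phi : (forall y, 0 <= Phi y) -> 0 <= Ev n w v x Phi.
Proof. by move=> H; rewrite -(Ev0 n x); apply: Ev_le. Qed.

Hypothesis w1 : forall i, \sum_(s : S) w i s = 1.

Lemma Ev_cst n x c : Ev n w v x (fun=> c) = c.
Proof.
elim: n x => //= n IH x; under eq_bigr do rewrite IH.
by rewrite -mulr_suml w1 mul1r.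
Qed.

Lemma Ev_le_cst n x Phi c : (forall y, Phi y <= c) -> Ev n w v x Phi <= c.
Proof. by move=> H; rewrite -[leRHS](Ev_cst n x); apply: Ev_le. Qed.

(** The supporting line of the power at [a]; in the induction the defect is the term
    [(k + 1) a^k (b - a)^2]. *)
Lemma bernoulli_tangent (a b : R) k : 0 <= a -> 0 <= b ->
  a ^+ k.+1 + k.+1%:R * a ^+ k * (b - a) <= b ^+ k.+1.
Proof.
move=> a0 b0; elim: k => [|k IH]; first by rewrite !expr1 expr0; lra.
have H : b * (a ^+ k.+1 + k.+1%:R * a ^+ k * (b - a)) <= b ^+ k.+2.
  by rewrite (exprS _ k.+1); apply: ler_wpM2l.
apply: le_trans H; rewrite -subr_ge0 (exprS _ k.+1) (exprS _ k).
rewrite -(natr1 k.+1) -(natr1 k).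
have -> : b * (a * a ^+ k + (k%:R + 1) * a ^+ k * (b - a)) -
  (a * (a * a ^+ k) + (k%:R + 1 + 1) * (a * a ^+ k) * (b - a)) =
  (k%:R + 1) * a ^+ k * (b - a) ^+ 2 by ring.
by rewrite mulr_ge0 ?sqr_ge0 // mulr_ge0 ?exprn_ge0 // addr_ge0.
Qed.

Lemma Ev_jensen_pow n x Phi k : (forall y, 0 <= Phi y) ->
  Ev n w v x Phi ^+ k.+1 <= Ev n w v x (fun y => Phi y ^+ k.+1).
Proof.
move=> P0; set a := Ev n w v x Phi.
have a0 : 0 <= a by exact: Ev_ge0.
have := @Ev_le n x (fun y => a ^+ k.+1 + k.+1%:R * a ^+ k * (Phi y - a))
  (fun y => Phi y ^+ k.+1) (fun y => bernoulli_tangent k a0 (P0 y)).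
apply: le_trans; rewrite EvD Ev_cst EvZ EvD Ev_cst -/a subrr mulr0 addr0.
exact: lexx.
Qed.

Lemma Ev_jensen_exp n x Phi :
  expR (Ev n w v x Phi) <= Ev n w v x (fun y => expR (Phi y)).
Proof.
set a := Ev n w v x Phi.
have := @Ev_le n x (fun y => expR a * (1 + (Phi y - a))) (fun y => expR (Phi y)).
rewrite EvZ EvD Ev_cst EvD Ev_cst -/a subrr addr0 mulr1; apply => y.
have -> : expR (Phi y) = expR a * expR (Phi y - a) by rewrite -expRD addrC subrK.
by apply: ler_wpM2l; [exact: expR_ge0 | exact: expR_ge1Dx].
Qed.

End Basic.

Lemma Ev_exch (A B : Type) (S T : finType) n m w v x (w' : nat -> T -> R) v' y
    (Phi : (nat -> A) -> (nat -> B) -> R) :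
  Ev n w v x (fun a => Ev m w' v' y (Phi a)) =
  Ev m w' v' y (fun b => @Ev A S n w v x (fun a => Phi a b)).
Proof.
elim: n x => //= n IH x.
rewrite Ev_sum; apply: eq_bigr => s _; by rewrite IH EvZ.
Qed.

Lemma Ev_map (A : Type) (S : finType) n (w : nat -> S -> R) (v : nat -> S -> A)
    (sg : nat -> S) Phi :
  Ex n w sg (fun tau => Phi (fun i => v i (tau i))) =
  Ev n w v (fun i => v i (sg i)) Phi.
Proof.
rewrite /Ex; elim: n sg => //= n IH sg; apply: eq_bigr => s _; rewrite IH.
congr (_ * Ev _ _ _ _ _); apply/funext => i; rewrite /upd.
by case: eqP => // ->.
Qed.

(** A product density is absorbed in the weights, whose total mass then need not be one. *)
Lemma Ex_wM (S : finType) n (w g : nat -> S -> R) (sg : nat -> S) Phi :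
  Ex n w sg (fun tau => (\prod_(i < n) g i (tau i)) * Phi tau) =
  Ex n (fun i s => w i s * g i s) sg Phi.
Proof.
rewrite /Ex; elim: n sg => [|n IH] sg /=; first by rewrite big_ord0 mul1r.
apply: eq_bigr => s _; rewrite -IH -mulrA; congr (_ * _); rewrite -EvZ.
apply: Ev_ext_on => y Hy; rewrite big_ord_recr /= Hy // upd_same; ring.
Qed.

Lemma Ex_prod (S : finType) n (w g : nat -> S -> R) (sg : nat -> S) :
  Ex n w sg (fun tau => \prod_(i < n) g i (tau i)) =
  \prod_(i < n) \sum_(s : S) w i s * g i s.
Proof.
have -> : Ex n w sg (fun tau => \prod_(i < n) g i (tau i)) =
  Ex n w sg (fun tau => (\prod_(i < n) g i (tau i)) * 1).
  by apply: Ev_ext => y; rewrite mulr1.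
rewrite Ex_wM /Ex; elim: n sg => [|n IH] sg /=; first by rewrite big_ord0.
rewrite big_ord_recr /= mulrC mulr_suml; apply: eq_bigr => s _; by rewrite IH.
Qed.

Definition conv (f : R -> R) : Prop := forall x y t, 0 <= t <= 1 ->
  f (t * x + (1 - t) * y) <= t * f x + (1 - t) * f y.

Definition cconv (Phi : (nat -> R) -> R) : Prop :=
  forall x i, conv (fun a => Phi (upd x i a)).

Lemma Ev_conv (S : finType) (w v : nat -> S -> R) Phi : (forall i s, 0 <= w i s) ->
  cconv Phi -> forall n i x, (n <= i)%N -> conv (fun a => Ev n w v (upd x i a) Phi).
Proof.
move=> w0 cP; elim=> [|n IH] i x ni /=; first exact: cP.
move=> a b t t01; rewrite !mulr_sumr -big_split /=; apply: ler_sum => s _.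
have ne : i != n by rewrite neq_ltn ni orbT.
rewrite !(upd_comm _ _ _ ne).
have := IH i (upd x n (v n s)) (ltnW ni) a b t t01.
move/(ler_wpM2l (w0 n s)); rewrite mulrDr => /le_trans; apply.
by rewrite !(mulrCA (w n s)).
Qed.

(** The laws are exchanged one at a time: after the lower coordinates are integrated out, the
    function is still convex in the next one ([Ev_conv]). The factors [c i] account for weights of
    total mass different from one. *)
Lemma Ev_cmp (S S' : finType) (w v : nat -> S -> R) (w' v' : nat -> S' -> R)
    (c : nat -> R) Phi :
  (forall i s, 0 <= w i s) -> (forall i s, 0 <= w' i s) -> (forall i, 0 <= c i) ->
  cconv Phi ->
  (forall i f, conv f -> \sum_(s : S) w i s * f (v i s) <=
                         c i * \sum_(s : S') w' i s * f (v' i s)) ->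
  forall n x, Ev n w v x Phi <= (\prod_(i < n) c i) * Ev n w' v' x Phi.
Proof.
move=> w0 w'0 c0 cP H; elim=> [|n IH] x; first by rewrite big_ord0 mul1r.
rewrite big_ord_recr /=.
apply: (@le_trans _ _ (\sum_(s : S) w n s *
   ((\prod_(i < n) c i) * Ev n w' v' (upd x n (v n s)) Phi))).
  by apply: ler_sum => s _; apply: ler_wpM2l.
under [X in X <= _]eq_bigr => s _ do rewrite mulrCA.
rewrite -mulr_sumr -mulrA; apply: ler_wpM2l; first by apply: prodr_ge0.
exact: (H n _ (Ev_conv v' w'0 cP x (leqnn n))).
Qed.

Lemma Ev_eqlaw (S S' : finType) (w v : nat -> S -> R) (w' v' : nat -> S' -> R) Phi :
  (forall i f, \sum_(s : S) w i s * f (v i s) = \sum_(s : S') w' i s * f (v' i s)) ->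
  forall n x, Ev n w v x Phi = Ev n w' v' x Phi.
Proof.
move=> H; elim=> [//|n IH] x /=.
under eq_bigr do rewrite IH.
exact: (H n (fun a => Ev n w' v' (upd x n a) Phi)).
Qed.

Lemma Ev_CS (A : Type) (S : finType) (w : nat -> S -> R) (v : nat -> S -> A) n x F G (a b : R) :
  (forall i s, 0 <= w i s) -> 0 <= a -> 0 <= b ->
  Ev n w v x (fun y => F y ^+ 2) <= a ^+ 2 ->
  Ev n w v x (fun y => G y ^+ 2) <= b ^+ 2 ->
  Ev n w v x (fun y => F y * G y) <= a * b.
Proof.
move=> w0 a0 b0 HF HG; apply/ler_addgt0Pr => e e0.
(* Either bound may vanish, and the weighted inequality below divides by both; they are raised by
   [E] at a total cost [e]. *)
have [E E0 HE] : exists2 E, 0 < E & (a + b + E) * E <= e.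
  exists (e / (a + b + 1 + e)); first by rewrite divr_gt0 //; lra.
  set D := a + b + 1 + e; have D0 : 0 < D by rewrite /D; lra.
  rewrite mulrA ler_pdivrMr // mulrC; apply: ler_wpM2l; first exact: ltW.
  rewrite /D; suff : e / D <= 1 by rewrite /D; lra.
  by rewrite ler_pdivrMr // mul1r /D; lra.
set a' := a + E; set b' := b + E.
have a'0 : 0 < a' by rewrite /a'; lra.
have b'0 : 0 < b' by rewrite /b'; lra.
apply: (@le_trans _ _ (a' * b')); last first.
  apply: le_trans (_ : a * b + (a + b + E) * E <= _); last by rewrite lerD2l.
  by rewrite /a' /b'; nra.
apply: (@le_trans _ _ (Ev n w v x (fun y => (b' / a' / 2%:R) * F y ^+ 2 +
    (a' / b' / 2%:R) * G y ^+ 2))).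
  apply: Ev_le => // y; rewrite -subr_ge0.
  have -> : b' / a' / 2%:R * F y ^+ 2 + a' / b' / 2%:R * G y ^+ 2 - F y * G y =
    (b' * F y - a' * G y) ^+ 2 / (2%:R * a' * b').
    by field; rewrite !gt_eqF.
  by rewrite divr_ge0 ?sqr_ge0 // !mulr_ge0 // ltW.
rewrite EvD !EvZ.
have -> : a' * b' = b' / a' / 2%:R * a' ^+ 2 + a' / b' / 2%:R * b' ^+ 2.
  by field; rewrite !gt_eqF.
apply: lerD; apply: ler_wpM2l; rewrite ?mulr_ge0 ?invr_ge0 ?(ltW a'0) ?(ltW b'0) //.
  apply: le_trans HF _; apply: lerXn2r; rewrite ?nnegrE ?(ltW a'0) //; rewrite /a'; lra.
apply: le_trans HG _; apply: lerXn2r; rewrite ?nnegrE ?(ltW b'0) //; rewrite /b'; lra.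
Qed.

Lemma Ev_mink (A : Type) (S : finType) (w : nat -> S -> R) (v : nat -> S -> A) n x
    (I : Type) (r : seq I) (Q : pred I) (F : I -> (nat -> A) -> R) (be : I -> R) :
  (forall i s, 0 <= w i s) -> (forall i, Q i -> 0 <= be i) ->
  (forall i, Q i -> Ev n w v x (fun y => F i y ^+ 2) <= be i ^+ 2) ->
  Ev n w v x (fun y => (\sum_(i <- r | Q i) F i y) ^+ 2) <=
    (\sum_(i <- r | Q i) be i) ^+ 2.
Proof.
move=> w0 b0 H.
rewrite (_ : Ev _ _ _ _ _ = \sum_(i <- r | Q i) \sum_(j <- r | Q j)
   Ev n w v x (fun y => F i y * F j y)); last first.
  rewrite (@Ev_ext _ _ _ _ _ _ _ (fun y => \sum_(i <- r | Q i) \sum_(j <- r | Q j) F i y * F j y)).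
    by rewrite Ev_sum; apply: eq_bigr => i _; rewrite Ev_sum.
  by move=> y; rewrite expr2 mulr_suml; apply: eq_bigr => i _; rewrite mulr_sumr.
rewrite expr2 mulr_suml; apply: ler_sum => i Qi; rewrite mulr_sumr.
by apply: ler_sum => j Qj; apply: Ev_CS => //; rewrite ?b0 ?H.
Qed.

Lemma Ev_lin (S : finType) (w v : nat -> S -> R) n m x (be : nat -> R) :
  (forall i, \sum_(s : S) w i s = 1) -> (n <= m)%N ->
  Ev n w v x (fun y => \sum_(i < m) be i * y i) =
  \sum_(i < m) be i * (if (i < n)%N then \sum_(s : S) w i s * v i s else x i).
Proof.
move=> w1; elim: n x => [|n IH] x nm /=; first by apply: eq_bigr => i _.
under eq_bigr => s _ do rewrite IH ?(ltnW nm) // mulr_sumr.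
rewrite exchange_big /=; apply: eq_bigr => i _.
rewrite ltnS [(i <= n)%N]leq_eqVlt; case: (eqVneq (i : nat) n) => [->|ne] /=.
  rewrite ltnn mulr_sumr; apply: eq_bigr => s _; rewrite upd_same; ring.
by under eq_bigr => s _ do rewrite (upd_ne _ _ ne); rewrite -mulr_suml w1 mul1r.
Qed.

End Ev.

(** * Property (tau) in one dimension *)

Section ExpBounds.
Context {R : realType}.
Implicit Types x : R.

Lemma expR_le_inv x : x < 1 -> expR x <= (1 - x)^-1.
Proof.
move=> x1; rewrite -[x]opprK expRN opprK lef_pV2 ?posrE ?expR_gt0 ?subr_gt0 //.
exact: expR_ge1Dx.
Qed.

Lemma expR_quad x : x <= 1 / 3%:R -> expR x <= 1 + x + x ^+ 2.
Proof.
move=> x3; case: (lerP x 0) => x0.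
  apply: le_trans (expR_le_inv _) _; first by lra.
  by rewrite -div1r ler_pdivrMr; [nra | lra].
have -> : x = x / 2%:R + x / 2%:R by field.
rewrite expRD -expr2.
have h : expR (x / 2%:R) <= (1 - x / 2%:R)^-1 by apply: expR_le_inv; lra.
have p : 0 < 1 - x / 2%:R by lra.
apply: (@le_trans _ _ ((1 - x / 2%:R)^-1 ^+ 2)).
  by apply: lerXn2r; rewrite ?nnegrE ?expR_ge0 ?invr_ge0 ?(ltW p).
rewrite exprVn -div1r ler_pdivrMr ?exprn_gt0 //.
have -> : x / 2%:R + x / 2%:R = x by field.
nra.
Qed.

End ExpBounds.

Section Seq.
Context {R : realType}.
Variables (Q : nat -> R) (K : nat).
(** [Q] is a tail and [p] its point masses. [Qnb], the new-better-than-used property, comes from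
    log-concavity; together with [Q1] it gives decay like [th^(2k)], so that the series below are
    ruled by their first terms. [dl] separates small from large values of [v]. *)
Let p k := Q k - Q k.+1.
Let th : R := 2%:R ^- 14.
Let kap : R := 2%:R ^- 14.
Let dl : R := 1 / 16%:R.
Hypothesis Q0 : Q 0%N = 1.
Hypothesis Qpos : forall k, 0 <= Q k.
Hypothesis Qdec : forall k, Q k.+1 <= Q k.
Hypothesis Qnb : forall i j, Q (i + j)%N <= Q i * Q j.
Hypothesis Q1 : Q 1%N <= th ^+ 2.
Hypothesis QK : forall k, (K < k)%N -> Q k = 0.

Lemma th_gt0 : 0 < th. Proof. by rewrite /th invr_gt0 exprn_gt0. Qed.
Lemma th_val : th = 1 / 16384%:R.
Proof. by rewrite /th -natrX div1r. Qed.

Lemma p_ge0 k : 0 <= p k. Proof. by rewrite /p subr_ge0. Qed.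

Lemma Qth k : Q k <= (th ^+ 2) ^+ k.
Proof.
elim: k => [|k IH]; first by rewrite Q0 expr0.
rewrite -addn1 (le_trans (Qnb _ _)) // addn1 exprSr.
by apply: ler_pM.
Qed.

Lemma sqrtQ k : Num.sqrt (Q k) <= th ^+ k.
Proof.
have t0 := th_gt0.
rewrite -(@ger0_norm _ (th ^+ k)) ?exprn_ge0 ?(ltW t0) // -sqrtr_sqr.
by rewrite ler_wsqrtr // -exprM mulnC exprM Qth.
Qed.

Lemma Qle1 k : Q k <= 1.
Proof.
apply: le_trans (Qth k) _; rewrite exprn_ile1 // ?sqr_ge0 //.
by rewrite th_val; lra.
Qed.

(** Nearly the whole tail at [k] is the mass at [k] itself, because the next tail is smaller by the
    factor [th ^+ 2]. *)
Lemma QpS k : Q k.+1 <= 2%:R * th ^+ 2 * p k.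
Proof.
have h : Q k.+1 <= Q k * Q 1%N by rewrite -addn1 Qnb.
have h2 : Q k * Q 1%N <= Q k * th ^+ 2 by apply: ler_wpM2l.
have := Qpos k; have := Qpos k.+1.
have -> : p k = Q k - Q k.+1 by [].
move: h h2; rewrite th_val; move: (Q k) (Q k.+1) (Q 1%N) => a b c; nra.
Qed.

Lemma pS k : p k.+1 <= 2%:R * th ^+ 2 * p k.
Proof. by apply: le_trans (QpS k); rewrite /p gerBl. Qed.

Lemma sum_p a N : \sum_(i < N) p (a + i)%N = Q a - Q (a + N)%N.
Proof.
elim: N => [|N IH]; first by rewrite big_ord0 addn0 subrr.
by rewrite big_ord_recr /= IH /p addnS; ring.
Qed.

Lemma geom_le (t : R) N : 0 <= t -> t <= 1 / 2%:R -> \sum_(i < N) t ^+ i.+1 <= 2%:R * t.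
Proof.
move=> t0 t2.
suff : \sum_(i < N) t ^+ i.+1 <= 2%:R * t - t ^+ N.+1 * 2%:R.
  by move=> /le_trans; apply; rewrite gerBl mulr_ge0 ?exprn_ge0.
elim: N => [|N IH]; first by rewrite big_ord0 expr1; lra.
rewrite big_ord_recr /=.
have := exprn_ge0 N.+1 t0; rewrite (exprS _ N.+1); move: IH; nra.
Qed.

(* One side of the inequality for a law on the integers with tail [Q]: [v] plays the role of [max(f, 0)] and
   [eg] that of [e^g]. While [v] is small, shifts by [l] of order [v k.+1 - v k] give
   [g <= v - c (v k.+1 - v k)^2], and a discrete Hardy inequality absorbs the remaining [v^2]; once [v] is
   large, the second bound on [eg] transports the tail from the last index at which [v] is small. *)
Section OneSide.
Variables (v eg : nat -> R).
Hypothesis v0 : v 0%N = 0.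
Hypothesis vinc : forall k, v k <= v k.+1.
Hypothesis eg1 : forall k (l : R), 0 <= l <= 1 ->
  eg k.+1 <= expR (v k.+1 - l * (v k.+1 - v k) + kap * l ^+ 2).
Hypothesis eg2 : forall j i, (0 < i)%N -> (j.+1 + i <= K)%N ->
  Num.sqrt (Q i) * eg (j.+1 + i)%N <= expR (v j).

Lemma v_ge0 k : 0 <= v k.
Proof. by elim: k => [|k IH]; rewrite ?v0 // (le_trans IH). Qed.

Lemma v_mono i j : (i <= j)%N -> v i <= v j.
Proof. exact: (homo_leq (@lexx _ _) (@le_trans _ _)). Qed.

(** To bound a product of two nonnegative factors by 1 it is enough to bound their sum by 2; [T] is
    the integrand of the sum minus 2. *)
Let T k := eg k + expR (- v k) - 2%:R.

Lemma low_term k : v k.+1 <= dl ->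
  T k.+1 <= 2%:R * v k.+1 ^+ 2 - 8%:R * (v k.+1 - v k) ^+ 2.
Proof.
move=> vd; have a0 := v_ge0 k; have ab := vinc k; have b0 := v_ge0 k.+1.
set a := v k in a0 ab *; set b := v k.+1 in vd ab b0 *.
have [d0 d1] : 0 <= b - a /\ b - a <= b by split; lra.
set d := b - a in d0 d1 *.
rewrite /dl in vd.
(* The shift [l = 16 d] is allowed since [d <= dl = 1/16]; it gains [16 d^2] and costs
   [kap l^2 = d^2 / 64]. *)
have l01 : 0 <= 16%:R * d <= 1 by apply/andP; split; lra.
have h1 := eg1 k l01; rewrite -/a -/b -/d in h1.
have h2 : expR (b - 16%:R * d * d + kap * (16%:R * d) ^+ 2) <= expR (b - 8%:R * d ^+ 2).
  rewrite ler_expR /kap -natrX; nra.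
have h3 : expR (b - 8%:R * d ^+ 2) <= 1 + (b - 8%:R * d ^+ 2) + (b - 8%:R * d ^+ 2) ^+ 2.
  by apply: expR_quad; nra.
have h4 : expR (- b) <= 1 + (- b) + (- b) ^+ 2 by apply: expR_quad; lra.
have h5 : 0 <= b - 8%:R * d ^+ 2 by nra.
have h6 : (b - 8%:R * d ^+ 2) ^+ 2 <= b ^+ 2.
  by apply: lerXn2r; rewrite ?nnegrE //; nra.
rewrite /T -/b; nra.
Qed.

Lemma high_sum b N : (b.+1 + N)%N = K.+1 -> v b <= dl -> dl < v b.+1 ->
  \sum_(i < N) p (b.+1 + i)%N * T (b.+1 + i)%N <= 4%:R * v b ^+ 2 * Q b.+1.
Proof.
move=> bN vb va.
case: N bN => [|N] bN.
  rewrite big_ord0; apply: mulr_ge0 => //; apply: mulr_ge0 => //; exact: sqr_ge0.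
have tp := th_gt0.
have vb0 := v_ge0 b.
(* The bound [1 - u + u^2] for [expR (- u)] is efficient only for moderate [u], hence the truncation
   at 1/4. *)
set u := Num.min (v b.+1) (1 / 4%:R).
have u1 : u <= v b.+1 by rewrite /u ge_min lexx.
have u2 : u <= 1 / 4%:R by rewrite /u ge_min lexx orbT.
have u3 : dl < u by rewrite /u lt_min va /dl; lra.
have HE : \sum_(i < N.+1) p (b.+1 + i)%N * eg (b.+1 + i)%N <=
    Q b.+1 * (expR (v b) * (expR kap + 2%:R * th)).
  rewrite big_ord_recl addn0 !mulrDr; apply: lerD.
    rewrite -expRD.
    have := eg1 b (l := 1); rewrite ler01 lexx => /(_ isT).
    rewrite (_ : _ - _ + _ = v b + kap) => [h|]; last by ring.
    apply: le_trans (ler_wpM2l (p_ge0 _) h) _.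
    by apply: ler_wpM2r; rewrite ?expR_ge0 // /p gerBl.
  rewrite mulrA; apply: (@le_trans _ _ (\sum_(i < N) Q b.+1 * expR (v b) * th ^+ i.+1)).
    apply: ler_sum => i _; rewrite lift0.
    have h2 := @eg2 b i.+1 isT; have ii := ltn_ord i.
    have {}h2 := h2 ltac:(lia).
    have pq : p (b.+1 + i.+1)%N <= Q b.+1 * Q i.+1.
      by apply: le_trans (Qnb _ _); rewrite /p gerBl.
    case: (lerP 0 (eg (b.+1 + i.+1)%N)) => e0; last first.
      apply: (@le_trans _ _ 0); first by rewrite mulr_ge0_le0 ?p_ge0 // ltW.
      by rewrite !mulr_ge0 ?expR_ge0 ?exprn_ge0 ?(ltW tp).
    apply: le_trans (ler_wpM2r e0 pq) _.
    rewrite -!mulrA; apply: ler_wpM2l => //.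
    (* One square root pays for [eg] through [eg2]; the other leaves the geometric factor
       [th ^+ i.+1]. *)
    have -> : Q i.+1 = Num.sqrt (Q i.+1) * Num.sqrt (Q i.+1) by rewrite -expr2 sqr_sqrtr.
    rewrite -mulrA [leRHS]mulrC; apply: ler_pM; rewrite ?sqrtr_ge0 ?mulr_ge0 ?sqrtr_ge0 //.
    exact: sqrtQ.
  rewrite -mulr_sumr; apply: ler_wpM2l; first by rewrite mulr_ge0 ?expR_ge0.
  by apply: geom_le; [exact: ltW | rewrite th_val; lra].
have HV : \sum_(i < N.+1) p (b.+1 + i)%N * (expR (- v (b.+1 + i)%N) - 2%:R) <=
    Q b.+1 * (expR (- u) - 2%:R).
  have -> : Q b.+1 = \sum_(i < N.+1) p (b.+1 + i)%N.
    by rewrite sum_p bN (QK (ltnSn K)) subr0.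
  rewrite mulr_suml; apply: ler_sum => i _; apply: ler_wpM2l; first exact: p_ge0.
  rewrite lerB // ler_expR lerN2; apply: le_trans u1 _; apply: v_mono; lia.
have -> : \sum_(i < N.+1) p (b.+1 + i)%N * T (b.+1 + i)%N =
   \sum_(i < N.+1) p (b.+1 + i)%N * eg (b.+1 + i)%N +
   \sum_(i < N.+1) p (b.+1 + i)%N * (expR (- v (b.+1 + i)%N) - 2%:R).
  by rewrite -big_split; apply: eq_bigr => i _; rewrite /T /=; ring.
apply: le_trans (lerD HE HV) _; rewrite -mulrDr [leRHS]mulrC; apply: ler_wpM2l => //.
have k1 : expR kap <= 1 + kap + kap ^+ 2 by apply: expR_quad; rewrite /kap -natrX; lra.
have k2 : expR (v b) <= 1 + v b + v b ^+ 2 by apply: expR_quad; move: vb; rewrite /dl; lra.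
have k3 : expR (- u) <= 1 + (- u) + (- u) ^+ 2.
  by apply: expR_quad; move: u3; rewrite /dl; lra.
have k4 : expR kap + 2%:R * th <= 1 + 1 / 4096%:R.
  move: k1; rewrite th_val /kap -natrX; lra.
have k5 : expR (v b) * (expR kap + 2%:R * th) <= (1 + v b + v b ^+ 2) * (1 + 1 / 4096%:R).
  by apply: ler_pM => //; rewrite ?expR_ge0 // addr_ge0 ?expR_ge0 // mulr_ge0 // ltW.
apply: le_trans (lerD k5 (lerB k3 (lexx 2%:R))) _.
move: vb vb0 u2 u3; rewrite /dl; move: (v b) (u) => s t s1 s0 t4 t16.
(* For [s >= 1/32] the error of order 1/4096 is absorbed by [s^2], and [t - t^2 >= s - s^2]. For
   smaller [s], [t - t^2] is at least its value 15/256 at 1/16, which exceeds [s + s^2] and the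
   error together. *)
case: (lerP (1 / 32%:R) s) => h.
  have : 0 <= (t - s) * (1 - t - s) by apply: mulr_ge0; lra.
  nra.
have : 0 <= (t - 1 / 16%:R) * (15%:R / 16%:R - t) by apply: mulr_ge0; lra.
nra.
Qed.

(** A discrete Hardy inequality. In [S], [v k.+1] is compared with [v k], whose weight [p k.+1] is a
    tiny multiple of [p k]; so [S] is at most about [2 D] and [2 S - 8 D] is negative, with room for
    the boundary term that absorbs the bound of [high_sum]. *)
Lemma low_sum b : (forall k, (k < b)%N -> v k.+1 <= dl) ->
  \sum_(k < b) p k.+1 * T k.+1 + 5%:R * v b ^+ 2 * Q b.+1 <= 0.
Proof.
move=> Hd; set S := \sum_(k < b) p k.+1 * v k.+1 ^+ 2.
set D := \sum_(k < b) p k.+1 * (v k.+1 - v k) ^+ 2.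
have S0 : 0 <= S by apply: sumr_ge0 => i _; rewrite mulr_ge0 ?p_ge0 ?sqr_ge0.
have H1 : \sum_(k < b) p k.+1 * T k.+1 <= 2%:R * S - 8%:R * D.
  rewrite /S /D !mulr_sumr -sumrB; apply: ler_sum => k _.
  have := ler_wpM2l (p_ge0 k.+1) (low_term (Hd k (ltn_ord k))).
  by move=> /le_trans; apply; rewrite le_eqVlt; apply/orP; left; apply/eqP; ring.
have H2 : \sum_(k < b) p k.+1 * v k ^+ 2 <= 2%:R * th ^+ 2 * S.
  apply: (@le_trans _ _ (\sum_(k < b) 2%:R * th ^+ 2 * (p k * v k ^+ 2))).
    apply: ler_sum => k _; rewrite [leRHS]mulrA; apply: ler_wpM2r; first exact: sqr_ge0.
    exact: pS.
  rewrite -mulr_sumr; apply: ler_wpM2l; first by rewrite mulr_ge0 ?sqr_ge0.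
  have -> : S = \sum_(k < b.+1) p k * v k ^+ 2.
    by rewrite big_ord_recl /= v0 expr0n /= mulr0 add0r; apply: eq_bigr.
  by rewrite big_ord_recr /= lerDl mulr_ge0 ?p_ge0 ?sqr_ge0.
have H3 : S <= 2%:R * (\sum_(k < b) p k.+1 * v k ^+ 2) + 2%:R * D.
  rewrite /S /D !mulr_sumr -big_split; apply: ler_sum => k _ /=.
  have := p_ge0 k.+1; move: (p k.+1) (v k) (v k.+1) => x y z x0.
  rewrite -subr_ge0.
  have -> : 2%:R * (x * y ^+ 2) + 2%:R * (x * (z - y) ^+ 2) - x * z ^+ 2 =
    x * (2%:R * y - z) ^+ 2 by ring.
  by rewrite mulr_ge0 ?sqr_ge0.
have H4 : v b ^+ 2 * Q b.+1 <= 2%:R * th ^+ 2 * S.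
  case eb: b => [|c].
    by rewrite v0 expr0n /= mul0r mulr_ge0 // mulr_ge0 ?sqr_ge0.
  have h : p c.+1 * v c.+1 ^+ 2 <= S.
    rewrite /S eb big_ord_recr /= lerDr; apply: sumr_ge0 => i _.
    by rewrite mulr_ge0 ?p_ge0 ?sqr_ge0.
  rewrite mulrC; apply: le_trans (ler_wpM2r (sqr_ge0 _) (QpS c.+1)) _.
  by rewrite -[leLHS](mulrA _ (p c.+1)); apply: ler_wpM2l => //; rewrite mulr_ge0 ?sqr_ge0.
move: H1 H2 H3 H4 S0; rewrite th_val; move: (\sum_(k < b) p k.+1 * v k ^+ 2) => Z; nra.
Qed.

Lemma one_side : \sum_(k < K) p k.+1 * T k.+1 <= 0.
Proof.
have [[b [bK vb va]]|all] : (exists b, [/\ (b < K)%N, forall k, (k < b)%N -> v k.+1 <= dl &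
    dl < v b.+1]) \/ (forall k, (k < K)%N -> v k.+1 <= dl).
  have [E|N] := pselect (exists b, (b < K)%N && (dl < v b.+1)).
    left; pose b := ex_minn E; exists b.
    rewrite /b; case: ex_minnP => m /andP[mK vm] mm; split=> // k km.
    rewrite leNgt; apply/negP => h.
    by have := mm k; rewrite h (ltn_trans km mK) leqNgt km => /(_ isT).
  right=> k kK; rewrite leNgt; apply/negP => h; apply: N; exists k; by rewrite kK h.
- have vb' : v b <= dl.
    by case: b bK vb va => [_ _ _|c bK vb _]; [rewrite v0 /dl; lra | apply: vb].
  have [N eK] : exists N, K = (b + N)%N by exists (K - b)%N; rewrite subnKC // ltnW.
  have := high_sum (b := b) (N := N); rewrite eK addSn => /(_ erefl vb' va).
  have := low_sum vb.
  have -> : \sum_(k < b + N) p k.+1 * T k.+1 = \sum_(k < b) p k.+1 * T k.+1 +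
     \sum_(i < N) p (b + i).+1 * T (b + i).+1 by rewrite big_split_ord.
  under [in X in _ -> X -> _]eq_bigr => i _ do rewrite addSn.
  have : 0 <= v b ^+ 2 * Q b.+1 by rewrite mulr_ge0 ?sqr_ge0.
  move: (\sum_(k < b) _) (\sum_(i < N) _) (v b ^+ 2) (Q b.+1) => *; nra.
- have := low_sum all; rewrite (QK (ltnSn K)) mulr0 addr0; exact.
Qed.

End OneSide.
End Seq.

Section Tau.
Context {R : realType}.

Definition kap : R := 2%:R ^- 14.
(** The bound required of the tail at 1; it is a square because the cost in [adm_tail] brings in
    square roots of tails. *)
Definition eta : R := (2%:R ^- 14) ^+ 2.

Lemma kap_gt0 : 0 < kap. Proof. by rewrite /kap invr_gt0 exprn_gt0. Qed.
Lemma kap_val : kap = 1 / 16384%:R.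
Proof. by rewrite /kap -natrX div1r. Qed.

Definition adm_quad (h l : R) : Prop := `|h| <= 2%:R /\ kap * h ^+ 2 <= l.

(* With [Q] the tail of an integer valued magnitude, [l] is the cost of the displacement [h]: it is quadratic for
   small [h] and of the order of [- ln Q] for large [h]. *)
Definition adm_tail (Q : nat -> R) (h l : R) : Prop := adm_quad h l \/
  exists j, [/\ (0 < j)%N, `|h| <= 2%:R * j%:R & expR (- (2%:R * l)) <= Q j].

(* Maurey's property (tau): a pair [g <= f + cost] replaces the infimum convolution. *)
Definition tau (S : finType) (w v : S -> R) (adm : R -> R -> Prop) : Prop :=
  forall f g : R -> R, conv f -> (forall x y l, adm (x - y) l -> g x <= f y + l) ->
  (\sum_s w s * expR (g (v s))) * (\sum_s w s * expR (- f (v s))) <= 1.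


Lemma mul_le1_of_add_le2 (x y : R) : 0 <= x -> 0 <= y -> x + y <= 2%:R -> x * y <= 1.
Proof. by move=> x0 y0 h; have := sqr_ge0 (x - y); nra. Qed.

(** Moving a fraction [l] of the way to the minimizer [z] of [f] lowers [f] by at least [l u] and
    costs at most [kap (2 l)^2]. With [l = min (4 u, 1)] the two exponentials, normalized by [f z],
    sum to at most 2 at each point. *)
Lemma tau_pm1 (S : finType) (w v : S -> R) : (forall s, 0 <= w s) -> \sum_s w s = 1 ->
  (forall s, v s = 1 \/ v s = -1) -> tau w v adm_quad.
Proof.
move=> w0 w1 v1 f g cf H.
have [z z1 Hz] : exists2 z, z = 1 \/ z = -1 & forall s, f z <= f (v s).
  case: (lerP (f 1) (f (-1))) => h; [exists 1|exists (-1)]; auto => s;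
  by case: (v1 s) => ->//; apply: ltW.
have key s : expR (g (v s) - f z) + expR (- (f (v s) - f z)) <= 2%:R.
  set u := f (v s) - f z; have u0 : 0 <= u by rewrite /u subr_ge0.
  have st l : 0 <= l <= 1 -> g (v s) - f z <= u - l * u + l ^+ 2 / 4096%:R.
    move=> l01; set y := l * z + (1 - l) * v s.
    have hy : `|v s - y| <= 2%:R * l.
      have -> : v s - y = l * (v s - z) by rewrite /y; ring.
      have [l0 _] := andP l01.
      rewrite normrM ger0_norm // mulrC; apply: ler_wpM2r => //.
      case: (v1 s) => ->; case: z1 => ->; rewrite ler_norml; apply/andP; split; lra.
    have [l0 l1] := andP l01.
    have h1 : g (v s) <= f y + kap * (v s - y) ^+ 2.
      by apply: H; split=> //; apply: le_trans hy _; lra.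
    have h2 : (v s - y) ^+ 2 <= (2%:R * l) ^+ 2.
      by rewrite -real_normK ?num_real //; apply: lerXn2r; rewrite ?nnegrE //; lra.
    have := cf z (v s) l l01; rewrite -/y /u => h3.
    move: h1; rewrite kap_val; nra.
  case: (lerP u (1 / 4%:R)) => u4.
    have := st (4%:R * u); rewrite (_ : 0 <= _ <= 1); last by apply/andP; split; lra.
    move=> /(_ isT) h.
    have h1 : expR (g (v s) - f z) <= expR (u - 2%:R * u ^+ 2) by rewrite ler_expR; nra.
    have h2 : expR (u - 2%:R * u ^+ 2) <= 1 + (u - 2%:R * u ^+ 2) + (u - 2%:R * u ^+ 2) ^+ 2.
      by apply: expR_quad; nra.
    have h3 : expR (- u) <= 1 + (- u) + (- u) ^+ 2 by apply: expR_quad; lra.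
    have h4 : (u - 2%:R * u ^+ 2) ^+ 2 <= u ^+ 2 by apply: lerXn2r; rewrite ?nnegrE //; nra.
    nra.
  have := st 1; rewrite ler01 lexx => /(_ isT) h.
  have h1 : expR (g (v s) - f z) <= expR (1 / 4096%:R) by rewrite ler_expR; lra.
  have h2 : expR (1 / 4096%:R) <= 1 + (1 / 4096%:R) + (1 / 4096%:R) ^+ 2 :> R.
    by apply: expR_quad; lra.
  have h3 : expR (- u) <= (1 - (- u))^-1 by apply: expR_le_inv; lra.
  have h4 : (1 - (- u))^-1 <= 4%:R / 5%:R.
    by rewrite -div1r ler_pdivrMr; lra.
  lra.
have -> : \sum_s w s * expR (g (v s)) = expR (f z) * \sum_s w s * expR (g (v s) - f z).
  rewrite mulr_sumr; apply: eq_bigr => s _; rewrite mulrCA -expRD; congr (_ * expR _); ring.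
have -> : \sum_s w s * expR (- f (v s)) =
    expR (- f z) * \sum_s w s * expR (- (f (v s) - f z)).
  rewrite mulr_sumr; apply: eq_bigr => s _; rewrite mulrCA -expRD; congr (_ * expR _); ring.
rewrite mulrACA -expRD subrr expR0 mul1r.
apply: mul_le1_of_add_le2.
- by apply: sumr_ge0 => s _; rewrite mulr_ge0 ?expR_ge0.
- by apply: sumr_ge0 => s _; rewrite mulr_ge0 ?expR_ge0.
rewrite -big_split /=.
apply: (@le_trans _ _ (\sum_s w s * 2%:R)); last by rewrite -mulr_suml w1 mul1r.
by apply: ler_sum => s _; rewrite -mulrDr; apply: ler_wpM2l.
Qed.

Section TauTail.
Variables (Q : nat -> R) (K : nat).
Let p k := Q k - Q k.+1.
Hypothesis Q0 : Q 0%N = 1.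
Hypothesis Qpos : forall k, 0 <= Q k.
Hypothesis Qdec : forall k, Q k.+1 <= Q k.
Hypothesis Qnb : forall i j, Q (i + j)%N <= Q i * Q j.
Hypothesis Q1 : Q 1%N <= eta.
Hypothesis QK : forall k, (K < k)%N -> Q k = 0.

Let th : R := 2%:R ^- 14.
Let thv : th = 1 / 16384%:R := kap_val.

(** The cost [adm_tail] with its least value [- ln (Q j) / 2] at level [j] inserted; the
    multiplicative form also makes sense for [Q j = 0]. *)
Definition rel_tail (f g : R -> R) : Prop :=
  (forall x y, `|x - y| <= 2%:R -> g x <= f y + kap * (x - y) ^+ 2) /\
  (forall x y j, (0 < j)%N -> `|x - y| <= 2%:R * j%:R ->
     Num.sqrt (Q j) * expR (g x) <= expR (f y)).

Lemma rel_tailP (f g : R -> R) : (forall x y l, adm_tail Q (x - y) l -> g x <= f y + l) ->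
  rel_tail f g.
Proof.
move=> H; split=> [x y xy|x y j j0 xy]; first by apply: H; left.
have := Qpos j; rewrite le_eqVlt => /orP[/eqP <-|q0].
  by rewrite sqrtr0 mul0r expR_ge0.
set l := - ln (Q j) / 2%:R.
have el : expR (- (2%:R * l)) = Q j.
  rewrite (_ : - (2%:R * l) = ln (Q j)); last by rewrite /l; field.
  by rewrite lnK ?posrE.
have sq : Num.sqrt (Q j) = expR (- l).
  have -> : Q j = expR (- l) ^+ 2.
    by rewrite -el expr2 -expRD; congr expR; ring.
  by rewrite sqrtr_sqr ger0_norm ?expR_ge0.
have h : g x <= f y + l by apply: H; right; exists j; split=> //; rewrite el.
by rewrite sq -expRD ler_expR; lra.
Qed.

Lemma rel_tail_opp (f g : R -> R) : rel_tail f g -> rel_tail (f \o -%R) (g \o -%R).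
Proof.
move=> [h1 h2]; split=> [x y xy|x y j j0 xy] /=.
  have := h1 (- x) (- y).
  by rewrite (_ : - x - - y = - (x - y)) ?normrN ?sqrrN; [apply | ring].
by apply: h2 => //; rewrite (_ : - x - - y = - (x - y)) ?normrN //; ring.
Qed.

Lemma conv_opp (f : R -> R) : conv f -> conv (f \o -%R).
Proof.
move=> cf x y t t01 /=; have := cf (- x) (- y) t t01.
by rewrite (_ : t * - x + _ = - (t * x + (1 - t) * y)); [ | ring].
Qed.

Section Norm.
Variables (f g : R -> R).
Hypothesis cf : conv f.
Hypothesis f0 : f 0 = 0.
Hypothesis fg : rel_tail f g.

(** Where [f] is negative, [v] is 0 and [eg] is 1, so these indices contribute nothing to
    [one_side]; [side_total] adds them back. *)
Let v (k : nat) : R := Num.max (f k%:R) 0.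
Let eg (k : nat) : R := if 0 <= f k%:R then expR (g k%:R) else 1.

Lemma star_le (k : nat) : f k%:R <= k%:R / k.+1%:R * f k.+1%:R.
Proof.
have k0 : 0 < k.+1%:R :> R by rewrite ltr0n.
have := @cf k.+1%:R 0 (k%:R / k.+1%:R).
rewrite mulr0 addr0 f0 mulr0 addr0 divfK ?gt_eqF //; apply.
by rewrite divr_ge0 //= ler_pdivrMr // mul1r ler_nat.
Qed.

Lemma star_lin (k : nat) : k%:R * f 1 <= f k%:R.
Proof.
case: k => [|k]; first by rewrite mul0r f0.
have k0 : 0 < k.+1%:R :> R by rewrite ltr0n.
have := @cf k.+1%:R 0 (k.+1%:R^-1).
rewrite mulr0 addr0 f0 mulr0 addr0 mulVf ?gt_eqF // => h.
rewrite -ler_pdivlMl //; apply: h.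
by rewrite invr_ge0 ler0n /= invf_le1 // ler1n.
Qed.

Lemma v_inc k : v k <= v k.+1.
Proof.
rewrite /v ge_max; apply/andP; split; last by rewrite le_max lexx orbT.
rewrite le_max; apply/orP.
case: (lerP (f k.+1%:R) 0) => h.
  right; apply: le_trans (star_le k) _; by rewrite mulr_ge0_le0 ?divr_ge0.
left; apply: le_trans (star_le k) _; rewrite ler_piMl ?(ltW h) //.
by rewrite ler_pdivrMr ?ltr0n // mul1r ler_nat.
Qed.

Lemma side_pos : \sum_(k < K) p k.+1 * (eg k.+1 + expR (- v k.+1) - 2%:R) <= 0.
Proof.
have [fg1 fg2] := fg.
apply: (@one_side R Q K Q0 Qpos Qdec Qnb Q1 QK v eg) => //.
- by rewrite /v f0 maxxx.
- exact: v_inc.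
- move=> k l l01; have [l0 l1] := andP l01.
  rewrite /eg; case: ifP => h; last first.
    have n0 : f k.+1%:R <= 0 by rewrite leNgt; apply/negP => /ltW; rewrite h.
    have e1 : v k.+1 = 0 by rewrite /v; apply/max_idPr.
    have e0 : v k = 0.
      apply/eqP; rewrite eq_le; have := v_inc k; rewrite e1 => -> /=.
      by rewrite /v le_max lexx orbT.
    rewrite e1 e0 subrr mulr0 subr0 add0r -[leLHS]expR0 ler_expR.
    by rewrite mulr_ge0 ?sqr_ge0 // ltW // kap_gt0.
  rewrite ler_expR; set y := l * k%:R + (1 - l) * k.+1%:R.
  have e : k.+1%:R - y = l by rewrite /y -natr1; ring.
  have h1 := fg1 k.+1%:R y; rewrite e ger0_norm // in h1.
  have h2 := h1 ltac:(lra).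
  apply: le_trans h2 _; apply: lerD => //.
  apply: le_trans (cf k%:R k.+1%:R l01) _.
  have -> : v k.+1 = f k.+1%:R by rewrite /v; apply/max_idPl.
  have : f k%:R <= v k by rewrite /v le_max lexx.
  nra.
- move=> j i i0 ji; rewrite /eg; case: ifP => h; last first.
    rewrite mulr1; apply: (@le_trans _ _ 1).
      by rewrite -[leRHS]sqrtr1 ler_wsqrtr // (@Qle1 R Q Q0 Qpos Qnb Q1).
    by rewrite -[leLHS]expR0 ler_expR /v le_max lexx orbT.
  apply: (@le_trans _ _ (expR (f j%:R))).
    apply: fg2 => //; rewrite -natrB; last by lia.
    by rewrite ger0_norm // -natrM ler_nat; lia.
  by rewrite ler_expR /v le_max lexx.
Qed.

Lemma cosh_le (x : R) : 0 <= x -> expR x + expR (- x) - 2%:R <= 2%:R * x ^+ 2 * expR x.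
Proof.
move=> x0; have e0 := expR_gt0 x.
have h1 : (1 - x) * expR x <= 1.
  have := expR_ge1Dx (- x) => h.
  have : (1 + - x) * expR x <= expR (- x) * expR x by apply: ler_wpM2r => //; exact: ltW.
  by rewrite -expRD addNr expR0.
have h2 : expR (- x) * (1 + x) <= 1.
  have := expR_ge1Dx x => h.
  have : expR (- x) * (1 + x) <= expR (- x) * expR x by apply: ler_wpM2l => //; exact: expR_ge0.
  by rewrite -expRD addNr expR0.
have h3 : expR x * expR (- x) = 1 by rewrite -expRD subrr expR0.
have i0 := expR_gt0 (- x).
have h4 : expR x - expR (- x) <= 2%:R * x * expR x.
  have h5 : (1 - 2%:R * x) * expR x <= expR (- x).
    have := expR_ge1Dx (- (2%:R * x)) => h.
    have : (1 + - (2%:R * x)) * expR x <= expR (- (2%:R * x)) * expR x.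
      by apply: ler_wpM2r => //; exact: ltW.
    by rewrite -expRD (_ : - (2%:R * x) + x = - x) //; ring.
  nra.
nra.
Qed.

(** Where [f] is negative, convexity and [f 0 = 0] give [- f k <= k b]. By [cosh_le] the excess is
    then at most [2 b^2 8^k], and the masses, at most [(th^2)^k], reduce the sum to a small multiple
    of [b^2]. *)
Lemma side_total (b : R) : 0 <= b -> b <= 1 / 16%:R -> - b <= f 1 ->
  \sum_(k < K) p k.+1 * (expR (g k.+1%:R) + expR (- f k.+1%:R) - 2%:R) <= b ^+ 2.
Proof.
move=> b0 b16 fb; have [fg1 fg2] := fg.
have p0 k : 0 <= p k by rewrite /p subr_ge0.
apply: (@le_trans _ _ (\sum_(k < K) p k.+1 * (eg k.+1 + expR (- v k.+1) - 2%:R) +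
   \sum_(k < K) 2%:R * b ^+ 2 * (8%:R * th ^+ 2) ^+ k.+1)).
  rewrite -big_split; apply: ler_sum => k _ /=; rewrite /eg /v.
  case: (lerP 0 (f k.+1%:R)) => h.
    rewrite lerDl; apply: mulr_ge0; first by rewrite mulr_ge0 ?sqr_ge0.
    by apply: exprn_ge0; rewrite mulr_ge0 ?sqr_ge0.
  rewrite oppr0 expR0 (_ : 1 + 1 - 2%:R = 0); last by ring.
  rewrite mulr0 add0r.
  set x := - f k.+1%:R; have x0 : 0 <= x by rewrite /x oppr_ge0 ltW.
  have xb : x <= k.+1%:R * b.
    have := star_lin k.+1; rewrite /x => h1.
    have : k.+1%:R * - b <= k.+1%:R * f 1 by apply: ler_wpM2l.
    by lra.
  have gx : g k.+1%:R <= f k.+1%:R.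
    by have := fg1 k.+1%:R k.+1%:R; rewrite subrr normr0 expr0n /= mulr0 addr0; apply.
  have e1 : expR (g k.+1%:R) + expR (- f k.+1%:R) - 2%:R <= 2%:R * x ^+ 2 * expR x.
    apply: le_trans (cosh_le x0); rewrite /x opprK lerB // addrC lerD2l.
    by rewrite ler_expR.
  have n2 : k.+1%:R <= 2%:R ^+ k.+1 :> R.
    by rewrite -natrX ler_nat ltnW // ltn_expl.
  have e2 : expR x <= 2%:R ^+ k.+1.
    have h2 : expR (1 / 3%:R) <= 2%:R :> R.
      by apply: le_trans (expR_quad (lexx _)) _; lra.
    have -> : x = x / k.+1%:R * k.+1%:R by rewrite divfK // pnatr_eq0.
    rewrite expRM_natr; apply: lerXn2r; rewrite ?nnegrE ?expR_ge0 //.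
    apply: le_trans h2; rewrite ler_expR ler_pdivrMr ?ltr0n //.
    apply: le_trans xb _; rewrite mulrC; apply: ler_wpM2r => //; lra.
  have e3 : x ^+ 2 <= b ^+ 2 * (2%:R ^+ k.+1) ^+ 2.
    rewrite -exprMn; apply: lerXn2r; rewrite ?nnegrE ?mulr_ge0 ?exprn_ge0 //.
    by apply: le_trans xb _; rewrite mulrC; apply: ler_wpM2l.
  have pk : p k.+1 <= (th ^+ 2) ^+ k.+1.
    have := @Qth R Q Q0 Qpos Qnb Q1 k.+1; apply: le_trans; rewrite /p gerBl; exact: Qpos.
  apply: le_trans (ler_wpM2l (p0 _) e1) _.
  apply: (@le_trans _ _ ((th ^+ 2) ^+ k.+1 * (2%:R * x ^+ 2 * expR x))).
    by apply: ler_wpM2r => //; rewrite !mulr_ge0 ?sqr_ge0 ?expR_ge0.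
  have -> : 2%:R * b ^+ 2 * (8%:R * th ^+ 2) ^+ k.+1 =
    (th ^+ 2) ^+ k.+1 * (2%:R * (b ^+ 2 * (2%:R ^+ k.+1) ^+ 2) * 2%:R ^+ k.+1).
    rewrite exprMn (_ : 8%:R = 2%:R * 2%:R * 2%:R :> R); last by ring.
    by rewrite !exprMn; ring.
  apply: ler_wpM2l; first by rewrite exprn_ge0 ?sqr_ge0.
  apply: ler_pM; rewrite ?expR_ge0 ?mulr_ge0 ?sqr_ge0 //.
  by apply: ler_wpM2l.
have -> : \sum_(k < K) 2%:R * b ^+ 2 * (8%:R * th ^+ 2) ^+ k.+1 =
  2%:R * b ^+ 2 * \sum_(k < K) (8%:R * th ^+ 2) ^+ k.+1 by rewrite mulr_sumr.
have h8 : \sum_(k < K) (8%:R * th ^+ 2) ^+ k.+1 <= 2%:R * (8%:R * th ^+ 2).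
  by apply: geom_le; rewrite ?mulr_ge0 ?sqr_ge0 // thv; lra.
have := side_pos; have := sqr_ge0 b.
move: h8; rewrite thv; move: (\sum_(k < K) _) (\sum_(k < K) _) (b ^+ 2) => *; nra.
Qed.

End Norm.

Let E (phi : R -> R) := p 0 * phi 0 +
  \sum_(k < K) p k.+1 * ((phi k.+1%:R + phi (- k.+1%:R)) / 2%:R).

Lemma sum_p1 : p 0 + \sum_(k < K) p k.+1 = 1.
Proof.
have := @sum_p R Q 0 K.+1; rewrite add0n Q0 (QK (ltnSn K)) subr0 => <-.
by rewrite big_ord_recl.
Qed.

Lemma E_ge0 (phi : R -> R) : (forall x, 0 <= phi x) -> 0 <= E phi.
Proof.
move=> h; rewrite addr_ge0 ?mulr_ge0 //; first by rewrite /p subr_ge0.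
apply: sumr_ge0 => k _; apply: mulr_ge0; first by rewrite /p subr_ge0.
by rewrite divr_ge0 ?addr_ge0.
Qed.

Lemma E_opp (phi : R -> R) : E (phi \o -%R) = E phi.
Proof.
rewrite /E /= oppr0; congr (_ + _); apply: eq_bigr => k _.
by rewrite opprK (addrC (phi (- _))).
Qed.

Lemma tau_small (f g : R -> R) : conv f -> f 0 = 0 -> rel_tail f g -> 0 <= f (-1) ->
  - (1 / 16%:R) <= f 1 -> E (expR \o g) * E (expR \o -%R \o f) <= 1.
Proof.
move=> cf f0 fg fm f1; have [fg1 fg2] := fg.
apply: mul_le1_of_add_le2; try by apply: E_ge0 => x /=; exact: expR_ge0.
set b := Num.max 0 (- f 1).
have b0 : 0 <= b by rewrite /b le_max lexx.
have b16 : b <= 1 / 16%:R by rewrite /b ge_max; apply/andP; split; lra.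
have bf : - b <= f 1 by rewrite lerNl /b le_max lexx orbT.
have S1 := side_total cf f0 fg b0 b16 bf.
have S2 : \sum_(k < K) p k.+1 * (expR (g (- k.+1%:R)) + expR (- f (- k.+1%:R)) - 2%:R) <= 0.
  have h1 : (f \o -%R) 0 = 0 by rewrite /= oppr0.
  have := @side_total _ _ (conv_opp cf) h1 (rel_tail_opp fg) 0 (lexx _).
  rewrite expr0n /= oppr0; apply; [lra | exact: fm].
(* The positive side may exceed its share by [b^2]. The atom at 0, of mass at least 1/2,
   compensates: the shift from 0 to [16 b] lowers [f] by at least [16 b^2] at a cost of
   [b^2 / 64]. *)
have Z : expR (g 0) - 1 <= - (4%:R * b ^+ 2).
  have h : g 0 <= - (8%:R * b ^+ 2).
    have l01 : 0 <= 16%:R * b <= 1 by apply/andP; split; lra.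
    have := fg1 0 (16%:R * b); rewrite sub0r normrN ger0_norm; last lra.
    rewrite sqrrN => /(_ ltac:(lra)) h1.
    have := cf 1 0 (16%:R * b) l01; rewrite mulr1 mulr0 addr0 f0 mulr0 addr0 => h2.
    have h3 : 16%:R * b * f 1 <= 16%:R * b * - b.
      rewrite /b; case: (lerP (- f 1) 0) => h; first by rewrite mulr0 !mul0r.
      by rewrite opprK.
    move: h1; rewrite kap_val => h1; have b2 := sqr_ge0 b.
    move: (f (16%:R * b)) (f 1) (g 0) h1 h2 h3 => x y z *; lra.
  have : expR (g 0) <= expR (- (8%:R * b ^+ 2)) by rewrite ler_expR.
  have : expR (- (8%:R * b ^+ 2)) <= 1 + - (8%:R * b ^+ 2) + (- (8%:R * b ^+ 2)) ^+ 2.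
    by apply: expR_quad; nra.
  have y1 : b ^+ 2 <= 1 / 256%:R by nra.
  have y0 := sqr_ge0 b.
  move: (b ^+ 2) y0 y1 (expR (g 0)) (expR _) => y y0 y1 s t *; nra.
have p0 : 1 / 2%:R <= p 0.
  have := Q1; rewrite /p Q0 /eta -/th thv; lra.
have -> : E (expR \o g) + E (expR \o -%R \o f) = 2%:R + p 0 * (expR (g 0) - 1) +
   (\sum_(k < K) p k.+1 * (expR (g k.+1%:R) + expR (- f k.+1%:R) - 2%:R) +
    \sum_(k < K) p k.+1 * (expR (g (- k.+1%:R)) + expR (- f (- k.+1%:R)) - 2%:R)) / 2%:R.
  transitivity (2%:R * (p 0 + \sum_(k < K) p k.+1) + p 0 * (expR (g 0) - 1) +
    (\sum_(k < K) p k.+1 * (expR (g k.+1%:R) + expR (- f k.+1%:R) - 2%:R) +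
    \sum_(k < K) p k.+1 * (expR (g (- k.+1%:R)) + expR (- f (- k.+1%:R)) - 2%:R)) / 2%:R);
    last by rewrite sum_p1 mulr1.
  rewrite /E /= f0 oppr0 expR0 addrACA -!big_split /= mulr_suml mulrDr mulr_sumr.
  set A := \sum_(i < K) _; set B := \sum_(i < K) 2%:R * _; set C := \sum_(i < K) _.
  have -> : A = B + C.
    by rewrite /A /B /C -big_split; apply: eq_bigr => i _ /=; field.
  ring.
have := sqr_ge0 b; move: S1 S2 Z p0; move: (\sum_(k < K) _) (\sum_(k < K) _) => s1 s2; nra.
Qed.

(* [Lam k] is (a bound for) [e^-(cost of k)]; the maximum of [Lam k * e^-(f k)] bounds both factors. *)
Let Lam (k : nat) : R :=
  if k == 0%N then 1 else if k == 1%N then expR (- (4%:R * kap)) else Num.sqrt (Q k).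

Lemma Lam_ge0 k : 0 <= Lam k.
Proof. by rewrite /Lam; do 2?case: ifP => _; rewrite ?expR_ge0 ?sqrtr_ge0. Qed.

Lemma sqrtQ_le1 k : Num.sqrt (Q k) <= 1.
Proof. by rewrite -[leRHS]sqrtr1 ler_wsqrtr // (@Qle1 R Q Q0 Qpos Qnb Q1). Qed.

Lemma Lam_le1 k : Lam k <= 1.
Proof.
rewrite /Lam; do 2?case: ifP => _ //; last exact: sqrtQ_le1.
by rewrite -[leRHS]expR0 ler_expR oppr_le0; apply: mulr_ge0 => //; apply/ltW/kap_gt0.
Qed.

Lemma Lam_rel (f g : R -> R) (x y : R) (j k : nat) : rel_tail f g ->
  `|x| = k%:R -> `|y| = j%:R -> Lam j * Lam k * expR (g x) <= expR (f y).
Proof.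
move=> [fg1 fg2]; wlog : j k x y / True by move=> H; exact: H.
move=> _ xk yj; set m := maxn j k.
have xy : `|x - y| <= 2%:R * m%:R.
  apply: le_trans (ler_normB _ _) _; rewrite xk yj -natrD -natrM ler_nat /m; lia.
have L1 := Lam_le1; have L0 := Lam_ge0.
have LL : Lam j * Lam k <= Lam m.
  rewrite /m; case: (leqP j k) => _.
    by rewrite -[leRHS]mul1r; apply: ler_wpM2r.
  by rewrite -[leRHS]mulr1; apply: ler_wpM2l.
apply: le_trans (ler_wpM2r (expR_ge0 _) LL) _.
case: (posnP m) => [m0|mpos].
  have e : x - y = 0.
    by apply/normr0_eq0/eqP; rewrite eq_le normr_ge0 andbT; move: xy; rewrite m0 mulr0.
  have := fg1 x y; rewrite e normr0 expr0n /= mulr0 addr0 => h.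
  by rewrite m0 /Lam eqxx mul1r ler_expR h.
case: (eqVneq m 1%N) => [m1|m1].
  have xy2 : `|x - y| <= 2%:R by move: xy; rewrite m1 mulr1.
  rewrite m1 /Lam /= -expRD ler_expR; have h := fg1 x y xy2.
  have h2 : (x - y) ^+ 2 <= 2%:R ^+ 2.
    by rewrite -real_normK ?num_real //; apply: lerXn2r; rewrite ?nnegrE.
  have := kap_gt0; nra.
by rewrite /Lam gtn_eqF // (negbTE m1); apply: fg2.
Qed.

Lemma pLam k : p k.+1 <= 2%:R * th ^+ k.+1 * Lam k.+1.
Proof.
have pq : p k.+1 <= Q k.+1 by rewrite /p gerBl.
have t0 : 0 <= th by rewrite thv; lra.
case: k pq => [|k] pq.
  rewrite /Lam /=; apply: le_trans pq _; apply: le_trans Q1 _; rewrite /eta -/th expr1.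
  have e : 1 - 4%:R * kap <= expR (- (4%:R * kap)) := expR_ge1Dx _.
  move: e; rewrite kap_val thv; lra.
rewrite /Lam /=; apply: le_trans pq _.
rewrite -[leLHS](sqr_sqrtr (Qpos _)) expr2.
apply: ler_wpM2r; first exact: sqrtr_ge0.
apply: le_trans (@sqrtQ R Q Q0 Qpos Qnb Q1 k.+2) _.
by rewrite ler_peMl ?exprn_ge0 // ler1n.
Qed.

Lemma exists_max (I : finType) (F : I -> R) (i0 : I) : exists i, forall j, F j <= F i.
Proof.
exists [arg max_(i > i0) F i]%O; case: arg_maxP => // i _ H j; exact: H.
Qed.

(** Here [a] exceeds 1 by a fixed amount since [f 1] is well below 0. The first factor is at most
    [(1 + 4 th) / a]. In the second, the atom and the negative side, where [f >= 0], contribute at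
    most 1 and the positive side only [2 th a]; the product stays below 1. *)
Lemma tau_big (f g : R -> R) : conv f -> f 0 = 0 -> rel_tail f g -> 0 <= f (-1) ->
  f 1 < - (1 / 16%:R) -> (0 < K)%N -> E (expR \o g) * E (expR \o -%R \o f) <= 1.
Proof.
move=> cf f0 fg fm f1 Kpos.
pose pt (i : 'I_K.+1 * bool) : R := if i.2 then i.1%:R else - i.1%:R.
have apt i : `|pt i| = i.1%:R by rewrite /pt; case: i.2; rewrite ?normrN ger0_norm.
have [i0 Hi0] := exists_max (fun i : 'I_K.+1 * bool => Lam i.1 * expR (- f (pt i))) (ord0, true).
set a := Lam i0.1 * expR (- f (pt i0)).
have a1 : 17%:R / 16%:R - 4%:R * kap <= a.
  have k1 : (1 < K.+1)%N by [].
  have := Hi0 (Ordinal k1, true); rewrite /pt /= /Lam /= -/a -expRD; apply: le_trans.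
  by apply: le_trans (expR_ge1Dx _); lra.
have a17 : 18%:R / 17%:R <= a by move: a1; rewrite kap_val; lra.
have a0 : 0 < a by lra.
have U1 (i : 'I_K.+1 * bool) : a * (Lam i.1 * expR (g (pt i))) <= 1.
  have h := Lam_rel fg (apt i) (apt i0).
  have := ler_wpM2r (expR_ge0 (- f (pt i0))) h.
  rewrite -expRD subrr expR0; apply: le_trans.
  by rewrite le_eqVlt; apply/orP; left; apply/eqP; rewrite /a; ring.
have U2 (i : 'I_K.+1 * bool) : Lam i.1 * expR (- f (pt i)) <= a := Hi0 i.
have L0 := Lam_ge0; have t0 : 0 <= th by rewrite thv; lra.
have pk0 k : 0 <= p k by rewrite /p subr_ge0.
have Hb k (y c : R) : 0 <= y -> Lam k.+1 * y <= c -> p k.+1 * y <= 2%:R * th ^+ k.+1 * c.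
  move=> y0 h; apply: le_trans (ler_wpM2r y0 (pLam k)) _; rewrite -[leLHS]mulrA.
  by apply: ler_wpM2l => //; rewrite mulr_ge0 ?exprn_ge0.
have GS : \sum_(k < K) 2%:R * th ^+ k.+1 <= 4%:R * th.
  rewrite -mulr_sumr; have := @geom_le R th K t0; rewrite {1}thv => h.
  have := h ltac:(lra); move: (\sum_(k < K) _) => *; lra.
have p01 : p 0 <= 1.
  rewrite -sum_p1 lerDl; apply: sumr_ge0 => k _; exact: pk0.
have A1 : a * E (expR \o g) <= 1 + 4%:R * th.
  rewrite /E mulrDr /=; apply: lerD.
    have := U1 (ord0, true); rewrite /pt /= /Lam /= mul1r => h.
    by rewrite mulrCA; apply: mulr_ile1 => //; rewrite mulr_ge0 ?expR_ge0 // ltW.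
  rewrite mulr_sumr; apply: le_trans GS; apply: ler_sum => k _.
  have kK : (k.+1 < K.+1)%N by rewrite ltnS.
  have h1 := U1 (Ordinal kK, true); have h2 := U1 (Ordinal kK, false).
  rewrite /pt /= in h1 h2.
  have g1 := Hb k (a * expR (g k.+1%:R)) 1; have g2 := Hb k (a * expR (g (- k.+1%:R))) 1.
  rewrite !mulr1 in g1 g2.
  have {}g1 := g1 ltac:(by rewrite mulr_ge0 ?expR_ge0 // ltW) ltac:(by rewrite mulrCA).
  have {}g2 := g2 ltac:(by rewrite mulr_ge0 ?expR_ge0 // ltW) ltac:(by rewrite mulrCA).
  have -> : a * (p k.+1 * ((expR (g k.+1%:R) + expR (g (- k.+1%:R))) / 2%:R)) =
    (p k.+1 * (a * expR (g k.+1%:R)) + p k.+1 * (a * expR (g (- k.+1%:R)))) / 2%:R.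
    by field.
  move: g1 g2; move: (p k.+1 * _) (p k.+1 * _) (2%:R * th ^+ k.+1) => *; lra.
have fneg (k : nat) : 0 <= f (- k%:R).
  have := @star_lin (f \o -%R) (conv_opp cf); rewrite /= oppr0 => /(_ f0 k).
  by apply: le_trans; rewrite mulr_ge0.
have B1 : E (expR \o -%R \o f) <= 1 + 2%:R * th * a.
  apply: (@le_trans _ _ (p 0 + (\sum_(k < K) p k.+1 +
     (\sum_(k < K) 2%:R * th ^+ k.+1) * a / 2%:R))).
    rewrite /E /= f0 oppr0 expR0 mulr1 lerD2l !mulr_suml -big_split /=.
    apply: ler_sum => k _.
    have kK : (k.+1 < K.+1)%N by rewrite ltnS.
    have h1 := U2 (Ordinal kK, true); rewrite /pt /= in h1.
    have g1 := Hb k _ _ (expR_ge0 _) h1.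
    have g2 : p k.+1 * expR (- f (- k.+1%:R)) <= p k.+1.
      by rewrite ler_piMr // -[leRHS]expR0 ler_expR oppr_le0.
    by have pk := pk0 k.+1; lra.
  rewrite addrA sum_p1 lerD2l.
  have : (\sum_(k < K) 2%:R * th ^+ k.+1) * a <= 4%:R * th * a.
    by apply: ler_wpM2r => //; exact: ltW.
  move: (_ * a) => *; lra.
have E1 : 0 <= E (expR \o g) by apply: E_ge0 => x; exact: expR_ge0.
have E2 : 0 <= E (expR \o -%R \o f) by apply: E_ge0 => x; exact: expR_ge0.
have E3 : E (expR \o g) <= (1 + 4%:R * th) / a by rewrite ler_pdivlMr // mulrC.
apply: le_trans (ler_pM E1 E2 E3 B1) _.
rewrite mulrAC ler_pdivrMr // mul1r; move: a17; rewrite thv; nra.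
Qed.

Lemma tau_seq (f g : R -> R) : conv f -> rel_tail f g ->
  E (expR \o g) * E (expR \o -%R \o f) <= 1.
Proof.
move=> cf fg.
pose f' x := f x - f 0; pose g' x := g x - f 0.
have cf' : conv f'.
  by move=> x y t t01; rewrite /f'; have := cf x y t t01; lra.
have f'0 : f' 0 = 0 by rewrite /f' subrr.
have fg' : rel_tail f' g'.
  case: fg => h1 h2; split=> [x y xy|x y j j0 xy]; rewrite /f' /g'.
    by have := h1 x y xy; lra.
  by rewrite !expRD mulrA; apply: ler_wpM2r; rewrite ?expR_ge0 ?h2.
have Es (phi : R -> R) c : E (fun x => c * phi x) = c * E phi.
  rewrite /E mulrDr mulr_sumr; congr (_ + _); first by ring.
  by apply: eq_bigr => k _; ring.
have Ee (phi psi : R -> R) : phi =1 psi -> E phi = E psi.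
  by move=> h; rewrite /E h; congr (_ + _); apply: eq_bigr => k _; rewrite !h.
have -> : E (expR \o g) * E (expR \o -%R \o f) =
    E (expR \o g') * E (expR \o -%R \o f').
  have -> : E (expR \o g) = E (fun x => expR (f 0) * (expR \o g') x).
    by apply: Ee => x /=; rewrite -expRD /g'; congr expR; ring.
  have -> : E (expR \o -%R \o f) = E (fun x => expR (- f 0) * (expR \o -%R \o f') x).
    by apply: Ee => x /=; rewrite -expRD /f'; congr expR; ring.
  by rewrite !Es mulrACA -expRD subrr expR0 mul1r.
clear Es Ee; move: f' g' cf' f'0 fg' => {fg cf}f {}g cf f0 fg.
(* Convexity and [f 0 = 0] give [f 1 + f (-1) >= 0], so after a reflection only [f 1] can be
   negative. *)
wlog fm : f g cf f0 fg / 0 <= f (-1).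
  move=> H; case: (lerP 0 (f (-1))) => h; first exact: H.
  have := H (f \o -%R) (g \o -%R) (conv_opp cf) _ (rel_tail_opp fg).
  rewrite /= oppr0 opprK => /(_ f0).
  have E1 := E_opp (expR \o g); have E2 := E_opp (expR \o -%R \o f).
  have -> : E (expR \o (g \o -%R)) = E (expR \o g) := E1.
  have -> : E (expR \o -%R \o (f \o -%R)) = E (expR \o -%R \o f) := E2.
  apply; have := cf 1 (-1) (1 / 2%:R); rewrite (_ : 0 <= _ <= 1) => [/(_ isT)|]; last first.
    by apply/andP; split; lra.
  rewrite (_ : _ * 1 + _ = 0); last by field.
  by rewrite f0; lra.
case: (lerP (- (1 / 16%:R)) (f 1)) => h1; first exact: tau_small.
case: (posnP K) => [K0|]; last exact: tau_big.
have p1 := sum_p1; rewrite /E K0 !big_ord0 !addr0 in p1 *.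
rewrite p1 !mul1r /= f0 oppr0 expR0 mulr1 -[leRHS]expR0 ler_expR.
by have := fg.1 0 0; rewrite subrr normr0 expr0n /= mulr0 addr0 f0; apply.
Qed.

End TauTail.

Section Law.
Variables (S0 : finType) (m : S0 -> R) (k : S0 -> nat).

Definition tailQ (j : nat) : R := \sum_(s : S0 | (j <= k s)%N) m s.

Hypothesis m0 : forall s, 0 <= m s.
Hypothesis m1 : \sum_s m s = 1.

Lemma tailQ0 : tailQ 0 = 1.
Proof. by rewrite -m1 /tailQ; apply: eq_bigl => s. Qed.

Lemma tailQ_ge0 j : 0 <= tailQ j.
Proof. by apply: sumr_ge0. Qed.

Lemma tailQ_sub j : tailQ j - tailQ j.+1 = \sum_(s | k s == j) m s.
Proof.
rewrite /tailQ (bigID (fun s => k s == j)) /=.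
rewrite [X in X + _ - _](_ : _ = \sum_(s | k s == j) m s); last first.
  by apply: eq_bigl => s; case: eqP => [->|]; rewrite ?leqnn ?andbF.
rewrite [X in _ + X - _](_ : _ = \sum_(s | (j.+1 <= k s)%N) m s); last first.
  by apply: eq_bigl => s; rewrite ltn_neqAle eq_sym andbC.
by rewrite addrK.
Qed.

Lemma tailQ_dec j : tailQ j.+1 <= tailQ j.
Proof. by rewrite -subr_ge0 tailQ_sub; apply: sumr_ge0. Qed.

Lemma tailQ_bound j : (\max_s k s < j)%N -> tailQ j = 0.
Proof.
move=> h; apply: big_pred0 => s; apply/negbTE; rewrite -ltnNge.
by apply: leq_ltn_trans h; apply: leq_bigmax.
Qed.

Lemma tailQ_sum (psi : nat -> R) K : (\max_s k s <= K)%N ->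
  \sum_s m s * psi (k s) = \sum_(j < K.+1) (tailQ j - tailQ j.+1) * psi j.
Proof.
move=> hK.
have kK s : (k s < K.+1)%N by rewrite ltnS; apply: leq_trans hK; apply: leq_bigmax.
rewrite (partition_big (fun s => Ordinal (kK s)) xpredT) //=.
apply: eq_bigr => j _; rewrite tailQ_sub mulr_suml.
apply: eq_big => [s|s /eqP <- //].
by rewrite -val_eqE.
Qed.

(** Says that [- ln (Q j) / j] is nondecreasing, which is what log-concavity gives relative to
    [Q 0 = 1]; powers in place of logarithms cover vanishing tails. *)
Definition lcQ : Prop :=
  forall i j, (0 < i)%N -> (i <= j)%N -> tailQ j ^+ i <= tailQ i ^+ j.

Hypothesis lc : lcQ.
Hypothesis q1 : tailQ 1 <= eta.

(** Raised to the power [i + j], the inequality splits into two instances of [lc]. *)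
Lemma tailQ_nb i j : tailQ (i + j) <= tailQ i * tailQ j.
Proof.
case: (posnP i) => [->|i0]; first by rewrite tailQ0 mul1r.
case: (posnP j) => [->|j0]; first by rewrite tailQ0 mulr1 addn0.
rewrite -(@ler_pXn2r _ (i + j)%N) ?nnegrE ?mulr_ge0 ?tailQ_ge0 ?addn_gt0 ?i0 //.
rewrite exprMn {1}exprD; apply: ler_pM; rewrite ?exprn_ge0 ?tailQ_ge0 //.
  by apply: lc; rewrite ?leq_addr.
by apply: lc; rewrite ?leq_addl.
Qed.

Lemma tau_tail : tau (fun bs : bool * S0 => m bs.2 / 2%:R)
  (fun bs => (-1) ^+ bs.1 * (k bs.2)%:R) (adm_tail tailQ).
Proof.
move=> f g cf H; set K := (\max_s k s)%N.
have QK j : (K < j)%N -> tailQ j = 0 by exact: tailQ_bound.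
have fg : rel_tail tailQ f g by apply: rel_tailP => //; exact: tailQ_ge0.
have := @tau_seq tailQ K tailQ0 tailQ_ge0 tailQ_dec tailQ_nb q1 QK f g cf fg.
have E (phi : R -> R) : tailQ 0 - tailQ 1 = tailQ 0 - tailQ 1 ->
  \sum_(bs : bool * S0) m bs.2 / 2%:R * phi ((-1) ^+ bs.1 * (k bs.2)%:R) =
  (tailQ 0 - tailQ 1) * phi 0 + \sum_(j < K) (tailQ j.+1 - tailQ j.+2) *
    ((phi j.+1%:R + phi (- j.+1%:R)) / 2%:R).
  move=> _.
  rewrite -(pair_bigA _ (fun (b : bool) s => m s / 2%:R * phi ((-1) ^+ b * (k s)%:R))) /=.
  rewrite big_bool /= -big_split /=.
  have -> : \sum_s (m s / 2%:R * phi ((-1) ^+ true * (k s)%:R) +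
      m s / 2%:R * phi ((-1) ^+ false * (k s)%:R)) =
    \sum_s m s * ((phi (k s)%:R + phi (- (k s)%:R)) / 2%:R).
    by apply: eq_bigr => s _; rewrite expr1 expr0 mul1r mulN1r; field.
  rewrite (tailQ_sum (fun j => (phi j%:R + phi (- j%:R)) / 2%:R) (leqnn _)).
  rewrite big_ord_recl /= oppr0; congr (_ * _ + _).
  by field.
by rewrite -(E (expR \o g) erefl) -(E (expR \o -%R \o f) erefl).
Qed.

End Law.
End Tau.

(** * Concentration of convex functions *)

Section Tensor.
Context {R : realType}.

Lemma Ev_base (A : Type) (S : finType) (w : nat -> S -> R) (v : nat -> S -> A) N
    (Phi : (nat -> A) -> R) :
  (forall y y', (forall i, (i < N)%N -> y i = y' i) -> Phi y = Phi y') ->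
  forall n x x', (forall i, (n <= i < N)%N -> x i = x' i) ->
  Ev n w v x Phi = Ev n w v x' Phi.
Proof.
move=> H; elim=> [|n IH] x x' hx /=; first by apply: H => i iN; exact: hx.
apply: eq_bigr => s _; congr (_ * _); apply: IH => i /andP[ni iN]; rewrite /upd.
by case: eqP => // /eqP ne; apply: hx; rewrite iN andbT ltn_neqAle eq_sym ne.
Qed.

Definition famax (A : finType) (a0 : A) (F : A -> R) : R := F [arg max_(a > a0) F a]%O.

Lemma le_famax (A : finType) (a0 : A) (F : A -> R) a : F a <= famax a0 F.
Proof. by rewrite /famax; case: arg_maxP => // b _; exact. Qed.

Lemma famax_ex (A : finType) (a0 : A) (F : A -> R) : exists a, famax a0 F = F a.
Proof. by eexists. Qed.

Lemma famax_le (A : finType) (a0 : A) (F : A -> R) c : (forall a, F a <= c) -> famax a0 F <= c.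
Proof. by move=> h; exact: h. Qed.

Lemma expR_conv (a b t : R) : 0 <= t <= 1 ->
  expR (t * a + (1 - t) * b) <= t * expR a + (1 - t) * expR b.
Proof.
move=> /andP[t0 t1]; set c := t * a + (1 - t) * b.
have h (y : R) : expR c * (1 + (y - c)) <= expR y.
  have -> : expR y = expR c * expR (y - c) by rewrite -expRD; congr expR; ring.
  by apply: ler_wpM2l; [exact: expR_ge0 | exact: expR_ge1Dx].
have ha := ler_wpM2l t0 (h a).
have t1' : 0 <= 1 - t by lra.
have hb := ler_wpM2l t1' (h b).
apply: le_trans (lerD ha hb).
rewrite le_eqVlt; apply/orP; left; apply/eqP; rewrite /c; ring.
Qed.

(** Hoelder's inequality: after division by the two exponential means it is the pointwise convexity
    of [expR]. *)
Lemma lse_conv (A : Type) (S : finType) (w : nat -> S -> R) (v : nat -> S -> A) n x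
   (h : (nat -> A) -> R -> R) :
  (forall i s, 0 <= w i s) -> (forall i, \sum_s w i s = 1) ->
  (forall y, conv (h y)) -> conv (fun z => ln (Ev n w v x (fun y => expR (h y z)))).
Proof.
move=> w0 w1 ch z1 z2 t t01.
have pos (F : (nat -> A) -> R) : 0 < Ev n w v x (fun y => expR (F y)).
  by apply: lt_le_trans (Ev_jensen_exp v w0 w1 n x F); exact: expR_gt0.
set a := ln (Ev n w v x (fun y => expR (h y z1))).
set b := ln (Ev n w v x (fun y => expR (h y z2))).
rewrite -ler_expR lnK ?posrE ?pos //.
have Ea : Ev n w v x (fun y => expR (h y z1)) = expR a by rewrite /a lnK ?posrE ?pos.
have Eb : Ev n w v x (fun y => expR (h y z2)) = expR b by rewrite /b lnK ?posrE ?pos.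
apply: (@le_trans _ _ (Ev n w v x (fun y => expR (t * a + (1 - t) * b) *
   (t * (expR (- a) * expR (h y z1)) + (1 - t) * (expR (- b) * expR (h y z2)))))).
  apply: Ev_le => // y; rewrite -!expRD.
  apply: (@le_trans _ _ (expR (t * h y z1 + (1 - t) * h y z2))).
    by rewrite ler_expR; apply: ch.
  have -> : t * h y z1 + (1 - t) * h y z2 =
    t * a + (1 - t) * b + (t * (- a + h y z1) + (1 - t) * (- b + h y z2)) by ring.
  by rewrite [leLHS]expRD; apply: ler_wpM2l; [exact: expR_ge0 | exact: expR_conv].
rewrite EvZ EvD !EvZ Ea Eb -!expRD !addNr expR0 !mulr1.
by rewrite (_ : t + (1 - t) = 1) ?mulr1 //; ring.
Qed.

Variables (S : finType) (w v : nat -> S -> R) (adm : nat -> R -> R -> Prop).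
Hypothesis w0 : forall i s, 0 <= w i s.
Hypothesis w1 : forall i, \sum_s w i s = 1.
Hypothesis tauH : forall i, tau (w i) (v i) (adm i).

(* Integrating out one coordinate of a maximum of affine functions gives a convex function, to which (tau)
   applies; [psi a i] is the conjugate of the cost at the slope [t a i]. *)
Lemma tensor n (A : finType) (a0 : A) (t psi : A -> nat -> R) :
  (forall a i, (i < n)%N -> forall h l, adm i h l -> t a i * h <= psi a i + l) ->
  forall (c : A -> R) x,
  Ev n w v x (fun y => expR (famax a0 (fun a => c a + \sum_(i < n) (t a i * y i - psi a i)))) *
  Ev n w v x (fun y => expR (- famax a0 (fun a => c a + \sum_(i < n) t a i * y i))) <= 1.
Proof.
elim: n => [|n IH] H c x.
  rewrite /= -expRD -[leRHS]expR0 ler_expR subr_le0.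
  by rewrite (_ : (fun a => _) = (fun a => c a + \sum_(i < 0) t a i * x i)) //;
     apply/funext => a; rewrite !big_ord0.
have {}IH := IH (fun a i ni => H a i (ltnW ni)).
pose U z := Ev n w v x (fun y => expR (famax a0 (fun a => (c a + t a n * z) +
   \sum_(i < n) (t a i * y i - psi a i)))).
pose V z := Ev n w v x (fun y => expR (- famax a0 (fun a => (c a + t a n * z) +
   \sum_(i < n) t a i * y i))).
pose G z := Ev n w v x (fun y => expR (famax a0 (fun a => (c a + (t a n * z - psi a n)) +
   \sum_(i < n) (t a i * y i - psi a i)))).
have Upos z : 0 < U z.
  by apply: lt_le_trans (Ev_jensen_exp v w0 w1 n x _); exact: expR_gt0.
have Gpos z : 0 < G z.
  by apply: lt_le_trans (Ev_jensen_exp v w0 w1 n x _); exact: expR_gt0.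
have UV z : V z <= expR (- ln (U z)).
  rewrite expRN lnK ?posrE // -div1r ler_pdivlMr // mulrC; exact: IH.
have cf : conv (fun z => ln (U z)).
  apply: (@lse_conv _ _ w v n x (fun y z => famax a0 (fun a => (c a + t a n * z) +
   \sum_(i < n) (t a i * y i - psi a i)))) => // y z1 z2 th th01.
  apply: famax_le => a; have [h0 h1] := andP th01.
  set s := \sum_(i < n) _.
  have -> : c a + t a n * (th * z1 + (1 - th) * z2) + s =
    th * (c a + t a n * z1 + s) + (1 - th) * (c a + t a n * z2 + s) by ring.
  apply: lerD; apply: ler_wpM2l; rewrite ?subr_ge0 //; rewrite /s.
    exact: (@le_famax A a0 (fun a => c a + t a n * z1 + \sum_(i < n) (t a i * y i - psi a i)) a).
  exact: (@le_famax A a0 (fun a => c a + t a n * z2 + \sum_(i < n) (t a i * y i - psi a i)) a).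
have rel (a b l : R) : adm n (a - b) l -> ln (G a) <= ln (U b) + l.
  move=> ad; rewrite -ler_expR expRD !lnK ?posrE // mulrC.
  rewrite -EvZ; apply: Ev_le => // y; rewrite -expRD ler_expR; apply: famax_le => d.
  have := H d n (ltnSn n) _ _ ad.
  have := @le_famax A a0 (fun a => c a + t a n * b + \sum_(i < n) (t a i * y i - psi a i)) d.
  rewrite /=; move: (famax _ _) (\sum_(i < n) _) => m s; lra.
have := tauH cf rel.
apply: le_trans.
have e1 z : Ev n w v (upd x n z) (fun y => expR (famax a0 (fun a => c a +
    \sum_(i < n.+1) (t a i * y i - psi a i)))) = G z.
  transitivity (Ev n w v (upd x n z) (fun y => expR (famax a0 (fun a => (c a +
     (t a n * z - psi a n)) + \sum_(i < n) (t a i * y i - psi a i))))).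
    apply: Ev_ext_on => y Hy; congr (expR (famax a0 _)); apply/funext => a.
    by rewrite big_ord_recr /= Hy // upd_same; ring.
  rewrite /G; apply: (@Ev_base _ _ w v n) => [y y' hy|i /andP[ni iN]].
    congr (expR (famax a0 _)); apply/funext => a; congr (_ + _).
    by apply: eq_bigr => i _; rewrite hy.
  by rewrite leqNgt iN in ni.
have e2 z : Ev n w v (upd x n z) (fun y => expR (- famax a0 (fun a => c a +
    \sum_(i < n.+1) t a i * y i))) = V z.
  transitivity (Ev n w v (upd x n z) (fun y => expR (- famax a0 (fun a => (c a +
     t a n * z) + \sum_(i < n) t a i * y i)))).
    apply: Ev_ext_on => y Hy; congr (expR (- famax a0 _)); apply/funext => a.
    by rewrite big_ord_recr /= Hy // upd_same; ring.
  rewrite /V; apply: (@Ev_base _ _ w v n) => [y y' hy|i /andP[ni iN]].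
    congr (expR (- famax a0 _)); apply/funext => a; congr (_ + _).
    by apply: eq_bigr => i _; rewrite hy.
  by rewrite leqNgt iN in ni.
rewrite /=; under eq_bigr => s _ do rewrite e1.
under [X in _ * X]eq_bigr => s _ do rewrite e2.
apply: ler_pM.
- by apply: sumr_ge0 => s _; rewrite mulr_ge0 // ltW.
- apply: sumr_ge0 => s _; rewrite mulr_ge0 // /V; apply: Ev_ge0 => // y; exact: expR_ge0.
- by apply: ler_sum => s _; rewrite lnK ?posrE.
- by apply: ler_sum => s _; apply: ler_wpM2l.
Qed.

(** A budget valid for every selection passes to the suprema: freezing the other coordinates shows
    that each supremum is finite, and selections within [e / n] of them give the sum. *)
Lemma sum_sup_le n (P : nat -> set R) (p : R) :
  (forall i, (i < n)%N -> P i !=set0) ->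
  (forall f : nat -> R, (forall i, (i < n)%N -> P i (f i)) -> \sum_(i < n) f i <= p) ->
  (forall i, (i < n)%N -> has_sup (P i)) /\ \sum_(i < n) sup (P i) <= p.
Proof.
move=> ne H.
have [f0 Hf0] : exists f : nat -> R, forall i, (i < n)%N -> P i (f i).
  have h i : exists y, (i < n)%N -> P i y.
    by case: (ltnP i n) => [/ne [y Py]|_]; [exists y | exists 0].
  by have [f Hf] := choice h; exists f.
have hs i : (i < n)%N -> has_sup (P i).
  move=> ni; split; first exact: ne.
  exists (p - \sum_(j < n | j != Ordinal ni) f0 j) => y Py.
  rewrite lerBrDr.
  have := H (fun j => if j == i then y else f0 j); rewrite (bigD1 (Ordinal ni)) //= eqxx.
  rewrite (eq_bigr (fun j : 'I_n => f0 j)); first apply.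
    by move=> j nj; case: eqP => [->//|_]; exact: Hf0.
  by move=> j nj; rewrite ifN //; apply: contra nj => /eqP e; apply/eqP/val_inj.
split=> //; apply/ler_addgt0Pr => e e0.
case: (posnP n) => [n0|npos].
  have := H f0 Hf0; move: e0; rewrite n0 !big_ord0; lra.
have h i : exists y, (i < n)%N -> P i y /\ sup (P i) - e / n%:R < y.
  case: (ltnP i n) => [ni|_]; last by exists 0.
  have d0 : 0 < e / n%:R by rewrite divr_gt0 // ltr0n.
  by have [y Py hy] := sup_adherent d0 (hs i ni); exists y.
have [f Hf] := choice h.
have := H f (fun i ni => (Hf i ni).1).
have : \sum_(i < n) (sup (P i) - e / n%:R) <= \sum_(i < n) f i.
  by apply: ler_sum => i _; apply/ltW/(Hf i (ltn_ord i)).2.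
have -> : \sum_(i < n) (sup (P i) - e / n%:R) = \sum_(i < n) sup (P i) - e.
  by rewrite sumrB sumr_const card_ord -[X in _ - X]mulr_natr divfK // pnatr_eq0 gtn_eqF.
lra.
Qed.

(* Convexity in the form in which it is used: every point has a supporting affine function, which depends on
   the first [n] coordinates only. *)
Definition subdiff n (M : (nat -> R) -> R) : Prop := forall x : nat -> R, exists t : nat -> R,
  (forall y : nat -> R, \sum_(i < n) t i * y i <= M y) /\ M x <= \sum_(i < n) t i * x i.

Lemma subdiff_ext n (M : (nat -> R) -> R) : subdiff n M ->
  forall y y', (forall i, (i < n)%N -> y i = y' i) -> M y = M y'.
Proof.
move=> H; suff L y y' : (forall i, (i < n)%N -> y i = y' i) -> M y <= M y'.
  move=> y y' h; apply/eqP; rewrite eq_le (L y y' h) L // => i ni; by rewrite h.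
move=> h; have [t [t1 t2]] := H y; apply: le_trans t2 _; apply: le_trans (t1 y').
by apply: ler_sum => i _; rewrite h.
Qed.

Lemma subdiff_add n (M : (nat -> R) -> R) x y : subdiff n M -> M (fun i => x i + y i) <= M x + M y.
Proof.
move=> H; have [t [t1 t2]] := H (fun i => x i + y i).
apply: le_trans t2 _; apply: le_trans (lerD (t1 x) (t1 y)).
by rewrite -big_split; apply: ler_sum => i _; rewrite mulrDr.
Qed.

Lemma subdiff_scale n (M : (nat -> R) -> R) x c : subdiff n M -> 0 <= c -> M (fun i => c * x i) <= c * M x.
Proof.
move=> H c0; have [t [t1 t2]] := H (fun i => c * x i).
apply: le_trans t2 _; apply: le_trans (ler_wpM2l c0 (t1 x)).
by rewrite mulr_sumr; apply: ler_sum => i _; rewrite mulrCA.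
Qed.

Lemma subdiff_cconv n (M : (nat -> R) -> R) : subdiff n M -> cconv M.
Proof.
move=> H x i a b t /andP[t0 t1].
set y := upd x i a; set z := upd x i b.
have -> : upd x i (t * a + (1 - t) * b) = (fun j => t * y j + (1 - t) * z j).
  by apply/funext => j; rewrite /y /z /upd; case: eqP => _; ring.
apply: le_trans (subdiff_add _ _ H) _; apply: lerD; apply: (subdiff_scale _ H) => //.
by rewrite subr_ge0.
Qed.

(** On the finite set of values of the vector, [M] is the maximum of its supporting functionals at
    these values, so [tensor] applies. The last premise says that the conjugate costs of each
    functional sum to at most [p]; Jensen's inequality bounds the mean of [expR (- lam M)] from
    below. *)
Lemma exp_moment n (M : (nat -> R) -> R) (lam p : R) x : subdiff n M -> 0 < lam ->
  (forall i, adm i 0 0) ->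
  (forall t : nat -> R, (forall y : nat -> R, \sum_(i < n) t i * y i <= M y) ->
    forall h l : nat -> R, (forall i, (i < n)%N -> adm i (h i) (l i)) ->
    lam * \sum_(i < n) t i * h i <= p + \sum_(i < n) l i) ->
  Ev n w v x (fun y => expR (lam * M y)) <= expR (p + lam * Ev n w v x M).
Proof.
move=> HB lam0 adm00 bud.
have [s0 _] : exists s0 : S, True.
  have [s0 _|no] := pickP (@predT S); first by exists s0.
  by have := w1 0; rewrite big_pred0 // => /eqP; rewrite eq_sym oner_eq0.
pose A := {ffun 'I_n -> S}.
pose pt (a : A) : nat -> R := fun i => if insub i is Some j then v i (a j) else x i.
have [tt Htt] := choice (fun a : A => HB (pt a)).
pose t a i := lam * tt a i.
pose P a i : set R := [set r | exists h l, adm i h l /\ r = t a i * h - l].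
have key a := @sum_sup_le n (P a) p.
have {}key a : (forall i, (i < n)%N -> has_sup (P a i)) /\ \sum_(i < n) sup (P a i) <= p.
  apply: key => [i _|f Hf]; first by exists 0, 0, 0; rewrite mulr0 subrr.
  have [hl Hhl] : exists hl : nat -> R * R, forall i, (i < n)%N ->
      adm i (hl i).1 (hl i).2 /\ f i = t a i * (hl i).1 - (hl i).2.
    have h i : exists q : R * R, (i < n)%N -> adm i q.1 q.2 /\ f i = t a i * q.1 - q.2.
      by case: (ltnP i n) => [/Hf [h [l H]]|_]; [exists (h, l)|exists (0, 0)].
    by have [hl Hhl] := choice h; exists hl.
  have := bud (tt a) (Htt a).1 (fun i => (hl i).1) (fun i => (hl i).2)
     (fun i ni => (Hhl i ni).1).
  rewrite -lerBlDr; apply: le_trans; rewrite mulr_sumr -sumrB; apply: ler_sum => i _.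
  by rewrite (Hhl i (ltn_ord i)).2 /t mulrA.
pose psi a i := sup (P a i).
have HT := @tensor n A [ffun=> s0] t psi.
have {}HT := HT _ (fun=> 0) x.
have tpsi a i : (i < n)%N -> forall h l, adm i h l -> t a i * h <= psi a i + l.
  move=> ni h l ad; rewrite -lerBlDr; apply: (@sup_upper_bound _ (P a i)).
    exact: (key a).1.
  by exists h, l.
have {}HT := HT tpsi.
have eM y : (forall i, (i < n)%N -> exists s, y i = v i s) ->
   famax [ffun=> s0] (fun a => \sum_(i < n) t a i * y i) = lam * M y.
  move=> Hy; have [s Hs] : exists s : nat -> S, forall i, (i < n)%N -> y i = v i (s i).
    have h i : exists q : S, (i < n)%N -> y i = v i q.
      by case: (ltnP i n) => [/Hy [q H]|_]; [exists q | exists s0].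
    by have [s Hs] := choice h; exists s.
  pose a : A := [ffun j : 'I_n => s j].
  have ya i : (i < n)%N -> y i = pt a i.
    by move=> ni; rewrite /pt insubT ffunE /= Hs.
  apply/eqP; rewrite eq_le; apply/andP; split.
    apply: famax_le => b; rewrite /t; under eq_bigr => i _ do rewrite -mulrA.
    by rewrite -mulr_sumr; apply: ler_wpM2l; [exact: ltW | exact: (Htt b).1].
  apply: le_trans (@le_famax _ _ (fun a => \sum_(i < n) t a i * y i) a).
  rewrite /t; under eq_bigr => i _ do rewrite -mulrA.
  rewrite -mulr_sumr; apply: ler_wpM2l; first exact: ltW.
  rewrite (subdiff_ext HB ya); apply: le_trans (Htt a).2 _.
  by apply: ler_sum => i _; rewrite ya.
have E1 : expR (- p) * Ev n w v x (fun y => expR (lam * M y)) <=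
   Ev n w v x (fun y => expR (famax [ffun=> s0] (fun a => 0 +
      \sum_(i < n) (t a i * y i - psi a i)))).
  rewrite -EvZ; apply: Ev_le_on => // y _ Hy; rewrite -expRD ler_expR -eM //.
  rewrite addrC lerBlDr; apply: famax_le => a; rewrite -lerBlDr.
  apply: le_trans (@le_famax _ _ (fun a => 0 + \sum_(i < n) (t a i * y i - psi a i)) a).
  by rewrite add0r sumrB lerB // (key a).2.
have E2 : expR (- (lam * Ev n w v x M)) <=
   Ev n w v x (fun y => expR (- famax [ffun=> s0] (fun a => 0 + \sum_(i < n) t a i * y i))).
  apply: (@le_trans _ _ (Ev n w v x (fun y => expR ((- lam) * M y)))).
    by rewrite -mulNr -EvZ; exact: Ev_jensen_exp.
  apply: Ev_le_on => // y _ Hy; rewrite ler_expR mulNr lerN2 -eM //.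
  by apply: famax_le => a; rewrite add0r; exact: (@le_famax _ _ (fun a => \sum_(i < n) t a i * y i) a).
have pos : 0 <= expR (- p) * Ev n w v x (fun y => expR (lam * M y)).
  by rewrite mulr_ge0 ?expR_ge0 //; apply: Ev_ge0 => // y; exact: expR_ge0.
have := le_trans (ler_pM pos (expR_ge0 _) E1 E2) HT.
rewrite mulrAC -expRD -opprD expRN mulrC ler_pdivrMr ?expR_gt0 // mul1r; exact.
Qed.

End Tensor.

Section Model.
Context {R : realType}.

(* Encodes "the cost of [x] is at most [l]" when the tail is only known at the integers. *)
Definition adm (Q : nat -> R) (x l : R) : Prop := (`|x| <= 1 /\ x ^+ 2 <= l) \/
  exists j, [/\ (0 < j)%N, `|x| <= j.+1%:R & expR (- l) <= Q j].

Definition ball (n : nat) (Q : nat -> nat -> R) (p : R) (x : nat -> R) : Prop :=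
  exists l : nat -> R, \sum_(i < n) l i <= p /\ forall i, (i < n)%N -> adm (Q i) (x i) (l i).

Definition model (S0 : finType) (m : nat -> S0 -> R) (k : nat -> S0 -> nat) : Prop :=
  forall i, [/\ forall s, 0 <= m i s, \sum_s m i s = 1, lcQ (m i) (k i) &
    tailQ (m i) (k i) 1 <= eta].


Lemma eta_le : eta <= expR (- 8%:R) :> R.
Proof.
have e : expR 1 <= 4%:R :> R.
  have h : expR (1 / 3%:R) <= 1 + 1 / 3%:R + (1 / 3%:R) ^+ 2 :> R by apply: expR_quad; lra.
  have -> : (1 : R) = 1 / 3%:R * 3%:R by field.
  rewrite expRM_natr; apply: (@le_trans _ _ ((1 + 1 / 3%:R + (1 / 3%:R) ^+ 2) ^+ 3)).
    by apply: lerXn2r; rewrite ?nnegrE ?expR_ge0 //; lra.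
  lra.
rewrite expRN -[X in expR X]mul1r expRM_natr /eta exprVn -exprM.
rewrite lef_pV2 ?posrE ?exprn_gt0 ?expR_gt0 //.
apply: (@le_trans _ _ (4%:R ^+ 8)).
  by apply: lerXn2r; rewrite ?nnegrE ?expR_ge0.
by rewrite -!natrX ler_nat.
Qed.

Section OneQ.
Variables (S0 : finType) (m : S0 -> R) (k : S0 -> nat).
Hypothesis m0 : forall s, 0 <= m s.
Hypothesis m1 : \sum_s m s = 1.
Hypothesis lc : lcQ m k.
Hypothesis q1 : tailQ m k 1 <= eta.
Let Q := tailQ m k.

Lemma tailQ_exp j : Q j <= expR (- (8%:R * j%:R)).
Proof.
elim: j => [|j IH]; first by rewrite mulr0 oppr0 expR0 /Q tailQ0.
rewrite -addn1; apply: le_trans (tailQ_nb m0 m1 lc _ _) _.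
rewrite natrD mulrDr mulr1 opprD expRD; apply: ler_pM => //; try exact: tailQ_ge0.
by apply: le_trans q1 eta_le.
Qed.

Lemma adm_level j l : expR (- l) <= Q j -> 8%:R * j%:R <= l.
Proof. by move=> /le_trans/(_ (tailQ_exp j)); rewrite ler_expR lerN2. Qed.

Lemma adm_ge0 x l : adm Q x l -> 0 <= l.
Proof.
case=> [[_ h]|[j [_ _ /adm_level h]]]; first by apply: le_trans h; exact: sqr_ge0.
by apply: le_trans h; rewrite mulr_ge0.
Qed.

Lemma adm_le x y l : `|y| <= `|x| -> adm Q x l -> adm Q y l.
Proof.
move=> yx [[h1 h2]|[j [j0 h1 h2]]].
  left; split; first exact: le_trans h1.
  by apply: le_trans h2; rewrite -(real_normK (num_real x)) -(real_normK (num_real y));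
     apply: lerXn2r; rewrite ?nnegrE.
by right; exists j; split=> //; exact: le_trans h1.
Qed.

(** The factor 2 absorbs [j + 1 <= 2 j]. If [j <= th], the scaled point falls in the quadratic
    range, where [8 j <= l] suffices. Otherwise the new level [j'] is the largest integer below
    [j / th], and [lc] compares [Q j'] with [Q j]. *)
Lemma adm_scale x l th : 1 <= th -> adm Q x l -> adm Q (x / (2%:R * th)) (l / th).
Proof.
move=> th1; have th0 : 0 < th by lra.
have t2 : 0 < 2%:R * th by lra.
have nx : `|x / (2%:R * th)| = `|x| / (2%:R * th).
  by rewrite normrM normfV (ger0_norm (ltW t2)).
case=> [[h1 h2]|[j [j0 h1 h2]]].
  left; rewrite nx; split; first by rewrite ler_pdivrMr // mul1r; lra.
  rewrite expr_div_n ler_pdivrMr ?exprn_gt0 //.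
  have -> : l / th * (2%:R * th) ^+ 2 = 4%:R * th * l by field; rewrite gt_eqF.
  by have := sqr_ge0 x; nra.
have jl := adm_level h2.
have j0R : 0 < j%:R :> R by rewrite ltr0n.
case: (lerP j%:R th) => jth.
  left; rewrite nx.
  have xb : `|x| / (2%:R * th) <= j%:R / th.
    rewrite ler_pdivrMr // (_ : j%:R / th * (2%:R * th) = 2%:R * j%:R); last first.
      by field; rewrite gt_eqF.
    by apply: le_trans h1 _; rewrite -natrM ler_nat; lia.
  have d1 : j%:R / th <= 1 by rewrite ler_pdivrMr // mul1r.
  split; first exact: le_trans d1.
  rewrite -(real_normK (num_real _)) nx.
  apply: (@le_trans _ _ (j%:R / th)).
    apply: (@le_trans _ _ ((j%:R / th) ^+ 2)).
      by apply: lerXn2r; rewrite ?nnegrE ?divr_ge0 // ltW.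
    by rewrite expr2 ler_piMl // divr_ge0 // ltW.
  by rewrite ler_pM2r ?invr_gt0 //; lra.
have ex : exists j', (j%:R / th <= j'.+1%:R)%R.
  by exists j; rewrite ler_pdivrMr // -natr1; nra.
pose j' := ex_minn ex.
have [hj1 hj2] : j%:R / th <= j'.+1%:R /\ j'%:R < j%:R / th.
  rewrite /j'; case: ex_minnP => q hq qm; split=> //.
  case: q hq qm => [|q] hq qm; first by rewrite divr_gt0.
  rewrite ltNge; apply/negP => /qm; by rewrite ltnn.
have j'0 : (0 < j')%N.
  rewrite lt0n; apply/negP => /eqP e; move: hj1; rewrite e ler_pdivrMr //; lra.
have j'j : (j' <= j)%N.
  rewrite -(ler_nat R); apply: le_trans (ltW hj2) _.
  by rewrite ler_pdivrMr // ler_peMr.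
right; exists j'; split=> //.
  rewrite nx; apply: le_trans hj1; rewrite ler_pdivrMr //.
  rewrite (_ : j%:R / th * (2%:R * th) = 2%:R * j%:R); last by field; rewrite gt_eqF.
  by apply: le_trans h1 _; rewrite -natrM ler_nat; lia.
have lp := lc j'0 j'j.
rewrite -(@ler_pXn2r _ j) ?nnegrE ?expR_ge0 ?tailQ_ge0 //.
apply: le_trans lp.
apply: (@le_trans _ _ (expR (- l) ^+ j')); last first.
  by apply: lerXn2r; rewrite ?nnegrE ?expR_ge0 ?tailQ_ge0.
rewrite -!expRM_natr ler_expR !mulNr lerN2.
have l0 : 0 <= l by apply: le_trans jl; rewrite mulr_ge0.
rewrite mulrAC -mulrA; apply: ler_wpM2l => //; exact: ltW.
Qed.

Lemma adm_of_tail h l : adm_tail Q h l -> adm Q (h / 4%:R) (l / kap).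
Proof.
have k0 := @kap_gt0 R.
have n4 : `|h / 4%:R| = `|h| / 4%:R by rewrite normrM normfV (@ger0_norm _ 4%:R).
case=> [[h1 h2]|[j [j0 h1 h2]]].
  left; rewrite n4; split; first by lra.
  rewrite ler_pdivlMr // expr_div_n; have := sqr_ge0 h; nra.
have l0 : 0 <= 2%:R * l.
  by apply: le_trans (adm_level h2); rewrite mulr_ge0.
right; exists j; split=> //.
  rewrite n4 ler_pdivrMr //; apply: le_trans h1 _; rewrite -!natrM ler_nat; lia.
apply: le_trans h2; rewrite ler_expR lerN2 ler_pdivlMr // kap_val; lra.
Qed.

End OneQ.

Section I1.
Variables (S0 : finType) (m : nat -> S0 -> R) (k : nat -> S0 -> nat).
Hypothesis mod : model m k.
Let Q i := tailQ (m i) (k i).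

Definition wt (i : nat) (bs : bool * S0) : R := m i bs.2 / 2%:R.
(* A symmetric variable is coded by a sign and a magnitude [k] and takes the value [+-(k + 1)]: it never
   vanishes, and it is the sum of the Rademacher variable [+-1] and of [+-k]. *)
Definition vl (i : nat) (bs : bool * S0) : R := (-1) ^+ bs.1 * (k i bs.2).+1%:R.

Lemma wt_ge0 i s : 0 <= wt i s.
Proof. by have [h _ _ _] := mod i; rewrite /wt divr_ge0. Qed.

Lemma wt_sumE i (F : bool -> S0 -> R) : \sum_bs wt i bs * F bs.1 bs.2 =
  \sum_s m i s * ((F true s + F false s) / 2%:R).
Proof.
rewrite -(pair_bigA _ (fun (b : bool) s => m i s / 2%:R * F b s)) /=.
rewrite big_bool /= -big_split /=; apply: eq_bigr => s _; by field.
Qed.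

Lemma wt_sum1 i : \sum_bs wt i bs = 1.
Proof.
have [_ h _ _] := mod i.
transitivity (\sum_bs wt i bs * (fun (b : bool) (s : S0) => 1) bs.1 bs.2).
  by apply: eq_bigr => bs _; rewrite mulr1.
rewrite (wt_sumE i (fun _ _ => 1)) -[RHS]h; apply: eq_bigr => s _; by field.
Qed.

(** Both [a] and [- a] are convex combinations of [b] and [- b], with exchanged weights. *)
Lemma conv_sym_mono (f : R -> R) (a b : R) : conv f -> `|a| <= `|b| ->
  f a + f (- a) <= f b + f (- b).
Proof.
move=> cf; wlog b0 : b / 0 <= b => [H ab|].
  case: (lerP 0 b) => b0; first exact: H.
  by have := H (- b); rewrite normrN opprK (addrC (f (- b))); apply=> //; lra.
wlog a0 : a / 0 <= a => [H ab|].
  case: (lerP 0 a) => a0; first exact: H.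
  by have := H (- a); rewrite normrN opprK (addrC (f (- a))); apply=> //; lra.
rewrite !ger0_norm // le_eqVlt => /orP[/eqP -> //|ab].
have b1 : 0 < b by lra.
pose t := (a + b) / (2%:R * b).
have t01 : 0 <= t <= 1.
  apply/andP; split; first by rewrite /t divr_ge0; lra.
  by rewrite /t ler_pdivrMr; lra.
have h1 := cf b (- b) t t01.
have h2 := cf (- b) b t t01.
have e1 : t * b + (1 - t) * - b = a by rewrite /t; field; rewrite gt_eqF.
have e2 : t * - b + (1 - t) * b = - a by rewrite /t; field; rewrite gt_eqF.
rewrite e1 in h1; rewrite e2 in h2; lra.
Qed.

Lemma sym_cmp (u v : nat -> S0 -> R) Phi : cconv Phi ->
  (forall i s, `|u i s| <= `|v i s|) -> forall n x,
  Ev n wt (fun i bs => (-1) ^+ bs.1 * u i bs.2) x Phi <=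
  Ev n wt (fun i bs => (-1) ^+ bs.1 * v i bs.2) x Phi.
Proof.
move=> cP uv n x.
have := @Ev_cmp R _ _ wt (fun i bs => (-1) ^+ bs.1 * u i bs.2)
  wt (fun i bs => (-1) ^+ bs.1 * v i bs.2) (fun=> 1) Phi wt_ge0 wt_ge0 (fun=> ler01) cP _ n x.
rewrite big1 // mul1r; apply => i f cf; rewrite mul1r.
rewrite (wt_sumE i (fun b s => f ((-1) ^+ b * u i s))).
rewrite (wt_sumE i (fun b s => f ((-1) ^+ b * v i s))).
have [h _ _ _] := mod i.
apply: ler_sum => s _; apply: ler_wpM2l => //.
rewrite expr1 expr0 !mulN1r !mul1r ler_pM2r ?invr_gt0 ?ltr0n //.
rewrite addrC [leRHS]addrC; exact: conv_sym_mono.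
Qed.

Lemma pow_exp_le (y lam : R) p : 0 <= y -> 0 < lam ->
  y ^+ p.+1 <= (p.+1%:R / lam) ^+ p.+1 * expR (lam * y).
Proof.
move=> y0 l0; have p0 : 0 < p.+1%:R :> R by rewrite ltr0n.
have -> : lam * y = lam * y / p.+1%:R * p.+1%:R by rewrite divfK // gt_eqF.
rewrite expRM_natr -exprMn; apply: lerXn2r; rewrite ?nnegrE //.
  by rewrite mulr_ge0 ?expR_ge0 // divr_ge0 // ltW.
rewrite mulrC; set u := lam * y / p.+1%:R.
have -> : y = u * (p.+1%:R / lam) by rewrite /u mulrA divfK ?gt_eqF // mulrC mulKf ?gt_eqF.
apply: ler_wpM2r; first by rewrite divr_ge0 // ltW.
by apply: le_trans (expR_ge1Dx u); rewrite lerDr.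
Qed.

(* (tau) with the linear functional [lam M], where [lam] is chosen proportional to [p / rho]. *)
Lemma moment_part n (M : (nat -> R) -> R) (v : nat -> bool * S0 -> R)
   (ad : nat -> R -> R -> Prop) (rho : R) p x :
  (forall i, tau (wt i) (v i) (ad i)) -> (forall i, ad i 0 0) ->
  (forall i h l, ad i h l -> adm_tail (Q i) h l) ->
  subdiff n M -> (forall y, 0 <= M y) -> 0 < rho ->
  (forall y, ball n Q p.+1%:R y -> M y <= rho) -> Ev n wt v x M <= rho ->
  Ev n wt v x (fun y => M y ^+ p.+1) <= (8%:R / kap * expR 2%:R * rho) ^+ p.+1.
Proof.
move=> tauv ad00 adt sM M0 r0 Mb EM.
have p0 : 0 < p.+1%:R :> R by rewrite ltr0n.
have k0 := @kap_gt0 R.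
pose lam : R := kap * p.+1%:R / (8%:R * rho).
have l0 : 0 < lam by rewrite /lam divr_gt0 // mulr_gt0.
have ad0 i h l : ad i h l -> 0 <= l.
  have [h1 h2 h3 h4] := mod i.
  by move=> /adt/(adm_of_tail h1 h2 h3 h4)/(adm_ge0 h1 h2 h3 h4); rewrite pmulr_lge0 // invr_gt0.
have bud (t : nat -> R) : (forall y : nat -> R, \sum_(i < n) t i * y i <= M y) ->
    forall h l : nat -> R, (forall i, (i < n)%N -> ad i (h i) (l i)) ->
    lam * \sum_(i < n) t i * h i <= p.+1%:R + \sum_(i < n) l i.
  move=> tM h l hl; set B := \sum_(i < n) l i.
  have B0 : 0 <= B by apply: sumr_ge0 => i _; apply: (ad0 i (h i)); exact: hl.
  (* A displacement of cost [B] may leave the ball. Division by [8 th] brings it back, and [lam] is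
     such that [8 lam rho = kap p.+1]; the resulting bound [kap p.+1 + B] is within the budget. *)
  pose th := Num.max 1 (B / (kap * p.+1%:R)).
  have th1 : 1 <= th by rewrite /th le_max lexx.
  have th2 : B / (kap * p.+1%:R) <= th by rewrite /th le_max lexx orbT.
  have th3 : th <= 1 + B / (kap * p.+1%:R).
    by rewrite /th ge_max lerDl lerDr ler01 andbT divr_ge0 // mulr_ge0 // ltW.
  have th0 : 0 < th by lra.
  have := Mb (fun i => h i / 4%:R / (2%:R * th)).
  have bl : ball n Q p.+1%:R (fun i => h i / 4%:R / (2%:R * th)).
    exists (fun i => l i / kap / th); split.
      rewrite -!mulr_suml -/B ler_pdivrMr // ler_pdivrMr //.
      move: th2; rewrite ler_pdivrMr ?mulr_gt0 // => /le_trans; apply.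
      by rewrite le_eqVlt; apply/orP; left; apply/eqP; ring.
    move=> i ni; have [h1 h2 h3 h4] := mod i.
    by apply: adm_scale => //; apply: adm_of_tail => //; apply: adt; exact: hl.
  move=> /(_ bl) Mh.
  have := le_trans (tM _) Mh.
  have -> : \sum_(i < n) t i * (h i / 4%:R / (2%:R * th)) =
     (\sum_(i < n) t i * h i) / (8%:R * th).
    by rewrite mulr_suml; apply: eq_bigr => i _; field; rewrite gt_eqF.
  rewrite ler_pdivrMr ?mulr_gt0 // => hh.
  apply: (@le_trans _ _ (lam * (rho * (8%:R * (1 + B / (kap * p.+1%:R)))))).
    apply: ler_wpM2l; first exact: ltW.
    apply: le_trans hh _; apply: ler_wpM2l; first exact: ltW.
    by apply: ler_wpM2l.
  have -> : lam * (rho * (8%:R * (1 + B / (kap * p.+1%:R)))) = kap * p.+1%:R + B.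
    by rewrite /lam; move: (p.+1%:R) p0 => P P0; field; rewrite !gt_eqF.
  by rewrite lerD2r ler_piMl ?(ltW p0) // kap_val; lra.
have HE := exp_moment wt_ge0 wt_sum1 tauv x sM l0 ad00 bud.
apply: (@le_trans _ _ ((p.+1%:R / lam) ^+ p.+1 * expR (2%:R * p.+1%:R))).
  apply: (@le_trans _ _ (Ev n wt v x (fun y => (p.+1%:R / lam) ^+ p.+1 * expR (lam * M y)))).
    apply: Ev_le => [|y]; [exact: wt_ge0 | exact: pow_exp_le].
  rewrite EvZ; apply: ler_wpM2l; first by rewrite exprn_ge0 // divr_ge0 // ltW.
  apply: le_trans HE _; rewrite ler_expR.
  have : lam * Ev n wt v x M <= lam * rho by apply: ler_wpM2l => //; exact: ltW.
  have -> : lam * rho = kap / 8%:R * p.+1%:R.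
    by rewrite /lam; move: (p.+1%:R) p0 => P P0; field; rewrite gt_eqF.
  have : kap / 8%:R * p.+1%:R <= p.+1%:R :> R by rewrite ler_piMl ?(ltW p0) // kap_val; lra.
  lra.
rewrite expRM_natr -exprMn le_eqVlt; apply/orP; left; apply/eqP; congr (_ ^+ _).
by rewrite /lam; move: (p.+1%:R) p0 => P P0; field; rewrite !gt_eqF.
Qed.

(** Four times the constant of [moment_part]: the variable is a sum of two, and two moments are
    added. *)
Definition CI1 : R := 32%:R / kap * expR 2%:R.

Lemma CI1_ge1 : 1 <= CI1.
Proof.
rewrite /CI1 kap_val; have := expR_ge1Dx (2%:R : R); nra.
Qed.

(** On one outcome, [M] at [vl] is at most the sum of its values at the sign [v1] and at the rest
    [v2], each of which has (tau). In the convex order both are below [vl], so the bound on the mean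
    is inherited. *)
Lemma moment n (M : (nat -> R) -> R) (rho : R) p x :
  subdiff n M -> (forall y, 0 <= M y) -> 0 < rho ->
  (forall y, ball n Q p.+1%:R y -> M y <= rho) -> Ev n wt vl x M <= rho ->
  Ev n wt vl x (fun y => M y ^+ p.+1) <= (CI1 * rho) ^+ p.+1.
Proof.
move=> sM M0 r0 Mb EM.
pose v1 (i : nat) (bs : bool * S0) : R := (-1) ^+ bs.1 * 1.
pose v2 (i : nat) (bs : bool * S0) : R := (-1) ^+ bs.1 * (k i bs.2)%:R.
have t1 i : tau (wt i) (v1 i) adm_quad.
  apply: tau_pm1; [exact: wt_ge0 | exact: wt_sum1 | move=> [b s]].
  by rewrite /v1; case: b => /=; rewrite ?expr1 ?expr0 ?mulr1; auto.
have t2 i : tau (wt i) (v2 i) (adm_tail (Q i)).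
  have [h1 h2 h3 h4] := mod i; exact: tau_tail.
have adq0 : @adm_quad R 0 0 by rewrite /adm_quad normr0 expr0n /= mulr0.
have M1 := @moment_part n M v1 (fun=> adm_quad) rho p x t1 (fun=> adq0)
   (fun i h l H => or_introl H) sM M0 r0 Mb.
have M2 := @moment_part n M v2 (fun i => adm_tail (Q i)) rho p x t2 (fun i => or_introl adq0)
   (fun i h l H => H) sM M0 r0 Mb.
have cM := subdiff_cconv sM.
have {}M1 := M1 (le_trans (sym_cmp (u := fun _ _ => 1) (v := fun i s => (k i s).+1%:R) cM _ n x) EM).
have {}M2 := M2 (le_trans (sym_cmp (u := fun i s => (k i s)%:R) (v := fun i s => (k i s).+1%:R) cM _ n x) EM).
have {}M1 := M1 (fun i s => ltac:(rewrite normr1 ger0_norm ?ler1n //)).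
have {}M2 := M2 (fun i s => ltac:(rewrite !ger0_norm ?ler_nat //)).
have [s0 _] : exists s0 : bool * S0, True.
  have [s0 _|no] := pickP (@predT (bool * S0)%type); first by exists s0.
  by have := wt_sum1 0; rewrite big_pred0 // => /eqP; rewrite eq_sym oner_eq0.
pose sg : nat -> bool * S0 := fun=> s0.
have tr (v : nat -> bool * S0 -> R) (F : R -> R) : Ev n wt v x (fun y => F (M y)) =
    Ex n wt sg (fun tau => F (M (fun i => v i (tau i)))).
  rewrite (Ev_map n wt v sg (fun y => F (M y))).
  apply: (@Ev_base _ _ _ wt v n) => [y y' h|i /andP[ni iN]].
    by rewrite (subdiff_ext sM h).
  by rewrite leqNgt iN in ni.
rewrite (tr vl (fun z => z ^+ p.+1)).
rewrite (tr v1 (fun z => z ^+ p.+1)) in M1; rewrite (tr v2 (fun z => z ^+ p.+1)) in M2.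
apply: (@le_trans _ _ (2%:R ^+ p.+1 * (Ex n wt sg (fun tau => M (fun i => v1 i (tau i)) ^+ p.+1) +
   Ex n wt sg (fun tau => M (fun i => v2 i (tau i)) ^+ p.+1)))).
  rewrite /Ex -EvD -EvZ; apply: Ev_le => [|t]; first exact: wt_ge0.
  have h : M (fun i => vl i (t i)) <= M (fun i => v1 i (t i)) + M (fun i => v2 i (t i)).
    apply: le_trans (subdiff_add _ _ sM); rewrite le_eqVlt; apply/orP; left; apply/eqP.
    by congr M; apply/funext => i; rewrite /vl /v1 /v2 -mulrDr -natr1 addrC.
  move: (M0 (fun i => v1 i (t i))) (M0 (fun i => v2 i (t i))) (M0 (fun i => vl i (t i))) h.
  set a := M (fun i => v1 i (t i)); set b := M (fun i => v2 i (t i)).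
  set c := M (fun i => vl i (t i)) => a0 b0 c0 h.
  apply: (@le_trans _ _ ((2%:R * Num.max a b) ^+ p.+1)).
    apply: lerXn2r; rewrite ?nnegrE ?mulr_ge0 ?le_max ?a0 //.
    have ha : a <= Num.max a b by rewrite le_max lexx.
    have hb : b <= Num.max a b by rewrite le_max lexx orbT.
    lra.
  rewrite exprMn; apply: ler_wpM2l; first by rewrite exprn_ge0.
  by case: (leP a b) => _; rewrite ?lerDl ?lerDr exprn_ge0.
apply: (@le_trans _ _ (2%:R ^+ p.+1 * (2%:R * (8%:R / kap * expR 2%:R * rho) ^+ p.+1))).
  by apply: ler_wpM2l; [rewrite exprn_ge0 | lra].
have k0 := @kap_gt0 R.
apply: (@le_trans _ _ (2%:R ^+ p.+1 * (2%:R ^+ p.+1 * (8%:R / kap * expR 2%:R * rho) ^+ p.+1))).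
  apply: ler_wpM2l; first by rewrite exprn_ge0.
  apply: ler_wpM2r; first by rewrite exprn_ge0 // mulr_ge0 ?(ltW r0) // mulr_ge0 ?expR_ge0 // divr_ge0 // ltW.
  by rewrite exprS ler_peMr // exprn_ege1 // ler1n.
rewrite -!exprMn le_eqVlt; apply/orP; left; apply/eqP; congr (_ ^+ _).
by rewrite /CI1; field; rewrite gt_eqF.
Qed.

End I1.

Section Subdiff.

Lemma subdiff_max n (A : finType) (a0 : A) (be : A -> nat -> R) :
  subdiff n (fun y => famax a0 (fun a => `|\sum_(i < n) be a i * y i|)).
Proof.
move=> x; have [a Ha] := famax_ex a0 (fun a => `|\sum_(i < n) be a i * x i|).
pose s : R := if 0 <= \sum_(i < n) be a i * x i then 1 else -1.
exists (fun i => s * be a i); split=> [y|].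
  apply: le_trans (le_famax a0 (fun a => `|\sum_(i < n) be a i * y i|) a).
  have -> : \sum_(i < n) s * be a i * y i = s * \sum_(i < n) be a i * y i.
    by rewrite mulr_sumr; apply: eq_bigr => i _; rewrite mulrA.
  apply: le_trans (ler_norm _) _; rewrite normrM.
  by rewrite /s; case: ifP => _; rewrite ?normrN normr1 mul1r.
have -> : \sum_(i < n) s * be a i * x i = s * \sum_(i < n) be a i * x i.
  by rewrite mulr_sumr; apply: eq_bigr => i _; rewrite mulrA.
rewrite Ha /s; case: ifP => h; first by rewrite ger0_norm // mul1r.
by rewrite ler0_norm ?mulN1r // ltW // ltNge h.
Qed.

Lemma subdiff_Ev n (A : Type) (S : finType) N (w : nat -> S -> R) (v : nat -> S -> A) x
   (M : (nat -> A) -> (nat -> R) -> R) :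
  (forall i s, 0 <= w i s) -> (forall a, subdiff n (M a)) ->
  subdiff n (fun y => Ev N w v x (fun a => M a y)).
Proof.
move=> w0 sM y.
have [t Ht] := choice (fun a => sM a y).
exists (fun i => Ev N w v x (fun a => t a i)); split=> [z|].
  have -> : \sum_(i < n) Ev N w v x (fun a => t a i) * z i =
     Ev N w v x (fun a => \sum_(i < n) t a i * z i).
    rewrite Ev_sum; apply: eq_bigr => i _; rewrite mulrC -EvZ.
    by apply: Ev_ext => a; rewrite mulrC.
  by apply: Ev_le => // a; exact: (Ht a).1.
have -> : \sum_(i < n) Ev N w v x (fun a => t a i) * y i =
   Ev N w v x (fun a => \sum_(i < n) t a i * y i).
  rewrite Ev_sum; apply: eq_bigr => i _; rewrite mulrC -EvZ.
  by apply: Ev_ext => a; rewrite mulrC.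
by apply: Ev_le => // a; exact: (Ht a).2.
Qed.

End Subdiff.
End Model.

(** * Linear forms in the coordinates *)

Section Prelim.
Context {R : realType}.

Lemma expR_sum (I : Type) (r : seq I) (P : pred I) (F : I -> R) :
  expR (\sum_(i <- r | P i) F i) = \prod_(i <- r | P i) expR (F i).
Proof. by apply: big_morph; [exact: expRD | exact: expR0]. Qed.

Lemma sum_CS (I : finType) (P : pred I) (x c : I -> R) :
  (\sum_(i | P i) x i * c i) ^+ 2 <= (\sum_(i | P i) x i ^+ 2) * (\sum_(i | P i) c i ^+ 2).
Proof.
pose L := \sum_(i | P i) \sum_(j | P j) (x i * c j - x j * c i) ^+ 2.
have L0 : 0 <= L by do 2!(apply: sumr_ge0 => ? _); exact: sqr_ge0.
suff e : L = (\sum_(i | P i) x i ^+ 2) * (\sum_(i | P i) c i ^+ 2) +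
    (\sum_(i | P i) c i ^+ 2) * (\sum_(i | P i) x i ^+ 2) -
    2%:R * ((\sum_(i | P i) x i * c i) * (\sum_(i | P i) x i * c i)).
  by move: L0; rewrite e expr2; lra.
rewrite !big_distrlr mulr_sumr -big_split -sumrB.
apply: eq_bigr => i _ /=; rewrite mulr_sumr -big_split -sumrB.
by apply: eq_bigr => j _ /=; ring.
Qed.

Lemma Ev_sq (S : finType) (w v : nat -> S -> R) n x a (be : nat -> R) :
  (forall i, \sum_s w i s = 1) -> (forall i, \sum_s w i s * v i s = 0) ->
  Ev n w v x (fun y => (a + \sum_(i < n) be i * y i) ^+ 2) =
  a ^+ 2 + \sum_(i < n) be i ^+ 2 * \sum_s w i s * v i s ^+ 2.
Proof.
move=> w1 w2; elim: n a x => [|n IH] a x /=; first by rewrite !big_ord0 !addr0.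
transitivity (\sum_s w n s * ((a + be n * v n s) ^+ 2 +
     \sum_(i < n) be i ^+ 2 * \sum_s w i s * v i s ^+ 2)).
  apply: eq_bigr => s _; congr (_ * _); rewrite -(IH _ (upd x n (v n s))).
  apply: Ev_ext_on => y Hy; rewrite big_ord_recr /= Hy // upd_same; congr (_ ^+ 2); ring.
rewrite big_ord_recr /=; set B := \sum_(i < n) _.
transitivity (\sum_s ((a ^+ 2 + B) * w n s + 2%:R * a * be n * (w n s * v n s) +
   be n ^+ 2 * (w n s * v n s ^+ 2))).
  by apply: eq_bigr => s _; ring.
rewrite !big_split /= -!mulr_sumr w1 w2; ring.
Qed.

Lemma rank_exists n (tau : nat -> R) : exists r : nat -> nat,
  [/\ forall i, (i < n)%N -> (r i < n)%N,
      forall g : nat -> R, \sum_(i < n) g (r i) = \sum_(i < n) g i &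
      forall i j, (i < n)%N -> (j < n)%N -> (r i <= r j)%N -> tau j <= tau i].
Proof.
pose le i j := tau j <= tau i.
have lt : transitive le by move=> a b c h1 h2; exact: le_trans h2 h1.
have lr : reflexive le by move=> a; exact: lexx.
have ltot : total le by move=> a b; exact: le_total.
pose s := sort le (iota 0 n).
have ps : perm_eq (iota 0 n) s by rewrite perm_sym perm_sort.
have us : uniq s by rewrite sort_uniq iota_uniq.
have ss : size s = n by rewrite size_sort size_iota.
have ms i : (i < n)%N -> i \in s by rewrite mem_sort mem_iota.
exists (index^~ s); split.
- by move=> i /ms; rewrite -index_mem ss.
- move=> g; rewrite -(big_mkord xpredT (fun i => g (index i s))) /index_iota subn0.
  rewrite (perm_big _ ps) /= (big_nth 0%N) ss big_mkord; apply: eq_bigr => i _.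
  by rewrite index_uniq ?ss.
- move=> i j ni nj; exact: (sorted_leq_index lt lr (sort_sorted ltot _) _ _ (ms _ ni) (ms _ nj)).
Qed.

(** The first [P] terms are at most 1 each; from there on, [1 / (m + 1)^2 <= 1 / m - 1 / (m + 1)]
    telescopes. *)
Lemma sum_min_sq (P : nat) n : \sum_(m < n) Num.min 1 ((P%:R / m.+1%:R) ^+ 2) <= 2%:R * P%:R :> R.
Proof.
have base q : \sum_(m < q) Num.min 1 ((P%:R / m.+1%:R) ^+ 2) <= q%:R :> R.
  rewrite -[leRHS]mulr1n; apply: (@le_trans _ _ (\sum_(m < q) (1 : R))).
    by apply: ler_sum => i _; rewrite ge_min lexx.
  by rewrite sumr_const card_ord.
case: (leqP n P) => nP.
  by apply: le_trans (base n) _; rewrite -natrM ler_nat; lia.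
case: (posnP P) => [P0|P0].
  rewrite P0 mulr0; apply: sumr_le0 => i _; by rewrite mul0r expr0n /= ge_min lexx orbT.
suff H d : \sum_(m < P + d) Num.min 1 ((P%:R / m.+1%:R) ^+ 2) <=
    2%:R * P%:R - P%:R ^+ 2 / (P + d)%:R :> R.
  rewrite -(subnKC (ltnW nP)); apply: le_trans (H _) _; rewrite gerBl.
  by rewrite divr_ge0 ?sqr_ge0.
have p0 : 0 < P%:R :> R by rewrite ltr0n.
elim: d => [|d IH].
  rewrite addn0; apply: le_trans (base P) _.
  by rewrite expr2 mulfK ?gt_eqF //; lra.
rewrite addnS big_ord_recr /=.
have : Num.min 1 ((P%:R / (P + d).+1%:R) ^+ 2) <=
   P%:R ^+ 2 / (P + d)%:R - P%:R ^+ 2 / (P + d).+1%:R :> R.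
  apply: (@le_trans _ _ ((P%:R / (P + d).+1%:R) ^+ 2)); first by rewrite ge_min lexx orbT.
  have q0 : 0 < (P + d)%:R :> R by rewrite ltr0n addn_gt0 P0.
  rewrite -natr1; move: ((P + d)%:R : R) q0 => q q0.
  have q1 : 0 < q + 1 by lra.
  rewrite -subr_ge0.
  have -> : P%:R ^+ 2 / q - P%:R ^+ 2 / (q + 1) - (P%:R / (q + 1)) ^+ 2 =
    P%:R ^+ 2 / (q * (q + 1) ^+ 2) by field; rewrite !gt_eqF.
  by rewrite divr_ge0 ?sqr_ge0 // mulr_ge0 ?sqr_ge0 // ltW.
by move=> h; apply: le_trans (lerD IH h) _; rewrite addrA subrK.
Qed.

Lemma quarter_half L : (2%:R * L.+1%:R + 1) * (1 / 4%:R) ^+ L.+1 <= 3%:R / 2%:R * (1 / 2%:R) ^+ L.+1 :> R.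
Proof.
elim: L => [|L IH]; first by rewrite !expr1; lra.
rewrite exprS (exprS _ L.+1) -(natr1 L.+1).
have : 0 <= (1 / 4%:R : R) ^+ L.+1 by rewrite exprn_ge0 // divr_ge0.
have : 1 <= L.+1%:R :> R by rewrite ler1n.
move: IH; move: (L.+1%:R : R) ((1 / 4%:R : R) ^+ L.+1) ((1 / 2%:R : R) ^+ L.+1) => A B C.
nra.
Qed.

(** Markov's inequality in place of counting: the weights of all selections sum to at most [A], so
    at most [A / B] of them have weight at least [B]. *)
Lemma union_bound (n : nat) (D : finType) (om : 'I_n -> D -> R) (A B c : R)
   (T : Type) (S : finType) N (w : nat -> S -> R) (v : nat -> S -> T) x
   (F : {ffun 'I_n -> D} -> (nat -> T) -> R) (round_point : (nat -> T) -> {ffun 'I_n -> D}) :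
  (forall i s, 0 <= w i s) -> (forall i d, 0 <= om i d) -> (forall s y, 0 <= F s y) ->
  \prod_i \sum_d om i d <= A -> 0 < B -> 0 <= c ->
  (forall s : {ffun 'I_n -> D}, B <= \prod_i om i (s i) -> Ev N w v x (F s) <= c) ->
  (forall y, B <= \prod_i om i (round_point y i)) ->
  Ev N w v x (fun y => F (round_point y) y) <= A / B * c.
Proof.
move=> w0 om0 F0 HA B0 c0 Hc Hsel.
apply: (@le_trans _ _ (Ev N w v x (fun y => \sum_(s : {ffun 'I_n -> D} | B <= \prod_i om i (s i)) F s y))).
  apply: Ev_le => // y; rewrite (bigD1 (round_point y)) //= lerDl; exact: sumr_ge0.
rewrite Ev_sum; apply: (@le_trans _ _ (\sum_(s : {ffun 'I_n -> D}) (\prod_i om i (s i)) / B * c)).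
  rewrite [leRHS](bigID (fun s : {ffun 'I_n -> D} => B <= \prod_i om i (s i))) /=.
  rewrite -[leLHS]addr0; apply: lerD.
    apply: ler_sum => s hs; apply: le_trans (Hc s hs) _.
    by apply: ler_peMl => //; rewrite ler_pdivlMr // mul1r.
  apply: sumr_ge0 => s _; rewrite mulr_ge0 // divr_ge0 ?(ltW B0) //; exact: prodr_ge0.
rewrite -mulr_suml -mulr_suml; apply: ler_wpM2r => //; apply: ler_wpM2r.
  by rewrite invr_ge0 ltW.
by rewrite -bigA_distr_bigA.
Qed.

End Prelim.

Section Lin.
Context {R : realType}.
Variables (S0 : finType) (m : nat -> S0 -> R) (k : nat -> S0 -> nat).
Hypothesis mod : model m k.
Let Q i := tailQ (m i) (k i).
Notation w := (wt m).
Notation v := (vl k).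

Lemma ball_scale n p (th : R) x : 1 <= th -> ball n Q (th * p) x ->
  ball n Q p (fun i => x i / (2%:R * th)).
Proof.
move=> t1 [l [l1 l2]]; have t0 : 0 < th by lra.
exists (fun i => l i / th); split.
  by rewrite -mulr_suml ler_pdivrMr // mulrC.
move=> i ni; have [h1 h2 h3 h4] := mod i; apply: adm_scale => //; exact: l2.
Qed.

Lemma ball_lev n p x : ball n Q p x -> exists2 l : nat -> R, \sum_(i < n) l i <= p &
  forall i, (i < n)%N -> 0 <= l i /\ adm (Q i) (x i) (l i).
Proof.
move=> [l [l1 l2]]; exists l => // i ni; split; last exact: l2.
have [h1 h2 h3 h4] := mod i; exact: (adm_ge0 h1 h2 h3 h4 (l2 i ni)).
Qed.

Lemma ball_le n p p' x : p <= p' -> ball n Q p x -> ball n Q p' x.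
Proof. by move=> pp [l [l1 l2]]; exists l; split=> //; exact: le_trans pp. Qed.

Lemma ball_mono n p x y : (forall i, (i < n)%N -> `|y i| <= `|x i|) -> ball n Q p x -> ball n Q p y.
Proof. by move=> yx [l [l1 l2]]; exists l; split=> // i ni; exact: adm_le (yx i ni) (l2 i ni). Qed.

Lemma tailQ_half i j : Q i j <= (1 / 4%:R) ^+ j.
Proof.
have [h1 h2 h3 h4] := mod i.
apply: le_trans (tailQ_exp h1 h2 h3 h4 j) _.
rewrite -mulNr expRM_natr; apply: lerXn2r; rewrite ?nnegrE ?expR_ge0 ?divr_ge0 //.
rewrite expRN mul1r lef_pV2 ?posrE ?expR_gt0 //.
by apply: le_trans (expR_ge1Dx _); lra.
Qed.

Lemma tailQ_le1 i j : Q i j <= 1.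
Proof. by apply: le_trans (tailQ_half i j) _; rewrite exprn_ile1 //; lra. Qed.

Lemma sum_tailQ i K : \sum_(j < K) Q i j <= 2%:R.
Proof.
suff H : \sum_(j < K) Q i j <= 2%:R - 2%:R * (1 / 4%:R) ^+ K.
  by apply: le_trans H _; rewrite gerBl mulr_ge0 // exprn_ge0 // divr_ge0.
elim: K => [|K IH]; first by rewrite big_ord0 expr0; lra.
rewrite big_ord_recr /= exprS; have := tailQ_half i K; have : (0:R) <= (1 / 4%:R) ^+ K by rewrite exprn_ge0 // divr_ge0.
lra.
Qed.

Lemma vl_mean i : \sum_s w i s * v i s = 0.
Proof.
rewrite (wt_sumE m i (fun b s => (-1) ^+ b * (k i s).+1%:R)); apply: big1 => s _.
by rewrite expr1 expr0; lra.
Qed.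

Lemma vl_sq i : \sum_s w i s * v i s ^+ 2 <= 4%:R.
Proof.
rewrite (wt_sumE m i (fun b s => ((-1) ^+ b * (k i s).+1%:R) ^+ 2)).
have [h1 h2 _ _] := mod i.
rewrite (_ : \sum_s _ = \sum_s m i s * (fun j => j.+1%:R ^+ 2) (k i s)); last first.
  by apply: eq_bigr => s _; rewrite expr1 expr0; congr (_ * _); lra.
rewrite (@tailQ_sum _ _ _ _ (fun j => j.+1%:R ^+ 2) _ (leqnn _)); set K := (\max_s k i s)%N.
have q0 : Q i 0 = 1 by exact: tailQ0.
have H L : \sum_(j < L.+1) (Q i j - Q i j.+1) * j.+1%:R ^+ 2 <=
   4%:R - 2%:R * (1 / 2%:R) ^+ L - Q i L.+1 * L.+1%:R ^+ 2.
  elim: L => [|L IH]; first by rewrite big_ord1 expr0 q0 !expr1n; lra.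
  rewrite big_ord_recr /=.
  have q := tailQ_half i L.+1.
  have e := @quarter_half R L.
  have e2 : (2%:R * L.+1%:R + 1) * Q i L.+1 <= 2%:R * (1 / 2%:R) ^+ L.+1.
    apply: (@le_trans _ _ ((2%:R * L.+1%:R + 1) * (1 / 4%:R) ^+ L.+1)).
      by apply: ler_wpM2l => //; rewrite addr_ge0 ?mulr_ge0.
    by apply: le_trans e _; apply: ler_wpM2r; [rewrite exprn_ge0 // divr_ge0 | lra].
  rewrite -(natr1 L.+1); move: IH e2; rewrite (exprS (1 / 2%:R) L); move: (L.+1%:R : R) (Q i L.+1) (Q i L.+2) => A B C.
  lra.
apply: le_trans (H K) _.
have : 0 <= Q i K.+1 * K.+1%:R ^+ 2 by rewrite mulr_ge0 ?sqr_ge0 // tailQ_ge0.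
have : 0 <= (1 / 2%:R : R) ^+ K by rewrite exprn_ge0 // divr_ge0.
lra.
Qed.

Lemma lin_sq n (be : nat -> R) x : Ev n w v x (fun y => (\sum_(i < n) be i * y i) ^+ 2) <=
  4%:R * \sum_(i < n) be i ^+ 2.
Proof.
have := @Ev_sq R _ w v n x 0 be (wt_sum1 mod) vl_mean.
rewrite (@Ev_ext _ _ _ _ _ _ _ _ (fun y => (\sum_(i < n) be i * y i) ^+ 2)); last by move=> y; rewrite add0r.
move=> ->; rewrite expr0n /= add0r mulr_sumr; apply: ler_sum => i _.
by rewrite mulrC ler_wpM2r ?sqr_ge0 ?vl_sq.
Qed.

Lemma ball_sq n x : ball n Q 12%:R x -> \sum_(i < n) x i ^+ 2 <= 16%:R.
Proof.
move=> /ball_lev[l l1 l2]; apply: (@le_trans _ _ (\sum_(i < n) l i)); last by lra.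
apply: ler_sum => i _; have [l0 ad] := l2 i (ltn_ord i).
have [h1 h2 h3 h4] := mod i.
case: ad => [[] //|[j [j0 xj Qj]]].
have jl := adm_level h1 h2 h3 h4 Qj.
have l12 : l i <= 12%:R.
  apply: le_trans l1; rewrite (bigD1 i) //= lerDl; apply: sumr_ge0 => i' _.
  by have [] := l2 i' (ltn_ord i').
have j1 : 1 <= j%:R :> R by rewrite ler1n.
rewrite -(real_normK (num_real (x i))).
apply: (@le_trans _ _ (j.+1%:R ^+ 2)); first by apply: lerXn2r; rewrite ?nnegrE.
rewrite -natr1; nra.
Qed.

(** On the ball of level 12 the Euclidean norm is at most 4, so Cauchy-Schwarz supplies the bound
    that [moment] asks for. The order 12 is that of the square of [Zf] below. *)
Lemma lin12 n (be : nat -> R) x : Ev n w v x (fun y => (\sum_(i < n) be i * y i) ^+ 12) <=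
  ((8%:R * CI1) ^+ 2 * \sum_(i < n) be i ^+ 2) ^+ 6.
Proof.
set B := \sum_(i < n) be i ^+ 2.
have B0 : 0 <= B by apply: sumr_ge0 => i _; exact: sqr_ge0.
have C1 := @CI1_ge1 R.
have w0 := wt_ge0 mod.
case: (ltrP 0 B) => [Bp|Bn]; last first.
  have bz : forall i : 'I_n, be i = 0.
    move=> i; have : \sum_(i < n) be i ^+ 2 == 0 by rewrite -/B eq_le Bn B0.
    rewrite psumr_eq0 => [/allP/(_ i)|j _]; last exact: sqr_ge0.
    by rewrite mem_index_enum sqrf_eq0 => /(_ isT)/eqP.
  rewrite (@Ev_ext _ _ _ _ _ _ _ _ (fun=> 0)) ?Ev0.
    by rewrite exprn_ge0 // mulr_ge0 ?sqr_ge0.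
  by move=> y; rewrite big1 ?expr0n // => i _; rewrite bz mul0r.
set t := Num.sqrt B.
have tB : t ^+ 2 = B by rewrite sqr_sqrtr.
have tp : 0 < t by rewrite sqrtr_gt0.
have sM := @subdiff_max R n unit tt (fun _ => be).
have := @moment R S0 m k mod n _ (8%:R * t) 11 x sM.
have -> : (CI1 * (8%:R * t)) ^+ 12 = ((8%:R * CI1) ^+ 2 * B) ^+ 6.
  by rewrite -tB -exprMn -exprM; congr (_ ^+ _); ring.
have mxE (y : nat -> R) : famax tt (fun _ : unit => `|\sum_(i < n) be i * y i|) = `|\sum_(i < n) be i * y i| by [].
have -> : Ev n w v x (fun y => (\sum_(i < n) be i * y i) ^+ 12) =
    Ev n w v x (fun y => famax tt (fun _ : unit => `|\sum_(i < n) be i * y i|) ^+ 12).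
  by apply: Ev_ext => y; rewrite mxE -normrX ger0_norm // (exprM _ 2 6) exprn_ge0 // sqr_ge0.
apply=> [y||y /ball_sq Hy|]; rewrite ?mulr_gt0 //.
- exact: normr_ge0.
- rewrite -(@ler_pXn2r _ 2) ?nnegrE ?mxE ?normr_ge0 ?mulr_ge0 ?(ltW tp) //.
  rewrite real_normK ?num_real //; apply: le_trans (sum_CS _ _ _) _.
  by rewrite -/B exprMn tB; nra.
- have M0 (y : nat -> R) : 0 <= famax tt (fun _ : unit => `|\sum_(i < n) be i * y i|) by exact: normr_ge0.
  rewrite -(@ler_pXn2r _ 2) ?nnegrE ?mulr_ge0 ?(ltW tp) ?Ev_ge0 //.
  apply: le_trans (@Ev_jensen_pow _ _ _ w v w0 (wt_sum1 mod) n x _ 1 M0) _.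
  apply: le_trans (_ : Ev n w v x (fun y => (\sum_(i < n) be i * y i) ^+ 2) <= _).
    by apply: Ev_le => // y; rewrite mxE real_normK ?num_real.
  by apply: le_trans (lin_sq n be x) _; rewrite -/B exprMn tB; lra.
Qed.

End Lin.

Ltac nng := repeat (first [ done | assumption | match goal with
  | |- is_true (0 <= _ ^+ 2)%R => exact: sqr_ge0
  | |- is_true (0 <= _ ^+ _)%R => apply: exprn_ge0
  | |- is_true (0 <= _ ^-1)%R => rewrite invr_ge0
  | |- is_true (0 <= _ * _)%R => apply: mulr_ge0
  | |- is_true (0 <= _ + _)%R => apply: addr_ge0
  | |- is_true (0 <= expR _)%R => exact: expR_ge0
  | |- is_true (0 <= `|_|)%R => exact: normr_ge0 end
  | (apply: ltW; assumption) ]).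

(** * One matrix: second moment of the supremum over the ball *)

Section Kp.
Context {R : realType}.
Variables (S0 : finType) (mX mY : nat -> S0 -> R) (kX kY : nat -> S0 -> nat).
Hypotheses (modX : model mX kX) (modY : model mY kY).
Let QX i := tailQ (mX i) (kX i).
Let QY i := tailQ (mY i) (kY i).
Notation wY := (wt mY).
Notation vY := (vl kY).
Variables (n p : nat) (b : nat -> nat -> R) (r : R) (y0 : nat -> R).
Let P : R := p.+1%:R.
Let tau2 i := \sum_(j < n) b i j ^+ 2.
Let tau i := Num.sqrt (tau2 i).
Let c i (y : nat -> R) := \sum_(j < n) b i j * y j.
Hypothesis r0 : 0 < r.
Hypothesis H1 : forall x : nat -> R, ball n QX P x -> \sum_(i < n) x i * tau i <= r.
Hypothesis H2 : forall x y : nat -> R, ball n QX P x -> ball n QY P y ->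
  \sum_(i < n) x i * c i y <= r.
Hypothesis H3 : forall x : nat -> R, ball n QX P x ->
  Ev n wY vY y0 (fun y => `|\sum_(i < n) x i * c i y|) <= r.
Variable rk : nat -> nat.
Hypothesis rk_lt : forall i, (i < n)%N -> (rk i < n)%N.
Hypothesis rk_sum : forall g : nat -> R, \sum_(i < n) g (rk i) = \sum_(i < n) g i.
Hypothesis rk_le : forall i j, (i < n)%N -> (j < n)%N -> (rk i <= rk j)%N -> tau j <= tau i.
Let hi i := (p < rk i)%N.

Let P0 : 0 < P. Proof. by rewrite /P ltr0n. Qed.
Let tau2_ge0 i : 0 <= tau2 i. Proof. by apply: sumr_ge0 => j _; exact: sqr_ge0. Qed.
Let tau_ge0 i : 0 <= tau i. Proof. exact: sqrtr_ge0. Qed.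
Let tauE i : tau i ^+ 2 = tau2 i. Proof. by rewrite sqr_sqrtr. Qed.

Lemma sum_le_cst N a : (a <= N)%N -> \sum_(j < N) (if (j < a)%N then 1 else 0 : R) = a%:R.
Proof.
move=> aN; rewrite -(big_mkord xpredT (fun j => if (j < a)%N then 1 else 0 : R)).
rewrite (@big_cat_nat _ _ _ a) //= [X in _ + X]big_nat_cond [X in _ + X]big1 ?addr0; last first.
  by move=> j /andP[/andP[h _] _]; rewrite ltnNge h.
rewrite big_nat_cond (eq_bigr (fun=> 1)) => [|j /andP[/andP[_ h] _]]; last by rewrite h.
by rewrite -big_nat_cond big_mkord sumr_const card_ord.
Qed.

(** Tests [H1] on the [rk i + 1] rows of largest norm, each with coordinate [sqrt (P / (rk i + 1))];
    the total quadratic cost is [P]. *)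
Lemma tau_rank i : (i < n)%N -> hi i -> tau2 i * (P * (rk i).+1%:R) <= r ^+ 2.
Proof.
move=> ni hii; set io : R := (rk i).+1%:R.
have io0 : 0 < io by rewrite /io ltr0n.
have Pio : P <= io by rewrite /P /io ler_nat ltnS ltnW.
set th := Num.sqrt (P / io).
have th2 : th ^+ 2 = P / io by rewrite sqr_sqrtr // divr_ge0 ?ltW.
have th0 : 0 <= th by exact: sqrtr_ge0.
have th1 : th <= 1.
  by rewrite -(@ler_pXn2r _ 2) ?nnegrE // th2 expr1n ler_pdivrMr // mul1r.
have cnt : \sum_(j < n) (if (rk j < (rk i).+1)%N then 1 else 0 : R) = io.
  by rewrite (rk_sum (fun m => if (m < (rk i).+1)%N then 1 else 0)) sum_le_cst ?rk_lt.
have := H1 (x := fun j => if (rk j < (rk i).+1)%N then th else 0).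
have bl : ball n QX P (fun j => if (rk j < (rk i).+1)%N then th else 0).
  exists (fun j => P / io * (if (rk j < (rk i).+1)%N then 1 else 0)); split.
    by rewrite -mulr_sumr cnt divfK ?gt_eqF.
  move=> j nj; left; case: ifP => _; first by rewrite ger0_norm // th1 th2 mulr1.
  by rewrite normr0 expr0n mulr0.
move=> /(_ bl) h.
have {}h : th * (io * tau i) <= r.
  apply: le_trans h; rewrite -cnt mulr_suml mulr_sumr; apply: ler_sum => j _.
  case: ifP => hj; last by rewrite !mul0r mulr0.
  by rewrite mul1r; apply: ler_wpM2l => //; apply: rk_le.
have : (th * (io * tau i)) ^+ 2 <= r ^+ 2.
  by apply: lerXn2r; rewrite ?nnegrE ?mulr_ge0 ?(ltW io0) ?(ltW r0).
rewrite !exprMn th2 tauE; apply: le_trans; rewrite le_eqVlt; apply/orP; left; apply/eqP.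
by clearbody io; field; rewrite gt_eqF.
Qed.

(** Tests [H1] on a multiple of [tau]. Its coordinates are at most 1 unless a single row carries
    more than the share [1 / P] of the sum; then [tau_rank] at that row is enough. *)
Lemma tau_rest : P * \sum_(i < n | hi i) tau2 i <= r ^+ 2.
Proof.
set T := \sum_(i < n | hi i) tau2 i.
have T0 : 0 <= T by apply: sumr_ge0.
case: (ltrP 0 T) => [Tp|]; last first.
  by move=> h; apply: (@le_trans _ _ 0); [rewrite pmulr_rle0 | exact: sqr_ge0].
case: (pselect (exists2 i : 'I_n, hi i & T < P * tau2 i)) => [[i hii Ti]|no].
  apply: le_trans (tau_rank (ltn_ord i) hii).
  apply: (@le_trans _ _ (P * (P * tau2 i))); first by apply: ler_wpM2l; exact: ltW.
  apply: (@le_trans _ _ (P * (tau2 i * (rk i).+1%:R))); last by rewrite mulrCA.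
  apply: ler_wpM2l; [exact: ltW | rewrite mulrC; apply: ler_wpM2l => //].
  by rewrite /P ler_nat ltnS ltnW.
set t := Num.sqrt T.
have tp : 0 < t by rewrite sqrtr_gt0.
have t2 : t ^+ 2 = T by rewrite sqr_sqrtr.
set q := Num.sqrt P.
have q2 : q ^+ 2 = P by rewrite sqr_sqrtr // ltW.
have q0 : 0 <= q by exact: sqrtr_ge0.
have bl : ball n QX P (fun j => if hi j then q * tau j / t else 0).
  exists (fun j => if hi j then P / T * tau2 j else 0); split.
    by rewrite -big_mkcond /= -mulr_sumr -/T divfK ?gt_eqF.
  move=> j nj; left; case: ifP => hj; last by rewrite normr0 expr0n.
  have e : (q * tau j / t) ^+ 2 = P / T * tau2 j.
    by rewrite expr_div_n exprMn q2 t2 tauE mulrAC.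
  split; last by rewrite e.
  rewrite -(@ler_pXn2r _ 2) ?nnegrE // real_normK ?num_real // e expr1n mulrAC ler_pdivrMr // mul1r.
  by rewrite leNgt; apply/negP => h; apply: no; exists (Ordinal nj).
have h := H1 bl.
have {}h : q * t <= r.
  apply: le_trans h.
  have -> : \sum_(i < n) (if hi i then q * tau i / t else 0) * tau i =
     \sum_(i < n | hi i) q / t * tau2 i.
    rewrite [RHS]big_mkcond /=; apply: eq_bigr => i _; case: ifP => _; last by rewrite mul0r.
    by rewrite -tauE; field; rewrite gt_eqF.
  rewrite -mulr_sumr -/T -t2 le_eqVlt; apply/orP; left; apply/eqP; field; by rewrite gt_eqF.
by rewrite -t2 -q2 -exprMn; apply: lerXn2r; rewrite ?nnegrE ?mulr_ge0 // ltW.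
Qed.

(* Points of the ball are approximated by a finite set: the coordinate [i] is rounded to a level at which its
   tail is at most [p / rank], and [om] is the weight of this choice in a union bound. *)
Let D : finType := option (bool * 'I_p.+2)%type.
Let om (i : 'I_n) (d : D) : R := match d with
  | None => 1
  | Some bj => if (rk i).+1%:R * QX i bj.2 <= P then QX i bj.2 ^+ 3 else 0 end.
Let val (d : D) : R := match d with None => 0 | Some bj => (-1) ^+ bj.1 * bj.2.+1%:R end.

Let QX0 i j : 0 <= QX i j. Proof. by have [h1 h2 h3 h4] := modX i; exact: tailQ_ge0. Qed.

Lemma om_ge0 i d : 0 <= om i d.
Proof. by case: d => [bj|] //=; case: ifP => _ //; rewrite exprn_ge0 // QX0. Qed.

(** Of the three factors in the cube, one is summed over the levels; the other two are at most
    [(P / rank)^2] by the condition in [om], and this is summable over the rows. *)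
Lemma om_sum : \prod_i \sum_d om i d <= expR (8%:R * P).
Proof.
apply: (@le_trans _ _ (expR (4%:R * \sum_(i < n) Num.min 1 ((P / (rk i).+1%:R) ^+ 2)))); last first.
  rewrite ler_expR (rk_sum (fun m => Num.min 1 ((P / m.+1%:R) ^+ 2))).
  have := @sum_min_sq R p.+1 n; rewrite -/P; lra.
rewrite mulr_sumr expR_sum; apply: ler_prod => i _; apply/andP; split.
  by apply: sumr_ge0 => d _; exact: om_ge0.
set g := Num.min _ _.
have g0 : 0 <= g by rewrite /g le_min ler01 sqr_ge0.
apply: le_trans (expR_ge1Dx _).
rewrite (bigD1 None) //= lerD2l.
have -> : \sum_(d | d != None) om i d = \sum_(bj : bool * 'I_p.+2) om i (Some bj).
  by rewrite (reindex_omap Some id) //=; [apply: eq_bigl => bj; rewrite eqxx | case].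
rewrite -(pair_bigA _ (fun (b0 : bool) (j : 'I_p.+2) => om i (Some (b0, j)))) /= big_bool /=.
suff H : \sum_(j < p.+2) (if (rk i).+1%:R * QX i j <= P then QX i j ^+ 3 else 0) <= 2%:R * g by lra.
apply: (@le_trans _ _ (\sum_(j < p.+2) g * QX i j)); last first.
  by rewrite -mulr_sumr mulrC; apply: ler_wpM2r => //; exact: (sum_tailQ modX).
apply: ler_sum => j _; case: ifP => h; last by rewrite mulr_ge0.
rewrite exprSr; apply: ler_wpM2r => //; rewrite /g le_min; apply/andP; split.
  by rewrite exprn_ile1 ?QX0 // (tailQ_le1 modX).
apply: lerXn2r; rewrite ?nnegrE ?QX0 ?divr_ge0 ?(ltW P0) //.
by rewrite ler_pdivlMr // mulrC.
Qed.

(* Controls the coordinates that are not rounded: [x |c| <= x r / P + x |c| (P |c| / r)^5]. *)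
Let Zf (i : nat) (y : nat -> R) := (rk i).+1%:R / P * `|c i y| * (P * `|c i y| / r) ^+ 5.

Lemma Zf_ge0 i y : 0 <= Zf i y.
Proof. by rewrite /Zf; nng. Qed.

Lemma round_coord (i : 'I_n) y x l : 0 <= l -> l <= P -> adm (QX i) x l -> exists d x',
  [/\ expR (- (3%:R * l)) <= om i d, 0 <= x', x' ^+ 2 <= l &
   `|x * c i y| <= val d * c i y + (if hi i then x' * `|c i y| else 0) + l * (r / P) +
      (if hi i then Zf i y else 0)].
Proof.
move=> l0 lP ad; have [m1 m2 m3 m4] := modX i.
set C := c i y; rewrite normrM.
have rP : 0 <= r / P by rewrite divr_ge0 ?ltW.
have lrP : 0 <= l * (r / P) by rewrite mulr_ge0.
have Z0 : 0 <= (if hi i then Zf i y else 0) by case: ifP => _ //; exact: Zf_ge0.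
have e3 : expR (- (3%:R * l)) <= 1 by rewrite -[leRHS]expR0 ler_expR oppr_le0 mulr_ge0.
have c0 := normr_ge0 C.
have sg (j : nat) : exists b0 : bool, (-1) ^+ b0 * j.+1%:R * C = j.+1%:R * `|C|.
  case: (lerP 0 C) => hC.
    by exists false; rewrite expr0 mul1r ger0_norm.
  by exists true; rewrite expr1 mulN1r mulNr ltr0_norm // mulrN.
have sum_low : 0 <= (if hi i then 0 * `|C| else 0) by rewrite mul0r; case: ifP.
case: ad => [[x1 x2]|[j [j0 xj Qj]]].
  case hii: (hi i).
    exists None, `|x|; split=> //; first by rewrite real_normK ?num_real.
    by rewrite /val mul0r add0r -addrA lerDl addr_ge0 //; move: Z0; rewrite hii.
  have [b0 hb] := sg 0%N.
  exists (Some (b0, ord0)), 0; split=> //=; rewrite ?expr0n //=.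
    rewrite /QX tailQ0 // mulr1 expr1n ifT //.
    by rewrite /P ler_nat ltnS leqNgt; apply/negP; rewrite /hi in hii; rewrite hii.
  by rewrite !addr0 hb mul1r; apply: le_trans (ler_wpM2r c0 x1) _; rewrite mul1r lerDl.
have jl : 8%:R * j%:R <= l by exact: (adm_level m1 m2 m3 m4 Qj).
have jR : 1 <= j%:R :> R by rewrite ler1n.
have xC : `|x| * `|C| <= j.+1%:R * `|C| by apply: ler_wpM2r.
case: (lerP ((rk i).+1%:R * QX i j) P) => low.
  have jp : (j < p.+2)%N.
    by rewrite -(ltr_nat R) -natr1; rewrite /P in lP; lra.
  have [b0 hb] := sg j.
  exists (Some (b0, Ordinal jp)), 0; split=> //=; rewrite ?expr0n //=.
    rewrite low mulrC -mulNr expRM_natr; apply: lerXn2r; rewrite ?nnegrE ?expR_ge0 ?QX0 //.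
  by rewrite hb; apply: le_trans xC _; rewrite -addrA -addrA lerDl; nng.
have ioP : P < (rk i).+1%:R.
  apply: lt_le_trans low _; rewrite -[leRHS]mulr1; apply: ler_wpM2l => //; exact: (tailQ_le1 modX).
have hii : hi i by move: ioP; rewrite /P ltr_nat ltnS.
exists None, 0; split=> //=; rewrite ?expr0n //= hii /= !mul0r !add0r.
have jio : j.+1%:R <= (rk i).+1%:R / P.
  rewrite ler_pdivlMr //; apply: (@le_trans _ _ (j.+1%:R * ((rk i).+1%:R * QX i j))).
    by apply: ler_wpM2l => //; exact: ltW.
  rewrite mulrCA -[leRHS]mulr1; apply: ler_wpM2l => //.
  apply: (@le_trans _ _ (j.+1%:R * expR (- (8%:R * j%:R)))).
    by apply: ler_wpM2l => //; exact: (tailQ_exp m1 m2 m3 m4).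
  rewrite expRN -ler_pdivlMr ?invr_gt0 ?expR_gt0 // invrK mul1r.
  by apply: le_trans (expR_ge1Dx _); rewrite -natr1; lra.
case: (lerP (P * `|C|) r) => hPC.
  apply: le_trans xC _; apply: (@le_trans _ _ (l * (r / P))); last first.
    by rewrite lerDl; exact: Zf_ge0.
  apply: ler_pM => //; first by rewrite -natr1; lra.
  by rewrite ler_pdivlMr // mulrC.
apply: le_trans xC _; apply: (@le_trans _ _ (Zf i y)); last by rewrite lerDr.
rewrite /Zf -/C; apply: (@le_trans _ _ ((rk i).+1%:R / P * `|C|)); first exact: ler_wpM2r.
rewrite ler_peMr //; first by rewrite mulr_ge0 // divr_ge0 ?ltW.
by rewrite exprn_ege1 // ler_pdivlMr // mul1r ltW.
Qed.

Lemma round_point y x : ball n QX P x -> exists s : {ffun 'I_n -> D},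
  expR (- (3%:R * P)) <= \prod_i om i (s i) /\
  (\sum_(i < n) x i * c i y) ^+ 2 <= 4%:R * ((\sum_(i < n) val (s i) * c i y) ^+ 2 +
    P * (\sum_(i < n | hi i) c i y ^+ 2) + r ^+ 2 + (\sum_(i < n | hi i) Zf i y) ^+ 2).
Proof.
move=> /(ball_lev modX)[l l1 l2].
have lP (i : 'I_n) : l i <= P.
  apply: le_trans l1; rewrite (bigD1 i) //= lerDl; apply: sumr_ge0 => i' _.
  by have [] := l2 i' (ltn_ord i').
have [d Hd] := choice (fun i : 'I_n => let: conj a1 a2 := l2 i (ltn_ord i) in round_coord y a1 (lP i) a2).
have [x' Hx] := choice Hd.
exists [ffun i => d i]; split.
  apply: (@le_trans _ _ (expR (\sum_(i < n) - (3%:R * l i)))).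
    by rewrite ler_expR sumrN -mulr_sumr lerN2 ler_wpM2l.
  rewrite expR_sum; apply: ler_prod => i _; rewrite expR_ge0 /= ffunE.
  by have [] := Hx i.
set A := \sum_(i < n) val _ * c i y; set Z := \sum_(i < n | hi i) Zf i y.
set W := \sum_(i < n | hi i) _.
set B := \sum_(i < n | hi i) x' i * `|c i y|.
have Z0 : 0 <= Z by apply: sumr_ge0 => i _; exact: Zf_ge0.
have B0 : 0 <= B by apply: sumr_ge0 => i _; rewrite mulr_ge0 //; have [] := Hx i.
have B2 : B ^+ 2 <= P * W.
  apply: le_trans (sum_CS _ _ _) _.
  have -> : \sum_(i < n | hi i) `|c i y| ^+ 2 = W.
    by apply: eq_bigr => i _; rewrite real_normK ?num_real.
  apply: ler_wpM2r; first by apply: sumr_ge0 => i _; exact: sqr_ge0.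
  apply: le_trans l1; rewrite big_mkcond /=; apply: ler_sum => i _.
  have [_ _ h _] := Hx i; case: ifP => // _; apply: le_trans h; exact: sqr_ge0.
set L := \sum_(i < n) x i * c i y.
have HL : `|L| <= A + B + r + Z.
  apply: le_trans (ler_norm_sum _ _ _) _.
  apply: (@le_trans _ _ (\sum_(i < n) (val (d i) * c i y + (if hi i then x' i * `|c i y| else 0) +
     l i * (r / P) + (if hi i then Zf i y else 0)))).
    by apply: ler_sum => i _; have [] := Hx i.
  rewrite !big_split /= -!big_mkcond /= -/Z -/B lerD2r -mulr_suml.
  have -> : \sum_(i < n) val (d i) * c i y = A by apply: eq_bigr => i _; rewrite ffunE.
  by rewrite lerD2l mulrA ler_pdivrMr // mulrC; apply: ler_wpM2l => //; exact: ltW.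
have L0 := normr_ge0 L.
rewrite -(real_normK (num_real L)).
apply: (@le_trans _ _ ((A + B + r + Z) ^+ 2)).
  by apply: lerXn2r; rewrite ?nnegrE //; lra.
apply: (@le_trans _ _ (4%:R * (A ^+ 2 + B ^+ 2 + r ^+ 2 + Z ^+ 2))); last by lra.
rewrite -subr_ge0.
have -> : 4%:R * (A ^+ 2 + B ^+ 2 + r ^+ 2 + Z ^+ 2) - (A + B + r + Z) ^+ 2 =
  (A - B) ^+ 2 + (A - r) ^+ 2 + (A - Z) ^+ 2 + (B - r) ^+ 2 + (B - Z) ^+ 2 + (r - Z) ^+ 2 by ring.
by rewrite !addr_ge0 ?sqr_ge0.
Qed.

(** Coordinates rounded to absolute value 1 occur only in the first [p + 1] rows and cost 1 each. At
    a level [j > 0] the cost is [- ln (Q j)], a third of [- ln om], and these sum to at most [P]. *)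
Lemma val_ball (s : {ffun 'I_n -> D}) : expR (- (3%:R * P)) <= \prod_i om i (s i) ->
  ball n QX (2%:R * P) (fun i => if insub i is Some i' then val (s i') else 0).
Proof.
move=> hs.
have prod0 : 0 < \prod_i om i (s i) by apply: lt_le_trans hs; exact: expR_gt0.
have pos i : 0 < om i (s i).
  rewrite lt_neqAle om_ge0 andbT eq_sym; apply/negP => /eqP e.
  by move: prod0; rewrite (bigD1 i) //= e mul0r ltxx.
exists (fun i => (if (rk i < p.+1)%N then 1 else 0) +
   (if insub i is Some i' then - ln (om i' (s i')) else 0) / 3%:R); split.
  rewrite big_split /= -mulr_suml (rk_sum (fun m => if (m < p.+1)%N then 1 else 0)).
  have -> : \sum_(i < n) (if insub (i : nat) is Some i' then - ln (om i' (s i')) else 0) =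
      \sum_(i < n) - ln (om i (s i)) by apply: eq_bigr => i _; rewrite valK.
  have h1 : \sum_(i < n) (if (i < p.+1)%N then 1 else 0) <= P.
    case: (leqP p.+1 n) => pn; first by rewrite sum_le_cst.
    apply: (@le_trans _ _ (\sum_(i < n) (1:R))); first by apply: ler_sum => i _; case: ifP.
    by rewrite sumr_const card_ord /P ler_nat ltnW.
  have h2 : \sum_(i < n) - ln (om i (s i)) <= 3%:R * P.
    rewrite sumrN lerNl -ler_expR expR_sum.
    by rewrite (eq_bigr (fun i => om i (s i))) // => i _; rewrite lnK // posrE.
  lra.
move=> i ni; case: insubP => [i' _ ei|]; last by rewrite ni.
move: ei => /= ei; subst i.
have := pos i'; have := om_ge0 i' (s i').
case: (s i') => [[b0 j]|] /=; last first.
  by move=> _ _; left; rewrite normr0 expr0n ln1 oppr0 mul0r addr0; split=> //; case: ifP.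
case: ifP => low _ q3; last by move: q3; rewrite ltxx.
have q0 : 0 < QX i' j by rewrite lt_neqAle QX0 andbT eq_sym; apply/negP => /eqP e; move: q3; rewrite e expr0n ltxx.
have qle : QX i' j <= 1 by exact: (tailQ_le1 modX).
have lnq : ln (QX i' j) <= 0 by rewrite ln_le0.
have [m1 m2 m3 m4] := modX i'.
have -> : - ln (QX i' j ^+ 3) / 3%:R = - ln (QX i' j) by rewrite lnXn // -mulr_natr; field.
case: (posnP j) => [j0|j0].
  left; rewrite normrMsign j0 normr1; split=> //.
  rewrite exprMn sqrr_sign mul1r expr1n ifT; first by move: lnq; rewrite j0; lra.
  move: low; rewrite j0 /QX tailQ0 // mulr1 /P ler_nat; exact.
right; exists j; split=> //; first by rewrite normrMsign ger0_norm.
rewrite -[leRHS](lnK (x := QX i' j)) ?posrE // ler_expR lerNl.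
by case: ifP => _; lra.
Qed.

(** The outer 4 comes from squaring a sum of four terms, [expR 11] from the union bound ([8 + 3]),
    the 5 from the Cauchy-Schwarz term and [r], and the last square from [E_Z]. *)
Definition CK2 : R := 4%:R * (expR 11%:R * (16%:R * CI1) ^+ 2 + 5%:R + (2%:R * (8%:R * CI1) ^+ 6) ^+ 2).

(** The union bound costs [expR (11 P)]. Taken after raising to the power [p + 1], it leaves only
    the factor [expR 11] once the root is extracted; a fixed point is handled by [moment] of order
    [2 (p + 1)]. *)
Lemma E_low (xs : (nat -> R) -> {ffun 'I_n -> D}) : (forall y, expR (- (3%:R * P)) <= \prod_i om i (xs y i)) ->
  Ev n wY vY y0 (fun y => (\sum_(i < n) val (xs y i) * c i y) ^+ 2) <=
  expR 11%:R * (16%:R * CI1 * r) ^+ 2.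
Proof.
move=> Hxs; have w0 := wt_ge0 modY; have C1 := @CI1_ge1 R.
have C0 : 0 <= CI1 :> R by lra.
have c0 : 0 <= 16%:R * CI1 * r by nng.
rewrite -(@ler_pXn2r _ p.+1) ?nnegrE; first last.
- by rewrite mulr_ge0 ?expR_ge0 ?sqr_ge0.
- by apply: Ev_ge0 => // y; exact: sqr_ge0.
- by [].
apply: le_trans (@Ev_jensen_pow _ _ _ _ vY w0 (wt_sum1 modY) n y0 _ p (fun y => sqr_ge0 _)) _.
pose F (s : {ffun 'I_n -> D}) (y : nat -> R) := ((\sum_(i < n) val (s i) * c i y) ^+ 2) ^+ p.+1.
have := @union_bound R n D om (expR (8%:R * P)) (expR (- (3%:R * P)))
  ((CI1 * (16%:R * r)) ^+ (2 * p.+1)) R _ n wY vY y0 F xs w0 om_ge0.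
have cc : 0 <= (CI1 * (16%:R * r)) ^+ (2 * p.+1) by nng.
have F0 s y : 0 <= F s y by rewrite /F exprn_ge0 // sqr_ge0.
move=> /(_ F0 om_sum (expR_gt0 _) cc) h.
apply: le_trans (h _ Hxs) _; last first.
  have e1 : (expR 11%:R * (16%:R * CI1 * r) ^+ 2) ^+ p.+1 =
     expR 11%:R ^+ p.+1 * ((16%:R * CI1 * r) ^+ 2) ^+ p.+1 by exact: exprMn.
  have e2 : (CI1 * (16%:R * r)) ^+ (2 * p.+1) = ((16%:R * CI1 * r) ^+ 2) ^+ p.+1.
    by rewrite exprM; congr (_ ^+ _ ^+ _); ring.
  rewrite e1 e2 le_eqVlt; apply/orP; left; apply/eqP; congr (_ * _).
  rewrite -expRN -expRD -expRM_natr -/P; congr expR; ring.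
move=> s /val_ball bl.
set xv := (fun i : nat => _) in bl.
pose be j := \sum_(i < n) xv i * b i j.
have exv (y : nat -> R) : \sum_(i < n) val (s i) * c i y = \sum_(j < n) be j * y j.
  rewrite /be /c; under [RHS]eq_bigr => j _ do rewrite mulr_suml.
  rewrite exchange_big /=; apply: eq_bigr => i _; rewrite mulr_sumr; apply: eq_bigr => j _.
  by rewrite /xv valK mulrA.
have sM := @subdiff_max R n unit tt (fun _ => be).
have mxE (y : nat -> R) : famax tt (fun _ : unit => `|\sum_(i < n) be i * y i|) = `|\sum_(i < n) be i * y i| by [].
have bl4 : ball n QX P (fun i => xv i / (2%:R * 2%:R)) by apply: (ball_scale modX _ bl); rewrite ler1n.
have e4 (y : nat -> R) : \sum_(i < n) (xv i / (2%:R * 2%:R)) * c i y = (\sum_(j < n) be j * y j) / 4%:R.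
  rewrite -exv mulr_suml; apply: eq_bigr => i _; by rewrite /xv valK; field.
have e2p : (2 * p.+1 = (2 * p + 1).+1)%N by rewrite mulnS addn1 add2n.
(* The rounded point and the test point, each of level [2 (p + 1)], are divided by 4 to reach level
   [p + 1]; hence 16. *)
have mom := @moment R S0 mY kY modY n _ (16%:R * r) (2 * p + 1) y0 sM.
rewrite e2p.
apply: le_trans (mom _ _ _ _).
- by apply: Ev_le => // y; rewrite /F exv mxE -e2p exprM real_normK ?num_real.
- by move=> y; exact: normr_ge0.
- by rewrite mulr_gt0.
- move=> y by'; rewrite mxE.
  have b4 : ball n QY P (fun i => y i / (2%:R * 2%:R)).
    by apply: (ball_scale modY); [rewrite ler1n | rewrite /P -natrM e2p].
  have e16 : \sum_(i < n) (xv i / (2%:R * 2%:R)) * c i (fun i => y i / (2%:R * 2%:R)) =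
     (\sum_(j < n) be j * y j) / 16%:R.
    by rewrite e4 !mulr_suml; apply: eq_bigr => i _; field.
  rewrite ler_norml; apply/andP; split.
    have bn : ball n QX P (fun i => - (xv i / (2%:R * 2%:R))).
      by apply: (ball_mono _ bl4) => i _; rewrite normrN.
    have := H2 bn b4.
    rewrite (_ : \sum_(i < n) _ = - ((\sum_(j < n) be j * y j) / 16%:R)); first by lra.
    by rewrite -e16 -sumrN; apply: eq_bigr => i _; rewrite mulNr.
  by have := H2 bl4 b4; rewrite e16; lra.
- have := H3 bl4.
  rewrite (@Ev_ext _ _ _ _ _ _ _ _ (fun y => 1 / 4%:R * famax tt (fun _ : unit => `|\sum_(i < n) be i * y i|))).
    by rewrite EvZ; set e := Ev _ _ _ _ _; move: (e) => e1; move: r0; lra.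
  by move=> y; rewrite e4 normrM mxE [`|4%:R^-1|]ger0_norm; lra.
Qed.

(** By [lin12] and [tau_rank], the row with [rk i + 1 = k] contributes a multiple of
    [(r / P) (P / k)^2] to the norm in L_2, and these bounds are summable. *)
Lemma E_Z : Ev n wY vY y0 (fun y => (\sum_(i < n | hi i) Zf i y) ^+ 2) <=
  (2%:R * (8%:R * CI1) ^+ 6 * r) ^+ 2.
Proof.
have w0 := wt_ge0 modY; have C1 := @CI1_ge1 R.
set C := 8%:R * CI1; have C0 : 0 <= C by rewrite /C; lra.
pose be (i : nat) := C ^+ 6 * r / P * Num.min 1 ((P / (rk i).+1%:R) ^+ 2).
have cp : 0 <= C ^+ 6 * r / P by rewrite divr_ge0 ?(ltW P0) // mulr_ge0 ?exprn_ge0 // ltW.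
have be0 i : 0 <= be i by rewrite /be mulr_ge0 // le_min ler01 sqr_ge0.
apply: (@le_trans _ _ ((\sum_(i < n | hi i) be i) ^+ 2)); last first.
  apply: lerXn2r; rewrite ?nnegrE ?sumr_ge0 //.
    by nng.
  apply: (@le_trans _ _ (\sum_(i < n) be i)).
    by rewrite [leLHS]big_mkcond /=; apply: ler_sum => i _; case: ifP.
  rewrite /be -mulr_sumr (rk_sum (fun m => Num.min 1 ((P / m.+1%:R) ^+ 2))).
  apply: (@le_trans _ _ (C ^+ 6 * r / P * (2%:R * P))).
    by apply: ler_wpM2l => //; exact: sum_min_sq.
  by rewrite le_eqVlt; apply/orP; left; apply/eqP; move: (P) P0 => P' P'0; field; rewrite gt_eqF.
apply: Ev_mink => // i hii.
set io : R := (rk i).+1%:R.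
have io0 : 0 < io by rewrite /io ltr0n.
have Pio : P <= io by rewrite /P /io ler_nat ltnS ltnW.
have me : Num.min 1 ((P / io) ^+ 2) = (P / io) ^+ 2.
  apply/min_idPr; rewrite exprn_ile1 ?divr_ge0 ?(ltW P0) ?(ltW io0) //.
  by rewrite ler_pdivrMr // mul1r.
apply: (@le_trans _ _ (Ev n wY vY y0 (fun y => ((io / P) ^+ 2 * (P / r) ^+ 10) * (c i y) ^+ 12))).
  apply: Ev_le => // y; rewrite /Zf -/io le_eqVlt; apply/orP; left; apply/eqP.
  have -> : c i y ^+ 12 = `|c i y| ^+ 12.
    by rewrite (exprM _ 2 6) -(real_normK (num_real (c i y))) -exprM.
  by clearbody io; move: (P) P0 => P' P'0; field; rewrite !gt_eqF.
rewrite EvZ.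
apply: (@le_trans _ _ ((io / P) ^+ 2 * (P / r) ^+ 10 * (C ^+ 2 * tau2 i) ^+ 6)).
  apply: ler_wpM2l; last exact: (lin12 modY).
  by rewrite mulr_ge0 ?sqr_ge0 // (exprM _ 2 5) exprn_ge0 // sqr_ge0.
apply: (@le_trans _ _ ((io / P) ^+ 2 * (P / r) ^+ 10 * (C ^+ 2 * (r ^+ 2 / (P * io))) ^+ 6)).
  apply: ler_wpM2l; first by rewrite mulr_ge0 ?sqr_ge0 // (exprM _ 2 5) exprn_ge0 // sqr_ge0.
  apply: lerXn2r; rewrite ?nnegrE; [by nng; exact: tau2_ge0 | by nng |].
  apply: ler_wpM2l; first exact: sqr_ge0.
  by rewrite ler_pdivlMr ?mulr_gt0 //; exact: tau_rank.
rewrite /be -/io me le_eqVlt; apply/orP; left; apply/eqP.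
by clear me; clearbody io; move: (P) P0 => P' P'0; field; rewrite !gt_eqF.
Qed.

(* The rows are ranked by their Euclidean norms. Low tail levels are few enough for a union bound; at the
   other levels a row of rank [k] has norm at most [r / sqrt (p k)], and the twelfth moment of a linear form
   is summable in [k]. *)
Lemma ball_norm_sq_ranked (xs : (nat -> R) -> nat -> R) : (forall y, ball n QX P (xs y)) ->
  Ev n wY vY y0 (fun y => (\sum_(i < n) xs y i * c i y) ^+ 2) <= CK2 * r ^+ 2.
Proof.
move=> Hxs; have w0 := wt_ge0 modY.
have [s Hs] := choice (fun y => round_point y (Hxs y)).
pose A (y : nat -> R) := (\sum_(i < n) val (s y i) * c i y) ^+ 2.
pose W (y : nat -> R) := P * (\sum_(i < n | hi i) c i y ^+ 2).
pose Z (y : nat -> R) := (\sum_(i < n | hi i) Zf i y) ^+ 2.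
apply: (@le_trans _ _ (Ev n wY vY y0 (fun y => 4%:R * ((A y + W y) + (r ^+ 2 + Z y))))).
  by apply: Ev_le => // y; have [_] := Hs y; rewrite /A /W /Z; lra.
rewrite EvZ EvD EvD EvD (Ev_cst _ (wt_sum1 modY)).
have HA := E_low (fun y => (Hs y).1).
have HZ := E_Z.
have HW : Ev n wY vY y0 W <= 4%:R * r ^+ 2.
  rewrite /W EvZ Ev_sum; apply: (@le_trans _ _ (P * \sum_(i < n | hi i) 4%:R * tau2 i)).
    by apply: ler_wpM2l; [exact: ltW | apply: ler_sum => i _; exact: (lin_sq modY)].
  by rewrite -mulr_sumr; have := tau_rest; lra.
rewrite /CK2; move: HA HW HZ; rewrite -/A -/W -/Z !exprMn.
set a := Ev _ _ _ _ A; set bb := Ev _ _ _ _ W; set z := Ev _ _ _ _ Z; lra.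
Qed.


End Kp.

(** * Smoothing and the discrete theorem *)

Section Sublin.
Context {R : realType}.

(** Serves [ball_norm], a supremum that is approached but not shown to be attained, so that no
    supporting functional is at hand. *)
Definition sublin (q : (nat -> R) -> R) : Prop :=
  (forall u v, q (fun i => u i + v i) <= q u + q v) /\
  (forall t u, 0 <= t -> q (fun i => t * u i) <= t * q u).

Lemma subdiff_sublin n q : subdiff n q -> sublin q.
Proof. by move=> H; split=> [u v|t u t0]; [exact: (subdiff_add _ _ H) | exact: (subdiff_scale _ H)]. Qed.

Lemma sublin_add p q : sublin p -> sublin q -> sublin (fun u => p u + q u).
Proof.
move=> [p1 p2] [q1 q2]; split=> [u v|t u t0]; first by have := p1 u v; have := q1 u v; lra.
by have := p2 t u t0; have := q2 t u t0; lra.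
Qed.

Lemma sublin_cconv q : sublin q -> cconv q.
Proof.
move=> [qa qs] x i a b t /andP[t0 t1].
have -> : upd x i (t * a + (1 - t) * b) = (fun j => t * upd x i a j + (1 - t) * upd x i b j).
  by apply/funext => j; rewrite /upd; case: eqP => _; ring.
apply: le_trans (qa _ _) _; apply: lerD; apply: qs => //.
by rewrite subr_ge0.
Qed.

Lemma conv_sq (f : R -> R) : conv f -> (forall x, 0 <= f x) -> conv (fun x => f x ^+ 2).
Proof.
move=> cf f0 x y t t01; have := cf x y t t01; have := f0 (t * x + (1 - t) * y).
move: (f _) (f x) (f y) => c a b c0 h; case/andP: t01 => t0 t1.
apply: (@le_trans _ _ ((t * a + (1 - t) * b) ^+ 2)).
  by apply: lerXn2r; rewrite ?nnegrE //; apply: le_trans h.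
have : 0 <= t * (1 - t) * (a - b) ^+ 2 by rewrite mulr_ge0 ?sqr_ge0 // mulr_ge0 // subr_ge0.
lra.
Qed.

End Sublin.

Section Nrm.
Context {R : realType}.
Variables (S0 : finType) (mX : nat -> S0 -> R) (kX : nat -> S0 -> nat).
Hypothesis (modX : model mX kX).
Let QX i := tailQ (mX i) (kX i).
Variables (n p : nat).
Let P : R := p.+1%:R.

Lemma ball0 : ball n QX P (fun=> 0).
Proof.
exists (fun=> 0); split; first by rewrite big1 // /P.
by move=> i _; left; rewrite normr0 expr0n.
Qed.

Lemma ball_bdd x i : ball n QX P x -> (i < n)%N -> `|x i| <= P + 1.
Proof.
move=> /(ball_lev modX)[l l1 l2] ni; have [l0 ad] := l2 i ni.
have P0 : 0 <= P by rewrite /P.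
have [h1 h2 h3 h4] := modX i.
have lP : l i <= P.
  apply: le_trans l1; rewrite (bigD1 (Ordinal ni)) //= lerDl; apply: sumr_ge0 => i' _.
  by have [] := l2 i' (ltn_ord i').
case: ad => [[h _]|[j [j0 xj Qj]]]; first by apply: le_trans h _; rewrite lerDr.
apply: le_trans xj _; rewrite -natr1 lerD2r.
by have := adm_level h1 h2 h3 h4 Qj; have : 0 <= j%:R :> R by []; lra.
Qed.

Definition ball_norm (c : nat -> R) : R :=
  sup [set z | exists2 x, ball n QX P x & z = \sum_(i < n) x i * c i].

Lemma ball_norm_has c : has_sup [set z | exists2 x, ball n QX P x & z = \sum_(i < n) x i * c i].
Proof.
split; first by exists (\sum_(i < n) (fun=> 0) i * c i), (fun=> 0) => //; exact: ball0.
exists (\sum_(i < n) (P + 1) * `|c i|) => z [x bx ->].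
apply: ler_sum => i _; apply: le_trans (ler_norm _) _; rewrite normrM.
by apply: ler_wpM2r => //; exact: ball_bdd.
Qed.

Lemma ball_norm_ge (c : nat -> R) x : ball n QX P x -> \sum_(i < n) x i * c i <= ball_norm c.
Proof. by move=> bx; apply: (sup_upper_bound (ball_norm_has c)); exists x. Qed.

Lemma ballN x : ball n QX P x -> ball n QX P (fun i => - x i).
Proof. by move=> bx; apply: (ball_mono _ bx) => i _; rewrite normrN. Qed.

Lemma ball_norm_abs (c : nat -> R) x : ball n QX P x -> `|\sum_(i < n) x i * c i| <= ball_norm c.
Proof.
move=> bx; rewrite ler_norml; apply/andP; split; last exact: ball_norm_ge.
rewrite lerNl -sumrN; apply: le_trans (ball_norm_ge c (ballN bx)).
by apply: ler_sum => i _; rewrite mulNr.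
Qed.

Lemma ball_norm_ge0 c : 0 <= ball_norm c.
Proof. by apply: le_trans (ball_norm_abs c ball0); exact: normr_ge0. Qed.

Lemma ball_norm_le (c : nat -> R) K : (forall x : nat -> R, ball n QX P x -> \sum_(i < n) x i * c i <= K) -> ball_norm c <= K.
Proof.
move=> H; apply: ge_sup; first by have [] := ball_norm_has c.
by move=> z [x bx ->]; exact: H.
Qed.

Lemma ball_norm_ex (c : nat -> R) e : 0 < e -> exists2 x, ball n QX P x & ball_norm c <= \sum_(i < n) x i * c i + e.
Proof.
move=> e0; have [z [x bx ->] h] := sup_adherent e0 (ball_norm_has c).
by exists x => //; rewrite -lerBlDr; exact: ltW.
Qed.

Lemma ball_norm_sublin : sublin ball_norm.
Proof.
split=> [u v|t u t0]; apply: ball_norm_le => x bx.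
  apply: le_trans (lerD (ball_norm_ge u bx) (ball_norm_ge v bx)).
  by rewrite -big_split; apply: ler_sum => i _; rewrite mulrDr.
apply: le_trans (ler_wpM2l t0 (ball_norm_ge u bx)).
by rewrite mulr_sumr; apply: ler_sum => i _; rewrite mulrCA.
Qed.

End Nrm.

Section Qn.
Context {R : realType}.
Variables (S0 : finType) (mX mY : nat -> S0 -> R) (kX kY : nat -> S0 -> nat).
Hypotheses (modX : model mX kX) (modY : model mY kY).
Let QX i := tailQ (mX i) (kX i).
Let QY i := tailQ (mY i) (kY i).
Variables (n p : nat).
Let P : R := p.+1%:R.

Lemma ball_norm_sq (b : nat -> nat -> R) (r : R) (y0 : nat -> R) : 0 < r ->
  (forall x : nat -> R, ball n QX P x ->
     \sum_(i < n) x i * Num.sqrt (\sum_(j < n) b i j ^+ 2) <= r) ->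
  (forall x y : nat -> R, ball n QX P x -> ball n QY P y ->
     \sum_(i < n) x i * (\sum_(j < n) b i j * y j) <= r) ->
  (forall x : nat -> R, ball n QX P x ->
     Ev n (wt mY) (vl kY) y0 (fun y => `|\sum_(i < n) x i * (\sum_(j < n) b i j * y j)|) <= r) ->
  Ev n (wt mY) (vl kY) y0 (fun y => ball_norm mX kX n p (fun i => \sum_(j < n) b i j * y j) ^+ 2) <=
    2%:R * (CK2 + 1) * r ^+ 2.
Proof.
move=> r0 H1 H2 H3.
have [rk [k1 k2 k3]] := rank_exists n (fun i => Num.sqrt (\sum_(j < n) b i j ^+ 2)).
have [xs Hxs] := choice (fun y : nat -> R =>
  let: ex_intro2 x a1 a2 := ball_norm_ex modX n p (fun i => \sum_(j < n) b i j * y j) r0 in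
  ex_intro (fun x => ball n QX P x /\ ball_norm mX kX n p (fun i => \sum_(j < n) b i j * y j) <=
     \sum_(i < n) x i * (\sum_(j < n) b i j * y j) + r) x (conj a1 a2)).
have := ball_norm_sq_ranked modX modY r0 H1 H2 H3 k1 k2 k3 (fun y => (Hxs y).1).
set E := Ev _ _ _ _ _ => h.
apply: (@le_trans _ _ (Ev n (wt mY) (vl kY) y0 (fun y => 2%:R *
   ((\sum_(i < n) xs y i * (\sum_(j < n) b i j * y j)) ^+ 2 + r ^+ 2)))).
  apply: Ev_le => [|y]; first exact: wt_ge0.
  have [_] := Hxs y; have := ball_norm_ge0 modX n p (fun i => \sum_(j < n) b i j * y j).
  move: (ball_norm _ _ _ _ _) (\sum_(i < n) _) => a c a0 ac.
  apply: (@le_trans _ _ ((c + r) ^+ 2)).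
    by apply: lerXn2r; rewrite ?nnegrE //; apply: le_trans ac.
  have := sqr_ge0 (c - r); lra.
rewrite EvZ EvD (Ev_cst _ (wt_sum1 modY)) -/E; lra.
Qed.

Variables (A : finType) (a0 : A) (b : A -> nat -> nat -> R) (x0 y0 : nat -> R) (r : R).
Definition bil (c : nat -> nat -> R) (x y : nat -> R) : R :=
  \sum_(i < n) x i * (\sum_(j < n) c i j * y j).
(** [N(x, y)] of the overview; in the application each [b a] is the matrix of a norming
    functional. *)
Definition maxbil (x y : nat -> R) : R := famax a0 (fun a => `|bil (b a) x y|).

Hypothesis r0 : 0 < r.
Hypothesis p0 : (0 < p)%N.
Hypothesis h1 : Ev n (wt mX) (vl kX) x0 (fun x => Ev n (wt mY) (vl kY) y0 (maxbil x)) <= r.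
Hypothesis h2 : forall x : nat -> R, ball n QX P x -> Ev n (wt mY) (vl kY) y0 (maxbil x) <= r.
Hypothesis h3 : forall y : nat -> R, ball n QY P y ->
  Ev n (wt mX) (vl kX) x0 (fun x => maxbil x y) <= r.
Hypothesis h4 : forall a (x : nat -> R), ball n QX P x ->
  \sum_(i < n) x i * Num.sqrt (\sum_(j < n) b a i j ^+ 2) <= r.
Hypothesis h5 : forall a (x y : nat -> R), ball n QX P x -> ball n QY P y -> bil (b a) x y <= r.

Lemma bilC c x y : bil c x y = \sum_(j < n) (\sum_(i < n) x i * c i j) * y j.
Proof.
rewrite /bil; under [RHS]eq_bigr => j _ do rewrite mulr_suml.
rewrite exchange_big /=; apply: eq_bigr => i _; rewrite mulr_sumr.
by apply: eq_bigr => j _; rewrite mulrA.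
Qed.

Lemma bilCx c x y : bil c x y = \sum_(i < n) (\sum_(j < n) c i j * y j) * x i.
Proof. by apply: eq_bigr => i _; rewrite mulrC. Qed.

Lemma le_maxbil a x y : `|bil (b a) x y| <= maxbil x y.
Proof. exact: (le_famax a0 (fun a => `|bil (b a) x y|)). Qed.

Lemma maxbil_ge0 x y : 0 <= maxbil x y.
Proof. by apply: le_trans (le_maxbil a0 x y); exact: normr_ge0. Qed.

Lemma maxbil_suby x : subdiff n (maxbil x).
Proof.
have := subdiff_max n a0 (fun a j => \sum_(i < n) x i * b a i j).
by congr subdiff; apply/funext => y; rewrite /maxbil; congr famax; apply/funext => a; rewrite bilC.
Qed.

Lemma maxbil_subx y : subdiff n (fun x => maxbil x y).
Proof.
have := subdiff_max n a0 (fun a i => \sum_(j < n) b a i j * y j).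
by congr subdiff; apply/funext => x; rewrite /maxbil; congr famax; apply/funext => a; rewrite bilCx.
Qed.

Let wX0 := wt_ge0 modX.
Let wY0 := wt_ge0 modY.

(* At a fixed [u], the function [x |-> |b_a(x, u)| / slice_norm a u] has bounded mean and is bounded on the ball. *)
Definition slice_norm (a : A) (u : nat -> R) : R := Ev n (wt mX) (vl kX) x0 (fun x => maxbil x u) +
  ball_norm mX kX n p (fun i => \sum_(j < n) b a i j * u j).

Lemma slice_normE a u : slice_norm a u = Ev n (wt mX) (vl kX) x0 (fun x => maxbil x u) +
  ball_norm mX kX n p (fun i => \sum_(j < n) b a i j * u j).
Proof. by []. Qed.

Lemma slice_norm_ge0 a u : 0 <= slice_norm a u.
Proof.
by rewrite /slice_norm addr_ge0 ?ball_norm_ge0 //; apply: Ev_ge0 => // x; exact: maxbil_ge0.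
Qed.

Lemma slice_norm_sublin a : sublin (slice_norm a).
Proof.
apply: sublin_add.
  apply: (@subdiff_sublin _ n).
  exact: (@subdiff_Ev _ n R (bool * S0)%type n (wt mX) (vl kX) x0 maxbil wX0 maxbil_suby).
have [s1 s2] := ball_norm_sublin modX n p; split=> [u v|t u t0].
  apply: le_trans (s1 _ _); rewrite le_eqVlt; apply/orP; left; apply/eqP; congr ball_norm.
  by apply/funext => i; rewrite -big_split; apply: eq_bigr => j _; rewrite mulrDr.
apply: le_trans (s2 _ _ t0); rewrite le_eqVlt; apply/orP; left; apply/eqP; congr ball_norm.
by apply/funext => i; rewrite mulr_sumr; apply: eq_bigr => j _; rewrite mulrCA.
Qed.

Lemma slice_norm_ball a y : ball n QY P y -> slice_norm a y <= 2%:R * r.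
Proof.
move=> bY; have := h3 bY.
have : ball_norm mX kX n p (fun i => \sum_(j < n) b a i j * y j) <= r.
  by apply: ball_norm_le => // x bx; exact: h5.
rewrite /slice_norm; lra.
Qed.

Definition CQ : R := CI1 ^+ 2 + 2%:R * (CK2 + 1).

Lemma slice_norm_sq a : Ev n (wt mY) (vl kY) y0 (fun u => slice_norm a u ^+ 2) <= 2%:R * CQ * r ^+ 2.
Proof.
pose F u := Ev n (wt mX) (vl kX) x0 (fun x => maxbil x u).
pose G u := ball_norm mX kX n p (fun i => \sum_(j < n) b a i j * u j).
apply: (@le_trans _ _ (Ev n (wt mY) (vl kY) y0 (fun u => 2%:R * (F u ^+ 2 + G u ^+ 2)))).
  apply: Ev_le => // u; rewrite /slice_norm -/(F u) -/(G u); have := sqr_ge0 (F u - G u); lra.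
rewrite EvZ EvD.
have HF : Ev n (wt mY) (vl kY) y0 (fun u => F u ^+ 2) <= (CI1 * r) ^+ 2.
  apply: (moment modY (p := 1)) => //.
  - exact: (@subdiff_Ev _ n R (bool * S0)%type n (wt mX) (vl kX) x0 maxbil wX0 maxbil_suby).
  - by move=> u; apply: Ev_ge0 => // x; exact: maxbil_ge0.
  (* The second moment calls for the ball of level 2, contained in that of level [p + 1] since
     [0 < p]. *)
  - move=> u bu; apply: h3; apply: ball_le bu; by rewrite /P ler_nat ltnS.
  - by rewrite /F -Ev_exch.
have HG : Ev n (wt mY) (vl kY) y0 (fun u => G u ^+ 2) <= 2%:R * (CK2 + 1) * r ^+ 2.
  apply: ball_norm_sq => //; first exact: h4.
    by move=> x y; exact: h5.
  move=> x bx; apply: le_trans (h2 bx); apply: Ev_le => // y; exact: le_maxbil.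
rewrite /CQ; move: HF HG; rewrite exprMn.
set e1 := Ev _ _ _ _ _; set e2 := Ev _ _ _ _ _; lra.
Qed.

End Qn.

(** * Change of measure for a point that depends on the outcome *)

Section Smooth0.
Context {R : realType}.

Lemma Ev_norm (A : Type) (S : finType) n (w : nat -> S -> R) (v : nat -> S -> A) x F :
  (forall i s, 0 <= w i s) -> `|Ev n w v x F| <= Ev n w v x (fun y => `|F y|).
Proof.
move=> w0; rewrite ler_norml; apply/andP; split; last by apply: Ev_le => // y; exact: ler_norm.
rewrite -mulN1r -EvZ; apply: Ev_le => // y; by rewrite mulN1r lerNl -normrN ler_norm.
Qed.

Lemma tilt_lin (S : finType) n (w D : nat -> S -> R) (u : nat -> S -> R) (tg : nat -> S) (be : nat -> R) :
  (forall j, \sum_s w j s * D j s = 1) ->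
  Ex n w tg (fun t => (\prod_(j < n) D j (t j)) * \sum_(j < n) be j * u j (t j)) =
  \sum_(j < n) be j * \sum_s w j s * D j s * u j s.
Proof.
move=> w1; rewrite Ex_wM.
rewrite (Ev_map n (fun i s => w i s * D i s) u tg (fun y => \sum_(j < n) be j * y j)).
rewrite (Ev_lin u _ _ w1 (leqnn n)); apply: eq_bigr => j _; by rewrite ltn_ord.
Qed.

(** Young's inequality with exponents [p + 1] and [(p + 1) / p]. As [(p + 1) / p <= 2] and
    [rho >= 1], the power of [rho] may be replaced by a square, so that a second moment will do. *)
Lemma young_tilt (M h rho : R) p : (0 < p)%N -> 0 <= M -> 0 <= h -> 1 <= rho ->
  M * h ^+ p * rho <= M ^+ p.+1 + h ^+ p.+1 * rho ^+ 2.
Proof.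
case: p => // p _ M0 h0 r1; have r0 : 0 <= rho by lra.
case: (lerP M (h * rho)) => hM.
  have -> : h ^+ p.+2 * rho ^+ 2 = (h * rho) * (h ^+ p.+1 * rho) by rewrite (exprS _ p.+1); ring.
  rewrite -mulrA; apply: le_trans (_ : h * rho * (h ^+ p.+1 * rho) <= _).
    by apply: ler_wpM2r => //; nng.
  by rewrite lerDr; nng.
have hM' : h <= M by apply: le_trans (ltW hM); rewrite ler_peMr.
apply: (@le_trans _ _ (M ^+ p.+2)); last by rewrite lerDl; nng.
rewrite (exprS M) -mulrA; apply: ler_wpM2l => //.
rewrite (exprSr h) -mulrA (exprSr M); apply: ler_pM; [by nng | by nng | | exact: ltW].
by apply: lerXn2r; rewrite ?nnegrE.
Qed.

End Smooth0.

Section Smooth.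
Context {R : realType}.
Variables (S0 : finType) (mX mY : nat -> S0 -> R) (kX kY : nat -> S0 -> nat).
Hypotheses (modX : model mX kX) (modY : model mY kY).
Let QX i := tailQ (mX i) (kX i).
Variables (n p : nat).
Let P : R := p.+1%:R.
Variables (A : finType) (a0 : A) (b : A -> nat -> nat -> R) (r : R) (sg : nat -> bool * S0).
Let x0 i := vl kX i (sg i) : R.
Hypothesis r0 : 0 < r.
Hypothesis p0 : (0 < p)%N.
Notation maxbil := (maxbil n a0 b).
Notation slice_norm := (slice_norm mX kX n p a0 b x0).
Let wX0 := wt_ge0 modX.
Let qn0 a u : 0 <= slice_norm a u. Proof. exact: slice_norm_ge0. Qed.

(** Each functional is divided by its own size at [u] before the maximum is taken: the maximum then
    has a moment bounded uniformly in [u], and the size of the functional selected by the outcome is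
    put back afterwards. *)
Let Mu (u x : nat -> R) : R := famax a0 (fun a => `|bil n (b a) x u| / (CI1 * (r + slice_norm a u))).

Let C0 : 0 < CI1 :> R. Proof. by have := @CI1_ge1 R; lra. Qed.
Let den a u : 0 < CI1 * (r + slice_norm a u).
Proof. by rewrite mulr_gt0 //; have := qn0 a u; move: r0; lra. Qed.

Lemma Mu_sub u : subdiff n (Mu u).
Proof.
have := subdiff_max n a0 (fun a i => (\sum_(j < n) b a i j * u j) / (CI1 * (r + slice_norm a u))).
congr subdiff; apply/funext => x; rewrite /Mu; congr famax; apply/funext => a.
rewrite bilCx -[X in _ / X](ger0_norm (ltW (den a u))) -normfV -normrM; congr (`|_|).
by rewrite mulr_suml; apply: eq_bigr => i _; rewrite mulrAC.
Qed.

Lemma Mu_moment u : Ev n (wt mX) (vl kX) x0 (fun x => Mu u x ^+ p.+1) <= 1.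
Proof.
have -> : 1 = (CI1 * (1 / CI1)) ^+ p.+1 :> R by rewrite mulrC divfK ?gt_eqF // expr1n.
apply: (moment modX).
- exact: Mu_sub.
- by move=> x; apply: le_trans (le_famax a0 _ a0); rewrite divr_ge0 // ltW.
- by rewrite divr_gt0.
- move=> x bx; apply: famax_le => a.
  rewrite ler_pdivrMr // mulrA mulfVK ?gt_eqF // mul1r.
  apply: le_trans (@ball_norm_abs _ _ _ _ modX n p (fun i => \sum_(j < n) b a i j * u j) x bx) _.
  have : 0 <= Ev n (wt mX) (vl kX) x0 (fun x => maxbil x u).
    by apply: Ev_ge0 => // z; exact: maxbil_ge0.
  by rewrite slice_normE -/P; move: r0; lra.
- pose e := Ev n (wt mX) (vl kX) x0 (fun x => maxbil x u).
  have e0 : 0 <= e by apply: Ev_ge0 => // z; exact: maxbil_ge0.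
  have re : 0 < CI1 * (r + e) by rewrite mulr_gt0 //; move: r0; lra.
  apply: (@le_trans _ _ (Ev n (wt mX) (vl kX) x0 (fun x => (CI1 * (r + e))^-1 * maxbil x u))).
    apply: Ev_le => // x; apply: famax_le => a; rewrite mulrC; apply: ler_pM => //.
    - by rewrite invr_ge0 ltW.
    - rewrite lef_pV2 ?posrE //; apply: ler_wpM2l; first exact: ltW.
      by rewrite lerD2l slice_normE -/e lerDl; exact: ball_norm_ge0.
    - exact: le_maxbil.
  rewrite EvZ -/e mulrC ler_pdivrMr // mulrA mulfVK ?gt_eqF // mul1r; move: r0; lra.
Qed.

Variables (S1 : finType) (w1 : nat -> S1 -> R) (u : nat -> S1 -> R) (tg : nat -> S1).
(** [D s] is the density selected by the outcome [s] and [g] its [p]-th root, so that [D * g] is the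
    power [1 + 1/p] of the density left by [young_tilt]. The mean in [Du] is half of [ym], which
    lets the densities stay away from 0. *)
Variables (D g : (nat -> bool * S0) -> nat -> S1 -> R).
Variables (am : (nat -> bool * S0) -> A) (ym : (nat -> bool * S0) -> nat -> R) (K : R).
Hypothesis w10 : forall j s, 0 <= w1 j s.
Hypothesis w11 : forall j, \sum_s w1 j s = 1.
Hypothesis D1 : forall sg j, \sum_s w1 j s * D sg j s = 1.
Hypothesis Du : forall sg j, (j < n)%N -> \sum_s w1 j s * D sg j s * u j s = ym sg j / 2%:R.
Hypothesis g0 : forall sg j s, 0 <= g sg j s.
Hypothesis gD : forall sg j s, g sg j s ^+ p = D sg j s.
Hypothesis HT : forall sg, Ex n w1 tg (fun t => (\prod_(j < n) (D sg j (t j) * g sg j (t j))) *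
  (r + slice_norm (am sg) (fun j => u j (t j))) ^+ 2) <= K * r ^+ 2.

Let D0 s j t : 0 <= D s j t. Proof. by rewrite -gD exprn_ge0. Qed.

(* The matrix [am s] and the point [ym s] depend on the outcome [s] of [X]. Replacing [ym s] by (twice) the mean
   of a vector that has density [prod D] with respect to a law not depending on [s] decouples them; Young's
   inequality then separates the density from the [p]-th moment, which is computed for a fixed vector. *)
Lemma smooth : Ex n (wt mX) sg (fun s => `|bil n (b (am s)) (fun i => vl kX i (s i)) (ym s)|) <=
  2%:R * CI1 * (1 + K) * r.
Proof.
pose X (s : nat -> bool * S0) : nat -> R := fun i => vl kX i (s i).
pose U (t : nat -> S1) : nat -> R := fun j => u j (t j).
apply: (@le_trans _ _ (Ex n (wt mX) sg (fun s => 2%:R * CI1 * r * Ex n w1 tg (fun t =>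
   Mu (U t) (X s) ^+ p.+1 + (\prod_(j < n) (D s j (t j) * g s j (t j))) *
     ((r + slice_norm (am s) (U t)) / r) ^+ 2)))).
  apply: Ev_le => // s.
  have -> : bil n (b (am s)) (fun i => vl kX i (s i)) (ym s) = 2%:R * Ex n w1 tg (fun t =>
     (\prod_(j < n) D s j (t j)) * bil n (b (am s)) (X s) (U t)).
    rewrite bilC.
    have -> : (fun t : nat -> S1 => (\prod_(j < n) D s j (t j)) * bil n (b (am s)) (X s) (U t)) =
       (fun t : nat -> S1 => (\prod_(j < n) D s j (t j)) * \sum_(j < n) (\sum_(i < n) X s i * b (am s) i j) * u j (t j)).
      by apply/funext => t; rewrite bilC.
    rewrite (tilt_lin n u tg (fun j => \sum_(i < n) X s i * b (am s) i j) (D1 s)) mulr_sumr.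
    by apply: eq_bigr => j _; rewrite Du // mulrCA; congr (_ * _); field.
  rewrite normrM (@ger0_norm _ 2%:R) // -[2%:R * CI1 * r]mulrA -[2%:R * (CI1 * r) * _]mulrA.
  apply: ler_wpM2l => //; apply: le_trans (Ev_norm _ _ _ _ w10) _; rewrite -EvZ; apply: Ev_le => // t.
  set a := am s; set H := \prod_(j < n) g s j (t j).
  have H0 : 0 <= H by apply: prodr_ge0.
  have HD : \prod_(j < n) D s j (t j) = H ^+ p.
    by rewrite -prodrXl; apply: eq_bigr => j _; rewrite gD.
  have HDg : \prod_(j < n) (D s j (t j) * g s j (t j)) = H ^+ p.+1.
    by rewrite -prodrXl; apply: eq_bigr => j _; rewrite -gD -exprSr.
  have Mge : `|bil n (b a) (X s) (U t)| <= CI1 * (r + slice_norm a (U t)) * Mu (U t) (X s).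
    rewrite mulrC -ler_pdivrMr //.
    exact: (le_famax a0 (fun a => `|bil n (b a) (X s) (U t)| / (CI1 * (r + slice_norm a (U t)))) a).
  have M0 : 0 <= Mu (U t) (X s).
    by apply: le_trans (le_famax a0 _ a0); rewrite divr_ge0 // ltW.
  have rho1 : 1 <= (r + slice_norm a (U t)) / r by rewrite ler_pdivlMr // mul1r lerDl.
  rewrite HDg normrM HD (ger0_norm (exprn_ge0 _ H0)).
  apply: le_trans (ler_wpM2l (exprn_ge0 _ H0) Mge) _.
  apply: le_trans (ler_wpM2l _ (young_tilt p0 M0 H0 rho1)); last by nng; exact: ltW.
  rewrite le_eqVlt; apply/orP; left; apply/eqP; field; by rewrite gt_eqF.
rewrite /Ex EvZ.
have h1 : Ev n (wt mX) (fun _ s => s) sg (fun s => Ev n w1 (fun _ t => t) tg (fun t => Mu (U t) (X s) ^+ p.+1)) <= 1.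
  rewrite Ev_exch; apply: Ev_le_cst => // t; apply: le_trans (Mu_moment (U t)).
  by rewrite -(Ev_map n (wt mX) (vl kX) sg (fun x => Mu (U t) x ^+ p.+1)); exact: lexx.
have h2 : Ev n (wt mX) (fun _ s => s) sg (fun s => Ev n w1 (fun _ t => t) tg (fun t =>
    (\prod_(j < n) (D s j (t j) * g s j (t j))) * ((r + slice_norm (am s) (U t)) / r) ^+ 2)) <= K.
  apply: Ev_le_cst => //; first exact: wt_sum1.
  move=> s; rewrite -[leRHS](@mulfK _ (r ^+ 2)) ?expf_neq0 ?gt_eqF // ler_pdivlMr ?exprn_gt0 //.
  apply: le_trans (HT s); rewrite mulrC -EvZ le_eqVlt; apply/orP; left; apply/eqP.
  by apply: Ev_ext => t; field; rewrite gt_eqF.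
have -> : 2%:R * CI1 * (1 + K) * r = 2%:R * CI1 * r * (1 + K) by ring.
apply: ler_wpM2l; first by nng; exact: ltW.
rewrite (@Ev_ext _ _ _ _ _ _ _ _ (fun s => Ev n w1 (fun _ t => t) tg (fun t => Mu (U t) (X s) ^+ p.+1) +
   Ev n w1 (fun _ t => t) tg (fun t => (\prod_(j < n) (D s j (t j) * g s j (t j))) *
     ((r + slice_norm (am s) (U t)) / r) ^+ 2))); last by move=> s; rewrite EvD.
by rewrite EvD; exact: lerD.
Qed.

End Smooth.

(** * Densities for a single coordinate *)

Section Root.
Context {R : realType}.

(** The [p]-th root of a positive [d]. *)
Definition rt (p : nat) (d : R) : R := expR (ln d / p%:R).

Lemma rt_gt0 p (d : R) : 0 < rt p d. Proof. exact: expR_gt0. Qed.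

Lemma rtX p (d : R) : (0 < p)%N -> 0 < d -> rt p d ^+ p = d.
Proof.
move=> p0 d0; rewrite /rt -expRM_natr divfK ?lnK ?posrE //.
by rewrite pnatr_eq0 -lt0n.
Qed.

Lemma rt_le1D p (t : R) : (0 < p)%N -> - 1 < t -> rt p (1 + t) <= 1 + t / p%:R.
Proof.
case: p => // p _ t1.
have p0 : 0 < p.+1%:R :> R by rewrite ltr0n.
have b0 : 0 <= 1 + t / p.+1%:R.
  have : - 1 <= t / p.+1%:R.
    by rewrite ler_pdivlMr // mulN1r; apply: le_trans (ltW t1); rewrite lerN2 ler1n.
  by move: (t / _) => z; lra.
rewrite -(@ler_pXn2r _ p.+1) ?nnegrE ?(ltW (rt_gt0 _ _)) // rtX //; last by lra.
have := bernoulli_tangent p ler01 b0; rewrite !expr1n mulr1 => h.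
apply: le_trans h; rewrite le_eqVlt; apply/orP; left; apply/eqP.
rewrite (addrC 1 (t / _)) addrK mulrC divfK ?gt_eqF //.
Qed.

Lemma rt_ratio p (d e : R) : (0 < p)%N -> 0 < d -> d <= e -> rt p e * d <= rt p d * e.
Proof.
move=> p0 d0 de; have e0 : 0 < e by exact: lt_le_trans de.
have le_ln : ln d <= ln e by rewrite ler_ln ?posrE.
rewrite -[X in _ * X <= _](lnK (x := d)) ?posrE // -[X in _ <= _ * X](lnK (x := e)) ?posrE //.
rewrite /rt -!expRD ler_expR.
have p1 : 1 <= p%:R :> R by rewrite ler1n.
have h : (ln e - ln d) / p%:R <= ln e - ln d.
  by rewrite ler_pdivrMr ?(lt_le_trans ltr01) // ler_peMr // subr_ge0.
by rewrite mulrBl in h; lra.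
Qed.

Lemma rt_mono p (d e : R) : (0 < p)%N -> 0 < d -> d <= e -> rt p d <= rt p e.
Proof.
move=> p0 d0 de; rewrite /rt ler_expR ler_pM2r ?invr_gt0 ?ltr0n // ler_ln ?posrE //.
exact: lt_le_trans de.
Qed.

End Root.

Section OneD.
Context {R : realType}.
Variable p : nat.
Hypothesis p0 : (0 < p)%N.

(** [T1] and [T2] are [(1 + t)^(1 + 1/p)] and [(1 - t)^(1 + 1/p)]. As [1 + 1/p <= 2], their relative
    difference is at most that of the squares, [2 t / (1 + t^2)]. *)
Lemma tilt_mean (t : R) : 0 <= t -> t <= 1 / 2%:R ->
  let T1 := (1 + t) * rt p (1 + t) in let T2 := (1 - t) * rt p (1 - t) in
  0 <= T1 - T2 /\ T1 - T2 <= 2%:R * t * (T1 + T2).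
Proof.
move=> t0 t2 T1 T2.
have d1 : 0 < 1 - t by lra.
have hr : rt p (1 + t) * (1 - t) <= rt p (1 - t) * (1 + t) by apply: rt_ratio => //; lra.
have hm : rt p (1 - t) <= rt p (1 + t) by apply: rt_mono => //; lra.
have g1 := rt_gt0 p (1 + t); have g2 := rt_gt0 p (1 - t).
rewrite /T1 /T2; move: (rt p (1 + t)) (rt p (1 - t)) hr hm g1 g2 => a c hr hm g1 g2.
split; first by nra.
have : (1 + t) * (1 - t) * (a * (1 - t)) <= (1 + t) * (1 - t) * (c * (1 + t)).
  by apply: ler_wpM2l => //; nra.
have h2 : 0 <= (1 + t) * a - (1 - t) * c by nra.
have h3 : 0 <= t ^+ 2 * ((1 + t) * a - (1 - t) * c) by rewrite mulr_ge0 ?sqr_ge0.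
lra.
Qed.

(* Small coordinates: tilted Rademacher variables with density [1 + y eps / 2]. *)
Lemma small_prior (y : R) : `|y| <= 1 -> exists d g : bool -> R, exists de : R,
  [/\ \sum_(b : bool) (1 / 2%:R) * d b = 1, \sum_(b : bool) (1 / 2%:R) * d b * (-1) ^+ b = y / 2%:R,
      forall b, 0 <= g b /\ g b ^+ p = d b,
      `|de| <= `|y|  &
      \sum_(b : bool) (1 / 2%:R) * (d b * g b) <= expR (y ^+ 2 / p%:R) /\
      forall f, conv f -> \sum_(b : bool) (1 / 2%:R) * (d b * g b) * f ((-1) ^+ b) <=
        (\sum_(b : bool) (1 / 2%:R) * (d b * g b)) * \sum_(b : bool) (1 / 2%:R) * f (de + 2%:R * (-1) ^+ b)].
Proof.
move=> y1; pose t := y / 2%:R.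
pose d (b : bool) := 1 + (-1) ^+ b * t.
have tb : - (1 / 2%:R) <= t <= 1 / 2%:R by move: y1; rewrite ler_norml /t; lra.
have d0 b : 0 < d b by rewrite /d; case: b; rewrite ?expr1 ?expr0; lra.
pose g b := rt p (d b).
have pR : 0 < p%:R :> R by rewrite ltr0n.
pose T1 := d false * g false; pose T2 := d true * g true.
have T10 : 0 < T1 by rewrite mulr_gt0 // rt_gt0.
have T20 : 0 < T2 by rewrite mulr_gt0 // rt_gt0.
(* The mean of the sign under the normalized weights [d * g]. As [|de| <= 1], both 1 and -1 lie
   between [de - 2] and [de + 2], which gives the comparison with [de] plus twice a fair sign. *)
pose de := (T1 - T2) / (T1 + T2).
have deT : de * (T1 + T2) = T1 - T2 by rewrite divfK // gt_eqF // addr_gt0.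
have dey : `|de| <= `|y|.
  rewrite /de normrM normfV (ger0_norm (ltW (addr_gt0 T10 T20))) ler_pdivrMr ?addr_gt0 //.
  have ye : `|y| = 2%:R * `|t| by rewrite /t normrM normfV (@ger0_norm _ 2%:R) //; field.
  rewrite ye; case: (lerP 0 t) => t0.
    have /(_ (andP tb).2)[h1 h2] := tilt_mean t0.
    rewrite (ger0_norm t0) ger0_norm; move: h1 h2; rewrite /T1 /T2 /g /d expr0 expr1 mul1r mulN1r //.
  have t0' : 0 <= - t by lra.
  have tb' : - t <= 1 / 2%:R by lra.
  have [h1 h2] := tilt_mean t0' tb'.
  rewrite (ltr0_norm t0) ler0_norm; move: h1 h2; rewrite opprK /T1 /T2 /g /d expr0 expr1 mul1r mulN1r //; lra.
exists d, g, de; split=> //.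
- by rewrite big_bool /d /= expr1 expr0; lra.
- by rewrite big_bool /d /= expr1 expr0 /t; lra.
- by move=> b; split; [exact: ltW (rt_gt0 _ _) | rewrite /g rtX].
split.
  have h1 : g false <= 1 + t / p%:R by rewrite /g /d expr0 mul1r; apply: rt_le1D => //; lra.
  have h2 : g true <= 1 - t / p%:R.
    have -> : g true = rt p (1 + - t) by rewrite /g /d expr1 mulN1r.
    have -> : 1 - t / p%:R = 1 + (- t) / p%:R by rewrite mulNr.
    by apply: rt_le1D => //; lra.
  apply: le_trans (expR_ge1Dx _).
  have : 0 <= y ^+ 2 / p%:R by rewrite divr_ge0 ?sqr_ge0 // ltW.
  have e : y ^+ 2 / p%:R = 4%:R * (t * (t / p%:R)) by rewrite /t; field; rewrite gt_eqF.
  rewrite e big_bool /=.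
  have h1' := ler_wpM2l (ltW (d0 false)) h1.
  have h2' := ler_wpM2l (ltW (d0 true)) h2.
  move: h1' h2'; rewrite /d expr0 expr1; move: (g true) (g false) (t / p%:R) => a c z.
  lra.
move=> f cf; rewrite !big_bool /= !expr1 !expr0 -/T1 -/T2.
have de1 : -1 <= de <= 1 by move: (le_trans dey y1); rewrite ler_norml.
have c1 := cf (de + 2%:R) (de - 2%:R) ((3%:R - de) / 4%:R).
have c2 := cf (de + 2%:R) (de - 2%:R) ((1 - de) / 4%:R).
have {}c1 := c1 ltac:(lra); have {}c2 := c2 ltac:(lra).
have e1 : (3%:R - de) / 4%:R * (de + 2%:R) + (1 - (3%:R - de) / 4%:R) * (de - 2%:R) = 1 by field.
have e2 : (1 - de) / 4%:R * (de + 2%:R) + (1 - (1 - de) / 4%:R) * (de - 2%:R) = -1 by field.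
rewrite e1 in c1; rewrite e2 in c2; rewrite mulrN1 mulr1.
have k1 := ler_wpM2l (ltW T10) c1; have k2 := ler_wpM2l (ltW T20) c2.
have [A0 [a1 a2]] : exists A0, T1 = A0 * (1 + de) /\ T2 = A0 * (1 - de).
  by exists ((T1 + T2) / 2%:R); split; move: deT; lra.
move: k1 k2; rewrite a1 a2; move: (f 1) (f (-1)) (f (de + 2%:R)) (f (de - 2%:R)) => f1 f2 f3 f4; lra.
Qed.

Variables (S0 : finType) (m : S0 -> R) (k : S0 -> nat).
Hypothesis m0 : forall s, 0 <= m s.
Hypothesis m1 : \sum_s m s = 1.
Hypothesis lc : lcQ m k.
Hypothesis q1 : tailQ m k 1 <= eta.
Let Q := tailQ m k.
Let w (bs : bool * S0) : R := m bs.2 / 2%:R.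
Let v (bs : bool * S0) : R := (-1) ^+ bs.1 * (k bs.2).+1%:R.

Lemma w_sumE (F : bool * S0 -> R) :
  \sum_bs w bs * F bs = \sum_s m s * ((F (true, s) + F (false, s)) / 2%:R).
Proof.
transitivity (\sum_bs (fun (b : bool) s => m s / 2%:R * F (b, s)) bs.1 bs.2).
  by apply: eq_bigr => [[b s] _].
rewrite -(pair_bigA _ (fun (b : bool) s => m s / 2%:R * F (b, s))) /=.
rewrite big_bool /= -big_split /=; apply: eq_bigr => s _; by field.
Qed.

Lemma Q_level j : Q j / 2%:R <= \sum_(s | k s == j) m s.
Proof.
have Q0 : 0 <= Q j by exact: tailQ_ge0.
rewrite -(tailQ_sub m k) -/Q.
have := tailQ_nb m0 m1 lc j 1; rewrite addn1 -/Q.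
have e4 : eta <= 1 / 4%:R :> R.
  apply: le_trans (@eta_le R) _; rewrite expRN mul1r lef_pV2 ?posrE ?expR_gt0 //.
  by apply: le_trans (expR_ge1Dx _); lra.
have := ler_wpM2l Q0 (le_trans q1 e4); rewrite -/Q; lra.
Qed.

(* Large coordinates: the law of [Y_j] itself, with extra mass on the value of magnitude [j0 + 1] and of the sign
   of [y]; removing this value from the tilted variable leaves a law comparable with that of [Y_j]. *)
Lemma large_prior (y l : R) : 0 <= l -> (y = 0 \/ exists j, [/\ (0 < j)%N, `|y| <= j.+1%:R & expR (- l) <= Q j]) ->
  exists d g v' : bool * S0 -> R,
  [/\ \sum_bs w bs * d bs = 1, \sum_bs w bs * d bs * v bs = y / 2%:R,
      forall bs, 0 <= g bs /\ g bs ^+ p = d bs,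
      forall bs, adm Q (v bs - v' bs) l &
      \sum_bs w bs * (d bs * g bs) <= expR (2%:R * l / p%:R) /\
      forall f, conv f -> \sum_bs w bs * (d bs * g bs) * f (v' bs) <=
        (\sum_bs w bs * (d bs * g bs)) * \sum_bs w bs * f (v bs)].
Proof.
move=> l0.
have pR : 0 < p%:R :> R by rewrite ltr0n.
have w1 : \sum_bs w bs = 1.
  transitivity (\sum_bs w bs * (fun=> 1) bs); first by apply: eq_bigr => bs _; rewrite mulr1.
  by rewrite w_sumE -[RHS]m1; apply: eq_bigr => s _; field.
have wv : \sum_bs w bs * v bs = 0.
  by rewrite w_sumE big1 // => s _; rewrite /v /= expr1 expr0; lra.
have w0 bs : 0 <= w bs by rewrite /w divr_ge0.
case=> [->|[j0 [jp yj Qj]]].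
  exists (fun=> 1), (fun=> 1), v; split.
  - by rewrite -mulr_suml w1 mul1r.
  - by rewrite mul0r -[RHS]wv; apply: eq_bigr => bs _; rewrite mulr1.
  - by move=> bs; rewrite ler01 expr1n.
  - by move=> bs; left; rewrite subrr normr0 expr0n.
  - split; first by rewrite mulr1 -mulr_suml w1 mul1r -[leLHS]expR0 ler_expR; nng.
    move=> f cf; rewrite !mulr1 -mulr_suml w1 !mul1r le_eqVlt; apply/orP; left; apply/eqP.
    by apply: eq_bigr => bs _; rewrite mulr1.
pose pj := \sum_(s | k s == j0) m s.
have hp : Q j0 / 2%:R <= pj by exact: Q_level.
have Qp : 0 < Q j0 by apply: lt_le_trans Qj; exact: expR_gt0.
have pp : 0 < pj by lra.
have j1 : 0 < j0.+1%:R :> R by rewrite ltr0n.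
(* Extra mass [th] on the value of magnitude [j0 + 1], with the sign of [y], produces a mean of
   absolute value [th (j0 + 1) = |y| / 2]; the remaining mass [1 - th] keeps the symmetric law. *)
pose th := `|y| / (2%:R * j0.+1%:R).
have th0 : 0 <= th by rewrite /th divr_ge0 // mulr_ge0 // ltW.
have th2 : th <= 1 / 2%:R by rewrite /th ler_pdivrMr ?mulr_gt0 //; lra.
pose sy := (y < 0).
pose d (bs : bool * S0) : R := 1 - th + (if (k bs.2 == j0) && (bs.1 == sy) then 2%:R * th / pj else 0).
have t20 : 0 <= 2%:R * th / pj by nng.
have d0 bs : 0 < d bs by rewrite /d; case: ifP => _; lra.
have pjE : \sum_s m s * (if k s == j0 then 1 else 0) = pj.
  by rewrite /pj [RHS]big_mkcond; apply: eq_bigr => s _; case: ifP; rewrite ?mulr1 ?mulr0.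
pose g bs := rt p (d bs).
pose v' (bs : bool * S0) : R := if k bs.2 == j0 then 0 else v bs.
exists d, g, v'; split.
- rewrite w_sumE (eq_bigr (fun s => (1 - th) * m s + th / pj * (m s * (if k s == j0 then 1 else 0)))).
    rewrite big_split /= -!mulr_sumr m1 pjE divfK ?gt_eqF //; lra.
  move=> s _; rewrite /d /=; case: (k s == j0) => /=; last by lra.
  by case: (sy) => /=; field; rewrite gt_eqF.
- rewrite (eq_bigr (fun bs => w bs * (d bs * v bs))) => [|bs _]; last by rewrite mulrA.
  rewrite w_sumE (eq_bigr (fun s => th * (-1) ^+ sy * j0.+1%:R / pj * (m s * (if k s == j0 then 1 else 0)))).
    rewrite -mulr_sumr pjE divfK ?gt_eqF //.
    have -> : th * (-1) ^+ sy * j0.+1%:R = ((-1) ^+ sy * `|y|) / 2%:R.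
      by rewrite /th; move: (j0.+1%:R) j1 => J J1; field; rewrite gt_eqF.
    congr (_ / _); rewrite /sy; case: ltrP => h; first by rewrite ltr0_norm // expr1; lra.
    by rewrite ger0_norm // expr0 mul1r.
  move=> s _; rewrite /d /v /=; case: eqP => [->|_] /=; last by rewrite expr1 expr0; lra.
  by case: (sy) => /=; rewrite ?expr1 ?expr0; move: (j0.+1%:R) => J; field; rewrite gt_eqF.
- by move=> bs; split; [exact: ltW (rt_gt0 _ _) | rewrite /g rtX].
- move=> bs; rewrite /v'; case: eqP => [e|_].
    right; exists j0; split=> //; rewrite subr0 /v e normrMsign ger0_norm //.
  by left; rewrite subrr normr0 expr0n.
have l8 : 8%:R <= l.
  have := adm_level m0 m1 lc q1 Qj; have : 1 <= j0%:R :> R by rewrite ler1n.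
  by lra.
have wd1 : \sum_bs w bs * d bs = 1.
  rewrite w_sumE (eq_bigr (fun s => (1 - th) * m s + th / pj * (m s * (if k s == j0 then 1 else 0)))).
    rewrite big_split /= -!mulr_sumr m1 pjE divfK ?gt_eqF //; lra.
  move=> s _; rewrite /d /=; case: (k s == j0) => /=; last by lra.
  by case: (sy) => /=; field; rewrite gt_eqF.
split.
  (* [1 / pj <= 2 e^l] by [Q_level], and [l >= 8] lets a second factor [e^l] absorb the
     constants. *)
  have dle bs : d bs <= expR (2%:R * l).
    have el : 4%:R <= expR l by apply: le_trans (expR_ge1Dx _); lra.
    apply: (@le_trans _ _ (4%:R * expR l)); last first.
      have -> : 2%:R * l = l + l by lra.
      by rewrite expRD; apply: ler_wpM2r => //; exact: expR_ge0.
    have ip : pj^-1 <= 2%:R * expR l.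
      rewrite -[leRHS]invrK lef_pV2 ?posrE ?invr_gt0 ?mulr_gt0 ?expR_gt0 //.
      by rewrite invfM -expRN; lra.
    have : 2%:R * th / pj <= pj^-1 by rewrite ler_piMl ?invr_ge0 ?(ltW pp) //; lra.
    rewrite /d; case: ifP => _; lra.
  have gle bs : g bs <= expR (2%:R * l / p%:R).
    rewrite /g /rt ler_expR ler_pM2r ?invr_gt0 // -[leRHS]expRK ler_ln ?posrE ?expR_gt0 //.
  apply: (@le_trans _ _ (\sum_bs w bs * d bs * expR (2%:R * l / p%:R))).
    by apply: ler_sum => bs _; rewrite mulrA; apply: ler_wpM2l => //; rewrite mulr_ge0 // ltW.
  by rewrite -mulr_suml wd1 mul1r.
move=> f cf.
pose to := (1 - th) * rt p (1 - th).
have to0 : 0 <= to by rewrite mulr_ge0 ?(ltW (rt_gt0 _ _)) //; lra.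
have dg bs : to <= d bs * g bs.
  rewrite /to /g; have h : 1 - th <= d bs by rewrite /d lerDl; case: ifP.
  by apply: ler_pM => //; [lra | exact: ltW (rt_gt0 _ _) | apply: rt_mono => //; lra].
have dgo bs : k bs.2 != j0 -> d bs * g bs = to.
  by move=> /negbTE h; rewrite /g /d h /= addr0.
pose F := \sum_(bs | k bs.2 != j0) w bs * f (v bs).
pose G := \sum_(bs | k bs.2 == j0) w bs * f (v bs).
pose Kc := \sum_(bs | k bs.2 == j0) w bs * (d bs * g bs).
pose W1 := \sum_(bs | k bs.2 == j0) w bs.
pose W2 := \sum_(bs | k bs.2 != j0) w bs.
have W12 : W1 + W2 = 1 by rewrite -w1 [RHS](bigID (fun bs => k bs.2 == j0)).
have Ktot : \sum_bs w bs * (d bs * g bs) = Kc + to * W2.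
  rewrite (bigID (fun bs => k bs.2 == j0)) /=; congr (_ + _).
  by rewrite /W2 mulr_sumr; apply: eq_bigr => bs h; rewrite dgo // mulrC.
have Etot : \sum_bs w bs * f (v bs) = G + F by rewrite (bigID (fun bs => k bs.2 == j0)).
have Ltot : \sum_bs w bs * (d bs * g bs) * f (v' bs) = Kc * f 0 + to * F.
  rewrite (bigID (fun bs => k bs.2 == j0)) /=; congr (_ + _).
    by rewrite /Kc mulr_suml; apply: eq_bigr => bs h; rewrite /v' h.
  rewrite /F mulr_sumr; apply: eq_bigr => bs h; rewrite /v' (negbTE h) dgo //; ring.
(* By symmetry the mean of [f] over any set of magnitudes is at least [f 0]; sending the level [j0],
   extra mass included, to 0 can therefore only lower the normalized mean. *)
have sym (T : pred nat) : f 0 * (\sum_(bs | T (k bs.2)) w bs) <= \sum_(bs | T (k bs.2)) w bs * f (v bs).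
  rewrite mulr_sumr big_mkcond [leRHS]big_mkcond /=.
  rewrite (eq_bigr (fun bs => w bs * (if T (k bs.2) then f 0 else 0))); last first.
    by move=> bs _; case: ifP => _; rewrite ?mulr0 // mulrC.
  rewrite [leRHS](eq_bigr (fun bs => w bs * (if T (k bs.2) then f (v bs) else 0))); last first.
    by move=> bs _; case: ifP => _; rewrite ?mulr0.
  rewrite !w_sumE; apply: ler_sum => s _; apply: ler_wpM2l => //=; case: ifP => _; last by rewrite !addr0.
  rewrite /v /= expr1 expr0 mul1r mulN1r.
  have := cf (- (k s).+1%:R) (k s).+1%:R (1 / 2%:R) ltac:(lra).
  have -> : 1 / 2%:R * - (k s).+1%:R + (1 - 1 / 2%:R) * (k s).+1%:R = 0 :> R by lra.
  lra.
have hG : f 0 * W1 <= G := sym (fun a => a == j0).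
have hF : f 0 * W2 <= F := sym (fun a => a != j0).
have hK : to * W1 <= Kc.
  rewrite /W1 /Kc mulr_sumr; apply: ler_sum => bs _; rewrite mulrC; exact: ler_wpM2l.
have W20 : 0 <= W2 by apply: sumr_ge0.
have W10 : 0 <= W1 by apply: sumr_ge0.
rewrite Ktot Etot Ltot.
move: hG hF hK W12 W10 W20 to0; move: (f 0) (G) (F) (Kc) (W1) (W2) (to) => z G' F' K' a b t hG hF hK ab a0 b0 t0.
have K0 : 0 <= K' by apply: le_trans hK; rewrite mulr_ge0.
have h1 : (K' + t * b) * (z * a) <= (K' + t * b) * G' by apply: ler_wpM2l => //; nng.
have h2 : 0 <= (F' - z * b) * (K' - t * a) by rewrite mulr_ge0 // subr_ge0.
have eb : b = 1 - a by lra.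
rewrite eb in h1 h2 *; nra.
Qed.


End OneD.

(** * The discrete theorem *)

Section Core.
Context {R : realType}.
Variables (S0 : finType) (mX mY : nat -> S0 -> R) (kX kY : nat -> S0 -> nat).
Hypotheses (modX : model mX kX) (modY : model mY kY).
Let QX i := tailQ (mX i) (kX i).
Let QY i := tailQ (mY i) (kY i).
Variables (n p : nat).
Let P : R := p.+1%:R.
Variables (A : finType) (a0 : A) (b : A -> nat -> nat -> R) (r : R) (sg tg : nat -> bool * S0).
Let x0 i := vl kX i (sg i) : R.
Let y0 i := vl kY i (tg i) : R.
Notation maxbil := (maxbil n a0 b).
Notation slice_norm := (slice_norm mX kX n p a0 b x0).
Hypothesis r0 : 0 < r.
Hypothesis p0 : (0 < p)%N.
Hypothesis h1 : Ev n (wt mX) (vl kX) x0 (fun x => Ev n (wt mY) (vl kY) y0 (maxbil x)) <= r.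
Hypothesis h2 : forall x : nat -> R, ball n QX P x -> Ev n (wt mY) (vl kY) y0 (maxbil x) <= r.
Hypothesis h3 : forall y : nat -> R, ball n QY P y ->
  Ev n (wt mX) (vl kX) x0 (fun x => maxbil x y) <= r.
Hypothesis h4 : forall a (x : nat -> R), ball n QX P x ->
  \sum_(i < n) x i * Num.sqrt (\sum_(j < n) b a i j ^+ 2) <= r.
Hypothesis h5 : forall a (x y : nat -> R), ball n QX P x -> ball n QY P y -> bil n (b a) x y <= r.

Let wX0 := wt_ge0 modX.
Let wY0 := wt_ge0 modY.
Let P0 : 0 < P. Proof. by rewrite /P ltr0n. Qed.
Let pR : 0 < p%:R :> R. Proof. by rewrite ltr0n. Qed.
Let Pp : P / p%:R <= 2%:R.
Proof. by rewrite ler_pdivrMr // /P -natrM ler_nat; lia. Qed.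

Lemma bil_ext c (x x' y y' : nat -> R) : (forall i, (i < n)%N -> x i = x' i) ->
  (forall i, (i < n)%N -> y i = y' i) -> bil n c x y = bil n c x' y'.
Proof.
move=> hx hy; apply: eq_bigr => i _; rewrite hx //; congr (_ * _).
by apply: eq_bigr => j _; rewrite hy.
Qed.

Lemma maxbil_ext (x x' y y' : nat -> R) : (forall i, (i < n)%N -> x i = x' i) ->
  (forall i, (i < n)%N -> y i = y' i) -> maxbil x y = maxbil x' y'.
Proof.
move=> hx hy; apply: (congr1 (famax a0)); apply/funext => a; congr (`|_|); exact: bil_ext.
Qed.

Lemma slice_norm_ext a (u v : nat -> R) : (forall i, (i < n)%N -> u i = v i) -> slice_norm a u = slice_norm a v.
Proof.
move=> h; rewrite !slice_normE (@Ev_ext _ _ _ _ _ _ _ _ (fun x => maxbil x v)); last by move=> x; exact: maxbil_ext.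
congr (_ + _); congr ball_norm; apply/funext => i; apply: eq_bigr => j _; by rewrite h.
Qed.

Let qn0 a u : 0 <= slice_norm a u. Proof. exact: slice_norm_ge0. Qed.
Let qna a u v : slice_norm a (fun i => u i + v i) <= slice_norm a u + slice_norm a v.
Proof. by have [h _] := slice_norm_sublin modX n p a0 b x0 a; exact: h. Qed.
Let qns a (t : R) u : 0 <= t -> slice_norm a (fun i => t * u i) <= t * slice_norm a u.
Proof. by have [_ h] := slice_norm_sublin modX n p a0 b x0 a; exact: h. Qed.
Let qnb a y : ball n QY P y -> slice_norm a y <= 2%:R * r.
Proof. by move=> bY; exact: (slice_norm_ball modX h3 h5). Qed.
Let qn2 a : Ev n (wt mY) (vl kY) y0 (fun u => slice_norm a u ^+ 2) <= 2%:R * CQ * r ^+ 2.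
Proof. exact: (slice_norm_sq modX modY r0 p0 h1 h2 h3 h4 h5). Qed.

Lemma Phi_cconv a (c : R) : 0 <= c -> cconv (fun u => (c + slice_norm a u) ^+ 2).
Proof.
move=> c0 x i; apply: (@conv_sq _ (fun z => c + slice_norm a (upd x i z))).
  move=> z1 z2 t t01.
  have := sublin_cconv (slice_norm_sublin modX n p a0 b x0 a) x i z1 z2 t01; lra.
by move=> z; rewrite addr_ge0.
Qed.

Lemma slice_norm_sq_cconv a : cconv (fun u => slice_norm a u ^+ 2).
Proof.
move=> x i; apply: (@conv_sq _ (fun z => slice_norm a (upd x i z))) => //.
exact: (sublin_cconv (slice_norm_sublin modX n p a0 b x0 a)).
Qed.

(** [expR 4] bounds the total mass of the tilted weights; the other factor bounds the mean square of
    [slice_norm] shifted by a multiple of [r]. *)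
Definition KT : R := expR 4%:R * (18%:R + 16%:R * CQ).

Lemma CQ_ge0 : 0 <= CQ :> R.
Proof.
have C1 := @CI1_ge1 R; have C0 : 0 <= CI1 :> R by lra.
by rewrite /CQ /CK2; nng.
Qed.

Lemma Ev_qn_base (S : finType) (w : nat -> S -> R) (v : nat -> S -> R) a (F : R -> R) z z' :
  Ev n w v z (fun u => F (slice_norm a u)) = Ev n w v z' (fun u => F (slice_norm a u)).
Proof.
apply: (@Ev_base _ _ _ w v n) => [y y' h|i /andP[ni iN]]; first by rewrite (slice_norm_ext a h).
by rewrite leqNgt iN in ni.
Qed.

(** After the tilt the signs are compared with [de] plus twice fair signs. The point [de] is in the
    ball because [|de| <= |y|], and fair signs lie below the [Y_j] in the convex order because the
    latter are at least 1 in absolute value. *)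
Lemma mixed_small (am : (nat -> bool * S0) -> A) (ym : (nat -> bool * S0) -> nat -> R) :
  (forall s j, `|ym s j| <= 1) -> (forall s, \sum_(j < n) ym s j ^+ 2 <= P) ->
  Ex n (wt mX) sg (fun s => `|bil n (b (am s)) (fun i => vl kX i (s i)) (ym s)|) <=
  2%:R * CI1 * (1 + KT) * r.
Proof.
move=> y1 y2.
have H (s : nat -> bool * S0) (j : nat) : exists dg : (bool -> R) * (bool -> R) * R,
  [/\ \sum_(b : bool) (1 / 2%:R) * dg.1.1 b = 1,
      \sum_(b : bool) (1 / 2%:R) * dg.1.1 b * (-1) ^+ b = ym s j / 2%:R,
      forall b, 0 <= dg.1.2 b /\ dg.1.2 b ^+ p = dg.1.1 b,
      `|dg.2| <= `|ym s j|  &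
      \sum_(b : bool) (1 / 2%:R) * (dg.1.1 b * dg.1.2 b) <= expR (ym s j ^+ 2 / p%:R) /\
      forall f, conv f -> \sum_(b : bool) (1 / 2%:R) * (dg.1.1 b * dg.1.2 b) * f ((-1) ^+ b) <=
        (\sum_(b : bool) (1 / 2%:R) * (dg.1.1 b * dg.1.2 b)) *
          \sum_(b : bool) (1 / 2%:R) * f (dg.2 + 2%:R * (-1) ^+ b)].
  by have [d [g [de h]]] := small_prior p0 (y1 s j); exists (d, g, de).
have [F' HF'] := choice (fun sj : (nat -> bool * S0) * nat => H sj.1 sj.2).
pose F s j := F' (s, j).
have HF s j := HF' (s, j); rewrite -/(F _ _) /= in HF.
pose u (j : nat) (e : bool) : R := (-1) ^+ e.
pose w1 (j : nat) (e : bool) : R := 1 / 2%:R.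
have w10 j e : 0 <= w1 j e by rewrite /w1 divr_ge0.
have w11 j : \sum_e w1 j e = 1 by rewrite big_bool /w1 /=; lra.
apply: (smooth modX r0 p0 (a0 := a0) (w1 := w1) (u := u) (tg := fun=> true)
  (D := fun s j => (F s j).1.1) (g := fun s j => (F s j).1.2)) => //.
- by move=> s j; have [] := HF s j.
- by move=> s j _; have [] := HF s j.
- by move=> s j e; have [_ _ h _ _] := HF s j; have [] := h e.
- by move=> s j e; have [_ _ h _ _] := HF s j; have [] := h e.
move=> s; set a := am s; set z := (fun j : nat => u j true).
pose dg j e := (F s j).1.1 e * (F s j).1.2 e.
pose c j := \sum_(e : bool) w1 j e * dg j e.
pose de j := (F s j).2.
have dg0 j e : 0 <= dg j e.
  by have [_ _ h _ _] := HF s j; have [g0 gd] := h e; rewrite /dg -gd mulr_ge0 // exprn_ge0.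
have c0 j : 0 <= c j by apply: sumr_ge0 => e _; rewrite mulr_ge0.
rewrite (Ex_wM n w1 dg (fun=> true) (fun t => (r + slice_norm a (fun j => u j (t j))) ^+ 2)).
rewrite (Ev_map n _ u (fun=> true) (fun v => (r + slice_norm a v) ^+ 2)) -/z.
have wd0 i e : 0 <= w1 i e * dg i e by rewrite mulr_ge0.
apply: le_trans (@Ev_cmp _ _ _ _ u w1 (fun j e => de j + 2%:R * u j e) c _ wd0 w10 c0
  (Phi_cconv a (ltW r0)) _ n z) _.
  by move=> i f cf; have [_ _ _ _ [_ h]] := HF s i; exact: h.
(* The coordinate [j] has tilted mass at most [expR (y_j^2 / p)], and the squares sum to at most
   [p + 1 <= 2 p]. *)
have hc : \prod_(j < n) c j <= expR 2%:R.
  apply: (@le_trans _ _ (\prod_(j < n) expR (ym s j ^+ 2 / p%:R))).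
    by apply: ler_prod => j _; rewrite c0; have [_ _ _ _ [h _]] := HF s j; exact: h.
  rewrite -expR_sum ler_expR -mulr_suml; apply: le_trans Pp.
  by rewrite ler_pM2r ?invr_gt0.
have bde : ball n QY P de.
  exists (fun j => ym s j ^+ 2); split=> // j _; left.
  have [_ _ _ hd _] := HF s j; split; first exact: le_trans (y1 s j).
  by rewrite -(real_normK (num_real (de j))) -(real_normK (num_real (ym s j)));
     apply: lerXn2r; rewrite ?nnegrE.
have hE : Ev n w1 (fun j e => de j + 2%:R * u j e) z (fun v => (r + slice_norm a v) ^+ 2) <=
    (18%:R + 16%:R * CQ) * r ^+ 2.
  rewrite (Ev_qn_base _ _ a (fun t => (r + t) ^+ 2) z (fun j => de j + 2%:R * u j true)).
  rewrite -(Ev_map n w1 (fun j e => de j + 2%:R * u j e) (fun=> true) (fun v => (r + slice_norm a v) ^+ 2)).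
  apply: (@le_trans _ _ (Ex n w1 (fun=> true) (fun t => 18%:R * r ^+ 2 + 8%:R * slice_norm a (fun j => u j (t j)) ^+ 2))).
    apply: Ev_le => // t.
    have ha : slice_norm a (fun j => de j + 2%:R * u j (t j)) <= 2%:R * r + 2%:R * slice_norm a (fun j => u j (t j)).
      apply: le_trans (qna _ _ _) _; apply: lerD; [exact: qnb | exact: qns].
    have := qn0 a (fun j => de j + 2%:R * u j (t j)); have := qn0 a (fun j => u j (t j)).
    move: ha; move: (slice_norm a _) (slice_norm a _) => q2 q1 ha q20 q10.
    apply: (@le_trans _ _ ((3%:R * r + 2%:R * q2) ^+ 2)).
      by apply: lerXn2r; rewrite ?nnegrE; [apply: addr_ge0 => //; exact: ltW | nng |  lra].
    have := sqr_ge0 (3%:R * r - 2%:R * q2); lra.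
  rewrite /Ex EvD (Ev_cst _ w11) EvZ.
  rewrite -/(Ex n w1 (fun=> true) (fun t => slice_norm a (fun j => u j (t j)) ^+ 2)).
  rewrite (Ev_map n w1 u (fun=> true) (fun v => slice_norm a v ^+ 2)).
  have := @Ev_cmp _ _ _ w1 u (wt mY) (vl kY) (fun=> 1) _ w10 wY0 (fun=> ler01) (slice_norm_sq_cconv a) _ n z.
  rewrite big1 // mul1r => hh.
  have : Ev n w1 u z (fun v => slice_norm a v ^+ 2) <= 2%:R * CQ * r ^+ 2.
    apply: le_trans (_ : Ev n (wt mY) (vl kY) y0 (fun u => slice_norm a u ^+ 2) <= _); last exact: qn2.
    rewrite -(Ev_qn_base (wt mY) (vl kY) a (fun t => t ^+ 2) z y0); apply: hh => i f cf; rewrite mul1r.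
    rewrite (wt_sumE mY i (fun e s => f ((-1) ^+ e * (kY i s).+1%:R))).
    have [m0 m1 _ _] := modY i.
    have -> : \sum_e w1 i e * f (u i e) = \sum_s mY i s * ((f (-1) + f 1) / 2%:R).
      by rewrite -mulr_suml m1 big_bool /w1 /u /= expr1 expr0; lra.
    apply: ler_sum => t _; apply: ler_wpM2l => //.
    rewrite expr1 expr0 mul1r mulN1r ler_pM2r ?invr_gt0 //.
    rewrite addrC [leRHS]addrC; apply: conv_sym_mono => //.
    by rewrite normr1 ger0_norm // ler1n.
  by rewrite -/z; set e := Ev _ _ _ _ _; lra.
have r2 := sqr_ge0 r; have cq := CQ_ge0.
have e0 : 0 <= Ev n w1 (fun j e => de j + 2%:R * u j e) z (fun v => (r + slice_norm a v) ^+ 2).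
  by apply: Ev_ge0 => // v; exact: sqr_ge0.
apply: le_trans (ler_wpM2r e0 hc) _; rewrite /KT -mulrA; apply: ler_pM; [exact: expR_ge0 | exact: e0 | by rewrite ler_expR ler_nat | exact: hE].
Qed.

(** The difference of [vl] and the reduced variable [v'] is a point of the ball with the levels of
    [ym], hence costs [2 r] in [slice_norm]; under the tilted weights, [v'] is below [Y_j] in the
    convex order up to its mass. *)
Lemma mixed_large (am : (nat -> bool * S0) -> A) (ym : (nat -> bool * S0) -> nat -> R)
    (l : (nat -> bool * S0) -> nat -> R) :
  (forall s j, 0 <= l s j /\ (ym s j = 0 \/
     exists k, [/\ (0 < k)%N, `|ym s j| <= k.+1%:R & expR (- l s j) <= QY j k])) ->
  (forall s, \sum_(j < n) l s j <= P) ->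
  Ex n (wt mX) sg (fun s => `|bil n (b (am s)) (fun i => vl kX i (s i)) (ym s)|) <=
  2%:R * CI1 * (1 + KT) * r.
Proof.
move=> y1 lP.
have H (s : nat -> bool * S0) (j : nat) : exists dg : (bool * S0 -> R) * (bool * S0 -> R) * (bool * S0 -> R),
  [/\ \sum_bs wt mY j bs * dg.1.1 bs = 1, \sum_bs wt mY j bs * dg.1.1 bs * vl kY j bs = ym s j / 2%:R,
      forall bs, 0 <= dg.1.2 bs /\ dg.1.2 bs ^+ p = dg.1.1 bs,
      forall bs, adm (QY j) (vl kY j bs - dg.2 bs) (l s j) &
      \sum_bs wt mY j bs * (dg.1.1 bs * dg.1.2 bs) <= expR (2%:R * l s j / p%:R) /\
      forall f, conv f -> \sum_bs wt mY j bs * (dg.1.1 bs * dg.1.2 bs) * f (dg.2 bs) <=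
        (\sum_bs wt mY j bs * (dg.1.1 bs * dg.1.2 bs)) * \sum_bs wt mY j bs * f (vl kY j bs)].
  have [m0 m1 m2 m3] := modY j; have [l0 hy] := y1 s j.
  by have [d [g [v' h]]] := large_prior p0 m0 m1 m2 m3 l0 hy; exists (d, g, v').
have [F' HF'] := choice (fun sj : (nat -> bool * S0) * nat => H sj.1 sj.2).
pose F s j := F' (s, j).
have HF s j := HF' (s, j); rewrite -/(F _ _) /= in HF.
apply: (smooth modX r0 p0 (a0 := a0) (w1 := wt mY) (u := vl kY) (tg := tg)
  (D := fun s j => (F s j).1.1) (g := fun s j => (F s j).1.2)) => //.
- exact: wt_sum1.
- by move=> s j; have [] := HF s j.
- by move=> s j _; have [] := HF s j.
- by move=> s j e; have [_ _ h _ _] := HF s j; have [] := h e.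
- by move=> s j e; have [_ _ h _ _] := HF s j; have [] := h e.
move=> s; set a := am s.
pose dg j e := (F s j).1.1 e * (F s j).1.2 e.
pose c j := \sum_e wt mY j e * dg j e.
pose v' j e := (F s j).2 e.
have dg0 j e : 0 <= dg j e.
  by have [_ _ h _ _] := HF s j; have [g0 gd] := h e; rewrite /dg -gd mulr_ge0 // exprn_ge0.
have c0 j : 0 <= c j by apply: sumr_ge0 => e _; rewrite mulr_ge0.
have wd0 i e : 0 <= wt mY i e * dg i e by rewrite mulr_ge0.
apply: (@le_trans _ _ (Ex n (wt mY) tg (fun t => (\prod_(j < n) dg j (t j)) *
    (3%:R * r + slice_norm a (fun j => v' j (t j))) ^+ 2))).
  apply: Ev_le => // t; apply: ler_wpM2l; first by apply: prodr_ge0 => j _; exact: dg0.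
  have bd : ball n QY P (fun j => vl kY j (t j) - v' j (t j)).
    by exists (l s); split=> // j _; have [_ _ _ h _] := HF s j; exact: h.
  have ha : slice_norm a (fun j => vl kY j (t j)) <= 2%:R * r + slice_norm a (fun j => v' j (t j)).
    rewrite (@slice_norm_ext a _ (fun j => (vl kY j (t j) - v' j (t j)) + v' j (t j))); last by move=> j _; rewrite subrK.
    apply: le_trans (qna _ _ _) _; apply: lerD => //; exact: qnb.
  by apply: lerXn2r; rewrite ?nnegrE; [apply: addr_ge0 => //; exact: ltW | by nng | move: r0; lra].
rewrite (Ex_wM n (wt mY) dg tg (fun t => (3%:R * r + slice_norm a (fun j => v' j (t j))) ^+ 2)).
rewrite (Ev_map n _ v' tg (fun v => (3%:R * r + slice_norm a v) ^+ 2)).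
set z := fun i : nat => v' i (tg i).
have r3 : 0 <= 3%:R * r by rewrite mulr_ge0 // ltW.
apply: le_trans (@Ev_cmp _ _ _ _ v' (wt mY) (vl kY) c _ wd0 wY0 c0 (Phi_cconv a r3) _ n z) _.
  by move=> i f cf; have [_ _ _ _ [_ h]] := HF s i; exact: h.
have hc : \prod_(j < n) c j <= expR 4%:R.
  apply: (@le_trans _ _ (\prod_(j < n) expR (2%:R * l s j / p%:R))).
    by apply: ler_prod => j _; rewrite c0; have [_ _ _ _ [h _]] := HF s j; exact: h.
  rewrite -expR_sum ler_expR -mulr_suml -mulr_sumr -mulrA.
  have : (\sum_(j < n) l s j) / p%:R <= P / p%:R by rewrite ler_pM2r ?invr_gt0.
  by have := Pp; lra.
have hE : Ev n (wt mY) (vl kY) z (fun v => (3%:R * r + slice_norm a v) ^+ 2) <=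
    (18%:R + 16%:R * CQ) * r ^+ 2.
  rewrite (Ev_qn_base _ _ a (fun t => (3%:R * r + t) ^+ 2) z y0).
  apply: (@le_trans _ _ (Ev n (wt mY) (vl kY) y0 (fun v => 18%:R * r ^+ 2 + 2%:R * slice_norm a v ^+ 2))).
    apply: Ev_le => // v; have := sqr_ge0 (3%:R * r - slice_norm a v); lra.
  rewrite EvD (Ev_cst _ (wt_sum1 modY)) EvZ.
  have := qn2 a; set e := Ev _ _ _ _ _.
  have : 0 <= CQ * r ^+ 2 by rewrite mulr_ge0 ?CQ_ge0 ?sqr_ge0.
  lra.
have e0 : 0 <= Ev n (wt mY) (vl kY) z (fun v => (3%:R * r + slice_norm a v) ^+ 2).
  by apply: Ev_ge0 => // v; exact: sqr_ge0.
apply: le_trans (ler_wpM2r e0 hc) _; rewrite /KT -mulrA; apply: ler_wpM2l; [exact: expR_ge0 | exact: hE].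
Qed.

Definition CS : R := 4%:R * CI1 * (1 + KT).

Lemma KT_ge0 : 0 <= KT.
Proof. by have h := CQ_ge0; rewrite /KT; nng. Qed.

Lemma CS_ge1 : 1 <= CS.
Proof. have := @CI1_ge1 R; have := KT_ge0; rewrite /CS; nra. Qed.

(** The coordinates of [ym s] are separated by the clause of [adm] that they satisfy: tilted signs
    serve the quadratic range, tilted copies of the [Y_j] the tails. *)
Lemma mixed_term (am : (nat -> bool * S0) -> A) (ym : (nat -> bool * S0) -> nat -> R) :
  (forall s, ball n QY P (ym s)) ->
  Ex n (wt mX) sg (fun s => `|bil n (b (am s)) (fun i => vl kX i (s i)) (ym s)|) <= CS * r.
Proof.
move=> bY.
have [l Hl] := choice (fun s => let: ex_intro2 l a1 a2 := ball_lev modY (bY s) in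
  ex_intro (fun l : nat -> R => \sum_(i < n) l i <= P /\ forall i, (i < n)%N -> 0 <= l i /\ adm (QY i) (ym s i) (l i))
   l (conj a1 a2)).
pose small s j := (`|ym s j| <= 1) && (ym s j ^+ 2 <= l s j).
pose yS s (j : nat) := if (j < n)%N && small s j then ym s j else 0.
pose yL s (j : nat) := if (j < n)%N && ~~ small s j then ym s j else 0.
pose l' s (j : nat) := if (j < n)%N then l s j else 0.
have hS := @mixed_small am yS; have hL := @mixed_large am yL l'.
apply: (@le_trans _ _ (2%:R * CI1 * (1 + KT) * r + 2%:R * CI1 * (1 + KT) * r)); last first.
  by rewrite /CS; lra.
apply: le_trans (lerD (hS _ _) (hL _ _)).
- rewrite /Ex -EvD; apply: Ev_le => // s.
  apply: le_trans (ler_normD _ _); rewrite le_eqVlt; apply/orP; left; apply/eqP; congr (`|_|).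
  rewrite /bil -big_split; apply: eq_bigr => i _ /=; rewrite -mulrDr -big_split; congr (_ * _).
  apply: eq_bigr => j _ /=; rewrite -mulrDr /yS /yL ltn_ord /=; congr (_ * _).
  by case: (small s j); rewrite /= ?addr0 ?add0r.
- move=> s j; rewrite /yS; case: ifP => [/andP[_ /andP[]] //|_]; by rewrite normr0.
- move=> s; apply: le_trans (Hl s).1; apply: ler_sum => j _; rewrite /yS.
  case: ifP => [/andP[_ /andP[]] //|_]; rewrite expr0n /=.
  by have [] := (Hl s).2 j (ltn_ord j).
- move=> s j; rewrite /l' /yL; case: (ltnP j n) => nj /=; last by split=> //; left.
  have [l0 ad] := (Hl s).2 j nj; split=> //.
  case: ad => [[a1 a2]|ad]; first by left; rewrite /small a1 a2.
  by case: ifP => _; [right | left].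
- move=> s; apply: le_trans (Hl s).1; rewrite le_eqVlt; apply/orP; left; apply/eqP.
  by apply: eq_bigr => j _; rewrite /l' ltn_ord.
Qed.

Lemma near_max (x : nat -> R) : exists2 y, ball n QY P y &
  forall y', ball n QY P y' -> maxbil x y' <= maxbil x y + r.
Proof.
pose St := [set z | exists2 y, ball n QY P y & z = maxbil x y].
have hs : has_sup St.
  split; first by exists (maxbil x (fun=> 0)), (fun=> 0) => //; exact: ball0.
  exists (famax a0 (fun a => \sum_(j < n) `|\sum_(i < n) x i * b a i j| * (P + 1))) => z [y bY ->].
  apply: famax_le => a; apply: le_trans (le_famax a0 _ a); rewrite bilC.
  apply: le_trans (ler_norm_sum _ _ _) _; apply: ler_sum => j _; rewrite normrM.
  by apply: ler_wpM2l => //; exact: (ball_bdd modY bY).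
have [z [y bY ->] h] := sup_adherent r0 hs.
exists y => // y' bY'; have : maxbil x y' <= sup St by apply: (sup_upper_bound hs); exists y'.
by move: h; lra.
Qed.

Definition CC : R := 9%:R * CI1 ^+ 2 * CS.

Lemma max3X (x y z : R) q : 0 <= x -> 0 <= y -> 0 <= z ->
  (x + y + z) ^+ q <= 3%:R ^+ q * (x ^+ q + y ^+ q + z ^+ q).
Proof.
move=> x0' y0' z0'; pose M := Num.max x (Num.max y z).
have hx : x <= M by rewrite /M le_max lexx.
have hy : y <= M by rewrite /M !le_max lexx orbT.
have hz : z <= M by rewrite /M !le_max lexx !orbT.
apply: (@le_trans _ _ ((3%:R * M) ^+ q)).
  by apply: lerXn2r; rewrite ?nnegrE; [by nng | lra | lra].
rewrite exprMn; apply: ler_wpM2l; first by nng.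
have X0 : 0 <= x ^+ q by nng. have Y0 : 0 <= y ^+ q by nng. have Z0 : 0 <= z ^+ q by nng.
rewrite /M; case: (leP x _) => _; last by lra.
by case: (leP y z) => _; lra.
Qed.

(* Conditionally on [X], the moment theorem for [Y] reduces the claim to moments of [E_Y N(X, Y)] and of
   [sup_y N(X, y)]; the mean of the latter is bounded by smoothing, and the moment theorem for [X] applies to
   both. *)
Theorem core : Ev n (wt mX) (vl kX) x0 (fun x => Ev n (wt mY) (vl kY) y0 (fun y => maxbil x y ^+ p.+1)) <=
  (CC * r) ^+ p.+1.
Proof.
have C1 := @CI1_ge1 R; have S1 := CS_ge1.
pose FT : finType := {ffun 'I_n -> bool * S0}.
pose xf (f : FT) (i : nat) : R := if insub i is Some i' then vl kX i (f i') else 0.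
have [yf Hyf] := choice (fun f : FT => let: ex_intro2 y a1 a2 := near_max (xf f) in
  ex_intro (fun y => ball n QY P y /\ forall y', ball n QY P y' -> maxbil (xf f) y' <= maxbil (xf f) y + r)
    y (conj a1 a2)).
pose f0 : FT := [ffun i : 'I_n => sg i].
(* One near maximizer of [N(x, .)] is fixed for each of the finitely many outcomes, and [G] is the
   maximum over all of them. It dominates the supremum at every outcome up to [r], and as a finite
   maximum it has supporting functionals. *)
pose G (x : nat -> R) := famax (a0, f0) (fun af : A * FT => `|bil n (b af.1) x (yf af.2)|).
have subG : subdiff n G.
  have := subdiff_max n (a0, f0) (fun (af : A * FT) i => \sum_(j < n) b af.1 i j * yf af.2 j).
  by congr subdiff; apply/funext => x; congr famax; apply/funext => af; rewrite bilCx.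
have G0 x : 0 <= G x by apply: le_trans (le_famax (a0, f0) _ (a0, f0)); exact: normr_ge0.
have EG : Ev n (wt mX) (vl kX) x0 G <= CS * r.
  have [af Haf] := choice (fun x => famax_ex (a0, f0) (fun af : A * FT => `|bil n (b af.1) x (yf af.2)|)).
  have := @mixed_term (fun s => (af (fun i => vl kX i (s i))).1) (fun s => yf (af (fun i => vl kX i (s i))).2)
    (fun s => (Hyf _).1).
  apply: le_trans; rewrite -(Ev_map n (wt mX) (vl kX) sg G) le_eqVlt; apply/orP; left; apply/eqP.
  by apply: Ev_ext => s; rewrite /G Haf.
have rC : r <= CS * r by rewrite ler_peMl // ltW.
have mG : Ev n (wt mX) (vl kX) x0 (fun x => G x ^+ p.+1) <= (CI1 * (CS * r)) ^+ p.+1.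
  apply: (moment modX) => //; first by rewrite mulr_gt0 //; lra.
  move=> x bx; apply: le_trans rC; apply: famax_le => -[a f] /=.
  rewrite ler_norml; apply/andP; split; last by apply: h5 => //; have [] := Hyf f.
  rewrite lerNl; have := h5 a (ballN bx) (Hyf f).1; apply: le_trans.
  by rewrite /bil -sumrN; apply: ler_sum => i _; rewrite mulNr.
pose F (x : nat -> R) := Ev n (wt mY) (vl kY) y0 (maxbil x).
have F0 x : 0 <= F x by apply: Ev_ge0 => // y; exact: maxbil_ge0.
have subF : subdiff n F.
  exact: (@subdiff_Ev _ n R (bool * S0)%type n (wt mY) (vl kY) y0 (fun y x => maxbil x y) wY0 (maxbil_subx n a0 b)).
have mF : Ev n (wt mX) (vl kX) x0 (fun x => F x ^+ p.+1) <= (CI1 * r) ^+ p.+1.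
  exact: (moment modX).
apply: (@le_trans _ _ (Ev n (wt mX) (vl kX) x0 (fun x => (CI1 * 3%:R) ^+ p.+1 *
    (F x ^+ p.+1 + G x ^+ p.+1 + r ^+ p.+1)))).
  rewrite -!(Ev_map n (wt mX) (vl kX) sg); apply: Ev_le => // s.
  set x := fun i : nat => vl kX i (s i).
  apply: (@le_trans _ _ ((CI1 * (F x + G x + r)) ^+ p.+1)); last first.
    rewrite exprMn (exprMn _ CI1) -mulrA; apply: ler_wpM2l; first by rewrite exprn_ge0 //; lra.
    by apply: max3X => //; exact: ltW.
  apply: (moment modY).
  - exact: maxbil_suby.
  - by move=> y; exact: maxbil_ge0.
  - by move: r0 (F0 x) (G0 x); lra.
  - move=> y bY; pose f : FT := [ffun i : 'I_n => s i].
    have xe i : (i < n)%N -> x i = xf f i.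
      by move=> ni; rewrite /xf insubT /= /f ffunE.
    rewrite (maxbil_ext xe (fun i _ => erefl (y i))).
    apply: le_trans ((Hyf f).2 y bY) _; rewrite lerD2r.
    rewrite -(maxbil_ext xe (fun i _ => erefl (yf f i))).
    apply: (@le_trans _ _ (G x)); last by rewrite lerDr.
    apply: famax_le => a; exact: (le_famax (a0, f0) (fun af : A * FT => `|bil n (b af.1) x (yf af.2)|) (a, f)).
  - by rewrite -/(F x); move: r0 (G0 x); lra.
rewrite EvZ EvD EvD (Ev_cst _ (wt_sum1 modX)).
apply: (@le_trans _ _ ((CI1 * 3%:R) ^+ p.+1 * (3%:R ^+ p.+1 * (CI1 * (CS * r)) ^+ p.+1))).
  apply: ler_wpM2l; first by rewrite exprn_ge0 // mulr_ge0 //; lra.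
  have t3 : 3%:R <= 3%:R ^+ p.+1 :> R by rewrite exprS ler_peMr // exprn_ege1 // ler1n.
  have ci0 : 0 <= CI1 :> R by lra.
  have I1 : 0 <= CI1 * r := mulr_ge0 ci0 (ltW r0).
  have I3 : 0 <= CS * r by apply: le_trans (ltW r0) rC.
  have I2 : 0 <= CI1 * (CS * r) := mulr_ge0 ci0 I3.
  have k1 : (CI1 * r) ^+ p.+1 <= (CI1 * (CS * r)) ^+ p.+1.
    by apply: lerXn2r; rewrite ?nnegrE ?I1 ?I2 //; apply: ler_wpM2l.
  have k2 : r ^+ p.+1 <= (CI1 * (CS * r)) ^+ p.+1.
    apply: lerXn2r; rewrite ?nnegrE ?(ltW r0) //.
    by apply: le_trans rC _; rewrite ler_peMl.
  have k0 : 0 <= (CI1 * (CS * r)) ^+ p.+1 by apply: le_trans k2; rewrite exprn_ge0 // ltW.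
  apply: (@le_trans _ _ (3%:R * (CI1 * (CS * r)) ^+ p.+1)); last exact: ler_wpM2r.
  by move: mF mG k1 k2; set e1 := Ev _ _ _ _ _; set e2 := Ev _ _ _ _ _; lra.
rewrite -!exprMn /CC le_eqVlt; apply/orP; left; apply/eqP; congr (_ ^+ _); ring.
Qed.

End Core.

(** * From integer values back to the rounded variables *)

Section Scale.
Context {R : realType}.

Lemma Ev_scale (S : finType) n (w v : nat -> S -> R) (c : R) x (Phi : (nat -> R) -> R) :
  Ev n w (fun i s => c * v i s) (fun i => c * x i) Phi = Ev n w v x (fun y => Phi (fun i => c * y i)).
Proof.
elim: n x => //= n IH x; apply: eq_bigr => s _; congr (_ * _); rewrite -IH; congr (Ev _ _ _ _ _).
by apply/funext => i; rewrite /upd; case: eqP.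
Qed.

Definition localn (n : nat) (Phi : (nat -> R) -> R) : Prop :=
  forall y y' : nat -> R, (forall i, (i < n)%N -> y i = y' i) -> Phi y = Phi y'.

Lemma Ev_local (S : finType) n (w v : nat -> S -> R) Phi x x' : localn n Phi ->
  Ev n w v x Phi = Ev n w v x' Phi.
Proof.
move=> h; apply: (@Ev_base _ _ _ w v n) => // i /andP[ni iN].
by rewrite leqNgt iN in ni.
Qed.

End Scale.

Section Fine1.
Context {R : realType}.
Variables (S0 : finType) (m : nat -> S0 -> R) (k : nat -> S0 -> nat) (a : nat -> S0 -> R).
Hypothesis (mod : model m k).
Hypothesis a0 : forall i s, 0 <= a i s.
Hypothesis ka : forall i s, 64%:R * (k i s)%:R <= a i s.
Hypothesis ak : forall i s, a i s <= 64%:R * (k i s).+1%:R.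
Hypothesis a1 : forall i, 1 / 3%:R <= \sum_(s | 1 / 2%:R <= a i s) m i s.

Definition fv (i : nat) (bs : bool * S0) : R := (-1) ^+ bs.1 * a i bs.2.

(* The values [+-a] and [+-64 (k + 1)] are comparable in the convex order up to constants, because
   [64 k <= a <= 64 (k + 1)] and [P(a >= 1/2) >= 1/3]. *)
Lemma fine_le Phi n x x' : cconv Phi -> localn n Phi ->
  Ev n (wt m) fv x Phi <= Ev n (wt m) (vl k) x' (fun y => Phi (fun i => 64%:R * y i)).
Proof.
move=> cP lP; rewrite -Ev_scale (Ev_local _ _ x (fun i => 64%:R * x' i) lP).
apply: le_trans (sym_cmp mod (v := fun i s => 64%:R * (k i s).+1%:R) cP _ n _) _.
  by move=> i s; rewrite !ger0_norm // mulr_ge0.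
rewrite le_eqVlt; apply/orP; left; apply/eqP; congr (Ev _ _ _ _ _).
by apply/funext => i; apply/funext => bs; rewrite /vl mulrCA.
Qed.

Lemma disc_le Phi n x x' : cconv Phi -> localn n Phi ->
  Ev n (wt m) (vl k) x Phi <= Ev n (wt m) fv x' (fun y => Phi (fun i => 12%:R * y i)).
Proof.
move=> cP lP; rewrite -Ev_scale (Ev_local _ _ x (fun i => 12%:R * x' i) lP).
have w0 := wt_ge0 mod.
have := @Ev_cmp R _ _ (wt m) (vl k) (wt m) (fun i s => 12%:R * fv i s) (fun=> 1) Phi w0 w0 (fun=> ler01) cP.
move=> H; apply: le_trans (H _ n (fun i => 12%:R * x' i)) _; last by rewrite big1 // mul1r.
move=> i f cf; rewrite mul1r.
have [m0 m1 _ _] := mod i.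
rewrite (wt_sumE m i (fun e s => f ((-1) ^+ e * (k i s).+1%:R))).
rewrite (wt_sumE m i (fun e s => f (12%:R * ((-1) ^+ e * a i s)))).
pose fs (t : R) := (f (- t) + f t) / 2%:R.
have e1 s : (f ((-1) ^+ true * (k i s).+1%:R) + f ((-1) ^+ false * (k i s).+1%:R)) / 2%:R = fs (k i s).+1%:R.
  by rewrite expr1 expr0 mul1r mulN1r.
have e2 s : (f (12%:R * ((-1) ^+ true * a i s)) + f (12%:R * ((-1) ^+ false * a i s))) / 2%:R = fs (12%:R * a i s).
  by rewrite expr1 expr0 mul1r mulN1r mulrN.
under eq_bigr => s _ do rewrite e1.
under [leRHS]eq_bigr => s _ do rewrite e2.
have mono (t u : R) : 0 <= t -> t <= u -> fs t <= fs u.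
  move=> t0 tu; rewrite /fs ler_pM2r ?invr_gt0 // addrC [leRHS]addrC.
  by apply: conv_sym_mono => //; rewrite !ger0_norm //; apply: le_trans tu.
have half (t u : R) l : 0 <= l <= 1 -> fs (l * t + (1 - l) * u) <= l * fs t + (1 - l) * fs u.
  move=> l01; have := cf t u l l01; have := cf (- t) (- u) l l01.
  have -> : l * - t + (1 - l) * - u = - (l * t + (1 - l) * u) by ring.
  rewrite /fs; lra.
(* On mass at least 1/3, [12 a >= 6]; convexity gives [fs 2 <= fs 6 / 3 + 2 fs 0 / 3]. *)
have f2 : fs 2%:R <= \sum_s m i s * fs (12%:R * a i s).
  apply: (@le_trans _ _ (\sum_s m i s * (if 1 / 2%:R <= a i s then fs 6%:R else fs 0))); last first.
    apply: ler_sum => s _; apply: ler_wpM2l => //.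
    case: ifP => h; apply: mono => //; first by lra.
    by rewrite mulr_ge0.
  rewrite (bigID (fun s => 1 / 2%:R <= a i s)) /=.
  rewrite (eq_bigr (fun s => m i s * fs 6%:R)) => [|s ->] //.
  rewrite [X in _ + X](eq_bigr (fun s => m i s * fs 0)) => [|s /negbTE ->] //.
  rewrite -!mulr_suml.
  have := m1; rewrite (bigID (fun s => 1 / 2%:R <= a i s)) /=; have := a1 i.
  set u := \sum_(s | _) _; set u' := \sum_(s | ~~ _) _ => hu huu.
  have h6 := half 6%:R 0 (1 / 3%:R) ltac:(lra).
  have e : 1 / 3%:R * 6%:R + (1 - 1 / 3%:R) * 0 = 2%:R :> R by lra.
  rewrite e in h6.
  have h0 : fs 0 <= fs 6%:R by apply: mono.
  have -> : u' = 1 - u by lra.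
  move: h6 h0 hu; move: (fs 6%:R) (fs 0) (fs 2%:R) => A B C; nra.
(* [k + 1] is the midpoint of 2 and [2 k], and [2 k <= 12 a]; the value 2 is treated by [f2]. *)
have fk s : fs (k i s).+1%:R <= 1 / 2%:R * fs 2%:R + (1 / 2%:R) * fs (12%:R * a i s).
  have := half 2%:R (2%:R * (k i s)%:R) (1 / 2%:R) ltac:(lra).
  have -> : 1 / 2%:R * 2%:R + (1 - 1 / 2%:R) * (2%:R * (k i s)%:R) = (k i s).+1%:R :> R.
    by rewrite -(natr1 (k i s)); lra.
  have : fs (2%:R * (k i s)%:R) <= fs (12%:R * a i s).
    by apply: mono; [rewrite mulr_ge0 | have := ka i s; have := a0 i s; lra].
  lra.
apply: (@le_trans _ _ (\sum_s (1 / 2%:R * fs 2%:R * m i s + (1 / 2%:R) * (m i s * fs (12%:R * a i s))))).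
  by apply: ler_sum => s _; have := ler_wpM2l (m0 s) (fk s); lra.
rewrite big_split /= -!mulr_sumr m1; lra.
Qed.

End Fine1.

Section FineCore.
Context {R : realType}.
Variables (S0 : finType) (mX mY : nat -> S0 -> R) (kX kY : nat -> S0 -> nat) (aX aY : nat -> S0 -> R).
Hypotheses (modX : model mX kX) (modY : model mY kY).
Hypotheses (aX0 : forall i s, 0 <= aX i s) (aY0 : forall i s, 0 <= aY i s).
Hypotheses (kaX : forall i s, 64%:R * (kX i s)%:R <= aX i s) (kaY : forall i s, 64%:R * (kY i s)%:R <= aY i s).
Hypotheses (akX : forall i s, aX i s <= 64%:R * (kX i s).+1%:R) (akY : forall i s, aY i s <= 64%:R * (kY i s).+1%:R).
Hypotheses (aX1 : forall i, 1 / 3%:R <= \sum_(s | 1 / 2%:R <= aX i s) mX i s)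
  (aY1 : forall i, 1 / 3%:R <= \sum_(s | 1 / 2%:R <= aY i s) mY i s).
Let QX i := tailQ (mX i) (kX i).
Let QY i := tailQ (mY i) (kY i).
Variables (n p : nat).
Let P : R := p.+1%:R.
Variables (A : finType) (a0 : A) (b : A -> nat -> nat -> R) (r : R) (sg tg : nat -> bool * S0).
Let x0 i := fv aX i (sg i) : R.
Let y0 i := fv aY i (tg i) : R.
Notation maxbil := (maxbil n a0 b).
Hypothesis r0 : 0 < r.
Hypothesis p0 : (0 < p)%N.
Hypothesis h1 : Ev n (wt mX) (fv aX) x0 (fun x => Ev n (wt mY) (fv aY) y0 (maxbil x)) <= r.
Hypothesis h2 : forall x : nat -> R, ball n QX P x -> Ev n (wt mY) (fv aY) y0 (maxbil x) <= r.
Hypothesis h3 : forall y : nat -> R, ball n QY P y ->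
  Ev n (wt mX) (fv aX) x0 (fun x => maxbil x y) <= r.
Hypothesis h4 : forall a (x : nat -> R), ball n QX P x ->
  \sum_(i < n) x i * Num.sqrt (\sum_(j < n) b a i j ^+ 2) <= r.
Hypothesis h5 : forall a (x y : nat -> R), ball n QX P x -> ball n QY P y -> bil n (b a) x y <= r.

Let wX0 := wt_ge0 modX.
Let wY0 := wt_ge0 modY.

Lemma maxbilZ s t x y : 0 <= s -> 0 <= t -> maxbil (fun i => s * x i) (fun j => t * y j) = s * t * maxbil x y.
Proof.
move=> s0 t0.
have bilZ c : bil n c (fun i => s * x i) (fun j => t * y j) = s * t * bil n c x y.
  rewrite /bil mulr_sumr; apply: eq_bigr => i _.
  transitivity (s * x i * (t * \sum_(j < n) c i j * y j)); last by ring.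
  by congr (_ * _); rewrite mulr_sumr; apply: eq_bigr => j _; ring.
have st : 0 <= s * t by rewrite mulr_ge0.
apply/eqP; rewrite eq_le; apply/andP; split.
  apply: famax_le => a; rewrite bilZ normrM ger0_norm //; apply: ler_wpM2l => //; exact: le_maxbil.
have [a Ha] := famax_ex a0 (fun a => `|bil n (b a) x y|).
rewrite [X in _ * X <= _]Ha -(ger0_norm st) -normrM -bilZ; exact: le_maxbil.
Qed.

Let cx y : cconv (fun x => maxbil x y). Proof. exact: subdiff_cconv (maxbil_subx n a0 b y). Qed.
Let cy x : cconv (maxbil x). Proof. exact: subdiff_cconv (maxbil_suby n a0 b x). Qed.
Let lx y : localn n (fun x => maxbil x y). Proof. by move=> x x' h; exact: maxbil_ext. Qed.
Let ly x : localn n (maxbil x). Proof. by move=> y y' h; exact: maxbil_ext. Qed.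

Lemma pow_conv q (x y t : R) : 0 <= t <= 1 -> 0 <= x -> 0 <= y ->
  (t * x + (1 - t) * y) ^+ q.+1 <= t * x ^+ q.+1 + (1 - t) * y ^+ q.+1.
Proof.
move=> /andP[t0 t1] x0' y0'; have t1' : 0 <= 1 - t by rewrite subr_ge0.
set c := t * x + (1 - t) * y.
have c0 : 0 <= c by rewrite /c; nng.
have ha := ler_wpM2l t0 (bernoulli_tangent q c0 x0').
have hb := ler_wpM2l t1' (bernoulli_tangent q c0 y0').
apply: le_trans (lerD ha hb); rewrite le_eqVlt; apply/orP; left; apply/eqP.
transitivity (c ^+ q.+1 + q.+1%:R * c ^+ q * ((t * x + (1 - t) * y) - c)).
  by rewrite -/c subrr mulr0 addr0.
by ring.
Qed.

Lemma cconvX q (Phi : (nat -> R) -> R) : cconv Phi -> (forall y, 0 <= Phi y) -> cconv (fun y => Phi y ^+ q.+1).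
Proof.
move=> cP P0 x i z1 z2 t t01; have h := cP x i z1 z2 t t01.
apply: le_trans (pow_conv q t01 (P0 _) (P0 _)).
apply: lerXn2r; rewrite ?nnegrE //; case/andP: t01 => t0 t1.
by rewrite addr_ge0 ?mulr_ge0 // subr_ge0.
Qed.

Lemma Ev_cconv (T : Type) (S : finType) (w : nat -> S -> R) (v : nat -> S -> T) N z
   (Phi : (nat -> T) -> (nat -> R) -> R) : (forall i s, 0 <= w i s) ->
  (forall a, cconv (Phi a)) -> cconv (fun y => Ev N w v z (fun a => Phi a y)).
Proof.
move=> w0 cP x i z1 z2 t t01.
rewrite -!EvZ -EvD; apply: Ev_le => // a; exact: cP.
Qed.

(** Each of the two slots loses 64 in [fine_le] and 12 in [disc_le]. *)
Definition CF : R := 64%:R ^+ 2 * (CC * 144%:R).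

Theorem fine_core : Ev n (wt mX) (fv aX) x0 (fun x => Ev n (wt mY) (fv aY) y0 (fun y => maxbil x y ^+ p.+1)) <=
  (CF * r) ^+ p.+1.
Proof.
pose X0 := fun i => vl kX i (sg i) : R.
pose Y0 := fun i => vl kY i (tg i) : R.
have N0 := maxbil_ge0 n a0 b.
have Z1 c x y : 0 <= c -> maxbil x (fun j => c * y j) = c * maxbil x y.
  by move=> c0; rewrite -[in RHS](mul1r c) -maxbilZ //; apply: maxbil_ext => // i _; rewrite mul1r.
have Z2 c x y : 0 <= c -> maxbil (fun j => c * x j) y = c * maxbil x y.
  by move=> c0; rewrite -[in RHS](mulr1 c) -maxbilZ //; apply: maxbil_ext => // i _; rewrite mul1r.
have r12 : 12%:R * r <= 144%:R * r by move: r0; lra.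
have core' := @core R S0 mX mY kX kY modX modY n p A a0 b (144%:R * r) sg tg.
have k2 (x : nat -> R) : Ev n (wt mY) (vl kY) Y0 (maxbil x) <= 12%:R * Ev n (wt mY) (fv aY) y0 (maxbil x).
  apply: le_trans (disc_le modY aY0 kaY aY1 Y0 y0 (cy x) (ly x)) _.
  by rewrite -EvZ; apply: Ev_le => // y; rewrite Z1.
have k3 (y : nat -> R) : Ev n (wt mX) (vl kX) X0 (fun x => maxbil x y) <= 12%:R * Ev n (wt mX) (fv aX) x0 (fun x => maxbil x y).
  apply: le_trans (disc_le modX aX0 kaX aX1 X0 x0 (cx y) (lx y)) _.
  by rewrite -EvZ; apply: Ev_le => // x; rewrite Z2.
have {core'} := core' ltac:(by rewrite mulr_gt0) p0.
have C1 : Ev n (wt mX) (vl kX) X0 (fun x => Ev n (wt mY) (vl kY) Y0 (maxbil x)) <= 144%:R * r.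
  apply: (@le_trans _ _ (Ev n (wt mX) (vl kX) X0 (fun x => 12%:R * Ev n (wt mY) (fv aY) y0 (maxbil x)))).
    by apply: Ev_le.
  rewrite EvZ Ev_exch.
  apply: (@le_trans _ _ (12%:R * Ev n (wt mY) (fv aY) y0 (fun y => 12%:R * Ev n (wt mX) (fv aX) x0 (fun x => maxbil x y)))).
    by apply: ler_wpM2l => //; apply: Ev_le.
  by rewrite EvZ -Ev_exch; have := h1; lra.
have C2 x : ball n QX P x -> Ev n (wt mY) (vl kY) Y0 (maxbil x) <= 144%:R * r.
  by move=> bx; apply: le_trans (k2 x) _; have := h2 bx; move: r12; lra.
have C3 y : ball n QY P y -> Ev n (wt mX) (vl kX) X0 (fun x => maxbil x y) <= 144%:R * r.
  by move=> bY; apply: le_trans (k3 y) _; have := h3 bY; move: r12; lra.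
have C4 a (x : nat -> R) : ball n QX P x -> \sum_(i < n) x i * Num.sqrt (\sum_(j < n) b a i j ^+ 2) <= 144%:R * r.
  by move=> bx; apply: le_trans (h4 a bx) _; move: r0; lra.
have C5 a (x y : nat -> R) : ball n QX P x -> ball n QY P y -> bil n (b a) x y <= 144%:R * r.
  by move=> bx bY; apply: le_trans (h5 a bx bY) _; move: r0; lra.
move=> /(_ C1 C2 C3 C4 C5) HC.
apply: (@le_trans _ _ (Ev n (wt mX) (vl kX) X0 (fun x => Ev n (wt mY) (vl kY) Y0 (fun y =>
    (64%:R ^+ 2) ^+ p.+1 * maxbil x y ^+ p.+1)))).
  apply: (@le_trans _ _ (Ev n (wt mX) (fv aX) x0 (fun x => Ev n (wt mY) (vl kY) Y0 (fun y => maxbil x (fun j => 64%:R * y j) ^+ p.+1)))).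
    apply: Ev_le => // x; apply: (fine_le modY aY0 akY y0 Y0).
      by apply: cconvX; [exact: cy | exact: N0].
    by move=> y y' h; rewrite (ly x h).
  apply: le_trans (fine_le modX aX0 akX x0 X0 _ _) _.
  - apply: (@Ev_cconv _ _ (wt mY) (vl kY) n Y0 (fun y x => maxbil x (fun j => 64%:R * y j) ^+ p.+1) wY0) => y; apply: cconvX; [exact: cx | by move=> x; exact: N0].
  - by move=> x x' h; apply: Ev_ext => y; rewrite (lx _ h).
  - apply: Ev_le => // x; apply: Ev_le => // y; rewrite maxbilZ // -exprMn.
    by rewrite expr2.
rewrite (@Ev_ext _ _ _ _ _ _ _ _ (fun x => (64%:R ^+ 2) ^+ p.+1 * Ev n (wt mY) (vl kY) Y0 (fun y => maxbil x y ^+ p.+1))).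
  have e : (CF * r) ^+ p.+1 = (64%:R ^+ 2) ^+ p.+1 * (CC * (144%:R * r)) ^+ p.+1.
    by rewrite -exprMn /CF; congr (_ ^+ _); ring.
  rewrite EvZ e; apply: ler_wpM2l; [by rewrite exprn_ge0 // sqr_ge0 | exact: HC].
by move=> x; rewrite EvZ.
Qed.

End FineCore.

(** * Discretization of the random variables *)

Section ExFfun.
Context {R : realType}.

Definition extf (S : Type) n (sg : nat -> S) (f : 'I_n -> S) (i : nat) : S :=
  if insub i is Some i' then f i' else sg i.

Lemma extf_lt (S : Type) n (sg : nat -> S) (f : 'I_n -> S) (i : 'I_n) : extf sg f i = f i.
Proof. by rewrite /extf valK. Qed.

(** [Phi] is expanded over indicators of single outcomes; each is a product over the coordinates, so
    its mean is a product of weights. *)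
Lemma Ex_ffun (S : finType) n (w : nat -> S -> R) sg Phi :
  Ex n w sg Phi = \sum_(f : {ffun 'I_n -> S}) Phi (extf sg f) * \prod_(i < n) w i (f i).
Proof.
pose g (f : {ffun 'I_n -> S}) i s : R := (s == extf sg f i)%:R.
transitivity (Ex n w sg (fun t => \sum_(f : {ffun 'I_n -> S}) Phi (extf sg f) * \prod_(i < n) g f i (t i))).
  apply: Ev_ext_on => t Ht.
  have te : extf sg [ffun i : 'I_n => t i] = t.
    apply/funext => i; case: (ltnP i n) => ni; last by rewrite /extf insubF ?Ht // ltnNge ni.
    by rewrite -[i]/(nat_of_ord (Ordinal ni)) extf_lt ffunE.
  have B : \prod_(i < n) g [ffun i : 'I_n => t i] i (t i) = 1.
    by apply: big1 => i _; rewrite /g te eqxx.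
  rewrite (bigD1 [ffun i : 'I_n => t i]) //= B te mulr1.
  rewrite [X in _ + X]big1 ?addr0 // => f ne.
  have [i Hi] : exists i, f i != t i.
    apply/existsP; rewrite -negb_forall; apply: contra ne => /forallP h.
    by apply/eqP/ffunP => i; rewrite ffunE; apply/eqP.
  by rewrite (bigD1 i) //= /g extf_lt eq_sym (negbTE Hi) mul0r mulr0.
rewrite /Ex Ev_sum; apply: eq_bigr => f _; rewrite EvZ; congr (_ * _).
rewrite -/(Ex n w sg (fun t => \prod_(i < n) g f i (t i))) Ex_prod; apply: eq_bigr => i _.
rewrite (bigD1 (f i)) //= /g extf_lt eqxx mulr1 big1 ?addr0 // => s ne.
by rewrite (negbTE ne) mulr0.
Qed.

End ExFfun.

Section FinRV.
Context {R : realType} {d : measure_display} {Omega : measurableType d} (P : probability Omega R).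

Lemma meas_fin (T : finType) (d' : measure_display) (U : measurableType d') (xi : Omega -> T) (G : T -> U) :
  (forall t, measurable (xi @^-1` [set t])) -> measurable_fun setT (fun w => G (xi w)).
Proof.
move=> mxi _ B mB; rewrite setTI.
have -> : (fun w => G (xi w)) @^-1` B = \bigcup_(t in [set t | B (G t)]) (xi @^-1` [set t]).
  by apply/seteqP; split=> w /=; [move=> h; exists (xi w) | move=> [t /= h ->]].
by apply: fin_bigcup_measurable => //; exact: finite_finset.
Qed.

Lemma int_fin (T : finType) (xi : Omega -> T) (G : T -> R) :
  (forall t, measurable (xi @^-1` [set t])) -> (forall t, 0 <= G t) ->
  (\int[P]_w (G (xi w))%:E = (\sum_t G t * fine (P (xi @^-1` [set t])))%:E)%E.
Proof.
move=> mxi G0.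
transitivity (\int[P]_w (\sum_(t : T) (G t * \1_(xi @^-1` [set t]) w)%:E)%E)%E.
  apply: eq_integral => w _; rewrite sumEFin; congr EFin.
  rewrite (bigD1 (xi w)) //= indicE mem_set // mulr1 big1 ?addr0 // => t ne.
  by rewrite indicE memNset ?mulr0 //= => e; rewrite e eqxx in ne.
rewrite ge0_integral_sum //.
- rewrite -sumEFin; apply: eq_bigr => t _.
  under eq_integral => w _ do rewrite EFinM.
  rewrite ge0_integralZl_EFin //.
  + by rewrite integral_indic // setIT EFinM fineK // fin_num_measure.
  + by apply/measurable_EFinP; exact: measurable_indic.
- move=> t; apply/measurable_EFinP; apply: measurable_funM; first exact: measurable_cst.
  exact: measurable_indic.
- by move=> t w _; rewrite lee_fin mulr_ge0.
Qed.

End FinRV.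

Section Tail.
Context {R : realType} {d : measure_display} {Omega : measurableType d} (P : probability Omega R).
Variable Z : Omega -> R.
Hypothesis mZ : measurable_fun setT Z.

Definition tailG (t : R) : R := fine (P [set w | t <= `|Z w|]).

Lemma mtail t : measurable [set w | t <= `|Z w|].
Proof.
have -> : [set w | t <= `|Z w|] = ((fun x : R => `|x|) \o Z) @^-1` `[t, +oo[.
  by apply/seteqP; split=> w /=; rewrite in_itv /= andbT.
rewrite -[X in measurable X]setTI; apply: (measurableT_comp (@normr_measurable R setT) mZ) => //.
Qed.

Lemma tailGE t : P [set w | t <= `|Z w|] = (tailG t)%:E.
Proof. by rewrite /tailG fineK // fin_num_measure //; exact: mtail. Qed.

Lemma tailG_ge0 t : 0 <= tailG t.
Proof. by rewrite /tailG fine_ge0. Qed.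

Lemma tailG0 t : t <= 0 -> tailG t = 1.
Proof.
move=> t0; apply/EFin_inj; rewrite -tailGE -(probability_setT P); congr (P _).
by apply/seteqP; split=> w //= _; exact: le_trans t0 _.
Qed.

Lemma tailG_noninc s t : s <= t -> tailG t <= tailG s.
Proof.
move=> st; rewrite -lee_fin -!tailGE; apply: le_measure; rewrite ?inE; try exact: mtail.
by move=> w /=; exact: le_trans.
Qed.

Lemma tailN_E t : tailN P Z t = if tailG t == 0 then +oo%E else (- ln (tailG t))%:E.
Proof. by rewrite /tailN tailGE. Qed.

Hypothesis lc : log_concave_tails P Z.
Hypothesis nrm : tail_normalized P Z.

Lemma tailN_le_fin t c : (tailN P Z t <= c%:E)%E -> expR (- c) <= tailG t.
Proof.
rewrite tailN_E; case: eqP => [_|/eqP h]; first by rewrite leye_eq.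
have g0 : 0 < tailG t by rewrite lt_neqAle eq_sym h tailG_ge0.
rewrite lee_fin => hc; rewrite -[leRHS](lnK (x := tailG t)) ?posrE // ler_expR; lra.
Qed.

Lemma tailN_ge_fin t c : 0 <= c -> (c%:E <= tailN P Z t)%E -> tailG t <= expR (- c).
Proof.
move=> c0; rewrite tailN_E; case: eqP => [->|/eqP h]; first by rewrite expR_ge0.
have g0 : 0 < tailG t by rewrite lt_neqAle eq_sym h tailG_ge0.
rewrite lee_fin => hc; rewrite -[leLHS](lnK (x := tailG t)) ?posrE // ler_expR; lra.
Qed.

Lemma expR_tailN t l : expR (- l) <= tailG t -> (tailN P Z t <= l%:E)%E.
Proof.
move=> h; rewrite tailN_E; have g0 : 0 < tailG t by apply: lt_le_trans h; exact: expR_gt0.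
rewrite gt_eqF // lee_fin; rewrite -[X in _ <= X](lnK (x := tailG t)) ?posrE // ler_expR in h; lra.
Qed.

Lemma tailN_scale s l : 0 <= s -> 0 < l < 1 -> (tailN P Z (l * s) <= l%:E * tailN P Z s)%E.
Proof.
move=> s0 l01; have := lc s0 (lexx 0) l01.
by rewrite mulr0 addr0 [X in (_ <= _ + _ * X)%E]tailN_E tailG0 // oner_eq0 ln1 oppr0 mule0 adde0.
Qed.

Lemma tailG_lc (c : R) i j : 0 <= c -> (0 < i)%N -> (i <= j)%N ->
  tailG (c * j%:R) ^+ i <= tailG (c * i%:R) ^+ j.
Proof.
move=> c0 i0; rewrite leq_eqVlt => /orP[/eqP -> //|ij].
have j0 : 0 < j%:R :> R by rewrite ltr0n (ltn_trans i0).
have iR : 0 < i%:R :> R by rewrite ltr0n.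
have [g0|g0] := eqVneq (tailG (c * j%:R)) 0.
  by rewrite g0 expr0n eqn0Ngt i0 /= exprn_ge0 // tailG_ge0.
have gj : 0 < tailG (c * j%:R) by rewrite lt_neqAle eq_sym g0 tailG_ge0.
have cij : c * i%:R <= c * j%:R by apply: ler_wpM2l => //; rewrite ler_nat ltnW.
have gi : 0 < tailG (c * i%:R) by apply: lt_le_trans gj _; exact: tailG_noninc.
have l01 : 0 < (i%:R / j%:R : R) < 1 by rewrite divr_gt0 //= ltr_pdivrMr // mul1r ltr_nat.
have := tailN_scale (mulr_ge0 c0 (ltW j0)) l01.
have -> : i%:R / j%:R * (c * j%:R) = c * i%:R by field; rewrite gt_eqF.
rewrite !tailN_E (negbTE g0) gt_eqF // -EFinM lee_fin => h.
rewrite -[X in X ^+ i <= _](lnK (x := tailG (c * j%:R))) ?posrE //.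
rewrite -[X in _ <= X ^+ j](lnK (x := tailG (c * i%:R))) ?posrE //.
rewrite -!expRM_natr ler_expR; have := ler_wpM2r (ltW j0) h.
have -> : i%:R / j%:R * - ln (tailG (c * j%:R)) * j%:R = - (ln (tailG (c * j%:R)) * i%:R).
  by field; rewrite gt_eqF.
lra.
Qed.

Let St := [set t : R | 0 <= t /\ (1 <= tailN P Z t)%E].

Lemma St_has : has_inf St.
Proof.
split; last by exists 0 => t [].
(* The infimum of the empty set is 0 by convention, which the normalization excludes. *)
apply: contrapT => /set0P/negP; rewrite negbK => /eqP e.
by have := nrm; rewrite /tail_normalized -/St e inf0 => /eqP; rewrite eq_sym oner_eq0.
Qed.

(** Some [t < 2] has [tailN] at least 1, and [tailN] grows at least linearly, so it is at least 32
    at 64; finally [expR (- 32) <= 2^-28]. This justifies the step 64 of the discretization. *)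
Lemma tailG_64 : tailG 64%:R <= eta.
Proof.
have [t [t0 Nt] tlt] := inf_adherent ltr01 St_has.
have infS : inf St = 1 := nrm.
rewrite infS in tlt.
have t1 : 1 <= t by rewrite -infS; apply: ge_inf; [have [] := St_has | split].
have l01 : 0 < t / 64%:R < 1 by apply/andP; split; [rewrite divr_gt0 //; lra | lra].
have := @tailN_scale 64%:R _ (ler0n _ _) l01.
have -> : t / 64%:R * 64%:R = t by field.
move=> h; apply: le_trans (_ : expR (- 32%:R) <= _).
  apply: tailN_ge_fin => //.
  have := le_trans Nt h; rewrite tailN_E; case: ifP => _; first by rewrite leey.
  rewrite -EFinM !lee_fin; set z := - ln _ => hz.
  have z0 : 0 <= z by rewrite -(@pmulr_rge0 _ (t / 64%:R)); [lra | by case/andP: l01].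
  have := ler_wpM2r z0 (_ : t / 64%:R <= 1 / 32%:R); lra.
rewrite expRN /eta exprVn -exprM lef_pV2 ?posrE ?expR_gt0 ?exprn_gt0 //.
have -> : 32%:R = 1 * 32%:R :> R by rewrite mul1r.
rewrite expRM_natr; apply: (@le_trans _ _ (2%:R ^+ 32)); first by rewrite ler_eXn2l // ltr1n.
by apply: lerXn2r; rewrite ?nnegrE ?expR_ge0 //; apply: le_trans (expR_ge1Dx 1); lra.
Qed.

(** The point 1/2 lies below the infimum, so its [tailN] is at most 1, and [expR 1 <= 3]. *)
Lemma tailG_half : 1 / 3%:R <= tailG (1 / 2%:R).
Proof.
have infS : inf St = 1 := nrm.
have nS : ~ St (1 / 2%:R).
  move=> h; have : inf St <= 1 / 2%:R by apply: ge_inf => //; have [] := St_has.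
  by rewrite infS; lra.
have hN : (tailN P Z (1 / 2%:R) <= 1%:E)%E.
  rewrite leNgt; apply/negP => h; apply: nS; split; [lra | exact: ltW].
apply: le_trans (tailN_le_fin hN).
rewrite expRN mul1r lef_pV2 ?posrE ?expR_gt0 //.
have h : expR (1 / 8%:R) <= 1 + 1 / 8%:R + (1 / 8%:R) ^+ 2 :> R by apply: expR_quad; lra.
have -> : (1 : R) = 1 / 8%:R * 8%:R by field.
rewrite expRM_natr; apply: (@le_trans _ _ ((1 + 1 / 8%:R + (1 / 8%:R) ^+ 2) ^+ 8)).
  by apply: lerXn2r; rewrite ?nnegrE ?expR_ge0 //; lra.
lra.
Qed.

End Tail.

Section Disc.
Context {R : realType}.
Variable M : nat.
Hypothesis M0 : (0 < M)%N.
Let MR : 0 < M%:R :> R. Proof. by rewrite ltr0n. Qed.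

(* [|x|] is truncated at [M] and rounded down to a multiple of [1 / (2 M)]; [dk] is the integer part of this
   value divided by 64. *)
Definition da (x : R) : nat := minn (Num.trunc (2%:R * M%:R * `|x|)) (2 * M ^ 2).
Definition dI (x : R) : 'I_(2 * M ^ 2).+1 := inord (da x).
Definition dmag (s : 'I_(2 * M ^ 2).+1) : R := s%:R / (2%:R * M%:R).
Definition dk (s : 'I_(2 * M ^ 2).+1) : nat := (s %/ (128 * M))%N.
Definition dsc (x : R) : bool * 'I_(2 * M ^ 2).+1 := (x < 0, dI x).
Definition dval (x : R) : R := (-1) ^+ (x < 0)%R * dmag (dI x).

Lemma dI_val x : dI x = da x :> nat.
Proof. by rewrite /dI inordK // ltnS geq_minr. Qed.

Lemma ge_da j x : (j <= da x)%N = (j <= 2 * M ^ 2)%N && (j%:R <= 2%:R * M%:R * `|x|).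
Proof. by rewrite /da leq_min andbC truncn_ge_nat // !mulr_ge0. Qed.

Lemma dmag_ge0 s : 0 <= dmag s.
Proof. by rewrite /dmag divr_ge0 // mulr_ge0. Qed.

Lemma dk_dmag s : 64%:R * (dk s)%:R <= dmag s.
Proof.
rewrite /dmag ler_pdivlMr ?mulr_gt0 //.
have : (s %/ (128 * M) * (128 * M) <= s)%N by exact: leq_trunc_div.
by rewrite -(ler_nat R) !natrM /dk; lra.
Qed.

Lemma dmag_dk s : dmag s <= 64%:R * (dk s).+1%:R.
Proof.
rewrite /dmag ler_pdivrMr ?mulr_gt0 //.
have : (s < (s %/ (128 * M)).+1 * (128 * M))%N by rewrite ltn_ceil // muln_gt0.
by move/ltnW; rewrite -(ler_nat R) !natrM /dk; lra.
Qed.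

Lemma signE (x : R) : x = (-1) ^+ (x < 0)%R * `|x|.
Proof. by case: ltrP => h; rewrite ?expr1 ?expr0 ?mul1r ?mulN1r; [rewrite ltr0_norm // opprK | rewrite ger0_norm]. Qed.

Lemma dval_le x : `|dval x| <= `|x|.
Proof.
rewrite /dval normrMsign ger0_norm ?dmag_ge0 // /dmag ler_pdivrMr ?mulr_gt0 // mulrC dI_val.
by have := leqnn (da x); rewrite ge_da => /andP[].
Qed.

(** Rounding costs at most [1 / (2 M)]. Truncation is active only for [|x| >= M], where [|x|] itself
    is at most [x^2 / M]. *)
Lemma dval_err x : `|x - dval x| <= (1 + x ^+ 2) / M%:R.
Proof.
rewrite {1}(signE x) /dval -mulrBr normrMsign.
have hd : dmag (dI x) <= `|x|.
  by have := dval_le x; rewrite /dval normrMsign ger0_norm // dmag_ge0.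
rewrite ger0_norm ?subr_ge0 // ler_pdivlMr //.
rewrite -(real_normK (num_real x)).
case: (leqP (2 * M ^ 2) (Num.trunc (2%:R * M%:R * `|x|))) => h.
  have e : dmag (dI x) = M%:R.
    rewrite /dmag dI_val /da (minn_idPr h) natrM natrX; field; by rewrite gt_eqF.
  rewrite e in hd *; have x0 := normr_ge0 x; nra.
have hlt : 2%:R * M%:R * `|x| < (Num.trunc (2%:R * M%:R * `|x|)).+1%:R.
  by rewrite -truncn_le_nat.
have e : dmag (dI x) * (2%:R * M%:R) = (Num.trunc (2%:R * M%:R * `|x|))%:R.
  by rewrite /dmag dI_val /da (minn_idPl (ltnW h)) divfK // gt_eqF // mulr_gt0.
have hlt' : 2%:R * M%:R * `|x| < dmag (dI x) * (2%:R * M%:R) + 1 by rewrite e natr1.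
have := sqr_ge0 `|x|; lra.
Qed.

Lemma meas_ge_da j : measurable [set x : R | (j <= da x)%N].
Proof.
case: (boolP (j <= 2 * M ^ 2)%N) => hj; last first.
  rewrite (_ : [set x | _] = set0) ?measurable0 //.
  by apply/seteqP; split=> x //=; rewrite ge_da (negbTE hj).
have -> : [set x : R | (j <= da x)%N] = (fun x : R => 2%:R * M%:R * `|x|) @^-1` `[j%:R, +oo[.
  by apply/seteqP; split=> x /=; rewrite ge_da hj in_itv /= andbT.
rewrite -[X in measurable X]setTI.
have mf : measurable_fun setT (fun x : R => 2%:R * M%:R * `|x|).
  by apply: measurable_funM; [exact: measurable_cst | exact: normr_measurable].
by apply: mf => //; exact: measurable_itv.
Qed.

Lemma meas_dI s : measurable (dI @^-1` [set s] : set R).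
Proof.
have -> : dI @^-1` [set s] = [set x : R | (s <= da x)%N] `\` [set x : R | (s.+1 <= da x)%N].
  apply/seteqP; split=> x /=.
    by move=> <-; rewrite dI_val ltnn; split.
  move=> [h1 h2]; apply/val_inj; rewrite /= dI_val; apply/eqP; rewrite eqn_leq h1 andbT leqNgt.
  by apply/negP.
by apply: measurableD; exact: meas_ge_da.
Qed.

Lemma meas_lt0 : measurable [set x : R | x < 0].
Proof.
have -> : [set x : R | x < 0] = `]-oo, 0[%classic by apply/seteqP; split=> x /=; rewrite in_itv.
exact: measurable_itv.
Qed.

Lemma meas_dsc t : measurable (dsc @^-1` [set t] : set R).
Proof.
case: t => [e s].
have -> : dsc @^-1` [set (e, s)] = (if e then [set x : R | x < 0] else ~` [set x : R | x < 0]) `&` dI @^-1` [set s].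
  apply/seteqP; split=> x /=; rewrite /dsc.
    by case=> <- ->; split=> //; case: ifP => //= h; apply/negP; rewrite h.
  move=> [h1 h2]; rewrite h2; congr (_, _); case: e h1 => /=; first by move=> ->.
  by move=> h; apply/negbTE/negP.
apply: measurableI; last exact: meas_dI.
case: e; first exact: meas_lt0.
by apply: measurableC; exact: meas_lt0.
Qed.

Context {d : measure_display} {Omega : measurableType d} (P : probability Omega R).

Section OneZ.
Variable Z : Omega -> R.
Hypothesis mZ : measurable_fun setT Z.

Lemma preZ (B : set R) : measurable B -> measurable (Z @^-1` B).
Proof. by move=> mB; rewrite -[X in measurable X]setTI; exact: mZ. Qed.

Definition dm (s : 'I_(2 * M ^ 2).+1) : R := fine (P ((fun w => dI (Z w)) @^-1` [set s])).

Let mdI s : measurable ((fun w => dI (Z w)) @^-1` [set s]).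
Proof. exact: (preZ (meas_dI s)). Qed.

Lemma prob_fin (T : finType) (xi : Omega -> T) (Q : pred T) :
  (forall t, measurable (xi @^-1` [set t])) ->
  P [set w | Q (xi w)] = (\sum_(t | Q t) fine (P (xi @^-1` [set t])))%:E.
Proof.
move=> mxi; have := @int_fin R d Omega P T xi (fun t => (Q t)%:R) mxi (fun t => ler0n _ _).
have mA : measurable [set w | Q (xi w)].
  rewrite -[X in measurable X]setTI; have := @meas_fin d Omega T _ bool xi Q mxi.
  by move=> /(_ measurableT [set true]) h; apply: h.
rewrite (_ : \int[P]_w _ = P [set w | Q (xi w)])%E; last first.
  transitivity (\int[P]_w (\1_[set w | Q (xi w)] w)%:E)%E; last by rewrite integral_indic // setIT.
  apply: eq_integral => w _; rewrite indicE.
  by case: (boolP (Q (xi w))) => h; [rewrite mem_set | rewrite memNset //; apply/negP].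
move=> ->; congr EFin; rewrite [RHS]big_mkcond; apply: eq_bigr => t _.
by case: ifP; rewrite ?mul1r ?mul0r.
Qed.

Lemma dm_ge0 s : 0 <= dm s. Proof. by rewrite /dm fine_ge0. Qed.

Lemma dm_sum (Q : pred 'I_(2 * M ^ 2).+1) : P [set w | Q (dI (Z w))] = (\sum_(s | Q s) dm s)%:E.
Proof. exact: (@prob_fin _ (fun w => dI (Z w)) Q mdI). Qed.

Lemma dm_sum1 : \sum_s dm s = 1.
Proof.
have := dm_sum predT; rewrite (_ : [set w | _] = setT); last by apply/seteqP; split.
by rewrite probability_setT => -[].
Qed.

Lemma dm_ge j : \sum_(s : 'I_(2 * M ^ 2).+1 | (j <= s)%N) dm s =
  if (j <= 2 * M ^ 2)%N then tailG P Z (j%:R / (2%:R * M%:R)) else 0.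
Proof.
apply/EFin_inj; rewrite -(dm_sum (fun s => (j <= s)%N)).
case: ifP => hj.
  rewrite -(tailGE P mZ); congr (P _); apply/seteqP; split=> w /=; rewrite dI_val ge_da hj /=.
    by rewrite ler_pdivrMr ?mulr_gt0 // mulrC.
  by rewrite ler_pdivrMr ?mulr_gt0 // mulrC.
rewrite (_ : [set w | _] = set0) ?measure0 //.
by apply/seteqP; split=> w //=; rewrite dI_val ge_da hj.
Qed.

Lemma dm_tailQ j : tailQ dm dk j =
  if (128 * M * j <= 2 * M ^ 2)%N then tailG P Z (64%:R * j%:R) else 0.
Proof.
rewrite /tailQ; transitivity (\sum_(s : 'I_(2 * M ^ 2).+1 | (128 * M * j <= s)%N) dm s).
  by apply: eq_bigl => s; rewrite /dk leq_divRL ?muln_gt0 // mulnC.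
rewrite dm_ge; case: ifP => // _; congr (tailG _ _ _); rewrite !natrM.
by field; rewrite gt_eqF.
Qed.

Hypothesis lc : log_concave_tails P Z.
Hypothesis nrm : tail_normalized P Z.

Lemma dm_lcQ : lcQ dm dk.
Proof.
move=> i j i0 ij; rewrite !dm_tailQ; case: ifP => hj; last first.
  by rewrite expr0n eqn0Ngt i0 /= exprn_ge0 //; case: ifP => // _; exact: tailG_ge0.
rewrite ifT; last by apply: leq_trans hj; rewrite leq_mul2l ij orbT.
exact: tailG_lc.
Qed.

Lemma dm_eta : tailQ dm dk 1 <= eta.
Proof.
rewrite dm_tailQ; case: ifP => _; first by rewrite mulr1; exact: tailG_64.
by rewrite /eta exprn_ge0 // invr_ge0 exprn_ge0.
Qed.

Lemma dm_half : 1 / 3%:R <= \sum_(s | 1 / 2%:R <= dmag s) dm s.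
Proof.
rewrite (eq_bigl (fun s : 'I_(2 * M ^ 2).+1 => (M <= s)%N)); last first.
  move=> s; rewrite /dmag ler_pdivlMr ?mulr_gt0 // -(ler_nat R).
  by have -> : 1 / 2%:R * (2%:R * M%:R) = M%:R :> R by field.
rewrite dm_ge ifT.
  have -> : M%:R / (2%:R * M%:R) = 1 / 2%:R :> R by field; rewrite gt_eqF.
  exact: tailG_half.
by rewrite expnS expn1; have := M0; nia.
Qed.

Hypothesis sy : symmetric_rv P Z.

Definition dq (t : bool * 'I_(2 * M ^ 2).+1) : R := fine (P ((fun w => dsc (Z w)) @^-1` [set t])).
Definition dv (t : bool * 'I_(2 * M ^ 2).+1) : R := (-1) ^+ t.1 * dmag t.2.

Let mdq t : measurable ((fun w => dsc (Z w)) @^-1` [set t]).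
Proof. exact: (preZ (meas_dsc t)). Qed.

Lemma dq_add s : dq (true, s) + dq (false, s) = dm s.
Proof.
have := @prob_fin _ (fun w => dsc (Z w)) (fun t => t.2 == s) mdq.
rewrite (_ : [set w | _] = (fun w => dI (Z w)) @^-1` [set s]); last first.
  by apply/seteqP; split=> w /=; [move/eqP | move=> ->; exact: eqxx].
rewrite -(fineK (fin_num_measure P _ (mdI s))) => -[]; rewrite -/(dm s) => ->.
transitivity (\sum_(t | t.2 == s) dq t) => //.
rewrite big_mkcond.
transitivity (\sum_t (fun e s' => if s' == s then dq (e, s') else 0) t.1 t.2); last by apply: eq_bigr => -[].
rewrite -(pair_bigA _ (fun e s' => if s' == s then dq (e, s') else 0)) /= big_bool /=.
by rewrite -!big_mkcond !big_pred1_eq.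
Qed.

Lemma dq_sym s : s != ord0 -> dq (true, s) = dq (false, s).
Proof.
move=> s0; rewrite /dq; congr fine.
have := sy (meas_dsc (true, s)); rewrite -[X in P X = _]/((fun w => dsc (Z w)) @^-1` [set (true, s)]) => ->.
congr (P _); apply/seteqP; split=> w /=; rewrite /dsc.
  case=> h1 h2; have -> : (Z w < 0) = false by apply/negbTE; rewrite -leNgt; move: h1; rewrite oppr_lt0 => /ltW.
  by rewrite -h2 /dI /da normrN.
case=> h1 h2; have -> : dI (- Z w) = s by rewrite -h2 /dI /da normrN.
rewrite oppr_lt0; congr (_, _); rewrite lt_neqAle leNgt h1 andbT; apply/negP => /eqP e.
move: s0; rewrite -h2 => /negP; apply; apply/eqP/val_inj; rewrite /= dI_val /da -e normr0 mulr0 truncn0.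
by rewrite min0n.
Qed.

(** Zero is coded with the positive sign, so at magnitude 0 the two signs may have different
    probabilities; but both stand for the value 0. At the other magnitudes symmetry applies. *)
Lemma dlaw (f : R -> R) : \sum_t dq t * f (dv t) = \sum_t (dm t.2 / 2%:R) * f (dv t).
Proof.
have E (F : bool * 'I_(2 * M ^ 2).+1 -> R) : \sum_t F t = \sum_s (F (true, s) + F (false, s)).
  transitivity (\sum_t (fun e s => F (e, s)) t.1 t.2); first by apply: eq_bigr => -[].
  by rewrite -(pair_bigA _ (fun e s => F (e, s))) /= big_bool /= -big_split.
rewrite !E; apply: eq_bigr => s _ /=; rewrite -(dq_add s).
have [->|s0] := eqVneq s ord0.
  have -> : dv (true, ord0) = dv (false, ord0) by rewrite /dv /dmag /= mul0r !mulr0.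
  by lra.
by rewrite (dq_sym s0); lra.
Qed.

End OneZ.
End Disc.

Section Joint.
Context {R : realType} {d : measure_display} {Omega : measurableType d} (P : probability Omega R).
Variables (n' : nat) (X Y : 'I_n'.+1 -> Omega -> R).
Let n := n'.+1.
Let ZZ (k : 'I_n'.+1 + 'I_n'.+1) : Omega -> R := match k with inl i => X i | inr j => Y j end.
Hypothesis ind : mutually_independent P ZZ.
Variable M : nat.
Hypothesis M0 : (0 < M)%N.
Let D := (bool * 'I_(2 * M ^ 2).+1)%type.

Lemma mXj i : measurable_fun setT (X i). Proof. exact: (ind.1 (inl i)). Qed.
Lemma mYj j : measurable_fun setT (Y j). Proof. exact: (ind.1 (inr j)). Qed.

Definition nx (i : nat) : Omega -> R := X (inord i).
Definition ny (i : nat) : Omega -> R := Y (inord i).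

Let T : finType := ({ffun 'I_n -> bool * 'I_(2 * M ^ 2).+1} * {ffun 'I_n -> bool * 'I_(2 * M ^ 2).+1})%type.
Definition xi (w : Omega) : T :=
  ([ffun i : 'I_n => dsc M (X i w)], [ffun j : 'I_n => dsc M (Y j w)]).

Let BB (t : T) (k : 'I_n + 'I_n) : set R :=
  match k with inl i => dsc M @^-1` [set t.1 i] | inr j => dsc M @^-1` [set t.2 j] end.

Let BB_meas t k : measurable (BB t k).
Proof. by case: k => i; exact: meas_dsc. Qed.

Lemma xi_pre t : xi @^-1` [set t] = \bigcap_(k in setT) (ZZ k @^-1` BB t k).
Proof.
case: t => f g; apply/seteqP; split=> w /=.
  by case=> <- <- [i|j] _ /=; rewrite ffunE.
move=> h; congr (_, _); apply/ffunP => i; rewrite ffunE.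
  exact: (h (inl i) I).
exact: (h (inr i) I).
Qed.

Lemma xi_meas t : measurable (xi @^-1` [set t]).
Proof.
rewrite xi_pre; apply: fin_bigcap_measurable; first exact: finite_finset.
by move=> k _; rewrite -[X in measurable X]setTI; apply: (ind.1 k).
Qed.

Lemma xi_prob t : fine (P (xi @^-1` [set t])) =
  (\prod_(i < n) @dq R M d Omega P (nx i) (t.1 i)) * \prod_(j < n) @dq R M d Omega P (ny j) (t.2 j).
Proof.
rewrite xi_pre ind.2 // big_sumType /=.
have e (Z : 'I_n -> Omega -> R) (f : 'I_n -> bool * 'I_(2 * M ^ 2).+1) : (forall i, measurable_fun setT (Z i)) ->
   (\prod_(i < n) P (Z i @^-1` (dsc M @^-1` [set f i])))%E = (\prod_(i < n) @dq R M d Omega P (Z i) (f i))%:E.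
  move=> mZ; rewrite (big_morph EFin EFinM (erefl 1%E)); apply: eq_bigr => i _.
  rewrite /dq fineK // fin_num_measure // -[X in measurable X]setTI.
  exact: (mZ i measurableT _ (meas_dsc (f i))).
rewrite (e X) ?(e Y) /=; [|exact: mYj|exact: mXj].
by congr (_ * _); apply: eq_bigr => i _; rewrite /nx /ny inord_val.
Qed.

Let s0 : nat -> bool * 'I_(2 * M ^ 2).+1 := fun=> (false, ord0).
Let xM (w : Omega) : nat -> R := fun i => dval M (nx i w).
Let yM (w : Omega) : nat -> R := fun i => dval M (ny i w).
Let local2 (U : Type) (F : (nat -> R) -> (nat -> R) -> U) : Prop := forall x x' y y' : nat -> R,
  (forall i, (i < n)%N -> x i = x' i) -> (forall i, (i < n)%N -> y i = y' i) -> F x y = F x' y'.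

Lemma disc_factor (U : Type) (F : (nat -> R) -> (nat -> R) -> U) w : local2 F ->
  F (xM w) (yM w) = F (fun i => @dv R M (extf s0 (xi w).1 i)) (fun i => @dv R M (extf s0 (xi w).2 i)).
Proof.
move=> lF; apply: lF => i ni; rewrite -[i]/(nat_of_ord (Ordinal ni)) extf_lt ffunE.
  by rewrite /xM /nx inord_val.
by rewrite /yM /ny inord_val.
Qed.

Lemma disc_meas d' (U : measurableType d') (F : (nat -> R) -> (nat -> R) -> U) : local2 F ->
  measurable_fun setT (fun w => F (fun i => dval M (nx i w)) (fun i => dval M (ny i w))).
Proof.
move=> lF.
rewrite (_ : (fun w => _) = fun w => (fun t : T => F (fun i => @dv R M (extf s0 t.1 i)) (fun i => @dv R M (extf s0 t.2 i))) (xi w)).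
  exact: (@meas_fin d Omega T d' U xi (fun t : T => F (fun i => @dv R M (extf s0 t.1 i)) (fun i => @dv R M (extf s0 t.2 i))) xi_meas).
by apply/funext => w; rewrite -(disc_factor w lF).
Qed.

Hypothesis syX : forall i, symmetric_rv P (X i).
Hypothesis syY : forall j, symmetric_rv P (Y j).

Lemma disc_expect (F : (nat -> R) -> (nat -> R) -> R) x0 y0 : local2 F -> (forall x y, 0 <= F x y) ->
  (\int[P]_w (F (fun i => dval M (nx i w)) (fun i => dval M (ny i w)))%:E =
   (Ev n (wt (fun i => @dm R M d Omega P (nx i))) (fv (fun=> @dmag R M)) x0 (fun x =>
      Ev n (wt (fun i => @dm R M d Omega P (ny i))) (fv (fun=> @dmag R M)) y0 (F x)))%:E)%E.
Proof.
move=> lF F0.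
pose G (t : T) := F (fun i => @dv R M (extf s0 t.1 i)) (fun i => @dv R M (extf s0 t.2 i)).
transitivity (\int[P]_w (G (xi w))%:E)%E.
  by apply: eq_integral => w _; rewrite (disc_factor w lF).
rewrite (@int_fin R d Omega P T xi G xi_meas (fun t => F0 _ _)); congr EFin.
transitivity (\sum_(t : T) (fun f g => G (f, g) * ((\prod_(i < n) @dq R M d Omega P (nx i) (f i)) * \prod_(j < n) @dq R M d Omega P (ny j) (g j))) t.1 t.2).
  by apply: eq_bigr => -[f g] _; rewrite xi_prob.
rewrite -(pair_bigA _ (fun f g => G (f, g) * ((\prod_(i < n) @dq R M d Omega P (nx i) (f i)) * \prod_(j < n) @dq R M d Omega P (ny j) (g j)))) /=.
have lawX i (f : R -> R) : \sum_t @dq R M d Omega P (nx i) t * f (@dv R M t) =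
   \sum_bs wt (fun i => @dm R M d Omega P (nx i)) i bs * f (fv (fun=> @dmag R M) i bs).
  by apply: dlaw => //; [exact: mXj | exact: syX].
have lawY i (f : R -> R) : \sum_t @dq R M d Omega P (ny i) t * f (@dv R M t) =
   \sum_bs wt (fun i => @dm R M d Omega P (ny i)) i bs * f (fv (fun=> @dmag R M) i bs).
  by apply: dlaw => //; [exact: mYj | exact: syY].
transitivity (Ev n (fun i => @dq R M d Omega P (nx i)) (fun=> @dv R M) (fun i => @dv R M (s0 i)) (fun x =>
   Ev n (fun i => @dq R M d Omega P (ny i)) (fun=> @dv R M) (fun i => @dv R M (s0 i)) (F x))).
  rewrite -(Ev_map n (fun i => @dq R M d Omega P (nx i)) (fun=> @dv R M) s0) Ex_ffun; apply: eq_bigr => f _.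
  rewrite -(Ev_map n (fun i => @dq R M d Omega P (ny i)) (fun=> @dv R M) s0) Ex_ffun mulr_suml; apply: eq_bigr => g _.
  by rewrite -mulrA; congr (_ * _); rewrite mulrC.
rewrite (Ev_eqlaw (w' := wt (fun i => @dm R M d Omega P (nx i))) (v' := fv (fun=> @dmag R M))) //.
transitivity (Ev n (wt (fun i => @dm R M d Omega P (nx i))) (fv (fun=> @dmag R M)) (fun i => @dv R M (s0 i)) (fun x =>
      Ev n (wt (fun i => @dm R M d Omega P (ny i))) (fv (fun=> @dmag R M)) y0 (F x))).
  apply: Ev_ext => x; rewrite (Ev_eqlaw (w' := wt (fun i => @dm R M d Omega P (ny i))) (v' := fv (fun=> @dmag R M))) //.
  by apply: Ev_local => y y' h; exact: lF.
by apply: Ev_local => x x' h; apply: Ev_ext => y; exact: lF.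
Qed.


Lemma disc_model (Z : 'I_n'.+1 -> Omega -> R) : (forall i, measurable_fun setT (Z i)) ->
  (forall i, log_concave_tails P (Z i)) -> (forall i, tail_normalized P (Z i)) ->
  model (fun i => @dm R M d Omega P (Z (inord i))) (fun=> @dk M).
Proof.
move=> mZ lcZ nZ i; split; first exact: dm_ge0.
- exact: dm_sum1.
- exact: dm_lcQ.
- exact: dm_eta.
Qed.

(** A coordinate at level [j > 0] satisfies [|x| <= j + 1 <= 64 j], while its discrete cost is at
    least that of the tail at [64 j]; the true cost is no larger. *)
Lemma disc_ball (Z : 'I_n'.+1 -> Omega -> R) q (x : nat -> R) : (forall i, measurable_fun setT (Z i)) ->
  (forall i, log_concave_tails P (Z i)) -> (forall i, tail_normalized P (Z i)) ->
  ball n (fun i => tailQ (@dm R M d Omega P (Z (inord i))) (@dk M)) q x -> Bball P Z q (fun i : 'I_n'.+1 => x i).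
Proof.
move=> mZ lcZ nZ bx; have mod := disc_model mZ lcZ nZ.
have [l l1 l2] := ball_lev mod bx.
rewrite /Bball /=; apply: (@le_trans _ _ (\sum_(i < n) (l i)%:E)%E); last by rewrite sumEFin lee_fin.
apply: lee_sum => i _; have [l0 ad] := l2 i (ltn_ord i).
rewrite /hatN; case: ad => [[x1 x2]|[j [j0 xj Qj]]]; first by rewrite x1 lee_fin.
have [h1 h2 h3 h4] := mod i.
have jl := adm_level h1 h2 h3 h4 Qj.
have jR : 1 <= j%:R :> R by rewrite ler1n.
case: ifP => h.
  rewrite lee_fin; apply: (@le_trans _ _ 1); last by lra.
  by rewrite -(real_normK (num_real (x i))) exprn_ile1.
rewrite (dm_tailQ M0 P (mZ _)) in Qj.
move: Qj; case: ifP => _; last first.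
  by rewrite leNgt expR_gt0.
rewrite inord_val => Qj; apply: expR_tailN; first exact: mZ.
apply: le_trans Qj _; apply: tailG_noninc; first exact: mZ.
by apply: le_trans xj _; rewrite -natr1; lra.
Qed.

End Joint.

(** * Norms and functionals of L_q *)

Section LqFacts.
Context {R : realType} {d : measure_display} {V : measurableType d} (mu : {measure set V -> \bar R}).
Variable q : R.
Hypothesis q1 : 1 <= q.
Let q0 : 0 < q. Proof. exact: lt_le_trans ltr01 q1. Qed.
Notation inL := (in_Lq mu q).

Definition Lqf (g : V -> R) : R := fine (Lqnorm mu q g).

Lemma LqfE g : inL g -> Lqnorm mu q g = (Lqf g)%:E.
Proof. by move=> [_ h]; rewrite /Lqf fineK // ge0_fin_numE // Lnorm_ge0. Qed.

Lemma Lqf_ge0 g : 0 <= Lqf g.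
Proof. by rewrite /Lqf fine_ge0 // Lnorm_ge0. Qed.

Lemma LqnormZ c g : inL g -> Lqnorm mu q (fun v => c * g v) = (`|c|%:E * Lqnorm mu q g)%E.
Proof.
move=> [mg fg].
have qE : (1 <= q%:E)%E by rewrite lee_fin.
have gL : g \in Lfun mu q%:E by rewrite inE; apply/andP; split; rewrite inE.
exact: (LnormZ (Lfun_Sub qE gL) c).
Qed.

Lemma in_LqZ c g : inL g -> inL (fun v => c * g v).
Proof.
move=> lg; split; first by apply: measurable_funM => //; exact: lg.1.
by rewrite LqnormZ // LqfE // -EFinM ltry.
Qed.

Lemma LqnormD g h : inL g -> inL h -> (Lqnorm mu q (fun v => g v + h v)%R <= Lqnorm mu q g + Lqnorm mu q h)%E.
Proof. by move=> [mg _] [mh _]; exact: minkowski_EFin. Qed.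

Lemma in_LqD g h : inL g -> inL h -> inL (fun v => g v + h v).
Proof.
move=> lg lh; split; first by apply: measurable_funD; [exact: lg.1 | exact: lh.1].
by apply: le_lt_trans (LqnormD lg lh) _; rewrite !LqfE // -EFinD ltry.
Qed.

Lemma in_Lq0 : inL (fun=> 0).
Proof.
split; first exact: measurable_cst.
by rewrite /Lqnorm -/(cst 0%E) Lnorm0 ?ltry // eqe gt_eqF.
Qed.

Lemma Lqf0 : Lqf (fun=> 0) = 0.
Proof. by rewrite /Lqf /Lqnorm -/(cst 0%E) Lnorm0 // eqe gt_eqF. Qed.

Lemma LqfZ c g : inL g -> Lqf (fun v => c * g v) = `|c| * Lqf g.
Proof. by move=> lg; apply/EFin_inj; rewrite EFinM -!LqfE // ?LqnormZ //; exact: in_LqZ. Qed.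

Lemma LqfD g h : inL g -> inL h -> Lqf (fun v => g v + h v) <= Lqf g + Lqf h.
Proof. by move=> lg lh; rewrite -lee_fin EFinD -!LqfE //; [exact: LqnormD | exact: in_LqD]. Qed.

Lemma in_Lq_sum (I : Type) (r : seq I) (g : I -> V -> R) : (forall i, inL (g i)) ->
  inL (fun v => \sum_(i <- r) g i v).
Proof.
move=> lg; elim: r => [|i r IH].
  by rewrite (_ : (fun v => _) = (fun=> 0)) //; [exact: in_Lq0 | apply/funext => v; rewrite big_nil].
rewrite (_ : (fun v => _) = fun v => g i v + \sum_(j <- r) g j v); first exact: in_LqD.
by apply/funext => v; rewrite big_cons.
Qed.

Lemma Lqf_sum (I : Type) (r : seq I) (g : I -> V -> R) : (forall i, inL (g i)) ->
  Lqf (fun v => \sum_(i <- r) g i v) <= \sum_(i <- r) Lqf (g i).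
Proof.
move=> lg; elim: r => [|i r IH].
  by rewrite big_nil (_ : (fun v => _) = (fun=> 0)) ?Lqf0 //; apply/funext => v; rewrite big_nil.
rewrite big_cons (_ : (fun v => _) = fun v => g i v + \sum_(j <- r) g j v); last first.
  by apply/funext => v; rewrite big_cons.
by apply: le_trans (LqfD (lg i) (in_Lq_sum _ lg)) _; rewrite lerD2l.
Qed.

Section Functional.
Variable f : (V -> R) -> R.
Hypothesis fB : f \in dual_unit_ball mu q.
Let fl c g h : inL g -> inL h -> f (fun v => c * g v + h v) = c * f g + f h.
Proof. by move=> *; have [-> //] := set_mem fB. Qed.

Lemma dual_le g : inL g -> `|f g| <= Lqf g.
Proof. by move=> lg; have [_ /(_ g lg)] := set_mem fB; rewrite LqfE // lee_fin. Qed.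

Lemma dual0 : f (fun=> 0) = 0.
Proof. by have := dual_le in_Lq0; rewrite Lqf0 normr_le0 => /eqP. Qed.

Lemma dual_sum (I : Type) (r : seq I) (c : I -> R) (g : I -> V -> R) : (forall i, inL (g i)) ->
  f (fun v => \sum_(i <- r) c i * g i v) = \sum_(i <- r) c i * f (g i).
Proof.
move=> lg; elim: r => [|i r IH].
  by rewrite big_nil -[RHS]dual0; congr f; apply/funext => v; rewrite big_nil.
rewrite big_cons -IH -fl //; last by apply: in_Lq_sum => j; exact: in_LqZ.
by congr f; apply/funext => v; rewrite big_cons.
Qed.
End Functional.

Lemma dual_zero : (fun=> 0) \in dual_unit_ball mu q.
Proof.
apply/mem_set; split=> [c g h _ _|g _]; first by rewrite mulr0 addr0.
by rewrite normr0 Lnorm_ge0.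
Qed.

(** The extremal functional of Hoelder's inequality: integration against [sg g |g / N|^(q - 1)],
    which has norm 1 in the conjugate exponent. For [q = 1] that exponent is infinite, and the bound
    [|w| <= 1] is used directly. *)
Lemma norming g : inL g -> exists2 f, f \in dual_unit_ball mu q & f g = Lqf g.
Proof.
move=> lg; have mg := lg.1.
have [N0|N0] := eqVneq (Lqf g) 0.
  by exists (fun=> 0); [exact: dual_zero | rewrite N0].
have Np : 0 < Lqf g by rewrite lt_neqAle eq_sym N0 Lqf_ge0.
set N := Lqf g in N0 Np *.
pose u v := `|N^-1 * g v|.
pose w v := Num.sg (g v) * u v `^ (q - 1).
have mu' : measurable_fun setT u.
  by apply: (measurableT_comp (@normr_measurable R setT)); apply: measurable_funM.
have msg : measurable_fun setT (fun v => Num.sg (g v)).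
  pose A := g @^-1` `]0, +oo[; pose B := g @^-1` `]-oo, 0[.
  have mA : measurable A by rewrite -[A]setTI; apply: mg.
  have mB : measurable B by rewrite -[B]setTI; apply: mg.
  rewrite (_ : (fun v => _) = fun v => \1_A v - \1_B v :> R).
    by apply: measurable_funB; exact: measurable_indic.
  apply/funext => v; rewrite !indicE.
  have hA : (v \in A) = (0 < g v).
    by apply/idP/idP; rewrite inE /A /= in_itv /= andbT.
  have hB : (v \in B) = (g v < 0).
    by apply/idP/idP; rewrite inE /B /= in_itv /=.
  rewrite hA hB; case: (ltgtP (g v) 0) => h.
  - by rewrite ltr0_sg // sub0r.
  - by rewrite gtr0_sg // subr0.
  - by rewrite h sgr0 subr0.
have mw : measurable_fun setT w.
  by apply: measurable_funM => //; exact: (measurableT_comp (measurable_powR _)).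
have gw v : g v * w v = N * u v `^ q.
  rewrite /w mulrA; have -> : g v * Num.sg (g v) = `|g v| by rewrite [LHS]mulrC -normrEsg.
  have e : `|g v| = N * u v by rewrite /u normrM gtr0_norm ?invr_gt0 // mulVKf.
  by rewrite e -mulrA mulr_powRB1 // /u.
have uq : (\int[mu]_v (u v `^ q)%:E = 1)%E.
  have h : Lqnorm mu q (fun v => N^-1 * g v) = 1%E.
    by rewrite LqnormZ // LqfE // -EFinM gtr0_norm ?invr_gt0 // mulVf.
  transitivity (Lqnorm mu q (fun v => N^-1 * g v)%R `^ q)%E.
    rewrite /Lqnorm poweR_Lnorm ?gt_eqF //; apply: eq_integral.
  by rewrite h poweR_EFin powR1.
have H h : inL h -> (\int[mu]_v `|(h v * w v)%:E| <= Lqnorm mu q h)%E.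
  move=> lh; have mh := lh.1.
  have [e1|e1] := eqVneq q 1.
    rewrite /Lqnorm e1 Lnorm1; apply: ge0_le_integral => //.
    - by apply: measurableT_comp => //; apply/measurable_EFinP; exact: measurable_funM.
    - by apply: measurableT_comp => //; apply/measurable_EFinP.
    - move=> v _; rewrite lee_fin normrM ler_piMr // /w e1 subrr powRr0 mulr1.
      by rewrite normr_sg lern1; case: (_ != 0).
  have q1' : 1 < q by rewrite lt_neqAle eq_sym e1.
  pose q' := q / (q - 1).
  have qm : 0 < q - 1 by lra.
  have q'0 : 0 < q' by rewrite divr_gt0.
  have hq : q^-1 + q'^-1 = 1 by rewrite /q' invf_div; field; rewrite gt_eqF.
  have hw : Lnorm mu q'%:E (EFin \o w) = 1%E.
    rewrite unlock (_ : \int[mu]_x _ = 1)%E ?poweR_EFin ?powR1 //.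
    rewrite -[RHS]uq; apply: eq_integral => v _ /=.
    congr EFin.
    have [g0|g0] := eqVneq (g v) 0.
      by rewrite /w /u g0 sgr0 mul0r mulr0 normr0 !powR0 // gt_eqF.
    rewrite /w normrM normr_sg g0 mul1r ger0_norm ?powR_ge0 // -powRrM.
    by congr (_ `^ _); rewrite /q'; field; rewrite gt_eqF.
  by have := hoelder mu mh mw q0 q'0 hq; rewrite Lnorm1 hw mule1.
have I h : inL h -> mu.-integrable setT (fun v => (h v * w v)%:E).
  move=> lh; apply/integrableP; split.
    by apply/measurable_EFinP; apply: measurable_funM => //; exact: lh.1.
  by apply: le_lt_trans (H h lh) _; rewrite LqfE // ltry.
exists (fun h => Rintegral mu setT (fun v => h v * w v)).
  apply/mem_set; split=> [c g1 h1 l1 l2|h lh].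
    transitivity (Rintegral mu setT (fun v => c * (g1 v * w v) + h1 v * w v)).
      by apply: eq_Rintegral => v _; rewrite mulrDl mulrA.
    rewrite RintegralD //; last exact: I; last first.
      rewrite (_ : _ \o _ = fun v => (c * g1 v * w v)%:E); first exact: I (in_LqZ c l1).
      by apply/funext => v /=; rewrite mulrA.
    by rewrite RintegralZl //; exact: I.
  apply: le_trans (H h lh); rewrite EFin_normr_Rintegral //; last exact: I.
  by apply: le_abse_integral => //; have /integrableP[] := I h lh.
rewrite /Rintegral; under eq_integral => v _ do rewrite gw.
rewrite (_ : \int[mu]_x _ = N%:E)%E //.
under eq_integral => v _ do rewrite EFinM.
rewrite ge0_integralZl_EFin ?uq ?mule1 // ?ltW // => [v _|].
  by rewrite lee_fin powR_ge0.
by apply/measurable_EFinP; exact: (measurableT_comp (measurable_powR _)).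
Qed.

End LqFacts.

Section ZZ.
Context {R : realType} {d : measure_display} {V : measurableType d} (mu : {measure set V -> \bar R}).
Variables (q : R) (n' : nat) (a : 'I_n'.+1 -> 'I_n'.+1 -> V -> R).
Hypothesis q1 : 1 <= q.
Let n := n'.+1.
Hypothesis La : forall i j, in_Lq mu q (a i j).

Definition cmb (x y : nat -> R) (v : V) : R := \sum_(i < n'.+1) \sum_(j < n'.+1) a i j v * x i * y j.
Definition chaos (x y : nat -> R) : R := Lqf mu q (cmb x y).

Lemma cmb_pair x y : cmb x y =
  fun v => \sum_(ij : 'I_n * 'I_n) x ij.1 * y ij.2 * a ij.1 ij.2 v.
Proof.
apply/funext => v; rewrite /cmb (pair_bigA _ (fun (i j : 'I_n) => a i j v * x i * y j)) /=.
by apply: eq_bigr => -[i j] _ /=; rewrite [RHS]mulrC mulrA.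
Qed.

Lemma in_Lq_cmb x y : in_Lq mu q (cmb x y).
Proof. by rewrite cmb_pair; apply: in_Lq_sum => // ij; apply: in_LqZ. Qed.

Lemma chaosE x y : Lqnorm mu q (cmb x y) = (chaos x y)%:E.
Proof. by rewrite LqfE //; exact: in_Lq_cmb. Qed.

Lemma chaos_ge0 x y : 0 <= chaos x y. Proof. exact: Lqf_ge0. Qed.

Lemma chaos_ext (x x' y y' : nat -> R) : (forall i, (i < n)%N -> x i = x' i) ->
  (forall i, (i < n)%N -> y i = y' i) -> chaos x y = chaos x' y'.
Proof.
move=> hx hy; congr (Lqf mu q _); apply/funext => v; apply: eq_bigr => i _; apply: eq_bigr => j _.
by rewrite hx // hy.
Qed.

Lemma chaosZ c e x y : 0 <= c -> 0 <= e -> chaos (fun i => c * x i) (fun i => e * y i) = c * e * chaos x y.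
Proof.
move=> c0 e0; rewrite /chaos (_ : cmb _ _ = fun v => (c * e) * cmb x y v).
  by rewrite LqfZ ?ger0_norm ?mulr_ge0 //; exact: in_Lq_cmb.
apply/funext => v; rewrite /cmb mulr_sumr; apply: eq_bigr => i _; rewrite mulr_sumr.
by apply: eq_bigr => j _; ring.
Qed.

Lemma chaos_lip x y x' y' : chaos x y <= chaos x' y' +
  \sum_(i < n'.+1) \sum_(j < n'.+1) `|x i * y j - x' i * y' j| * Lqf mu q (a i j).
Proof.
pose D v := \sum_(ij : 'I_n * 'I_n) (x ij.1 * y ij.2 - x' ij.1 * y' ij.2) * a ij.1 ij.2 v.
have LD : in_Lq mu q D by apply: in_Lq_sum => // ij; apply: in_LqZ.
rewrite {1}/chaos (_ : cmb x y = fun v => cmb x' y' v + D v); last first.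
  apply/funext => v; rewrite !cmb_pair /D -big_split; apply: eq_bigr => ij _ /=.
  by rewrite -mulrDl addrC subrK.
apply: le_trans (LqfD q1 (in_Lq_cmb _ _) LD) _; rewrite lerD2l.
rewrite (pair_bigA _ (fun i j : 'I_n => `|x i * y j - x' i * y' j| * Lqf mu q (a i j))) /=.
have LDi (ij : 'I_n * 'I_n) : in_Lq mu q (fun v => (x ij.1 * y ij.2 - x' ij.1 * y' ij.2) * a ij.1 ij.2 v).
  exact: in_LqZ.
apply: le_trans (Lqf_sum q1 _ LDi) _.
by apply: ler_sum => ij _; rewrite LqfZ.
Qed.

Definition fb (f : (V -> R) -> R) (i j : nat) : R := f (a (inord i) (inord j)).

Lemma dual_bil f x y : f \in dual_unit_ball mu q -> f (cmb x y) = bil n (fb f) x y.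
Proof.
move=> fB; rewrite cmb_pair (dual_sum q1 fB _ (fun ij : 'I_n * 'I_n => x ij.1 * y ij.2) (g := fun ij => a ij.1 ij.2)) //.
rewrite /bil.
transitivity (\sum_(i < n) \sum_(j < n) x i * y j * f (a i j)).
  by rewrite (pair_bigA _ (fun i j : 'I_n => x i * y j * f (a i j))).
apply: eq_bigr => i _; rewrite mulr_sumr; apply: eq_bigr => j _.
by rewrite /fb !inord_val; ring.
Qed.

Lemma bil_chaos f x y : f \in dual_unit_ball mu q -> `|bil n (fb f) x y| <= chaos x y.
Proof. by move=> fB; rewrite -dual_bil //; apply: dual_le => //; exact: in_Lq_cmb. Qed.

Lemma chaos_norming x y : exists2 f, f \in dual_unit_ball mu q & bil n (fb f) x y = chaos x y.
Proof.
have [f fB e] := norming q1 (in_Lq_cmb x y).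
by exists f => //; rewrite -dual_bil.
Qed.

End ZZ.

Section FatouLe.
Context {R : realType} {d : measure_display} {T : measurableType d} (mu : {measure set T -> \bar R}).

Lemma fatou_le (u : nat -> T -> R) (g : T -> R) (K : R) :
  (forall k, measurable_fun setT (u k)) -> (forall k w, 0 <= u k w) ->
  (forall w, u ^~ w @ \oo --> g w) ->
  (\forall k \near \oo, (\int[mu]_w (u k w)%:E <= K%:E)%E) ->
  (\int[mu]_w (g w)%:E <= K%:E)%E.
Proof.
move=> mu' u0 ug uK.
have e w : limn_einf (fun k => (u k w)%:E) = (g w)%:E.
  by apply: (cvg_limn_einf_sup _).1; apply: cvg_EFin; [exact: nearW | exact: ug].
under eq_integral => w _ do rewrite -e.
apply: le_trans (fatou mu measurableT _ _) _.
- by move=> k; exact/measurable_EFinP.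
- by move=> k w _; rewrite lee_fin.
rewrite limn_einf_lim; apply: lime_le; first exact: is_cvg_einfs.
near=> k; apply: le_trans (_ : (\int[mu]_w (u k w)%:E <= _)%E); last by near: k.
by apply: ereal_inf_lbound; exists k => //=.
Unshelve. all: by end_near.
Qed.

End FatouLe.

Section Err.
Context {R : realType}.
Variable M : nat.
Hypothesis M0 : (0 < M)%N.
Let MR : 0 < M%:R :> R. Proof. by rewrite ltr0n. Qed.

Lemma err1 (x x' y y' : R) : `|x - x'| <= (1 + x ^+ 2) / M%:R -> `|x'| <= `|x| ->
  `|y - y'| <= (1 + y ^+ 2) / M%:R ->
  `|x * y - x' * y'| <= 2%:R / M%:R * (2%:R + x ^+ 4 + y ^+ 4).
Proof.
move=> hx hx' hy.
have -> : x * y - x' * y' = (x - x') * y + x' * (y - y') by ring.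
apply: le_trans (ler_normD _ _) _; rewrite !normrM.
have b z : `|z| <= 1 + z ^+ 2 :> R.
  rewrite -(real_normK (num_real z)); have := sqr_ge0 (`|z| - 1 / 2%:R); nra.
have i0 : 0 <= M%:R^-1 :> R by rewrite invr_ge0 ltW.
have A : `|x - x'| * `|y| <= (1 + x ^+ 2) * (1 + y ^+ 2) / M%:R.
  apply: (@le_trans _ _ ((1 + x ^+ 2) / M%:R * (1 + y ^+ 2))); first by apply: ler_pM.
  by rewrite mulrAC.
have B : `|x'| * `|y - y'| <= (1 + x ^+ 2) * (1 + y ^+ 2) / M%:R.
  rewrite -mulrA; apply: ler_pM => //; exact: le_trans hx' (b x).
have C : (1 + x ^+ 2) * (1 + y ^+ 2) <= 2%:R + x ^+ 4 + y ^+ 4.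
  have := sqr_ge0 (x ^+ 2 - y ^+ 2); have := sqr_ge0 (x ^+ 2 - 1); have := sqr_ge0 (y ^+ 2 - 1).
  set X := x ^+ 2; set Y := y ^+ 2.
  have -> : x ^+ 4 = X ^+ 2 by rewrite /X -exprM.
  have -> : y ^+ 4 = Y ^+ 2 by rewrite /Y -exprM.
  nra.
have := ler_wpM2r i0 C; move: A B; set U := (1 + x ^+ 2) * _; set W := 2%:R + _ + _.
by rewrite (_ : 2%:R / M%:R * W = W / M%:R + W / M%:R); [lra | field; rewrite gt_eqF].
Qed.

End Err.

(** * Passage to the limit *)

Section Conv.
Context {R : realType}.

Lemma cvg_harm (u : nat -> R) (l c : R) : (forall k, `|u k - l| <= c / k.+1%:R) -> u @ \oo --> l.
Proof.
move=> h; apply/cvgrPdist_le => e e0.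
have c0 : 0 <= c by have := h 0; rewrite divr1; apply: le_trans.
near=> k; rewrite distrC; apply: le_trans (h k) _.
rewrite ler_pdivrMr // mulrC -ler_pdivrMr //.
have : (Num.trunc (c / e) <= k)%N by near: k; exact: nbhs_infty_ge.
rewrite -ltnS => hk; apply: ltW; rewrite -truncn_lt_nat //; exact: divr_ge0 c0 (ltW e0).
Unshelve. all: by end_near.
Qed.

Lemma dval_cvg (x : R) : dval k.+1 x @[k --> \oo] --> x.
Proof.
apply: (@cvg_harm _ _ (1 + x ^+ 2)) => k; rewrite distrC; exact: dval_err.
Qed.

End Conv.

Section IntLin.
Context {R : realType} {d : measure_display} {T : measurableType d} (mu : {measure set T -> \bar R}).
Variables f g : T -> R.
Hypotheses (mf : measurable_fun setT f) (mg : measurable_fun setT g).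
Hypotheses (f0 : forall w, 0 <= f w) (g0 : forall w, 0 <= g w).

Lemma int_add : (\int[mu]_w (f w + g w)%:E = \int[mu]_w (f w)%:E + \int[mu]_w (g w)%:E)%E.
Proof.
under eq_integral => w _ do rewrite EFinD.
by rewrite ge0_integralD //; [move=> w _; rewrite lee_fin|exact/measurable_EFinP|
  move=> w _; rewrite lee_fin|exact/measurable_EFinP].
Qed.

Lemma int_scale c : 0 <= c -> (\int[mu]_w (c * f w)%:E = c%:E * \int[mu]_w (f w)%:E)%E.
Proof.
move=> c0; under eq_integral => w _ do rewrite EFinM.
by rewrite ge0_integralZl_EFin //; [move=> w _; rewrite lee_fin|exact/measurable_EFinP].
Qed.

Lemma int_le : (forall w, f w <= g w) -> (\int[mu]_w (f w)%:E <= \int[mu]_w (g w)%:E)%E.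
Proof.
move=> fg; apply: ge0_le_integral => //; try exact/measurable_EFinP.
- by move=> w _; rewrite lee_fin.
- by move=> w _; rewrite lee_fin.
Qed.

End IntLin.

Section Moment.
Context {R : realType} {S0 : finType} (m : nat -> S0 -> R) (k : nat -> S0 -> nat) (a : nat -> S0 -> R).
Hypothesis (mod : model m k).
Hypothesis ak : forall i s, a i s <= 64%:R * (k i s).+1%:R.
Hypothesis a0 : forall i s, 0 <= a i s.

Definition K4 : R := 1 + ((8%:R * CI1) ^+ 2 * 64%:R ^+ 2) ^+ 6.

(** Since [y^4 <= 1 + |y|^12], the bound [lin12] can be reused for a single coordinate. These
    moments control the discretization error. *)
Lemma mom4 n i x : (i < n)%N -> Ev n (wt m) (fv a) x (fun y => y i ^+ 4) <= K4.
Proof.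
move=> ni; have w0 := wt_ge0 mod; have w1 := wt_sum1 mod.
pose Phi (y : nat -> R) := `|y i|.
have cP : cconv Phi.
  move=> z j z1 z2 t /andP[t0 t1]; rewrite /Phi /upd; case: eqP => _.
    apply: le_trans (ler_normD _ _) _.
    by rewrite !normrM (ger0_norm t0) (ger0_norm (_ : 0 <= 1 - t)) // subr_ge0.
  by rewrite -mulrDl addrC subrK mul1r.
apply: (@le_trans _ _ (Ev n (wt m) (fv a) x (fun y => 1 + Phi y ^+ 12))).
  apply: Ev_le => // y; rewrite /Phi.
  have -> : y i ^+ 4 = `|y i| ^+ 4 by rewrite -normrX ger0_norm // (exprM _ 2 2) sqr_ge0.
  have := normr_ge0 (y i); set z := `|y i| => z0.
  case: (lerP z 1) => z1; first by rewrite (le_trans (exprn_ile1 _ z0 z1)) // lerDl exprn_ge0.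
  have : z ^+ 4 <= z ^+ 12 by rewrite ler_weXn2l // ltW.
  by lra.
rewrite EvD Ev_cst // /K4 lerD2l.
have c12 := cconvX 11 cP (fun y => normr_ge0 _).
apply: le_trans (fine_le mod a0 ak x x c12 _) _.
  by move=> y y' h; rewrite /Phi h.
have := lin12 mod n (fun j => if j == i then 64%:R else 0) x.
have -> : \sum_(j < n) (if nat_of_ord j == i then 64%:R else 0) ^+ 2 = 64%:R ^+ 2 :> R.
  rewrite (bigD1 (Ordinal ni)) //= eqxx big1 ?addr0 // => j ne.
  by rewrite ifF ?expr0n //; apply/negbTE.
apply: le_trans; rewrite le_eqVlt; apply/orP; left; apply/eqP; apply: Ev_ext => y.
have -> : \sum_(j < n) (if nat_of_ord j == i then 64%:R else 0) * y j = 64%:R * y i.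
  rewrite (bigD1 (Ordinal ni)) //= eqxx big1 ?addr0 // => j ne.
  by rewrite ifF ?mul0r //; apply/negbTE.
by rewrite /Phi -normrX ger0_norm // (exprM _ 2 6) exprn_ge0 // sqr_ge0.
Qed.

Lemma K4_ge1 : 1 <= K4.
Proof. by rewrite /K4 lerDl exprn_ge0 // mulr_ge0 // sqr_ge0. Qed.

End Moment.

Section DGood.
Context {R : realType} (n : nat).

(* The two ways a slot of the chaos is filled: by the random vector ([phi = id]) or by a fixed vector. *)
Definition slot (phi : (nat -> R) -> nat -> R) : Prop :=
  (forall M (x : nat -> R) i, (0 < M)%N -> (i < n)%N ->
    `|phi x i - phi (fun i => dval M (x i)) i| <= (1 + phi x i ^+ 2) / M%:R /\
    `|phi (fun i => dval M (x i)) i| <= `|phi x i|) /\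
  (forall x x' : nat -> R, (forall i, (i < n)%N -> x i = x' i) -> forall i, (i < n)%N -> phi x i = phi x' i).

Lemma slot_id : slot id.
Proof.
split; last by [].
by move=> M x i M0 ni; split; [exact: dval_err | exact: dval_le].
Qed.

Lemma slot_cst c : slot (fun=> c).
Proof.
split; last by [].
by move=> M x i M0 ni; split => //; rewrite subrr normr0 divr_ge0 // addr_ge0 // sqr_ge0.
Qed.

End DGood.

Section Transfer.
Context {R : realType} {d : measure_display} {V : measurableType d} (mu : {measure set V -> \bar R}).
Variables (q : R) (n' : nat) (a : 'I_n'.+1 -> 'I_n'.+1 -> V -> R).
Hypothesis q1 : 1 <= q.
Let n := n'.+1.
Hypothesis La : forall i j, in_Lq mu q (a i j).
Context {dO : measure_display} {Omega : measurableType dO} (P : probability Omega R).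
Variables (X Y : 'I_n'.+1 -> Omega -> R).
Hypothesis ind : mutually_independent P
  (fun k : 'I_n'.+1 + 'I_n'.+1 => match k with inl i => X i | inr j => Y j end).
Notation Z := (chaos mu q a).
Let L i j := Lqf mu q (a i j).
Let xs (w : Omega) : nat -> R := fun i => nx X i w.
Let ys (w : Omega) : nat -> R := fun i => ny Y i w.
Let dd M (x : nat -> R) : nat -> R := fun i => dval M (x i).

(* Comes from [(1 + x^2)(1 + y^2) <= 2 + x^4 + y^4]. *)
Definition err_weight (x y : nat -> R) : R :=
  \sum_(i < n'.+1) \sum_(j < n'.+1) (2%:R + x i ^+ 4 + y j ^+ 4) * L i j.

Lemma x4_ge0 (x : R) : 0 <= x ^+ 4.
Proof. by rewrite (exprM _ 2 2) sqr_ge0. Qed.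

Lemma err_weight_ge0 x y : 0 <= err_weight x y.
Proof.
apply: sumr_ge0 => i _; apply: sumr_ge0 => j _; apply: mulr_ge0; last exact: Lqf_ge0.
by have := x4_ge0 (x i); have := x4_ge0 (y j); lra.
Qed.

Section Slots.
Variables phi psi : (nat -> R) -> nat -> R.
Hypotheses (gp : slot n phi) (gs : slot n psi).

Lemma chaos_disc_le M x y : (0 < M)%N ->
  `|Z (phi (dd M x)) (psi (dd M y)) - Z (phi x) (psi y)| <= 2%:R * err_weight (phi x) (psi y) / M%:R.
Proof.
move=> M0.
have E (i j : 'I_n'.+1) : `|phi x i * psi y j - phi (dd M x) i * psi (dd M y) j| <=
    2%:R / M%:R * (2%:R + phi x i ^+ 4 + psi y j ^+ 4).
  have [h1 h2] := gp.1 M x i M0 (ltn_ord i); have [h3 h4] := gs.1 M y j M0 (ltn_ord j).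
  exact: (err1 M0).
have D (f : 'I_n'.+1 -> 'I_n'.+1 -> R) : (forall i j, f i j <= 2%:R / M%:R * (2%:R + phi x i ^+ 4 + psi y j ^+ 4)) ->
   \sum_(i < n'.+1) \sum_(j < n'.+1) f i j * L i j <= 2%:R * err_weight (phi x) (psi y) / M%:R.
  move=> hf; rewrite -mulrAC /err_weight mulr_sumr; apply: ler_sum => i _; rewrite mulr_sumr; apply: ler_sum => j _.
  by rewrite mulrA; apply: ler_wpM2r; [exact: Lqf_ge0 | exact: hf].
rewrite ler_norml; apply/andP; split.
  rewrite lerNl opprB lerBlDl; apply: le_trans (chaos_lip q1 La _ _ (phi (dd M x)) (psi (dd M y))) _.
  by rewrite lerD2l; apply: D.
rewrite lerBlDl; apply: le_trans (chaos_lip q1 La _ _ (phi x) (psi y)) _.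
by rewrite lerD2l; apply: D => i j; rewrite distrC.
Qed.

Lemma chaos_disc_cvg x y : (Z (phi (dd k.+1 x)) (psi (dd k.+1 y))) @[k --> \oo] --> Z (phi x) (psi y).
Proof. by apply: (@cvg_harm _ _ _ (2%:R * err_weight (phi x) (psi y))) => k; exact: chaos_disc_le. Qed.

Lemma chaos_local2 (x x' y y' : nat -> R) : (forall i, (i < n)%N -> x i = x' i) ->
  (forall i, (i < n)%N -> y i = y' i) -> Z (phi x) (psi y) = Z (phi x') (psi y').
Proof. by move=> hx hy; apply: chaos_ext; [exact: gp.2 | exact: gs.2]. Qed.

Lemma chaos_disc_meas M : (0 < M)%N ->
  measurable_fun setT (fun w => Z (phi (dd M (xs w))) (psi (dd M (ys w)))).
Proof. by move=> _; exact: (disc_meas ind M chaos_local2). Qed.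

Lemma chaos_meas : measurable_fun setT (fun w => Z (phi (xs w)) (psi (ys w))).
Proof.
apply: (measurable_fun_cvg (h := fun k w => Z (phi (dd k.+1 (xs w))) (psi (dd k.+1 (ys w))))).
  by move=> k; exact: chaos_disc_meas.
by move=> w _; exact: chaos_disc_cvg.
Qed.

Variable K : R.
Hypothesis mphi : forall i, (i < n)%N -> measurable_fun setT (fun w => phi (xs w) i).
Hypothesis mpsi : forall i, (i < n)%N -> measurable_fun setT (fun w => psi (ys w) i).
Hypothesis Kphi : forall i, (i < n)%N -> (\int[P]_w (phi (xs w) i ^+ 4)%:E <= K%:E)%E.
Hypothesis Kpsi : forall i, (i < n)%N -> (\int[P]_w (psi (ys w) i ^+ 4)%:E <= K%:E)%E.

Definition err_const : R := \sum_(i < n'.+1) \sum_(j < n'.+1) (2%:R + K + K) * L i j.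

Let m4 (f : Omega -> R) : measurable_fun setT f -> measurable_fun setT (fun w => (f w ^+ 4)%:E).
Proof. by move=> mf; apply/measurable_EFinP; exact: measurable_funX. Qed.

Lemma err_weight_meas : measurable_fun setT (fun w => err_weight (phi (xs w)) (psi (ys w))).
Proof.
apply: measurable_sum => i; apply: measurable_sum => j.
apply: measurable_funM => //; apply: measurable_funD; last by apply: measurable_funX; exact: mpsi.
by apply: measurable_funD => //; apply: measurable_funX; exact: mphi.
Qed.

Lemma int_err_weight : (\int[P]_w (err_weight (phi (xs w)) (psi (ys w)))%:E <= err_const%:E)%E.
Proof.
have mt (i j : 'I_n'.+1) : measurable_fun setT (fun w => (2%:R + phi (xs w) i ^+ 4 + psi (ys w) j ^+ 4)%:E).
  apply/measurable_EFinP; apply: measurable_funD; last by apply: measurable_funX; exact: mpsi.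
  by apply: measurable_funD => //; apply: measurable_funX; exact: mphi.
have t0 (i j : 'I_n'.+1) w : 0 <= 2%:R + phi (xs w) i ^+ 4 + psi (ys w) j ^+ 4.
  by have := x4_ge0 (phi (xs w) i); have := x4_ge0 (psi (ys w) j); lra.
under eq_integral => w _.
  rewrite /err_weight -sumEFin; under eq_bigr => i _ do rewrite -sumEFin.
  over.
rewrite ge0_integral_sum //; last 2 first.
- move=> i; apply: emeasurable_sum => j; under eq_fun => w do rewrite EFinM.
  by apply: emeasurable_funM => //.
- move=> i w _; apply: sume_ge0 => j _; rewrite lee_fin mulr_ge0 //; exact: Lqf_ge0.
rewrite /err_const -sumEFin; apply: lee_sum => i _.
rewrite ge0_integral_sum //; last 2 first.
- by move=> j; under eq_fun => w do rewrite EFinM; apply: emeasurable_funM.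
- by move=> j w _; rewrite lee_fin mulr_ge0 //; exact: Lqf_ge0.
rewrite -sumEFin; apply: lee_sum => j _.
under eq_integral => w _ do rewrite EFinM.
rewrite ge0_integralZr //; [|by move=> w _; rewrite lee_fin|exact: Lqf_ge0].
rewrite EFinM; apply: lee_wpmul2r; first exact: Lqf_ge0.
have mi := mphi (ltn_ord i); have mj := mpsi (ltn_ord j).
rewrite int_add; [|by apply: measurable_funD => //; exact: measurable_funX|exact: measurable_funX|
  by move=> w; rewrite addr_ge0 // x4_ge0|by move=> w; exact: x4_ge0].
rewrite int_add //; [|exact: measurable_funX|by move=> w; exact: x4_ge0].
rewrite [in leRHS]EFinD; apply: leeD; last exact: Kpsi.
rewrite [in leRHS]EFinD; apply: leeD; last exact: Kphi.
rewrite integral_cst //; apply: (@le_trans _ _ ((2%:R : R)%:E * 1)%E); last by rewrite mule1.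
by apply: lee_wpmul2l => //; exact: probability_le1.
Qed.

Lemma disc_err M : (0 < M)%N ->
  (\int[P]_w (Z (phi (dd M (xs w))) (psi (dd M (ys w))))%:E <=
   \int[P]_w (Z (phi (xs w)) (psi (ys w)))%:E + (2%:R * err_const / M%:R)%:E)%E.
Proof.
move=> M0; have c0 : 0 <= 2%:R / M%:R :> R by rewrite divr_ge0.
have mW : measurable_fun setT (fun w => 2%:R / M%:R * err_weight (phi (xs w)) (psi (ys w))).
  by apply: measurable_funM => //; exact: err_weight_meas.
apply: (@le_trans _ _ (\int[P]_w (Z (phi (xs w)) (psi (ys w)) + 2%:R / M%:R * err_weight (phi (xs w)) (psi (ys w)))%:E)%E).
  apply: int_le.
  - exact: chaos_disc_meas.
  - by apply: measurable_funD => //; exact: chaos_meas.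
  - by move=> w; exact: chaos_ge0.
  - move=> w; rewrite -lerBlDl.
    apply: le_trans (ler_norm _) _; apply: le_trans (chaos_disc_le _ _ M0) _.
    by rewrite mulrAC.
rewrite int_add //; [|exact: chaos_meas|by move=> w; exact: chaos_ge0|by move=> w; rewrite mulr_ge0 // err_weight_ge0].
apply: leeD => //; rewrite int_scale //; [|exact: err_weight_meas|by move=> w; exact: err_weight_ge0].
rewrite (_ : (2%:R * err_const / M%:R)%:E = (2%:R / M%:R)%:E * err_const%:E)%E; last by rewrite -EFinM mulrAC.
by apply: lee_wpmul2l => //; exact: int_err_weight.
Qed.

End Slots.

End Transfer.

Lemma cvg_exp {R : realType} (u : nat -> R) (l : R) m : u @ \oo --> l -> (fun k => u k ^+ m) @ \oo --> l ^+ m.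
Proof. by move=> h; exact: (cvg_comp _ _ h (@exprn_continuous R m l)). Qed.

Section Gamma.
Context {R : realType} {d : measure_display} {Omega : measurableType d} (P : probability Omega R).
Variables (Y : Omega -> R) (gamma : R).
Hypotheses (mY : measurable_fun setT Y) (nrm : tail_normalized P Y)
  (sg : subgaussian P gamma Y).

(** The excess over 2 is the square of [expR (y / 2) - expR (- y / 2)]; for [|y| >= 1/2] this
    difference is at least [5/4 - 4/5 = 9/20] in absolute value, and [(9/20)^2 >= 1/5]. *)
Lemma two_expR (y : R) : 2%:R + 1 / 5%:R * (1 / 2%:R <= `|y|)%R%:R <= expR y + expR (- y).
Proof.
have E (z : R) : 2%:R + (expR (z / 2%:R) - expR (- (z / 2%:R))) ^+ 2 = expR z + expR (- z).
  have -> : expR z = expR (z / 2%:R) * expR (z / 2%:R) by rewrite -expRD -splitr.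
  have -> : expR (- z) = expR (- (z / 2%:R)) * expR (- (z / 2%:R)) by rewrite -expRD -opprD -splitr.
  have h : expR (z / 2%:R) * expR (- (z / 2%:R)) = 1 by rewrite -expRD subrr expR0.
  set u := expR (z / 2%:R) in h *; set v := expR (- (z / 2%:R)) in h *.
  have -> : (u - v) ^+ 2 = u * u + v * v - 2%:R * (u * v) by ring.
  by rewrite h; ring.
have [h|h] := boolP (1 / 2%:R <= `|y|); last by rewrite mulr0 addr0 -E lerDl sqr_ge0.
have -> : expR y + expR (- y) = expR `|y| + expR (- `|y|).
  by case: (ger0P y) => // _; rewrite opprK addrC.
rewrite -E mulr1 lerD2l; set t := `|y| / 2%:R.
have t1 : 1 / 4%:R <= t by rewrite /t; lra.
have a : 5%:R / 4%:R <= expR t by apply: le_trans (expR_ge1Dx t); lra.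
have b : expR (- t) <= 4%:R / 5%:R.
  rewrite expRN -[leRHS]invrK lef_pV2 ?posrE ?expR_gt0 //; apply: le_trans a; lra.
have c : 9%:R / 20%:R <= expR t - expR (- t) by lra.
apply: (@le_trans _ _ ((9%:R / 20%:R) ^+ 2)); first by lra.
by apply: lerXn2r => //; rewrite nnegrE; [lra | apply: le_trans c; lra].
Qed.

(* The only way in which subgaussianity enters: it bounds [gamma] from below, as [|Y| >= 1/2] has probability
   at least [1/3]. *)
Lemma gamma_ge : 1 / 31%:R <= gamma.
Proof.
have mE (s : R) : measurable_fun setT (fun w => expR (s * Y w)).
  by apply: measurableT_comp => //; exact: measurable_funM.
have h1 : (\int[P]_w (expR (1 * Y w) + expR (-1 * Y w))%:E <= (expR gamma + expR gamma)%:E)%E.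
  rewrite int_add //.
  rewrite EFinD; apply: leeD; [have := sg.2 1 | have := sg.2 (-1)].
    by rewrite expr1n mulr1.
  by rewrite sqrrN expr1n mulr1.
pose A := [set w | 1 / 2%:R <= `|Y w|].
have mA : measurable A := mtail mY _.
have h2 : ((2%:R + 1 / 5%:R * (1 / 3%:R))%:E <= \int[P]_w (2%:R + 1 / 5%:R * \1_A w)%:E)%E.
  have c0 : 0 <= 1 / 5%:R :> R by lra.
  have mA' : measurable_fun setT (fun w => 1 / 5%:R * \1_A w : R).
    by apply: measurable_funM => //; exact: measurable_indic.
  have A0 w : 0 <= 1 / 5%:R * \1_A w :> R by exact: mulr_ge0.
  rewrite int_add //.
  rewrite EFinD; apply: leeD.
    rewrite integral_cst //; apply: (@le_trans _ _ ((2%:R : R)%:E * 1)%E); first by rewrite mule1.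
    by apply: lee_wpmul2l => //; rewrite -(probability_setT P).
  rewrite int_scale //.
  rewrite integral_indic // setIT EFinM; apply: lee_wpmul2l; first by rewrite lee_fin.
  apply: (@le_trans _ _ (tailG P Y (1 / 2%:R))%:E); first by rewrite lee_fin; exact: tailG_half.
  by rewrite -(tailGE P mY); exact: lexx.
have h3 : (\int[P]_w (2%:R + 1 / 5%:R * \1_A w)%:E <= \int[P]_w (expR (1 * Y w) + expR (-1 * Y w))%:E)%E.
  apply: int_le.
  - by apply: measurable_funD => //; apply: measurable_funM => //; exact: measurable_indic.
  - by apply: measurable_funD.
  - by move=> w; rewrite addr_ge0 // mulr_ge0 //; lra.
  - move=> w; rewrite mulN1r (mul1r (Y w)); apply: le_trans (two_expR (Y w)).
    rewrite lerD2l; apply: ler_wpM2l; first by lra.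
    rewrite indicE ler_nat; case: (boolP (w \in A)) => //=; rewrite inE /A /= => ->.
    by [].
(* The integrals give [expR gamma >= 31/30], while [gamma < 1/31] would give
   [expR gamma <= 1 / (1 - gamma) < 31/30]. *)
have := le_trans (le_trans h2 h3) h1; rewrite lee_fin => h4.
rewrite leNgt; apply/negP => gs.
have e0 := expR_gt0 gamma.
have : expR gamma * (1 - gamma) <= 1.
  have : expR gamma * expR (- gamma) = 1 by rewrite -expRD subrr expR0.
  move=> e; rewrite -[leRHS]e; apply: ler_wpM2l; [exact: ltW | exact: expR_ge1Dx].
nra.
Qed.

End Gamma.

Section Main.
Context {R : realType} {d : measure_display} {V : measurableType d} (mu : {measure set V -> \bar R}).
Variables (q : R) (n' : nat) (a : 'I_n'.+1 -> 'I_n'.+1 -> V -> R).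
Hypothesis q1 : 1 <= q.
Let n := n'.+1.
Hypothesis La : forall i j, in_Lq mu q (a i j).
Context {dO : measure_display} {Omega : measurableType dO} (P : probability Omega R).
Variables (X Y : 'I_n'.+1 -> Omega -> R).
Hypothesis ind : mutually_independent P
  (fun k : 'I_n'.+1 + 'I_n'.+1 => match k with inl i => X i | inr j => Y j end).
Hypotheses (syX : forall i, symmetric_rv P (X i)) (syY : forall j, symmetric_rv P (Y j))
  (lcX : forall i, log_concave_tails P (X i)) (lcY : forall j, log_concave_tails P (Y j))
  (nrX : forall i, tail_normalized P (X i)) (nrY : forall j, tail_normalized P (Y j)).
Notation Z := (chaos mu q a).
Let xs (w : Omega) : nat -> R := fun i => nx X i w.
Let ys (w : Omega) : nat -> R := fun i => ny Y i w.
Let dd M (x : nat -> R) : nat -> R := fun i => dval M (x i).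
Let mX := mXj ind.
Let mY := mYj ind.

Let modX M (M0 : (0 < M)%N) := disc_model M0 mX lcX nrX.
Let modY M (M0 : (0 < M)%N) := disc_model M0 mY lcY nrY.

Lemma dval4_cvg (x : R) : (fun k => dval k.+1 x ^+ 4 : R) @ \oo --> (x ^+ 4 : R).
Proof. exact: (@cvg_exp R (fun k => dval k.+1 x) x 4 (@dval_cvg R x)). Qed.

Lemma mom4X i : (i < n)%N -> (\int[P]_w (xs w i ^+ 4)%:E <= (@K4 R)%:E)%E.
Proof.
move=> ni; apply: (fatou_le (u := fun k w => dd k.+1 (xs w) i ^+ 4)).
- move=> k; apply: (disc_meas ind k.+1 (F := fun x y => x i ^+ 4)).
  by move=> x x' y y' h _; rewrite h.
- by move=> k w; exact: x4_ge0.
- by move=> w; exact: dval4_cvg.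
- apply: nearW => k; rewrite (disc_expect ind k.+1 syX syY (F := fun x y => x i ^+ 4) (fun=> 0) (fun=> 0)).
  + rewrite lee_fin; apply: le_trans (mom4 (modX (ltn0Sn k)) (fun _ => dmag_dk (ltn0Sn k)) (fun _ => @dmag_ge0 R k.+1) (fun=> 0) ni).
    rewrite le_eqVlt; apply/orP; left; apply/eqP; apply: Ev_ext => x; rewrite Ev_cst //.
    exact: wt_sum1 (modY (ltn0Sn k)).
  + by move=> x x' y y' h _; rewrite h.
  + by move=> x y; exact: x4_ge0.
Qed.

Lemma mom4Y i : (i < n)%N -> (\int[P]_w (ys w i ^+ 4)%:E <= (@K4 R)%:E)%E.
Proof.
move=> ni; apply: (fatou_le (u := fun k w => dd k.+1 (ys w) i ^+ 4)).
- move=> k; apply: (disc_meas ind k.+1 (F := fun x y => y i ^+ 4)).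
  by move=> x x' y y' _ h; rewrite h.
- by move=> k w; exact: x4_ge0.
- by move=> w; exact: dval4_cvg.
- apply: nearW => k; rewrite (disc_expect ind k.+1 syX syY (F := fun x y => y i ^+ 4) (fun=> 0) (fun=> 0)).
  + rewrite lee_fin Ev_cst; last exact: wt_sum1 (modX (ltn0Sn k)).
    exact: (mom4 (modY (ltn0Sn k)) (fun _ => dmag_dk (ltn0Sn k)) (fun _ => @dmag_ge0 R k.+1) (fun=> 0) ni).
  + by move=> x x' y y' _ h; rewrite h.
  + by move=> x y; exact: x4_ge0.
Qed.

Variables (p : R) (p' : nat) (s : R).
Hypothesis p1 : 1 <= p.
Hypothesis p'0 : (0 < p')%N.
Hypothesis pp : p'.+1%:R <= 3%:R * p.
Hypothesis s0 : 0 <= s.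
Hypothesis H1 : (\int[P]_w (Z (xs w) (ys w))%:E <= (31%:R * s)%:E)%E.
Hypothesis H2 : forall x : nat -> R, Bball P X p (fun i : 'I_n => x i) ->
  (\int[P]_w (Z x (ys w))%:E <= s%:E)%E.
Hypothesis H3 : forall y : nat -> R, Bball P Y p (fun i : 'I_n => y i) ->
  (\int[P]_w (Z (xs w) y)%:E <= s%:E)%E.
Hypothesis H4 : forall f (x : nat -> R), f \in dual_unit_ball mu q -> Bball P X p (fun i : 'I_n => x i) ->
  \sum_(i < n) x i * Num.sqrt (\sum_(j < n) fb a f i j ^+ 2) <= s.
Hypothesis H5 : forall f (x y : nat -> R), f \in dual_unit_ball mu q ->
  Bball P X p (fun i : 'I_n => x i) -> Bball P Y p (fun i : 'I_n => y i) -> bil n (fb a f) x y <= s.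

Let Q : R := p'.+1%:R.
(** One fourth moment bound for both kinds of slots: [K4] for random coordinates, [(Q + 1)^4] for
    those of a point of the ball. *)
Let K : R := K4 + (Q + 1) ^+ 4.

Let K4K : @K4 R <= K.
Proof. by rewrite /K lerDl x4_ge0. Qed.

Let ballK (x : R) : `|x| <= Q + 1 -> (\int[P]_w (x ^+ 4)%:E <= K%:E)%E.
Proof.
move=> h; rewrite integral_cst //; apply: (@le_trans _ _ ((x ^+ 4)%:E * 1)%E).
  by apply: lee_wpmul2l; [rewrite lee_fin x4_ge0 | exact: probability_le1].
rewrite mule1 lee_fin /K; have k1 := @K4_ge1 R.
have -> : x ^+ 4 = `|x| ^+ 4 by rewrite -normrX ger0_norm // x4_ge0.
have : `|x| ^+ 4 <= (Q + 1) ^+ 4 by apply: lerXn2r => //; rewrite nnegrE // (le_trans _ h).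
by lra.
Qed.

Section Level.
Variables (M : nat) (ep : R).
Hypothesis M0 : (0 < M)%N.
Hypothesis ep0 : 0 < ep.
Hypothesis Me : 2%:R * err_const mu q a K / M%:R <= ep.
(** As [p'.+1 <= 3 p], a point of the discrete ball has to be divided by 6; the term with two such
    points loses 36, which also covers the 31 of [H1]. [ep] is left for the discretization error. *)
Let r := 36%:R * s + ep.
Let pmX := fun i => dm (M := M) P (nx X i).
Let pmY := fun i => dm (M := M) P (ny Y i).
Let ka : nat -> 'I_(2 * M ^ 2).+1 -> nat := fun=> @dk M.
Let va : nat -> 'I_(2 * M ^ 2).+1 -> R := fun=> @dmag R M.
Let sg : nat -> bool * 'I_(2 * M ^ 2).+1 := fun=> (false, ord0).
Let x0 := fun i => fv va i (sg i) : R.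

Let shrink {Zv : 'I_n'.+1 -> Omega -> R} (mZ : forall i, measurable_fun setT (Zv i)) (lcZ : forall i, log_concave_tails P (Zv i))
  (nrZ : forall i, tail_normalized P (Zv i)) x :
  ball n (fun i => tailQ (dm (M := M) P (Zv (inord i))) (@dk M)) Q x -> Bball P Zv p (fun i : 'I_n => 6%:R^-1 * x i).
Proof.
move=> bx; have md := disc_model M0 mZ lcZ nrZ.
have t3 : 1 <= 3%:R :> R by lra.
have := ball_scale md t3 (ball_le pp bx).
move/(disc_ball M0 mZ lcZ nrZ); congr (Bball P Zv p _).
by apply/funext => i; rewrite mulrC; congr (_ * _); congr (_^-1); ring.
Qed.

Let T : finType := ({ffun 'I_n'.+1 -> bool * 'I_(2 * M ^ 2).+1} * {ffun 'I_n'.+1 -> bool * 'I_(2 * M ^ 2).+1})%type.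
Let gx (t : T) : nat -> R := fun i => dv (extf sg t.1 i).
Let gy (t : T) : nat -> R := fun i => dv (extf sg t.2 i).

Lemma disc_bound : (\int[P]_w (Z (dd M (xs w)) (dd M (ys w)) ^+ p'.+1)%:E <= ((CF * r) ^+ p'.+1)%:E)%E.
Proof.
have r0 : 0 < r by rewrite /r ltr_wpDl // mulr_ge0.
have r1 c : c <= 36%:R -> c * s + ep <= r by move=> hc; rewrite /r lerD2r ler_wpM2r.
have r2 c u : 0 <= c <= 36%:R -> u <= s -> c * u <= r.
  move=> /andP[c0 c36] us; apply: le_trans (r1 c c36); apply: (@le_trans _ _ (c * s)); first exact: ler_wpM2l.
  by rewrite lerDl ltW.
(* A norming functional for each of the finitely many outcomes: the maximum over them equals the
   norm of the chaos at the outcomes and is at most that norm everywhere. *)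
have [f Hf] : {f : T -> (V -> R) -> R & forall t, f t \in dual_unit_ball mu q /\ bil n (fb a (f t)) (gx t) (gy t) = Z (gx t) (gy t)}.
  apply: (@choice T _ (fun t f => f \in dual_unit_ball mu q /\ bil n (fb a f) (gx t) (gy t) = Z (gx t) (gy t))) => t.
  by have [f f1 f2] := chaos_norming q1 La (gx t) (gy t); exists f.
pose b t := fb a (f t).
pose t0 : T := ([ffun=> (false, ord0)], [ffun=> (false, ord0)]).
have NZ x y : maxbil n t0 b x y <= Z x y.
  by apply: famax_le => t; apply: bil_chaos => //; have [] := Hf t.
have ZN w : Z (dd M (xs w)) (dd M (ys w)) <= maxbil n t0 b (dd M (xs w)) (dd M (ys w)).
  apply: le_trans (le_famax t0 (fun t => `|bil n (b t) _ _|) (xi X Y M w)); apply: le_trans (ler_norm _).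
  rewrite (disc_factor X Y M w (chaos_local2 mu q a (slot_id n) (slot_id n))).
  rewrite (disc_factor X Y M (F := bil n (b (xi X Y M w)))).
    by have [_ ->] := Hf (xi X Y M w).
  by move=> x x' y y'; exact: bil_ext.
have lN : forall x x' y y' : nat -> R, (forall i, (i < n'.+1)%N -> x i = x' i) ->
    (forall i, (i < n'.+1)%N -> y i = y' i) -> maxbil n t0 b x y ^+ p'.+1 = maxbil n t0 b x' y' ^+ p'.+1.
  by move=> x x' y y' hx hy; rewrite (maxbil_ext t0 b hx hy).
have N0 := maxbil_ge0 n t0 b.
have w0X := wt_ge0 (modX M0); have w0Y := wt_ge0 (modY M0).
have w1X := wt_sum1 (modX M0); have w1Y := wt_sum1 (modY M0).
apply: (@le_trans _ _ (\int[P]_w (maxbil n t0 b (dd M (xs w)) (dd M (ys w)) ^+ p'.+1)%:E)%E).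
  apply: int_le.
  - by apply: measurable_funX; apply: (chaos_disc_meas mu q a ind (slot_id n) (slot_id n) M0).
  - exact: (disc_meas ind M lN).
  - by move=> w; rewrite exprn_ge0 // chaos_ge0.
  - by move=> w; apply: lerXn2r; rewrite ?nnegrE ?chaos_ge0 ?N0 // ZN.
rewrite (disc_expect ind M syX syY (F := fun x y => maxbil n t0 b x y ^+ p'.+1) x0 x0 lN); last first.
  by move=> x y; rewrite exprn_ge0.
have disc2 phi psi c : slot n phi -> slot n psi ->
    (forall i, (i < n)%N -> measurable_fun setT (fun w => phi (xs w) i)) ->
    (forall i, (i < n)%N -> measurable_fun setT (fun w => psi (ys w) i)) ->
    (forall i, (i < n)%N -> (\int[P]_w (phi (xs w) i ^+ 4)%:E <= K%:E)%E) ->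
    (forall i, (i < n)%N -> (\int[P]_w (psi (ys w) i ^+ 4)%:E <= K%:E)%E) ->
    (\int[P]_w (Z (phi (xs w)) (psi (ys w)))%:E <= c%:E)%E ->
    Ev n (wt pmX) (fv va) x0 (fun x => Ev n (wt pmY) (fv va) x0 (fun y => Z (phi x) (psi y))) <= c + ep.
  move=> g1 g2 m1 m2 k1 k2 hc; rewrite -lee_fin.
  rewrite -(disc_expect ind M syX syY (F := fun x y => Z (phi x) (psi y)) x0 x0 (chaos_local2 mu q a g1 g2) (fun x y => chaos_ge0 _ _ _ _ _)).
  apply: le_trans (disc_err q1 La ind g1 g2 m1 m2 k1 k2 M0) _.
  by rewrite EFinD; apply: leeD => //; rewrite lee_fin.
have mxs i : (i < n)%N -> measurable_fun setT (fun w => xs w i) by move=> _; exact: mX.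
have mys i : (i < n)%N -> measurable_fun setT (fun w => ys w i) by move=> _; exact: mY.
have kxs i : (i < n)%N -> (\int[P]_w (xs w i ^+ 4)%:E <= K%:E)%E.
  by move=> ni; apply: le_trans (mom4X ni) _; rewrite lee_fin.
have kys i : (i < n)%N -> (\int[P]_w (ys w i ^+ 4)%:E <= K%:E)%E.
  by move=> ni; apply: le_trans (mom4Y ni) _; rewrite lee_fin.
have i6 : 0 <= 6%:R :> R by lra.
have chaos6l x y : Z x y = 6%:R * Z (fun i => 6%:R^-1 * x i) y.
  have := chaosZ q1 La (fun i => 6%:R^-1 * x i) y i6 ler01; rewrite mulr1 => <-.
  by apply: chaos_ext => i _; [field | rewrite mul1r].
have chaos6r x y : Z x y = 6%:R * Z x (fun i => 6%:R^-1 * y i).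
  have := chaosZ q1 La x (fun i => 6%:R^-1 * y i) ler01 i6; rewrite mul1r => <-.
  by apply: chaos_ext => i _; [rewrite mul1r | field].
rewrite lee_fin; apply: (fine_core (modX M0) (modY M0)) => //.
- by move=> i t; exact: dmag_ge0.
- by move=> i t; exact: dmag_ge0.
- by move=> i t; exact: dk_dmag.
- by move=> i t; exact: dk_dmag.
- by move=> i t; exact: dmag_dk.
- by move=> i t; exact: dmag_dk.
- by move=> i; apply: dm_half.
- by move=> i; apply: dm_half.
- apply: (@le_trans _ _ (Ev n (wt pmX) (fv va) x0 (fun x => Ev n (wt pmY) (fv va) x0 (Z x)))).
    by apply: Ev_le => // x; apply: Ev_le => // y; exact: NZ.
  apply: le_trans (disc2 id id _ (slot_id n) (slot_id n) mxs mys kxs kys H1) _.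
  by apply: r1; lra.
- move=> x bx.
  apply: (@le_trans _ _ (Ev n (wt pmY) (fv va) x0 (Z x))); first by apply: Ev_le.
  apply: (@le_trans _ _ (Ev n (wt pmX) (fv va) x0 (fun=> Ev n (wt pmY) (fv va) x0 (Z x)))); first by rewrite Ev_cst.
  have c1 : (\int[P]_w (Z x (ys w))%:E <= (6%:R * s)%:E)%E.
    under eq_integral => w _ do rewrite chaos6l.
    rewrite int_scale //; [|exact: (chaos_meas q1 La ind (slot_cst n _) (slot_id n))|by move=> w; exact: chaos_ge0].
    by rewrite EFinM; apply: lee_wpmul2l => //; apply: H2; exact: (shrink mX lcX nrX).
  apply: le_trans (disc2 (fun=> x) id _ (slot_cst n x) (slot_id n) _ mys _ kys c1) _ => //.
  + by move=> i ni; apply: ballK; exact: (ball_bdd (modX M0) bx ni).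
  + by apply: r1; lra.
- move=> y bY.
  apply: (@le_trans _ _ (Ev n (wt pmX) (fv va) x0 (fun x => Z x y))); first by apply: Ev_le.
  have c1 : (\int[P]_w (Z (xs w) y)%:E <= (6%:R * s)%:E)%E.
    under eq_integral => w _ do rewrite chaos6r.
    rewrite int_scale //; [|exact: (chaos_meas q1 La ind (slot_id n) (slot_cst n _))|by move=> w; exact: chaos_ge0].
    by rewrite EFinM; apply: lee_wpmul2l => //; apply: H3; exact: (shrink mY lcY nrY).
  apply: (@le_trans _ _ (Ev n (wt pmX) (fv va) x0 (fun x => Ev n (wt pmY) (fv va) x0 (fun=> Z x y)))).
    by apply: Ev_le => // x; rewrite Ev_cst.
  apply: le_trans (disc2 id (fun=> y) _ (slot_id n) (slot_cst n y) mxs _ kxs _ c1) _ => //.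
  + by move=> i ni; apply: ballK; exact: (ball_bdd (modY M0) bY ni).
  + by apply: r1; lra.
- move=> t x bx; have := @H4 _ (fun i => 6%:R^-1 * x i) (Hf t).1 (shrink mX lcX nrX bx).
  rewrite -/(b t); set u := \sum_(i < n) _; move=> hu.
  rewrite (_ : \sum_(i < n) _ = 6%:R * u); first by apply: r2 => //; lra.
  by rewrite /u mulr_sumr; apply: eq_bigr => i _; field.
- move=> t x y bx bY; have := @H5 _ (fun i => 6%:R^-1 * x i) (fun i => 6%:R^-1 * y i) (Hf t).1 (shrink mX lcX nrX bx) (shrink mY lcY nrY bY).
  rewrite -/(b t); set u := bil _ _ _ _; move=> hu.
  rewrite (_ : bil n (b t) x y = 36%:R * u); first by apply: r2 => //; lra.
  rewrite /u /bil mulr_sumr; apply: eq_bigr => i _.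
  rewrite (_ : \sum_(j < n) b t i j * (6%:R^-1 * y j) = 6%:R^-1 * \sum_(j < n) b t i j * y j); first by field.
  by rewrite mulr_sumr; apply: eq_bigr => j _; ring.
Qed.

End Level.

Lemma int_bound ep : 0 < ep ->
  (\int[P]_w (Z (xs w) (ys w) ^+ p'.+1)%:E <= ((CF * (36%:R * s + ep)) ^+ p'.+1)%:E)%E.
Proof.
move=> ep0; apply: (fatou_le (u := fun k w => Z (dd k.+1 (xs w)) (dd k.+1 (ys w)) ^+ p'.+1)).
- by move=> k; apply: measurable_funX; exact: (chaos_disc_meas mu q a ind (slot_id n) (slot_id n) (ltn0Sn k)).
- by move=> k w; rewrite exprn_ge0 // chaos_ge0.
- move=> w; apply: cvg_exp.
  exact: (chaos_disc_cvg q1 La (slot_id n) (slot_id n)).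
- have h : (2%:R * err_const mu q a K / k.+1%:R) @[k --> \oo] --> (0 : R).
    apply: (@cvg_harm _ _ _ `|2%:R * err_const mu q a K|) => k.
    by rewrite subr0 normrM normfV (ger0_norm (ler0n _ _)).
  near=> k; apply: disc_bound => //.
  near: k; move/cvgrPdist_le: h => /(_ _ ep0); apply: filterS => k.
  by rewrite sub0r normrN; apply: le_trans; exact: ler_norm.
Unshelve. all: by end_near.
Qed.

End Main.

Lemma CF_gt0 {R : realType} : 0 < CF :> R.
Proof.
have c1 := @CI1_ge1 R; have c2 := @CS_ge1 R.
have c3 : 0 < CS :> R by apply: lt_le_trans c2.
have c4 : 0 < CI1 :> R by apply: lt_le_trans c1.
have c5 : 0 < CC :> R by rewrite /CC; apply: mulr_gt0 c3; apply: mulr_gt0 => //; exact: exprn_gt0.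
by rewrite /CF; apply: mulr_gt0; [exact: exprn_gt0 | exact: mulr_gt0].
Qed.

(** Lowers the exponent from [m + 1] to [p] through the pointwise bound
    [u^p <= rho^p (1 + (u / rho)^(m + 1))], whose two terms serve [u <= rho] and [u > rho]. *)
Lemma Lnorm_of_power {R : realType} {d : measure_display} {Omega : measurableType d} (P : probability Omega R)
  (U : Omega -> R) (p rho : R) (m : nat) : measurable_fun setT U -> (forall w, 0 <= U w) ->
  1 <= p -> p <= m.+1%:R -> 0 < rho ->
  (\int[P]_w (U w ^+ m.+1)%:E <= (rho ^+ m.+1)%:E)%E ->
  (Lnorm P p%:E (fun w => (U w)%:E) <= (2%:R * rho)%:E)%E.
Proof.
move=> mU U0 p1 pm r0 H.
have p0 : 0 < p by lra.
have rp : 0 < rho `^ p by exact: powR_gt0.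
have rm : 0 < rho ^+ m.+1 by exact: exprn_gt0.
have pt u : 0 <= u -> u `^ p <= rho `^ p + rho `^ p / rho ^+ m.+1 * u ^+ m.+1.
  move=> u0; have [ur|ur] := lerP u rho.
    apply: (@le_trans _ _ (rho `^ p)); first by apply: ge0_ler_powR; rewrite ?nnegrE // ltW.
    by rewrite lerDl mulr_ge0 ?exprn_ge0 // divr_ge0 // ltW.
  have t1 : 1 <= u / rho by rewrite ler_pdivlMr // mul1r ltW.
  have e : u = rho * (u / rho) by rewrite mulrC divfK // gt_eqF.
  rewrite {1}e powRM ?(ltW r0) //; last by rewrite (le_trans _ t1).
  apply: (@le_trans _ _ (rho `^ p * (u / rho) ^+ m.+1)).
    apply: ler_wpM2l; first exact: ltW.
    by rewrite -powR_mulrn ?(le_trans _ t1) //; exact: ler_powR.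
  rewrite exprMn exprVn mulrA mulrAC lerDr; exact: ltW.
have I : (\int[P]_w (U w `^ p)%:E <= ((2%:R * rho) `^ p)%:E)%E.
  have mp : measurable_fun setT (fun w => U w `^ p) by exact: (measurableT_comp (measurable_powR _)).
  have mX : measurable_fun setT (fun w => U w ^+ m.+1) by exact: measurable_funX.
  have X0 w : 0 <= U w ^+ m.+1 by rewrite exprn_ge0.
  have c0 : 0 <= rho `^ p / rho ^+ m.+1 by rewrite divr_ge0 // ltW.
  have mcX : measurable_fun setT (fun w => rho `^ p / rho ^+ m.+1 * U w ^+ m.+1) by apply: measurable_funM.
  have cX0 w : 0 <= rho `^ p / rho ^+ m.+1 * U w ^+ m.+1 by rewrite mulr_ge0.
  apply: (@le_trans _ _ (\int[P]_w (rho `^ p + rho `^ p / rho ^+ m.+1 * U w ^+ m.+1)%:E)%E).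
    apply: int_le => //; [by apply: measurable_funD | by move=> w; exact: powR_ge0 | by move=> w; exact: pt].
  rewrite int_add //; last by move=> _; exact: ltW.
  rewrite int_scale //.
  apply: (@le_trans _ _ ((rho `^ p)%:E + (rho `^ p / rho ^+ m.+1)%:E * (rho ^+ m.+1)%:E)%E).
    apply: leeD; last by apply: lee_wpmul2l.
    rewrite integral_cst //; apply: (@le_trans _ _ ((rho `^ p)%:E * 1)%E); last by rewrite mule1.
    by apply: lee_wpmul2l; [rewrite lee_fin ltW | exact: probability_le1].
  rewrite -EFinM divfK ?gt_eqF // -EFinD lee_fin powRM ?(ltW r0) //.
  have : 2%:R <= 2%:R `^ p :> R by rewrite -[X in X <= _]powRr1 //; apply: ler_powR => //; rewrite ler1n.
  have := ltW rp; nra.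
rewrite unlock.
have e : (\int[P]_w (`|(U w)%:E| `^ p) = \int[P]_w (U w `^ p)%:E)%E.
  by apply: eq_integral => w _; rewrite gee0_abs ?lee_fin // poweR_EFin.
rewrite e.
have -> : ((2%:R * rho)%:E = ((2%:R * rho) `^ p)%:E `^ p^-1)%E.
  by rewrite poweR_EFin -powRrM mulfV ?gt_eqF // powRr1 // mulr_ge0 // ltW.
apply: gt0_ler_poweR => //; rewrite ?in_itv /= ?leey ?andbT ?invr_ge0 ?(ltW p0) //.
  by apply: integral_ge0 => w _; rewrite lee_fin powR_ge0.
by rewrite lee_fin powR_ge0.
Qed.

Section Ball0.
Context {R : realType} {d : measure_display} {Omega : measurableType d} (P : probability Omega R).
Variables (n : nat) (Z : 'I_n -> Omega -> R) (p : R).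
Hypothesis p0 : 0 <= p.

Lemma Bball0 : Bball P Z p (fun=> 0).
Proof.
rewrite /Bball /= big1 ?lee_fin // => i _.
by rewrite /hatN normr0 ler01 expr0n.
Qed.

Lemma normZp_ge0 b : (0 <= normZp P Z p b)%E.
Proof.
apply: ereal_sup_ubound; exists (fun=> 0); first exact: Bball0.
by congr EFin; apply: big1 => i _; rewrite mulr0.
Qed.
End Ball0.

Theorem theorem2p2 (R : realType) (q : R) (hq : 1 <= q) :
  exists C : R, 0 < C /\
  forall (dV : measure_display) (V : measurableType dV)
         (mu : {measure set V -> \bar R})
         (dO : measure_display) (Omega : measurableType dO)
         (P : probability Omega R)
         (n : nat) (X Y : 'I_n -> Omega -> R) (gamma : R)
         (a : 'I_n -> 'I_n -> V -> R) (p : R),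
    (1 <= n)%N ->
    mutually_independent P
      (fun k : 'I_n + 'I_n => match k with inl i => X i | inr j => Y j end) ->
    (forall i, symmetric_rv P (X i)) -> (forall j, symmetric_rv P (Y j)) ->
    (forall i, log_concave_tails P (X i)) -> (forall j, log_concave_tails P (Y j)) ->
    (forall i, tail_normalized P (X i)) -> (forall j, tail_normalized P (Y j)) ->
    0 < gamma -> (forall j, subgaussian P gamma (Y j)) ->
    (forall i j, in_Lq mu q (a i j)) ->
    1 <= p ->
    (Lnorm P p%:E (fun w => Lqnorm mu q
        (fun v => (\sum_(i < n) \sum_(j < n) a i j v * X i w * Y j w)%R))
    <= C%:E *
       (gamma%:E * \int[P]_w Lqnorm mu q
           (fun v => (\sum_(i < n) \sum_(j < n) a i j v * X i w * Y j w)%R)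
        + ereal_sup ((fun x : 'I_n -> R => \int[P]_w Lqnorm mu q
           (fun v => (\sum_(i < n) \sum_(j < n) a i j v * x i * Y j w)%R))
             @` Bball P X p)
        + ereal_sup ((fun y : 'I_n -> R => \int[P]_w Lqnorm mu q
           (fun v => (\sum_(i < n) \sum_(j < n) a i j v * X i w * y j)%R))
             @` Bball P Y p)
        + ereal_sup ((fun f : (V -> R) -> R =>
             normZp P X p (fun i => Num.sqrt (\sum_(j < n) f (a i j) ^+ 2)%R))
             @` dual_unit_ball mu q)
        + ereal_sup ((fun f : (V -> R) -> R =>
             normXYp P X Y p (fun i j => f (a i j)))
             @` dual_unit_ball mu q)))%E.
Proof.
have CF0 := @CF_gt0 R.
(* The factor 36 of [int_bound] times the 2 of [Lnorm_of_power]. *)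
exists (72%:R * CF); split; first by rewrite mulr_gt0.
move=> dV V mu dO Omega P [//|n'] X Y gamma a p _ ind syX syY lcX lcY nrX nrY g0 sgY La p1.
have mX := mXj ind; have mY := mYj ind.
have p0 : 0 <= p by lra.
set xs := fun w i => nx X i w; set ys := fun w i => ny Y i w.
have cmbE (x y : 'I_n'.+1 -> R) (x' y' : nat -> R) : (forall i : 'I_n'.+1, x i = x' i) -> (forall i : 'I_n'.+1, y i = y' i) ->
    Lqnorm mu q (fun v => \sum_(i < n'.+1) \sum_(j < n'.+1) a i j v * x i * y j) = (chaos mu q a x' y')%:E.
  move=> hx hy; rewrite -chaosE //; congr (Lqnorm mu q _); apply/funext => v.
  by apply: eq_bigr => i _; apply: eq_bigr => j _; rewrite hx hy.
have xsE w (i : 'I_n'.+1) : X i w = xs w i by rewrite /xs /nx inord_val.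
have ysE w (i : 'I_n'.+1) : Y i w = ys w i by rewrite /ys /ny inord_val.
set T1 := (\int[P]_w _)%E; set T2 := ereal_sup _; set T3 := ereal_sup _; set T4 := ereal_sup _; set T5 := ereal_sup _.
have fn0 : dual_unit_ball mu q (fun=> 0) := set_mem (dual_zero mu q).
have T1E : T1 = (\int[P]_w (chaos mu q a (xs w) (ys w))%:E)%E.
  by apply: eq_integral => w _; apply: cmbE.
have T10 : (0 <= T1)%E by apply: integral_ge0 => w _; exact: Lnorm_ge0.
have T20 : (0 <= T2)%E.
  apply: (@le_trans _ _ (\int[P]_w Lqnorm mu q (fun v => \sum_(i < n'.+1) \sum_(j < n'.+1) a i j v * 0 * Y j w)%R)%E).
    by apply: integral_ge0 => w _; exact: Lnorm_ge0.
  by apply: ereal_sup_ubound; exists (fun=> 0) => //; exact: Bball0.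
have T30 : (0 <= T3)%E.
  apply: (@le_trans _ _ (\int[P]_w Lqnorm mu q (fun v => \sum_(i < n'.+1) \sum_(j < n'.+1) a i j v * X i w * 0)%R)%E).
    by apply: integral_ge0 => w _; exact: Lnorm_ge0.
  by apply: ereal_sup_ubound; exists (fun=> 0) => //; exact: Bball0.
have T40 : (0 <= T4)%E.
  apply: (@le_trans _ _ (normZp P X p (fun i => Num.sqrt (\sum_(j < n'.+1) (0 : R) ^+ 2)))); first exact: normZp_ge0.
  by apply: ereal_sup_ubound; exists (fun=> 0).
have T50 : (0 <= T5)%E.
  apply: (@le_trans _ _ (normXYp P X Y p (fun i j => 0))); last by apply: ereal_sup_ubound; exists (fun=> 0).
  apply: ereal_sup_ubound; exists (fun=> 0); first exact: Bball0.
  exists (fun=> 0); first exact: Bball0.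
  by rewrite big1 // => i _; apply: big1 => j _; rewrite !mul0r.
have gT1 : (0 <= gamma%:E * T1)%E by apply: mule_ge0; rewrite ?lee_fin // ltW.
have S2 := adde_ge0 gT1 T20; have S3 := adde_ge0 S2 T30; have S4 := adde_ge0 S3 T40.
have S5 := adde_ge0 S4 T50.
set S := (_ + T5)%E in S5 *.
have l4 : (gamma%:E * T1 + T2 + T3 + T4 <= S)%E by rewrite leeDl.
have l3 : (gamma%:E * T1 + T2 + T3 <= S)%E by apply: le_trans l4; rewrite leeDl.
have l2 : (gamma%:E * T1 + T2 <= S)%E by apply: le_trans l3; rewrite leeDl.
have L1 : (gamma%:E * T1 <= S)%E by apply: le_trans l2; rewrite leeDl.
have L2 : (T2 <= S)%E by apply: le_trans l2; rewrite leeDr.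
have L3 : (T3 <= S)%E by apply: le_trans l3; rewrite leeDr.
have L4 : (T4 <= S)%E by apply: le_trans l4; rewrite leeDr.
have L5 : (T5 <= S)%E by rewrite leeDr.
move: S5 L1 L2 L3 L4 L5; clearbody S; clear l2 l3 l4.
(* If the sum is infinite there is nothing to prove; otherwise the real number [s] bounds each of
   the five terms. *)
case: S => [s| |] // S5 L1 L2 L3 L4 L5; last by rewrite gt0_muley ?leey // lte_fin mulr_gt0.
rewrite lee_fin in S5.
have gm := gamma_ge (mY ord0) (nrY ord0) (sgY ord0).
have H1 : (\int[P]_w (chaos mu q a (xs w) (ys w))%:E <= (31%:R * s)%:E)%E.
  rewrite -T1E EFinM -lee_pdivrMl //; apply: le_trans L1; apply: lee_wpmul2r => //.
  by rewrite lee_fin; lra.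
have H2 (x : nat -> R) : Bball P X p (fun i : 'I_n'.+1 => x i) ->
    (\int[P]_w (chaos mu q a x (ys w))%:E <= s%:E)%E.
  move=> bx; apply: le_trans L2; apply: ereal_sup_ubound; exists (fun i : 'I_n'.+1 => x i) => //.
  by apply: eq_integral => w _; apply: cmbE.
have H3 (y : nat -> R) : Bball P Y p (fun i : 'I_n'.+1 => y i) ->
    (\int[P]_w (chaos mu q a (xs w) y)%:E <= s%:E)%E.
  move=> bY; apply: le_trans L3; apply: ereal_sup_ubound; exists (fun i : 'I_n'.+1 => y i) => //.
  by apply: eq_integral => w _; apply: cmbE.
have H4 f (x : nat -> R) : f \in dual_unit_ball mu q -> Bball P X p (fun i : 'I_n'.+1 => x i) ->
    \sum_(i < n'.+1) x i * Num.sqrt (\sum_(j < n'.+1) fb a f i j ^+ 2) <= s.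
  move=> fB bx; rewrite -lee_fin; apply: le_trans L4.
  apply: (@le_trans _ _ (normZp P X p (fun i => Num.sqrt (\sum_(j < n'.+1) f (a i j) ^+ 2)))).
    apply: ereal_sup_ubound; exists (fun i : 'I_n'.+1 => x i) => //.
    congr EFin; apply: eq_bigr => i _; rewrite mulrC; congr (_ * Num.sqrt _).
    by apply: eq_bigr => j _; rewrite /fb !inord_val.
  by apply: ereal_sup_ubound; exists f => //; exact: set_mem.
have H5 f (x y : nat -> R) : f \in dual_unit_ball mu q -> Bball P X p (fun i : 'I_n'.+1 => x i) ->
    Bball P Y p (fun i : 'I_n'.+1 => y i) -> bil n'.+1 (fb a f) x y <= s.
  move=> fB bx bY; rewrite -lee_fin; apply: le_trans L5.
  apply: (@le_trans _ _ (normXYp P X Y p (fun i j => f (a i j)))).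
    apply: ereal_sup_ubound; exists (fun i : 'I_n'.+1 => x i) => //; exists (fun i : 'I_n'.+1 => y i) => //.
    congr EFin; apply: eq_bigr => i _; rewrite mulr_sumr; apply: eq_bigr => j _.
    by rewrite /fb !inord_val mulrCA mulrA.
  by apply: ereal_sup_ubound; exists f => //; exact: set_mem.
(* The discrete theorem needs an integer exponent: [p <= p'.+1 <= 3 p]. *)
pose p' := (Num.trunc p).+1.
have /andP[tp1 tp2] := truncn_itv p0.
have pp : p'.+1%:R <= 3%:R * p by rewrite /p' -!natr1; lra.
have pP : p <= p'.+1%:R by rewrite -natr1 ltW // (lt_le_trans tp2) // lerDl.
have -> : (fun w => Lqnorm mu q (fun v => \sum_(i < n'.+1) \sum_(j < n'.+1) a i j v * X i w * Y j w)) =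
    (fun w => (chaos mu q a (xs w) (ys w))%:E).
  by apply/funext => w; apply: cmbE.
rewrite -EFinM; apply/lee_addgt0Pr => e e0.
(* Chosen so that [2 CF ep = e]. *)
pose ep := e / (2%:R * CF).
have ep0 : 0 < ep by rewrite divr_gt0 // mulr_gt0.
have IB := int_bound hq La ind syX syY lcX lcY nrX nrY (ltn0Sn _) pp S5 H1 H2 H3 H4 H5 ep0.
have r0 : 0 < CF * (36%:R * s + ep) by rewrite mulr_gt0 // ltr_wpDl // mulr_ge0.
apply: le_trans (Lnorm_of_power _ _ p1 pP r0 IB) _.
- exact: (chaos_meas hq La ind (slot_id _) (slot_id _)).
- by move=> w; exact: chaos_ge0.
rewrite -EFinD lee_fin le_eqVlt; apply/orP; left; apply/eqP.
by rewrite /ep; field; rewrite gt_eqF.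
Qed.
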